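(* Let $\beta>1$ and $\{X_t\}_{t\in[0,1]}\in S_G^\beta(0,1)$. For $n\in\mathbb N$ let $t^n_k=k/2^n$ and $\mathcal I_n=\{t_k^n:k=0,1,\dots,2^n\}$, and define backwardly $V^n_1=X_1$, $V^n_{t^n_k}=\max(X_{t^n_k},\hat{\mathbb E}_{t_k^n}[V^n_{t^n_{k+1}}])$ for $k=0,1,\dots,2^n-1$. Let $\mathcal I=\bigcup_n\mathcal I_n$ and, for $t=t_k^n\in\mathcal I$, let $V^\infty_t=\lim_{m\ge n,\,m\to\infty}V^m_{t}$ (an increasing limit). Then for each $t\in\mathcal I$, $$V_t^\infty=\operatorname*{ess\,sup}_{\tau\in\mathcal T^\infty_{t,1}}\hat{\mathbb E}_t[X_\tau],$$ where $\mathcal T^\infty_{t,1}$ is the collection of all $G$-stopping times $\tau$ with $t\le\tau\le1$.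
   Context: Framework. Fix $0\le\underline\sigma\le\bar\sigma<\infty$ and $G(a)=\frac12(\bar\sigma^2a^+-\underline\sigma^2a^-)$. $\Omega=C_0([0,\infty);\mathbb R)$ is the space of continuous paths starting at $0$ (locally uniform topology, Borel $\sigma$-field $\mathcal B(\Omega)$), $B$ the canonical process, $\Omega_t=\{\omega_{\cdot\wedge t}:\omega\in\Omega\}$. $L_{ip}(\Omega_t)=\{\varphi(B_{t_1},\dots,B_{t_m}): m\ge1,\ t_i\in[0,t],\ \varphi \text{ bounded Lipschitz}\}$, $L_{ip}(\Omega)=\bigcup_tL_{ip}(\Omega_t)$. $\hat{\mathbb E}$ is the $G$-expectation, with conditional $G$-expectations $\hat{\mathbb E}_t$: for $X=\varphi(B_{t_1},B_{t_2}-B_{t_1},\dots,B_{t_m}-B_{t_{m-1}})$ one sets $\hat{\mathbb E}_{t_j}[X]=\varphi_j(B_{t_1},\dots,B_{t_j}-B_{t_{j-1}})$, where $\varphi_m=\varphi$ and $\varphi_{i-1}(x_1,\dots,x_{i-1})=u(t_i-t_{i-1},0)$ with $u$ the viscosity solution of $\partial_tu=G(\partial^2_{yy}u)$, $u(0,y)=\varphi_i(x_1,\dots,x_{i-1},y)$; $\hat{\mathbb E}=\hat{\mathbb E}_0$. $L_G^p(\Omega_t)$ is the completion of $L_{ip}(\Omega_t)$ under $\hat{\mathbb E}[|\cdot|^p]^{1/p}$. $\mathcal P$ is the weakly compact set of all probability measures $P$ on $\Omega$ with $E^P[X]\le\hat{\mathbb E}[X]$ for all $X\in L_{ip}(\Omega)$;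 it represents $\hat{\mathbb E}$, and for Borel $X$ such that $E^P[X]$ exists for all $P\in\mathcal P$ one sets $\hat{\mathbb E}[X]=\sup_{P\in\mathcal P}E^P[X]$. $c(A)=\sup_{P\in\mathcal P}P(A)$; ''q.s.'' means outside a set of capacity $c$ zero. Relations between random variables are q.s. $S_G^p(0,T)$ is the completion of $S_G^0(0,T)=\{h(t,B_{t_1\wedge t},\dots,B_{t_n\wedge t}):t_1,\dots,t_n\in[0,T],\ h\ \text{bounded Lipschitz on }\mathbb R^{n+1}\}$ under $\|\eta\|_{S_G^p}=\{\hat{\mathbb E}[\sup_{t\in[0,T]}|\eta_t|^p]\}^{1/p}$. Spaces. $L^0(\Omega)$: Borel maps $\Omega\to[-\infty,\infty]$; $\mathcal L(\Omega)$: those $X\in L^0(\Omega)$ for which $E^P[X]$ exists for every $P\in\mathcal P$; $\mathbb L^1(\Omega)=\{X\in L^0(\Omega):\hat{\mathbb E}[|X|]<\infty\}$; $L_G^{1^*}(\Omega)$: $X\in\mathbb L^1(\Omega)$ with $X_n\downarrow X$ q.s. for some $\{X_n\}\subset L_G^1(\Omega)$; $L_G^{1^*_*}(\Omega)$: $X\in\mathbb L^1(\Omega)$ with $X_n\uparrow X$ q.s. for some $\{X_n\}\subset L_G^{1^*}(\Omega)$; $\bar L_G^{1^*_*}(\Omega)$: $X\in\mathbb L^1(\Omega)$ with $\hat{\mathbb E}[|X_n-X|]\to0$ for some $\{X_n\}\subset L_G^{1^*_*}(\Omega)$. The same definitions with $\Omega_t$ give the spaces over $\Omega_t$. Conditional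 expectation on $\bar L_G^{1^*_*}(\Omega)$. $\hat{\mathbb E}_t$ is extended from $L_{ip}(\Omega)$ to $L^1_G(\Omega)$ and $\bar L_G^{1^*_*}(\Omega)$ by norm limits and monotone limits; it is characterized by $\hat{\mathbb E}_t[X]=\operatorname{ess\,sup}^P_{Q\in\mathcal P(t,P)}E^Q[X|\mathcal F_t]$ $P$-a.s. for every $P\in\mathcal P$, where $\mathcal F_t=\mathcal B(\Omega_t)$ and $\mathcal P(t,P)=\{Q\in\mathcal P:E^Q[X]=E^P[X]\ \forall X\in L_{ip}(\Omega_t)\}$. A random time $\tau:\Omega\to[0,\infty)$ is a $G$-stopping time if $I_{\{\tau\le t\}}\in L_G^{1^*}(\Omega_t)$ for each $t\ge0$. $X_\tau$ denotes $\omega\mapsto X_{\tau(\omega)}(\omega)$. Essential supremum (quasi-sure): for $\mathcal H\subset\mathbb L^1(\Omega)$, $\operatorname{ess\,sup}_{\xi\in\mathcal H}\xi$ is a random variable $\eta\in L^0(\Omega)$ with (i) $\eta\ge\xi$ q.s. for all $\xi\in\mathcal H$, and (ii) if $\eta'\in\mathcal L(\Omega)$ satisfies $\eta'\ge\xi$ q.s. for all $\xi\in\mathcal H$ then $\eta\le\eta'$ q.s. It need not exist in general, but is unique if it does; the asserted equality includes existence. *)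

(* Defs.v *)
From HB Require Import structures.
From mathcomp Require Import all_boot all_order all_algebra.
From mathcomp Require Import all_classical all_reals all_analysis.
From mathcomp Require Import measurable_realfun.

Set Implicit Arguments.
Unset Strict Implicit.
Unset Printing Implicit Defensive.
Import Order.TTheory GRing.Theory Num.Theory.
Import numFieldTopology.Exports numFieldNormedType.Exports.

Local Open Scope classical_set_scope.
Local Open Scope ring_scope.

(* A path of C_0([0,oo); R) is encoded by its extension by 0 to the negative
   half-line, which is continuous on R since the path starts at 0.  Uniform
   convergence on the compact subsets of R is then locally uniform convergence
   on [0,oo). *)
Definition C0 (R : realType) : set {family compact, R -> R} :=
  [set w | continuous (w : R -> R) /\ forall t : R, t <= 0 -> w t = 0].

Definition pathspace (R : realType) : Type := set_type (@C0 R).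

HB.instance Definition _ (R : realType) :=
  Topological.copy (pathspace R) (set_type (@C0 R)).

Lemma C0_0 (R : realType) : @C0 R (fun=> 0).
Proof. by split=> // t; exact: cvg_cst. Qed.

HB.instance Definition _ (R : realType) :=
  isPointed.Build (pathspace R) (SigSub (mem_set (@C0_0 R))).

Definition Omega (R : realType) := g_sigma_algebraType (@open (pathspace R)).

Definition B (R : realType) (t : R) (w : Omega R) : R :=
  (\val (w : pathspace R) : R -> R) t.

Lemma C0_stop (R : realType) (t : R) (w : Omega R) :
  @C0 R (fun s => B (Num.min s t) w).
Proof.
have [cw w0] : C0 (\val (w : pathspace R)).
  exact: set_mem (valP (w : pathspace R)).
split=> [s|s s0].
  rewrite /B; apply: (@continuous_comp _ _ _ (fun s : R => Num.min s t)).
    by apply: continuous_min; [exact: cvg_id|exact: cvg_cst].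
  exact: cw.
by apply: w0; rewrite ge_min s0.
Qed.

Definition stop (R : realType) (t : R) (w : Omega R) : Omega R :=
  SigSub (mem_set (C0_stop t w)) : pathspace R.

Section GFramework.
Variables (R : realType) (sl sb : R).
Local Notation Om := (Omega R).
Implicit Types (P : probability Om R) (h : \bar R).

(* [F_ t%:E] is B(Omega_t), seen as a sigma-algebra on Omega through
   w |-> w_{. /\ t}.  The index +oo stands for Omega itself (B(Omega)); the
   spaces of random variables below are indexed in the same way. *)
Definition F_ h : set (set Om) :=
  match h with
  | t%:E => [set stop t @^-1` A | A in measurable]
  | _ => measurable
  end.

Definition bounded_lipschitz n (phi : 'rV[R]_n -> R) : Prop :=
  bounded_fun (phi : 'rV[R]_n -> R^o) /\
  [lipschitz (phi x : R^o) | x in [set: 'rV[R]_n]].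

Definition Lip h : set (Om -> R) :=
  [set X | exists n (ts : 'I_n.+1 -> R) (phi : 'rV[R]_n.+1 -> R),
     [/\ forall i, 0 <= ts i /\ ((ts i)%:E <= h)%E,
         bounded_lipschitz phi &
         X = fun w => phi (\row_i B (ts i) w)]].

Definition G (a : R) : R :=
  2^-1 * (sb ^+ 2 * Num.max a 0 - sl ^+ 2 * Num.max (- a) 0).

Definition d_t (psi : R -> R -> R) (t y : R) : R := derive1 (psi^~ y) t.
Definition d_y (psi : R -> R -> R) (t y : R) : R := derive1 (psi t) y.
Definition d_yy (psi : R -> R -> R) (t y : R) : R := derive1 (d_y psi t) y.

Definition C12 (psi : R -> R -> R) : Prop :=
  forall t y : R, 0 < t ->
    [/\ derivable (psi^~ y) t 1,
        derivable (psi t) y 1 &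
        derivable (d_y psi t) y 1] /\
    [/\ {for (t, y), continuous (fun p : R * R => d_t psi p.1 p.2)},
        {for (t, y), continuous (fun p : R * R => d_y psi p.1 p.2)} &
        {for (t, y), continuous (fun p : R * R => d_yy psi p.1 p.2)}].

Definition viscosity_subsolution (u : R -> R -> R) : Prop :=
  forall psi t y, C12 psi -> 0 < t ->
    (forall s z, 0 < s -> u s z <= psi s z) -> psi t y = u t y ->
    d_t psi t y <= G (d_yy psi t y).

Definition viscosity_supersolution (u : R -> R -> R) : Prop :=
  forall psi t y, C12 psi -> 0 < t ->
    (forall s z, 0 < s -> psi s z <= u s z) -> psi t y = u t y ->
    G (d_yy psi t y) <= d_t psi t y.

(* Boundedness is the growth condition that makes the solution with a bounded
   Lipschitz initial value unique. *)
Definition viscosity_solution (phi : R -> R) (u : R -> R -> R) : Prop :=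
  [/\ forall y, u 0 y = phi y,
      {within [set p : R * R | 0 <= p.1],
        continuous (fun p : R * R => u p.1 p.2)},
      exists M, forall t y, 0 <= t -> `|u t y| <= M,
      viscosity_subsolution u &
      viscosity_supersolution u].

Definition Gheat (phi : R -> R) : R -> R -> R :=
  xget (fun _ _ => 0) [set u | viscosity_solution phi u].

(* [Gvalue [:: d_1; ..; d_m] f] is phi_0 in the backward recursion
   phi_m = f, phi_{i-1}(x_1, .., x_{i-1}) = u(d_i, 0),
   u(0, y) = phi_i(x_1, .., x_{i-1}, y). *)
Fixpoint Gvalue (ds : seq R) (f : seq R -> R) : R :=
  if ds is d :: ds' then
    Gheat (fun y => Gvalue ds' (fun xs => f (y :: xs))) d 0
  else f [::].

Definition row_of n (xs : seq R) : 'rV[R]_n := \row_(i < n) xs`_i.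

(* With t_0 = 0 and B_0 = 0: t_i - t_{i-1}, and B_{t_i} - B_{t_{i-1}}. *)
Definition time_steps (ts : seq R) : seq R := pairmap (fun r s => s - r) 0 ts.
Definition increments (ts : seq R) (w : Om) : seq R :=
  pairmap (fun r s => B s w - B r w) 0 ts.

(* [X] in L_ip(Omega) and [Y] = E_t[X], with t = t_j. *)
Definition cond_Lip (t : R) (X Y : Om -> R) : Prop :=
  exists n (ts : n.+1.-tuple R) (j : nat) (phi : 'rV[R]_n.+1 -> R),
    [/\ path <=%R 0 ts, (j <= n.+1)%N, t = (0 :: ts)`_j &
        bounded_lipschitz phi] /\
    [/\ X = (fun w => phi (row_of n.+1 (increments ts w))) &
        Y = (fun w => Gvalue (drop j (time_steps ts)) (fun xs =>
               phi (row_of n.+1 (take j (increments ts w) ++ xs))))].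

Definition PP : set (probability Om R) :=
  [set P | forall X (e : R), cond_Lip 0 X (cst e) ->
     (\int[P]_w (X w)%:E <= e%:E)%E].

Definition Ehat (X : Om -> \bar R) : \bar R :=
  ereal_sup [set (\int[P]_w X w)%E | P in PP].

Definition capacity (A : set Om) : \bar R := ereal_sup [set P A | P in PP].

Definition qs (Q : Om -> Prop) : Prop :=
  exists N : set Om,
    [/\ measurable N, capacity N = 0%E & forall w, ~ N w -> Q w].

Definition L0 h : set (Om -> \bar R) :=
  [set X | forall A : set (\bar R), measurable A -> F_ h (X @^-1` A)].

(* The expectation under P of a Borel map exists, possibly infinite, when its
   positive or its negative part is P-integrable. *)
Definition Lexp : set (Om -> \bar R) :=
  [set X | L0 +oo%E X /\ forall P, PP P ->
     (\int[P]_w X^\+ w < +oo)%E \/ (\int[P]_w X^\- w < +oo)%E].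

Definition L1 h : set (Om -> \bar R) :=
  [set X | L0 h X /\ (Ehat (fun w => `|X w|) < +oo)%E].

Definition cvg_L1 (Xn : nat -> Om -> \bar R) (X : Om -> \bar R) : Prop :=
  Ehat (fun w => `|Xn n w - X w|)%E @[n --> \oo] --> 0%E.

Definition qs_decreases (Xn : nat -> Om -> \bar R) (X : Om -> \bar R) : Prop :=
  qs (fun w => nonincreasing_seq (Xn ^~ w) /\ Xn n w @[n --> \oo] --> X w).

Definition qs_increases (Xn : nat -> Om -> \bar R) (X : Om -> \bar R) : Prop :=
  qs (fun w => nondecreasing_seq (Xn ^~ w) /\ Xn n w @[n --> \oo] --> X w).

Definition LG1 h : set (Om -> \bar R) :=
  [set X | L1 h X /\ exists Xn : nat -> Om -> R,
     (forall n, Lip h (Xn n)) /\ cvg_L1 (fun n => EFin \o Xn n) X].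

(* L_G^{1^*} *)
Definition LG1s h : set (Om -> \bar R) :=
  [set X | L1 h X /\ exists Xn,
     (forall n, LG1 h (Xn n)) /\ qs_decreases Xn X].

(* L_G^{1^*_*} *)
Definition LG1ss h : set (Om -> \bar R) :=
  [set X | L1 h X /\ exists Xn,
     (forall n, LG1s h (Xn n)) /\ qs_increases Xn X].

(* \bar L_G^{1^*_*} *)
Definition LG1bar h : set (Om -> \bar R) :=
  [set X | L1 h X /\ exists Xn,
     (forall n, LG1ss h (Xn n)) /\ cvg_L1 Xn X].

(* [cond_* t X Y] says that [Y] is a version of E_t[X]. *)
Definition cond_LG1 (t : R) (X Y : Om -> \bar R) : Prop :=
  [/\ LG1 +oo%E X, L1 t%:E Y & exists Xn Yn : nat -> Om -> R,
    [/\ forall n, cond_Lip t (Xn n) (Yn n),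
        cvg_L1 (fun n => EFin \o Xn n) X &
        cvg_L1 (fun n => EFin \o Yn n) Y]].

Definition cond_LG1s (t : R) (X Y : Om -> \bar R) : Prop :=
  [/\ LG1s +oo%E X, L1 t%:E Y & exists Xn Yn,
    [/\ forall n, cond_LG1 t (Xn n) (Yn n),
        qs_decreases Xn X & qs_decreases Yn Y]].

Definition cond_LG1ss (t : R) (X Y : Om -> \bar R) : Prop :=
  [/\ LG1ss +oo%E X, L1 t%:E Y & exists Xn Yn,
    [/\ forall n, cond_LG1s t (Xn n) (Yn n),
        qs_increases Xn X & qs_increases Yn Y]].

Definition cond_LG1bar (t : R) (X Y : Om -> \bar R) : Prop :=
  [/\ LG1bar +oo%E X, L1 t%:E Y & exists Xn Yn,
    [/\ forall n, cond_LG1ss t (Xn n) (Yn n),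
        cvg_L1 Xn X & cvg_L1 Yn Y]].

Definition Econd_defined (t : R) (X : Om -> \bar R) : Prop :=
  exists Y, cond_LG1bar t X Y.

(* A version of E_t[X] when [Econd_defined t X], and 0 otherwise. *)
Definition Econd (t : R) (X : Om -> \bar R) : Om -> \bar R :=
  xget (cst 0%E) [set Y | cond_LG1bar t X Y].

Definition SG0 (T : R) : set (R -> Om -> R) :=
  [set eta | exists n (ts : 'I_n -> R) (hh : 'rV[R]_(1 + n) -> R),
     [/\ forall i, 0 <= ts i <= T, bounded_lipschitz hh &
         eta = fun t w =>
           hh (row_mx (const_mx t) (\row_i B (Num.min (ts i) t) w))]].

Definition SGnorm (p T : R) (eta : R -> Om -> R) : \bar R :=
  poweR (Ehat (fun w => ereal_sup
    [set (`|eta t w| `^ p)%:E | t in [set t : R | 0 <= t <= T]])) p^-1.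

(* An element of the completion of SG0 is represented by a process all of whose
   paths are continuous on [0,T]: a sequence in SG0 that is Cauchy for the norm
   has a subsequence that converges uniformly on [0,T] q.s. *)
Definition SG (p T : R) : set (R -> Om -> R) :=
  [set X : R -> Om -> R | [/\ forall t : R, 0 <= t <= T -> measurable_fun setT (X t),
     forall w, {within [set t : R | 0 <= t <= T], continuous (fun t => X t w)} &
     exists eta : nat -> R -> Om -> R,
       (forall n, SG0 T (eta n)) /\
       SGnorm p T (fun t w => eta n t w - X t w) @[n --> \oo] --> 0%E]].

Definition G_stopping_time (tau : Om -> R) : Prop :=
  (forall w, 0 <= tau w) /\
  forall t, 0 <= t -> LG1s t%:E (fun w => (\1_[set w' | tau w' <= t] w)%:E).

Definition stopping_times (t T : R) : set (Om -> R) :=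
  [set tau | G_stopping_time tau /\ forall w, t <= tau w <= T].

Definition at_time (X : R -> Om -> R) (tau : Om -> R) : Om -> \bar R :=
  fun w => (X (tau w) w)%:E.

Definition is_qs_ess_sup (H : set (Om -> \bar R)) (eta : Om -> \bar R) : Prop :=
  [/\ L0 +oo%E eta,
      forall xi, H xi -> qs (fun w => xi w <= eta w)%E &
      forall eta', Lexp eta' ->
        (forall xi, H xi -> qs (fun w => xi w <= eta' w)%E) ->
        qs (fun w => eta w <= eta' w)%E].

Definition dyadic (n k : nat) : R := k%:R / 2 ^+ n.

(* [Vback X n j] is V^n at the time t^n_{2^n - j}. *)
Fixpoint Vback (X : R -> Om -> R) (n j : nat) : Om -> \bar R :=
  if j is j'.+1 then
    let t := dyadic n (2 ^ n - j) in
    fun w => maxe (X t w)%:E (Econd t (Vback X n j') w)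
  else fun w => (X 1 w)%:E.

(* V^n at the time t^n_k, for k <= 2^n. *)
Definition V (X : R -> Om -> R) (n k : nat) : Om -> \bar R :=
  Vback X n (2 ^ n - k).

(* V^{n+j} at the time t^n_k = t^{n+j}_{k 2^j}. *)
Definition Vrefined (X : R -> Om -> R) (n k j : nat) : Om -> \bar R :=
  V X (n + j) (k * 2 ^ j).

Definition Vinf (X : R -> Om -> R) (n k : nat) : Om -> \bar R :=
  fun w => limn (fun j => Vrefined X n k j w).

End GFramework.

(* Main.v *)
(** The G-heat equation is solved by the Nisio semigroup, a limit along the dyadic
    time grids of iterated three-point operators; viscosity comparison (doubling in
    time, against solutions smoothed in space) identifies it with [Gheat].  A linear
    functional below the G-expectation that extends a given law on F_t and attains
    E_t[X] comes from Hahn-Banach, and from a measure by chaining and Daniell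
    continuity.  Hence a version Y of E_t[X] is characterized by: E^P[X; A] <= E^P[Y; A]
    for every P in PP and A in F_t, with equality up to e under some Q in PP that
    agrees with P on F_t.  This passes to all the completions.

    Upper bound: V^m is a supermartingale above X, and a stopping time is the limit of
    its dyadic approximations from the right, along which X is continuous in L^1.
    Lower bound: the first grid time t_k with V^m = X is a G-stopping time since
    {tau <= t_k} = {min_(j <= k) (V_j - X_j) <= 0} and the indicator of (-oo, 0] is a
    decreasing limit of Lipschitz functions; pasting nearly optimal measures backwards
    along the grid shows that it is optimal for V^m.  Monotonicity in m does the rest. *)
From HB Require Import structures.
Require Import Defs.
From mathcomp Require Import all_boot all_order all_algebra.
From mathcomp Require Import all_classical all_reals all_analysis measurable_realfun.
From mathcomp Require Import zify ring lra.
Import Order.TTheory GRing.Theory Num.Theory.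
Import numFieldTopology.Exports numFieldNormedType.Exports.
Local Open Scope classical_set_scope.
Local Open Scope ring_scope.
Set Implicit Arguments.
Unset Strict Implicit.
Unset Printing Implicit Defensive.

(** * Nisio semigroups *)

(** [Gheat] picks a solution by choice, so nothing can be computed with the G-expectation before
    existence and uniqueness are known. As [sl = 0] is allowed, solutions need not be smooth;
    uniqueness therefore compares an arbitrary solution with the constructed one, whose space
    averages are smooth supersolutions because the semigroup is sublinear and translation invariant.
    The reverse bound restarts linear heat flows at every grid time.

    One fixed free ultrafilter supplies the compactness: every bounded real sequence converges along
    it and the limit keeps sums and inequalities. It builds the semigroups, the limit paths of the
    Daniell argument and the weak limits of measures in [PP].

    The conditional expectation is characterized by integrals over sets of F_t since these survive
    limits. L^1 limits and increasing limits are direct; a decreasing limit moves the nearly optimal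
    measure with the index and needs weak compactness and terms in [LG1].

    Versions are determined only q.s., and [Econd] and [Vinf] are total functions with default
    values; hence the passage to real-valued adapted versions before stopping sets are formed. *)

Definition ultra : set_system nat := projT1 (cid (ultraFilterLemma eventually_filter)).

#[global] Instance ultra_ultra : UltraFilter ultra.
Proof. by rewrite /ultra; case: cid => G []. Qed.

Lemma ultra_eventually : \oo `<=` ultra.
Proof. by rewrite /ultra; case: cid => G []. Qed.

Section Ulim.
Variable R : realType.
Implicit Types u v : nat -> R.

Definition ubd u := exists M, forall n, `|u n| <= M.
Definition ulim u : R := lim (u @ ultra).

Lemma ulim_cvg u : ubd u -> u @ ultra --> ulim u.
Proof.
move=> [M uM].
have : compact `[- M, M]%classic by exact: segment_compact.
have Uu : UltraFilter (u @ ultra).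
  apply: Build_UltraFilter => G PG uG; apply/seteqP; split=> // A GA.
  have [//|nA] := in_ultra_setVsetC (u @^-1` A) ultra_ultra.
  have /uG GnA : (u @ ultra) (~` A) by [].
  by have /filter_ex [x []] : G (A `&` ~` A) by exact: filterI.
rewrite compact_ultra => /(_ (u @ ultra) Uu)[|p [_ /= up]].
  by rewrite /nbhs /=; apply: (@filterE _ ultra) => n /=; rewrite in_itv /= -ler_norml.
by apply/cvg_ex; exists p.
Qed.

Lemma cvg_ulim u l : u @ ultra --> l -> ulim u = l.
Proof. by move=> ?; exact: cvg_lim. Qed.

Lemma cvg_ultra u (l : R) : u @ \oo --> l -> u @ ultra --> l.
Proof. by move=> + A Al => /(_ A Al); exact: ultra_eventually. Qed.

Lemma ulim_le u v : ubd u -> ubd v -> (forall n, u n <= v n) -> ulim u <= ulim v.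
Proof.
move=> bu bv uv.
by apply: (@ler_cvg_to _ ultra _ _ u v);
  [exact: ulim_cvg|exact: ulim_cvg|exact: nearW].
Qed.

Lemma ulim_near_le u v : ubd u -> ubd v -> (\forall n \near ultra, u n <= v n) -> ulim u <= ulim v.
Proof.
by move=> bu bv uv;
  apply: (@ler_cvg_to _ ultra _ _ u v); [exact: ulim_cvg|exact: ulim_cvg|].
Qed.

Lemma ubdD u v : ubd u -> ubd v -> ubd (fun n => u n + v n).
Proof.
move=> [M uM] [N vN]; exists (M + N) => n.
by rewrite (le_trans (ler_normD _ _))// lerD.
Qed.

Lemma ubdM u v : ubd u -> ubd v -> ubd (fun n => u n * v n).
Proof.
move=> [M uM] [N vN]; exists (M * N) => n.
by rewrite normrM ler_pM.
Qed.

Lemma ubd_cst (c : R) : ubd (fun=> c). Proof. by exists `|c|. Qed.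

Lemma ulimD u v : ubd u -> ubd v -> ulim (fun n => u n + v n) = ulim u + ulim v.
Proof. by move=> bu bv; apply: cvg_ulim; apply: cvgD; exact: ulim_cvg. Qed.

Lemma ulimM u v : ubd u -> ubd v -> ulim (fun n => u n * v n) = ulim u * ulim v.
Proof. by move=> bu bv; apply: cvg_ulim; apply: cvgM; exact: ulim_cvg. Qed.

Lemma ulim_cst (c : R) : ulim (fun=> c) = c.
Proof. by apply: cvg_ulim; exact: cvg_cst. Qed.

Lemma ulim_norm_le u (M : R) : (forall n, `|u n| <= M) -> `|ulim u| <= M.
Proof.
move=> uM.
have bu : ubd u by exists M.
have := ulim_le bu (ubd_cst M) (fun n => le_trans (ler_norm _) (uM n)).
have := ulim_le (ubd_cst (- M)) bu.
rewrite !ulim_cst => + h2; move=> h1; rewrite ler_norml h2 andbT; apply: h1 => n.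
by have := uM n; rewrite ler_norml => /andP[].
Qed.

End Ulim.

(** * Sublinear translation-invariant operators and their moments *)

Section Sublinear.
Variable R : realType.
Implicit Types (f g h : R -> R) (T : (R -> R) -> R -> R).

(** Order four is the growth at which a local Taylor bound can be made global by adding a multiple
    of [x ^+ 4], at a cost of order [tau ^+ 2] over a time tau. *)
Definition gr f := exists C, forall y, `|f y| <= C * (1 + y ^+ 4).

Lemma gr_ge0 f : gr f -> exists2 C, 0 <= C & forall y, `|f y| <= C * (1 + y ^+ 4).
Proof.
move=> [C fC]; exists `|C| => // y; apply: le_trans (fC y) _.
by rewrite ler_wpM2r ?ler_norm// addr_ge0// exprn_even_ge0.
Qed.

Lemma grD f g : gr f -> gr g -> gr (fun x => f x + g x).
Proof.
move=> [C fC] [D gD]; exists (C + D) => y.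
by rewrite mulrDl (le_trans (ler_normD _ _))// lerD.
Qed.

Lemma grZ (a : R) f : gr f -> gr (fun x => a * f x).
Proof.
move=> [C fC]; exists (`|a| * C) => y.
by rewrite normrM -mulrA ler_wpM2l.
Qed.

Lemma grN f : gr f -> gr (fun x => - f x).
Proof. by move=> [C fC]; exists C => y; rewrite normrN. Qed.

Lemma gr_cst (c : R) : gr (fun=> c).
Proof.
exists `|c| => y; rewrite ler_peMr// lerDl exprn_even_ge0//.
Qed.

Lemma gr_pow4 : gr (fun x => x ^+ 4).
Proof. by exists 1 => y; rewrite mul1r ger0_norm ?exprn_even_ge0// lerDr. Qed.

Lemma sqr_le4 (y : R) : y ^+ 2 <= 1 + y ^+ 4.
Proof. have : 0 <= (y ^+ 2 - 1) ^+ 2 by exact: sqr_ge0. have := sqr_ge0 y; nra. Qed.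

Lemma norm_le4 (y : R) : `|y| <= 1 + y ^+ 4.
Proof.
have := sqr_ge0 (`|y| - 1); have := sqr_ge0 (y ^+ 2 - 1).
by have := real_normK (num_real y); have := normr_ge0 y; nra.
Qed.

Lemma gr_sqr : gr (fun x => x ^+ 2).
Proof. by exists 1 => y; rewrite mul1r ger0_norm ?sqr_ge0// sqr_le4. Qed.

Lemma gr_id : gr id.
Proof. by exists 1 => y; rewrite mul1r norm_le4. Qed.

Lemma gr_tr (a : R) f : gr f -> gr (fun x => f (x + a)).
Proof.
move=> /gr_ge0[C C0 fC]; exists (C * (8 * (1 + a ^+ 4))) => y.
rewrite (le_trans (fC _))// -mulrA ler_wpM2l//.
have h x z : 0 <= x -> 0 <= z -> (x + z) ^+ 2 <= 2 * (x ^+ 2 + z ^+ 2) :> R.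
  by have := sqr_ge0 (x - z); nra.
have : (y + a) ^+ 4 <= 8 * (y ^+ 4 + a ^+ 4).
  have h1 : (y + a) ^+ 2 <= 2 * (y ^+ 2 + a ^+ 2) by have := sqr_ge0 (y - a); nra.
  have := h _ _ (sqr_ge0 y) (sqr_ge0 a).
  have := sqr_ge0 (y + a); rewrite -!exprM; nra.
have ? : 0 <= y ^+ 4 by exact: exprn_even_ge0.
have ? : 0 <= a ^+ 4 by exact: exprn_even_ge0.
nra.
Qed.

Lemma gr_norm f : gr f -> gr (fun x => `|f x|).
Proof. by move=> [C fC]; exists C => y; rewrite normr_id. Qed.

Lemma gr_bd f (M : R) : (forall x, `|f x| <= M) -> gr f.
Proof.
move=> fM; exists M => y; apply: le_trans (fM y) _.
have M0 : 0 <= M by exact: le_trans (fM 0).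
by rewrite ler_peMr// lerDl exprn_even_ge0.
Qed.

Definition quad (c p q : R) := fun x => c + p * x + q * x ^+ 2.

Lemma gr_quad c p q : gr (quad c p q).
Proof.
by apply: grD; [apply: grD; [exact: gr_cst|apply: grZ; exact: gr_id]|apply: grZ; exact: gr_sqr].
Qed.

Definition lip (L : R) f := forall x y, `|f x - f y| <= L * `|x - y|.

Lemma gr_lip L f : lip L f -> gr f.
Proof.
move=> fL.
have [D fD] : gr (fun x => `|f 0| + `|L| * `|x|).
  by apply: grD; [exact: gr_cst|apply: grZ; apply: gr_norm; exact: gr_id].
exists D => y; apply: le_trans (fD y); apply: le_trans (ler_norm _).
have := fL y 0; rewrite subr0 => fy.
have h := ler_normD (f 0) (f y - f 0).
rewrite addrC subrK in h; apply: le_trans h _.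
rewrite lerD2l; apply: le_trans fy _.
by rewrite ler_wpM2r// ler_norm.
Qed.

(** These properties hold for one step and survive composition, maxima and limits. Translation
    invariance keeps Lipschitz constants and reduces every estimate to the point 0. *)
Record subl T : Prop := Subl {
  sl_mono : forall f g, gr f -> gr g -> (forall y, f y <= g y) -> forall y, T f y <= T g y;
  sl_add : forall f g y, gr f -> gr g -> T (fun x => f x + g x) y <= T f y + T g y;
  sl_hom : forall a f y, 0 <= a -> gr f -> T (fun x => a * f x) y = a * T f y;
  sl_tr : forall a f y, gr f -> T (fun x => f (x + a)) y = T f (y + a);
  sl_cst : forall c y, T (fun=> c) y = c;
  sl_gr : forall f, gr f -> gr (T f) }.

(* The moments of a sublinear operator that advances time by tau, with
   generator [f |-> g f''].  Only quadratics are propagated exactly. *)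
Definition mom (g : R -> R) (tau : R) T :=
  (forall c p q y, T (quad c p q) y = quad c p q y + g (2 * q) * tau) /\
  (forall y, T (fun x => x ^+ 4) y <=
     y ^+ 4 + 6 * (g 2 * tau) * y ^+ 2 + 3 * (g 2 * tau) ^+ 2).

Section Theory.
Variable T : (R -> R) -> R -> R.
Hypothesis slT : subl T.

Lemma sl_shift f c y : gr f -> T (fun x => f x + c) y = T f y + c.
Proof.
move=> gf; apply/le_anti/andP; split.
  by rewrite -[X in _ <= _ + X](sl_cst slT c y); apply: sl_add => //; exact: gr_cst.
have := @sl_add _ slT (fun x => f x + c) (fun=> - c) y.
rewrite (_ : (fun x => f x + c + - c) = f); last by apply/funext => x; rewrite addrK.
rewrite (sl_cst slT) => h; rewrite -lerBrDr; apply: h; last exact: gr_cst.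
by apply: grD => //; exact: gr_cst.
Qed.

Lemma sl_le_add f g h y : gr f -> gr g -> gr h -> (forall x, f x <= g x + h x) ->
  T f y <= T g y + T h y.
Proof.
move=> gf gg gh fgh; apply: le_trans (sl_add slT _ gg gh).
by apply: (sl_mono slT) => //; exact: grD.
Qed.

Lemma sl_le_shift f g c y : gr f -> gr g -> (forall x, f x <= g x + c) -> T f y <= T g y + c.
Proof. by move=> gf gg fg; rewrite -(sl_cst slT c y); apply: sl_le_add => //; exact: gr_cst. Qed.

Lemma sl_dist f g h y : gr f -> gr g -> gr h -> (forall x, `|f x - g x| <= h x) ->
  `|T f y - T g y| <= T h y.
Proof.
move=> gf gg gh fgh; rewrite ler_distl lerBlDr; apply/andP; split;
  apply: sl_le_add => // x; have := fgh x; rewrite ler_distl => /andP[]; lra.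
Qed.

Lemma sl_bd f (M : R) : (forall x, `|f x| <= M) -> forall y, `|T f y| <= M.
Proof.
move=> fM y; have gf := gr_bd fM.
rewrite ler_norml; have h1 := sl_cst slT (- M) y; have h2 := sl_cst slT M y.
apply/andP; split; [rewrite -h1|rewrite -h2]; apply: (sl_mono slT) => //;
  try exact: gr_cst; by move=> x; have := fM x; rewrite ler_norml => /andP[].
Qed.

Lemma sl_lip L f : lip L f -> lip L (T f).
Proof.
move=> fL x y; have gf := gr_lip fL.
have -> : T f x = T (fun z => f (z + (x - y))) y.
  by rewrite (sl_tr slT)//; congr (T f _); ring.
rewrite -[X in _ <= X](sl_cst slT _ y).
apply: sl_dist => //; [exact: gr_tr|exact: gr_cst|].
by move=> z; apply: le_trans (fL _ _) _; rewrite (_ : z + _ - z = x - y)//; ring.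
Qed.

Lemma sl_zero f y : T f y = T (fun x => f (y + x)) 0 \/ ~ gr f.
Proof.
have [gf|] := pselect (gr f); [left|by right].
by rewrite (eq_fun (fun x => congr1 f (addrC y x))) (sl_tr slT)// add0r.
Qed.

Lemma sl_at f y : gr f -> T f y = T (fun x => f (y + x)) 0.
Proof. by case: (sl_zero f y). Qed.

Variables (g : R -> R) (tau : R).
Hypotheses (tau0 : 0 <= tau) (mT : mom g tau T).

Lemma mom_sqr : T (fun x => x ^+ 2) 0 = g 2 * tau.
Proof.
have := mT.1 0 0 1 0; rewrite /quad (_ : (fun x => _) = (fun x => x ^+ 2)).
  by move=> ->; rewrite mulr1; ring.
by apply/funext => x; ring.
Qed.

Lemma mom_pow4 : T (fun x => x ^+ 4) 0 <= 3 * (g 2 * tau) ^+ 2.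
Proof. by apply: le_trans (mT.2 0) _; lra. Qed.

(** From [|x| <= d + x ^+ 2 / d]: only the exact second moment enters, and d remains free to be
    optimized. *)
Lemma lip_mom L f y d : 0 < d -> lip L f -> 0 <= L ->
  `|T f y - f y| <= L * (d + g 2 * tau / d).
Proof.
move=> d0 fL L0; have gf := gr_lip fL.
rewrite sl_at// -[f y](sl_cst slT _ 0).
have -> : L * (d + g 2 * tau / d) = T (fun x => L / d * x ^+ 2 + L * d) 0.
  rewrite sl_shift; last by apply: grZ; exact: gr_sqr.
  rewrite (sl_hom slT) ?mom_sqr//; [by field; rewrite gt_eqF|by rewrite divr_ge0// ltW|exact: gr_sqr].
apply: sl_dist.
- have := gr_tr y gf; congr gr; apply/funext => x; by rewrite addrC.
- exact: gr_cst.
- by apply: grD; [apply: grZ; exact: gr_sqr|exact: gr_cst].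
move=> x; apply: le_trans (fL _ _) _.
rewrite (_ : y + x - y = x); last by ring.
rewrite (_ : L / d * x ^+ 2 + L * d = L * (x ^+ 2 / d + d)); last by ring.
rewrite ler_wpM2l//.
rewrite -(@ler_pM2r _ d)// mulrDl divfK ?gt_eqF// -(real_normK (num_real x)).
have := sqr_ge0 (`|x| - d); nra.
Qed.

End Theory.

Lemma gr_iter T : subl T -> forall k f, gr f -> gr (iter k T f).
Proof. by move=> sT; elim=> //= k IH f gf; apply: (sl_gr sT); exact: IH. Qed.

Lemma subl_id : subl id. Proof. by []. Qed.

Lemma subl_comp T T' : subl T -> subl T' -> subl (T \o T').
Proof.
move=> s s'; split=> /=.
- move=> f g gf gg fg; apply: (sl_mono s); try exact: (sl_gr s').
  exact: (sl_mono s').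
- move=> f g y gf gg; apply: (sl_le_add s); try exact: (sl_gr s').
    by apply: (sl_gr s'); exact: grD.
  by move=> x; exact: sl_add.
- move=> a f y a0 gf; rewrite -(sl_hom s)//; last exact: (sl_gr s').
  by congr (T _ y); apply/funext => x; exact: sl_hom.
- move=> a f y gf; rewrite -(sl_tr s)//; last exact: (sl_gr s').
  by congr (T _ y); apply/funext => x; exact: sl_tr.
- move=> c y; rewrite -[RHS](sl_cst s c y); congr (T _ y); apply/funext => x.
  exact: sl_cst.
- by move=> f gf; apply: (sl_gr s); exact: (sl_gr s').
Qed.

(** The right-hand side of the quartic bound is the fourth moment at y of a Gaussian of variance
    [g 2 * tau], so composing two bounds adds the variances exactly. *)
Lemma mom_comp g T T' a b : 0 <= g 2 -> 0 <= a -> 0 <= b -> subl T -> subl T' ->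
  mom g a T -> mom g b T' -> mom g (a + b) (T \o T').
Proof.
move=> g0 a0 b0 s s' [m1 m2] [m1' m2']; split=> /= [c p q y|y].
  have -> : T' (quad c p q) = fun x => quad c p q x + g (2 * q) * b by exact/funext.
  by rewrite (sl_shift s) ?m1; [ring|exact: gr_quad].
have gs : gr (fun x => 6 * (g 2 * b) * x ^+ 2 + 3 * (g 2 * b) ^+ 2).
  by apply: grD; [apply: grZ; exact: gr_sqr|exact: gr_cst].
have := @sl_le_add _ s (T' (fun x => x ^+ 4)) (fun x => x ^+ 4)
   (fun x => 6 * (g 2 * b) * x ^+ 2 + 3 * (g 2 * b) ^+ 2) y (sl_gr s' gr_pow4) gr_pow4 gs.
move=> /(_ _)/le_trans; apply; first by move=> x; rewrite addrA; exact: m2'.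
have -> : T (fun x => 6 * (g 2 * b) * x ^+ 2 + 3 * (g 2 * b) ^+ 2) y =
  6 * (g 2 * b) * (y ^+ 2 + g 2 * a) + 3 * (g 2 * b) ^+ 2.
  rewrite (sl_shift s) ?(sl_hom s) ?mulr_ge0//; try exact: gr_sqr; last by apply: grZ; exact: gr_sqr.
  congr (_ * _ + _); have := m1 0 0 1 y; rewrite /quad mulr1.
  by rewrite (_ : (fun x => _) = (fun x => x ^+ 2)) ?add0r ?mul0r ?add0r ?mul1r//;
    apply/funext => x; ring.
by apply: le_trans (lerD (m2 y) (lexx _)) _; rewrite le_eqVlt; apply/orP; left; apply/eqP; ring.
Qed.

Lemma iter_subl T k : subl T -> subl (iter k T).
Proof.
move=> s; elim: k => [|k IH]; first exact: subl_id.
exact: (subl_comp s IH).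
Qed.

Lemma mom_id g : mom g 0 id.
Proof. by split=> [c p q y|y] /=; rewrite !mulr0 ?addr0// expr0n/= mulr0 mul0r !addr0. Qed.

Lemma iter_mom g T a k : 0 <= g 2 -> 0 <= a -> subl T -> mom g a T -> mom g (k%:R * a) (iter k T).
Proof.
move=> g0 a0 s m; elim: k => [|k IH]; first by rewrite mul0r; exact: mom_id.
rewrite -natr1 mulrDl mul1r addrC.
by apply: (mom_comp g0 a0 _ s _ m IH); [exact: mulr_ge0|exact: iter_subl].
Qed.

End Sublinear.

Lemma near_forall_ltn (F : set_system nat) (FF : Filter F) (P : nat -> nat -> Prop) N :
  (forall i, (i < N)%N -> \forall n \near F, P i n) ->
  \forall n \near F, forall i, (i < N)%N -> P i n.
Proof.
elim: N => [|N IH] H; first exact: nearW.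
apply: filterS2 (IH (fun i iN => H i (leqW iN))) (H N (ltnSn N)) => n h1 h2 i.
by rewrite ltnS leq_eqVlt => /orP[/eqP ->//|]; exact: h1.
Qed.

Section UlimNear.
Variable R : realType.

Lemma ulim_eq_near (u v : nat -> R) : ubd u -> ubd v ->
  (forall e : R, 0 < e -> \forall n \near ultra, `|u n - v n| <= e) -> ulim u = ulim v.
Proof.
move=> bu bv uv; apply/le_anti/andP; split; apply/ler_addgt0Pr => e e0.
- rewrite -[X in _ + X](ulim_cst e) -ulimD//; last exact: ubd_cst.
  apply: ulim_near_le => //; first by apply: ubdD => //; exact: ubd_cst.
  by apply: filterS (uv _ e0) => n; rewrite ler_distl => /andP[]; lra.
- rewrite -[X in _ + X](ulim_cst e) -ulimD//; last exact: ubd_cst.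
  apply: ulim_near_le => //; first by apply: ubdD => //; exact: ubd_cst.
  by apply: filterS (uv _ e0) => n; rewrite ler_distl => /andP[]; lra.
Qed.

Lemma cvg_invSn : (n.+1%:R^-1 : R) @[n --> \oo] --> (0 : R).
Proof. exact: cvg_harmonic. Qed.

Lemma near_invSn (e : R) : 0 < e -> \forall n \near ultra, (n.+1%:R^-1 : R) <= e.
Proof.
move=> e0; apply: ultra_eventually.
have /cvgrPdist_le/(_ _ e0) := cvg_invSn; apply: filterS => n.
by rewrite sub0r normrN ger0_norm.
Qed.

Lemma gr_center (y c d : R) : gr (fun z => c + d * (z - y) ^+ 2).
Proof.
apply: grD; first exact: gr_cst; apply: grZ.
have := gr_tr (- y) (@gr_sqr R); exact.
Qed.

Lemma mom_center (g : R -> R) a (T : (R -> R) -> R -> R) (y c d : R) : 0 <= d ->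
  subl T -> mom g a T -> T (fun z => c + d * (z - y) ^+ 2) y = c + d * (g 2 * a).
Proof.
move=> d0 sT mT; rewrite (sl_at sT); last exact: gr_center.
have -> : (fun x => c + d * (y + x - y) ^+ 2) = (fun x => d * x ^+ 2 + c).
  by apply/funext => x; ring.
rewrite (sl_shift sT) ?(sl_hom sT) ?(mom_sqr mT)//; [ring|exact: gr_sqr|].
by apply: grZ; exact: gr_sqr.
Qed.

Lemma mom_bd (g : R -> R) a (T : (R -> R) -> R -> R) f C y : 0 <= C ->
  subl T -> mom g a T -> (forall x, `|f x| <= C * (1 + x ^+ 4)) ->
  `|T f y| <= C * (1 + (y ^+ 4 + 6 * (g 2 * a) * y ^+ 2 + 3 * (g 2 * a) ^+ 2)).
Proof.
move=> C0 sT mT fC; have gf : gr f by exists C.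
have g4 : gr (fun x : R => x ^+ 4 + 1) by apply: grD; [exact: gr_pow4|exact: gr_cst].
have h : `|T f y - T (fun=> 0) y| <= T (fun x => C * (x ^+ 4 + 1)) y.
  apply: sl_dist => //; [exact: gr_cst|exact: grZ|].
  by move=> x; rewrite subr0 addrC; exact: fC.
move: h; rewrite (sl_cst sT) subr0 => /le_trans; apply.
rewrite (sl_hom sT y C0 g4); apply: ler_wpM2l => //.
by rewrite (sl_shift sT 1 y (@gr_pow4 R)) addrC lerD2l; exact: mT.2.
Qed.

End UlimNear.

(** * Limit semigroup of iterated sublinear operators *)

Section Semigroup.
Variables (R : realType) (g : R -> R) (O : nat -> (R -> R) -> R -> R).
Hypothesis g0 : 0 <= g 2.
Hypothesis sO : forall n, subl (O n).
Hypothesis mO : forall n, mom g n.+1%:R^-1 (O n).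

Definition steps n (t : R) : nat := Num.truncn (t * n.+1%:R).
Definition stepop n t : (R -> R) -> R -> R := iter (steps n t) (O n).
(** A limit along the ultrafilter exists for all f of quartic growth and all y at once. For the
    G-heat flow and bounded Lipschitz data, uniqueness shows later that it does not depend on the
    ultrafilter. *)
Definition sem (t : R) (f : R -> R) (y : R) : R := ulim (fun n => stepop n t f y).

Lemma stepop_subl n t : subl (stepop n t). Proof. exact: iter_subl. Qed.

Lemma stepop_mom n t : mom g ((steps n t)%:R * n.+1%:R^-1) (stepop n t).
Proof. by apply: iter_mom => //. Qed.

Lemma steps_le n t : 0 <= t -> (steps n t)%:R * n.+1%:R^-1 <= t.
Proof.
move=> t0; rewrite ler_pdivrMr// /steps.
by have /truncn_itv/andP[] : 0 <= t * n.+1%:R by exact: mulr_ge0.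
Qed.

Lemma steps_gt n t : 0 <= t -> t - n.+1%:R^-1 <= (steps n t)%:R * n.+1%:R^-1.
Proof.
move=> t0; rewrite ler_pdivlMr// mulrBl mulVf// lerBlDr natr1 /steps.
by have /truncn_itv/andP[_ /ltW] : 0 <= t * n.+1%:R by exact: mulr_ge0.
Qed.

Lemma steps_ge0 n t : 0 <= (steps n t)%:R * (n.+1%:R^-1 : R).
Proof. by rewrite mulr_ge0. Qed.

Lemma cvg_steps t : 0 <= t -> ((steps n t)%:R * (n.+1%:R^-1 : R)) @[n --> ultra] --> t.
Proof.
move=> t0; apply: cvg_ultra.
apply: (@squeeze_cvgr _ _ _ _ (fun n => t - n.+1%:R^-1) (fun=> t)).
- by apply: nearW => n; rewrite steps_le// steps_gt.
- by rewrite -[X in _ --> X]subr0; apply: cvgB; [exact: cvg_cst|exact: cvg_invSn].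
- exact: cvg_cst.
Qed.

Lemma ubd_steps t : 0 <= t -> ubd (fun n => (steps n t)%:R * (n.+1%:R^-1 : R)).
Proof. by move=> t0; exists t => n; rewrite ger0_norm ?steps_ge0// steps_le. Qed.

Lemma stepop_bd n t f C y : 0 <= t -> 0 <= C -> (forall x, `|f x| <= C * (1 + x ^+ 4)) ->
  `|stepop n t f y| <= C * (1 + (y ^+ 4 + 6 * (g 2 * t) * y ^+ 2 + 3 * (g 2 * t) ^+ 2)).
Proof.
move=> t0 C0 fC.
apply: le_trans (mom_bd y C0 (stepop_subl n t) (stepop_mom n t) fC) _.
have h1 := steps_le n t0; have h2 := steps_ge0 n t.
rewrite ler_wpM2l// lerD2l lerD ?lerD2l// ?ler_wpM2r ?sqr_ge0 ?ler_wpM2l//.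
  by rewrite lerXn2r ?nnegrE ?mulr_ge0// ler_wpM2l.
Qed.

Lemma ubd_stepop t f y : 0 <= t -> gr f -> ubd (fun n => stepop n t f y).
Proof.
move=> t0 /gr_ge0[C C0 fC].
by exists (C * (1 + (y ^+ 4 + 6 * (g 2 * t) * y ^+ 2 + 3 * (g 2 * t) ^+ 2))) => n; exact: stepop_bd.
Qed.

Lemma sem_gr t f : 0 <= t -> gr f -> gr (sem t f).
Proof.
move=> t0 /gr_ge0[C C0 fC].
have [D fD] : gr (fun y => C * (1 + (y ^+ 4 + 6 * (g 2 * t) * y ^+ 2 + 3 * (g 2 * t) ^+ 2))).
  apply: grZ; apply: grD; first exact: gr_cst.
  apply: grD; last exact: gr_cst; apply: grD; first exact: gr_pow4.
  by apply: grZ; exact: gr_sqr.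
exists D => y; apply: le_trans (fD y); apply: le_trans (ler_norm _).
by apply: ulim_norm_le => n; exact: stepop_bd.
Qed.

Lemma sem_subl t : 0 <= t -> subl (sem t).
Proof.
move=> t0; split.
- move=> f h gf gh fh y; apply: ulim_le; try exact: ubd_stepop.
  by move=> n; apply: (sl_mono (stepop_subl n t)).
- move=> f h y gf gh; rewrite -ulimD; try exact: ubd_stepop.
  apply: ulim_le; first by apply: ubd_stepop => //; exact: grD.
    by apply: ubdD; exact: ubd_stepop.
  by move=> n; apply: (sl_add (stepop_subl n t)).
- move=> a f y a0 gf; have := ulimM (ubd_cst a) (ubd_stepop y t0 gf); rewrite ulim_cst /sem => <-.
  by congr ulim; apply/funext => n; apply: (sl_hom (stepop_subl n t)).
- move=> a f y gf.
  by congr ulim; apply/funext => n; apply: (sl_tr (stepop_subl n t)).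
- move=> c y; rewrite -[RHS](ulim_cst c); congr ulim; apply/funext => n.
  exact: (sl_cst (stepop_subl n t)).
- by move=> f; exact: sem_gr.
Qed.

Lemma sem_mom t : 0 <= t -> mom g t (sem t).
Proof.
move=> t0; have bs := ubd_steps t0.
have cs := cvg_ulim (cvg_steps t0).
split=> [c p q y|y].
  transitivity (ulim (fun n => quad c p q y + g (2 * q) * ((steps n t)%:R * n.+1%:R^-1))).
    by congr ulim; apply/funext => n; exact: (stepop_mom n t).1.
  have bc := ubd_cst (g (2 * q)); have bq := ubd_cst (quad c p q y).
  by rewrite (ulimD bq (ubdM bc bs)) (ulimM bc bs) !ulim_cst cs.
pose a n : R := (steps n t)%:R * n.+1%:R^-1.
apply: (@le_trans _ _ (ulim (fun n => y ^+ 4 + 6 * (g 2 * t) * y ^+ 2 + 3 * (g 2 * t) ^+ 2))).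
  apply: ulim_le; [by apply: ubd_stepop => //; exact: gr_pow4|exact: ubd_cst|].
  move=> n; apply: le_trans ((stepop_mom n t).2 y) _.
  have h1 := steps_le n t0; have h2 := steps_ge0 n t.
  rewrite lerD ?lerD2l// ?ler_wpM2r ?sqr_ge0 ?ler_wpM2l//.
  by rewrite lerXn2r ?nnegrE ?mulr_ge0// ler_wpM2l.
by rewrite ulim_cst.
Qed.

Lemma sem_lip t f L y d : 0 <= t -> 0 < d -> lip L f -> 0 <= L ->
  `|sem t f y - f y| <= L * (d + g 2 * t / d).
Proof. by move=> t0 d0 fL L0; apply: (lip_mom (sem_subl t0) (sem_mom t0)). Qed.

Lemma stepop_lip n t f L y : 0 <= t -> lip L f -> 0 <= L ->
  `|stepop n t f y - f y| <= L * (1 + g 2 * t).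
Proof.
move=> t0 fL L0; have h := lip_mom (stepop_subl n t) (stepop_mom n t) y ltr01 fL L0.
apply: le_trans h _; rewrite divr1 ler_wpM2l// lerD2l ler_wpM2l//.
exact: steps_le.
Qed.

Lemma sem_add t f h : (forall n f h y, gr f -> gr h -> O n (fun x => f x + h x) y = O n f y + O n h y) ->
  0 <= t -> gr f -> gr h -> forall y, sem t (fun x => f x + h x) y = sem t f y + sem t h y.
Proof.
move=> addO t0 gf gh y; rewrite -ulimD; try exact: ubd_stepop.
congr ulim; apply/funext => n; rewrite /stepop.
elim: (steps n t) y => //= k IH y.
rewrite -addO; try exact: gr_iter.
by congr (O n _ y); apply/funext => x; exact: IH.
Qed.

(** All iterates share the Lipschitz constant L, so convergence on a finite net of mesh eta spreads
    to the ball. *)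
Lemma stepop_loc_unif t f L y r e : 0 <= t -> lip L f -> 0 <= L -> 0 < r -> 0 < e ->
  \forall n \near ultra, forall z, `|z - y| <= r -> `|stepop n t f z - sem t f z| <= e.
Proof.
move=> t0 fL L0 r0 e0; have gf := gr_lip fL.
pose eta := e / (4 * (L + 1)).
have eta0 : 0 < eta by rewrite divr_gt0// mulr_gt0// ltr_wpDl.
pose N := (Num.truncn (2 * r / eta)).+1.
pose pt i : R := y - r + i%:R * eta.
have : \forall n \near ultra, forall i, (i < N)%N -> `|stepop n t f (pt i) - sem t f (pt i)| <= e / 2.
  apply: near_forall_ltn => i _.
  have := ulim_cvg (ubd_stepop (pt i) t0 gf).
  move/cvgrPdist_le => /(_ (e / 2)) H.
  have /H : 0 < e / 2 by rewrite divr_gt0.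
  by apply: filterS => n; rewrite distrC.
apply: filterS => n Hn z zy.
pose i := Num.truncn ((z - (y - r)) / eta).
have zp : 0 <= (z - (y - r)) / eta.
  by rewrite divr_ge0 ?(ltW eta0)//; move: zy; rewrite ler_distl => /andP[]; lra.
have /truncn_itv/andP[i1 i2] := zp.
have iN : (i < N)%N.
  rewrite ltnS; apply: le_truncn; rewrite ler_pM2r ?invr_gt0//.
  by move: zy; rewrite ler_distl => /andP[]; lra.
have zi : `|z - pt i| <= eta.
  have k1 : i%:R * eta <= z - (y - r) by rewrite -ler_pdivlMr.
  have k2 : z - (y - r) < i%:R * eta + eta.
    have -> : i%:R * eta + eta = i.+1%:R * eta by rewrite -natr1 mulrDl mul1r.
    by rewrite -ltr_pdivrMr.
  by rewrite ler_distl /pt; apply/andP; split; lra.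
have l1 := sl_lip (stepop_subl n t) fL z (pt i).
have l2 := sl_lip (sem_subl t0) fL (pt i) z.
have h := Hn _ iN.
have Le : L * `|z - pt i| <= e / 4.
  apply: (@le_trans _ _ (L * eta)); first by rewrite ler_wpM2l.
  rewrite /eta -(@ler_pM2r _ (4 * (L + 1))) ?mulr_gt0 ?ltr_wpDl//.
  rewrite -mulrA divfK; last by rewrite gt_eqF// mulr_gt0// ltr_wpDl.
  by nra.
rewrite distrC in l2.
have : `|stepop n t f z - sem t f z| <= L * `|z - pt i| + e / 2 + L * `|z - pt i|.
  apply: le_trans (ler_distD (sem t f (pt i)) _ _) _.
  apply: lerD; last by rewrite distrC (distrC z) in l2 *; exact: l2.
  by apply: le_trans (ler_distD (stepop n t f (pt i)) _ _) _; exact: lerD.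
lra.
Qed.

(** Rounding down twice may lose one step. *)
Lemma steps_add n (s t : R) : 0 <= s -> 0 <= t ->
  (steps n (s + t) = steps n s + steps n t)%N \/ (steps n (s + t) = steps n s + (steps n t).+1)%N.
Proof.
move=> s0 t0; rewrite /steps mulrDl.
set a := s * _; set b := t * _.
have a0 : 0 <= a by exact: mulr_ge0.
have b0 : 0 <= b by exact: mulr_ge0.
have /andP[a1 a2] := truncn_itv a0; have /andP[b1 b2] := truncn_itv b0.
have [h|h] := ltP (a + b) (Num.truncn a + Num.truncn b).+1%:R.
  left; apply: truncn_def; rewrite h andbT natrD; lra.
right; apply: truncn_def; rewrite addnS h /=.
move: a2 b2; rewrite -!natr1 natrD; lra.
Qed.

(** Inside [stepop n s] the iterate [stepop n t f] is replaced by its limit. The error is small on a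
    ball around y and bounded outside, where the second moment controls it; the step lost to
    rounding moves a Lipschitz function little. *)
Lemma sem_semigroup (s t : R) f L y : 0 <= s -> 0 <= t -> lip L f -> 0 <= L ->
  sem (s + t) f y = sem s (sem t f) y.
Proof.
move=> s0 t0 fL L0; have gf := gr_lip fL.
have st0 : 0 <= s + t by exact: addr_ge0.
have gLt := sl_lip (sem_subl t0) fL.
apply: ulim_eq_near; [exact: ubd_stepop|by apply: ubd_stepop => //; exact: (sl_gr (sem_subl t0))|].
move=> e e0.
pose D := 2 * (L * (1 + g 2 * t)).
have D0 : 0 <= D by rewrite !mulr_ge0// addr_ge0// mulr_ge0.
(* Chosen so that [D * (g 2 * s) / r ^+ 2 <= e / 4], using [r <= r ^+ 2]. *)
pose r := 1 + 4 * (D * (g 2 * s)) / e.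
have r1 : 1 <= r by rewrite lerDl divr_ge0 ?(ltW e0)// mulr_ge0// mulr_ge0// mulr_ge0.
have r0 : 0 < r by exact: lt_le_trans r1.
(* With these d and ee, one step of length at most ee moves an L-Lipschitz function by at most
   [e / 4 + e / 4] in [lip_mom]. *)
pose d := e / (4 * (L + 1)).
have d0 : 0 < d by rewrite divr_gt0// mulr_gt0// ltr_wpDl.
pose ee := e / (4 * (L + 1) * (g 2 + 1)) * d.
have ee0 : 0 < ee by rewrite mulr_gt0// divr_gt0// !mulr_gt0// ltr_wpDl.
have e40 : 0 < e / 4 by rewrite divr_gt0.
have := stepop_loc_unif y t0 fL L0 r0 e40.
apply: filterS2 (near_invSn ee0) => n en Hn.
pose gn := stepop n t f.
have gnL : lip L gn by exact: (sl_lip (stepop_subl n t) fL).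
have h1 : `|stepop n (s + t) f y - stepop n s gn y| <= e / 2.
  rewrite /gn /stepop; case: (steps_add n s0 t0) => ->; rewrite iterD ?iterS.
    by rewrite subrr normr0 divr_ge0// ltW.
  have := @sl_dist _ _ (stepop_subl n s) (O n gn) gn (fun=> e / 2) y.
  rewrite (sl_cst (stepop_subl n s)); apply.
  - by apply: (sl_gr (sO n)); exact: (gr_lip gnL).
  - exact: (gr_lip gnL).
  - exact: gr_cst.
  move=> x; apply: le_trans (lip_mom (sO n) (mO n) x d0 gnL L0) _.
  have L1 : 0 < L + 1 by exact: ltr_wpDl.
  have g1 : 0 < g 2 + 1 by exact: ltr_wpDl.
  apply: (@le_trans _ _ ((L + 1) * (d + (g 2 + 1) * ee / d))).
    have k1 : 0 <= n.+1%:R^-1 :> R by [].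
    have k2 : 0 <= g 2 * n.+1%:R^-1 / d by rewrite divr_ge0 ?(ltW d0)// mulr_ge0.
    have k3 : g 2 * n.+1%:R^-1 / d <= (g 2 + 1) * ee / d.
      by rewrite ler_pM2r ?invr_gt0// ler_pM// lerDl.
    by apply: ler_pM => //; [rewrite addr_ge0// ltW|rewrite lerDl|rewrite lerD2l].
  rewrite le_eqVlt; apply/orP; left; apply/eqP; rewrite /ee.
  by rewrite mulrA mulfK ?gt_eqF// /d; field; rewrite !gt_eqF.
have h2 : `|stepop n s gn y - stepop n s (sem t f) y| <= e / 2.
  (* The constant covers the ball of radius r; outside it the quadratic weight is at least D, the
     global bound of the difference. *)
  pose h z := e / 4 + D / r ^+ 2 * (z - y) ^+ 2.
  have := @sl_dist _ _ (stepop_subl n s) gn (sem t f) h y (gr_lip gnL) (gr_lip gLt) (gr_center _ _ _).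
  move=> /(_ _)/le_trans; apply.
    move=> z; rewrite /h; have Dr : 0 <= D / r ^+ 2 by rewrite divr_ge0// sqr_ge0.
    have [zy|/ltW zy] := leP `|z - y| r.
      by apply: le_trans (Hn _ zy) _; rewrite lerDl mulr_ge0// sqr_ge0.
    have k1 := stepop_lip n z t0 fL L0; have k2 := sem_lip z t0 ltr01 fL L0.
    rewrite divr1 in k2; rewrite distrC in k2.
    have k3 : `|gn z - sem t f z| <= D.
      apply: le_trans (ler_distD (f z) _ _) _; rewrite /D mulr2n mulrDl mul1r.
      exact: lerD.
    apply: le_trans k3 _; apply: ler_wpDl; first exact: ltW.
    rewrite -mulrA ler_peMr// mulrC ler_pdivlMr ?exprn_gt0// mul1r -[leRHS]real_normK ?num_real//.
    by rewrite lerXn2r ?nnegrE// ltW.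
  rewrite (mom_center _ _ _ (stepop_subl n s) (stepop_mom n s)); last by rewrite divr_ge0// sqr_ge0.
  have -> : e / 2 = e / 4 + e / 4 by field.
  rewrite lerD2l.
  rewrite mulrAC ler_pdivrMr ?exprn_gt0//.
  apply: (@le_trans _ _ (D * (g 2 * s))).
    by rewrite ler_wpM2l// ler_wpM2l// steps_le.
  apply: (@le_trans _ _ (e / 4 * r)).
    rewrite /r mulrDr mulr1 (_ : e / 4 * _ = D * (g 2 * s)); last by field; rewrite gt_eqF.
    by rewrite lerDr ltW.
  rewrite ler_pM2l// expr2; nra.
apply: le_trans (ler_distD (stepop n s gn y) _ _) _; lra.
Qed.

End Semigroup.

(** * Random walks, linear heat flows and the G-heat flow *)

Section Instances.
Variable R : realType.
Implicit Types (f : R -> R) (T : (R -> R) -> R -> R).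

(** A step of the symmetric random walk of variance [sg ^+ 2 / n.+1]; the generator of the limit is
    [f |-> linG sg f'']. *)
Definition bin (sg : R) n f (y : R) : R :=
  2^-1 * (f (y + sg * Num.sqrt n.+1%:R^-1) + f (y - sg * Num.sqrt n.+1%:R^-1)).

Definition linG (sg a : R) : R := 2^-1 * sg ^+ 2 * a.

Lemma bin_subl sg n : subl (bin sg n).
Proof.
rewrite /bin; set c := sg * _; split.
- by move=> f h _ _ fh y; rewrite ler_pM2l// lerD.
- by move=> f h y _ _; rewrite -mulrDr le_eqVlt; apply/orP; left; apply/eqP; ring.
- by move=> a f y _ _; ring.
- by move=> a f y _; rewrite [y + c + a]addrAC [y - c + a]addrAC.
- by move=> d y; field.
- move=> f gf; apply: grZ; apply: grD; exact: gr_tr.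
Qed.

Lemma bin_mom sg n : mom (linG sg) n.+1%:R^-1 (bin sg n).
Proof.
rewrite /bin; have : Num.sqrt (n.+1%:R^-1 : R) ^+ 2 = n.+1%:R^-1 by rewrite sqr_sqrtr.
set c := Num.sqrt _ => c2; rewrite -c2 /linG; split=> [d p q y|y].
  by rewrite /quad; field.
have -> : 2^-1 * ((y + sg * c) ^+ 4 + (y - sg * c) ^+ 4) =
  y ^+ 4 + 6 * (2^-1 * sg ^+ 2 * 2 * c ^+ 2) * y ^+ 2 + (2^-1 * sg ^+ 2 * 2 * c ^+ 2) ^+ 2 by field.
rewrite lerD2l; set a := _ ^+ 2; have : 0 <= a by exact: sqr_ge0.
lra.
Qed.

Lemma linG0 sg : 0 <= linG sg 2.
Proof. by rewrite /linG mulr_ge0// mulr_ge0// sqr_ge0. Qed.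

Definition heat sg t := sem (bin sg) t.

Lemma heat_subl sg t : 0 <= t -> subl (heat sg t).
Proof. by apply: (sem_subl (linG0 sg)) => n; [exact: bin_subl|exact: bin_mom]. Qed.

Lemma heat_mom sg t : 0 <= t -> mom (linG sg) t (heat sg t).
Proof. by apply: (sem_mom (linG0 sg)) => n; [exact: bin_subl|exact: bin_mom]. Qed.

Lemma heat_semigroup sg (s t : R) f L y : 0 <= s -> 0 <= t -> lip L f -> 0 <= L ->
  heat sg (s + t) f y = heat sg s (heat sg t f) y.
Proof. by apply: (sem_semigroup (linG0 sg)) => n; [exact: bin_subl|exact: bin_mom]. Qed.

Lemma heatD sg t f h y : 0 <= t -> gr f -> gr h ->
  heat sg t (fun x => f x + h x) y = heat sg t f y + heat sg t h y.
Proof.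
move=> t0 gf gh; apply: (sem_add (linG0 sg)) => // n; [exact: bin_subl|exact: bin_mom|].
by move=> u v z _ _; rewrite /bin; ring.
Qed.

Lemma heatN sg t f y : 0 <= t -> gr f -> heat sg t (fun x => - f x) y = - heat sg t f y.
Proof.
move=> t0 gf; have := heatD sg y t0 gf (grN gf).
rewrite (_ : (fun x => f x + - f x) = fun=> 0); last by apply/funext => x; rewrite subrr.
by rewrite (sl_cst (heat_subl sg t0)) => h; lra.
Qed.

Lemma subl_max T T' : subl T -> subl T' -> subl (fun f y => Num.max (T f y) (T' f y)).
Proof.
move=> s s'; split.
- move=> f h gf gh fh y; rewrite ge_max !le_max (sl_mono s gf gh fh)/=.
  by rewrite (sl_mono s' gf gh fh) orbT.
- move=> f h y gf gh; rewrite ge_max; apply/andP; split.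
    by apply: le_trans (sl_add s _ gf gh) _; rewrite lerD// le_max lexx.
  by apply: le_trans (sl_add s' _ gf gh) _; rewrite lerD// le_max lexx orbT.
- by move=> a f y a0 gf; rewrite (sl_hom s)// (sl_hom s')// maxr_pMr.
- by move=> a f y gf; rewrite (sl_tr s)// (sl_tr s').
- by move=> c y; rewrite (sl_cst s) (sl_cst s') maxxx.
- move=> f gf; have [C fC] := sl_gr s gf; have [D fD] := sl_gr s' gf.
  exists (Num.max C D) => y; have h : 0 <= 1 + y ^+ 4 by rewrite addr_ge0// exprn_even_ge0.
  have [_|_] := leP (T f y) (T' f y).
    by apply: le_trans (fD y) _; rewrite ler_wpM2r// le_max lexx orbT.
  by apply: le_trans (fC y) _; rewrite ler_wpM2r// le_max lexx.
Qed.

Variables (sl sb : R).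
Hypotheses (sl0 : 0 <= sl) (slb : sl <= sb).

Lemma sqr_sl : sl ^+ 2 <= sb ^+ 2.
Proof. by rewrite lerXn2r ?nnegrE// (le_trans sl0). Qed.

(** [linG sg a] is linear in [sg ^+ 2], hence extreme at the ends of the volatility interval; two
    heat flows suffice to build G. *)
Lemma G_max (a : R) : Num.max (linG sl a) (linG sb a) = G sl sb a.
Proof.
have := sqr_sl; rewrite /linG /G => h.
have [a0|a0] := leP 0 a.
  rewrite (@max_r _ _ (- a) 0) ?oppr_le0// mulr0 subr0 max_r; first by ring.
  by apply: ler_wpM2r => //; apply: ler_wpM2l.
rewrite (@max_l _ _ (- a)) ?oppr_ge0 ?(ltW a0)//.
rewrite max_l; first by ring.
by apply: ler_wnM2r; [exact: ltW|apply: ler_wpM2l].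
Qed.

Lemma G2 : G sl sb 2 = sb ^+ 2.
Proof.
rewrite -G_max /linG mulrAC mulVf ?mul1r// mulrAC mulVf ?mul1r//.
by rewrite max_r// sqr_sl.
Qed.

Lemma G20 : 0 <= G sl sb 2. Proof. by rewrite G2 sqr_ge0. Qed.

Lemma G_mono (a b : R) : a <= b -> G sl sb a <= G sl sb b.
Proof.
move=> ab; rewrite -!G_max ge_max !le_max /linG.
by apply/andP; split; apply/orP; [left|right]; apply: ler_wpM2l => //;
  apply: mulr_ge0 => //; exact: sqr_ge0.
Qed.

Lemma G_add (a b : R) : 0 <= b -> G sl sb (a + b) <= G sl sb a + sb ^+ 2 * b.
Proof.
move=> b0; have sb2 : 0 <= sb ^+ 2 by exact: sqr_ge0.
have sl2 := sqr_sl; have : 0 <= sl ^+ 2 by exact: sqr_ge0.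
move=> sl20; rewrite -!G_max ge_max; apply/andP; split; rewrite -lerBlDr le_max /linG;
  apply/orP; [left|right]; rewrite mulrDr lerBlDr lerD2l; nra.
Qed.

(** The maximum is taken over exact heat flows rather than random walk steps because a supersolution
    can be compared with a heat flow; this is what bounds the iterates by any solution in
    [nis_le_solution]. *)
Definition Gop n f (y : R) : R :=
  Num.max (heat sl n.+1%:R^-1 f y) (heat sb n.+1%:R^-1 f y).

Lemma Gop_subl n : subl (Gop n).
Proof. by apply: subl_max; exact: heat_subl. Qed.

Lemma Gop_mom n : mom (G sl sb) n.+1%:R^-1 (Gop n).
Proof.
have n0 : 0 <= n.+1%:R^-1 :> R by [].
have [m1 m2] := heat_mom sl n0; have [m1' m2'] := heat_mom sb n0.
rewrite /Gop; split=> [c p q y|y].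
  by rewrite m1 m1' -addr_maxr -maxr_pMl// G_max.
have hl : linG sl 2 <= G sl sb 2 by rewrite -G_max le_max lexx.
have hb : linG sb 2 <= G sl sb 2 by rewrite -G_max le_max lexx orbT.
have key a : 0 <= a -> a <= G sl sb 2 ->
    y ^+ 4 + 6 * (a * n.+1%:R^-1) * y ^+ 2 + 3 * (a * n.+1%:R^-1) ^+ 2 <=
    y ^+ 4 + 6 * (G sl sb 2 * n.+1%:R^-1) * y ^+ 2 + 3 * (G sl sb 2 * n.+1%:R^-1) ^+ 2.
  move=> a0 aG; have u0 : 0 <= a * n.+1%:R^-1 by exact: mulr_ge0.
  have uv : a * n.+1%:R^-1 <= G sl sb 2 * n.+1%:R^-1 by exact: ler_wpM2r.
  move: u0 uv; set u := a * _; set v := G _ _ _ * _ => u0 uv.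
  have := ler_wpM2r (sqr_ge0 y) uv; have : u ^+ 2 <= v ^+ 2 by rewrite lerXn2r ?nnegrE// (le_trans u0).
  lra.
by rewrite ge_max (le_trans (m2 y)) ?(le_trans (m2' y))// key// linG0.
Qed.

Definition nis t := sem Gop t.

Lemma nis_subl t : 0 <= t -> subl (nis t).
Proof. by apply: (sem_subl G20) => n; [exact: Gop_subl|exact: Gop_mom]. Qed.

Lemma nis_mom t : 0 <= t -> mom (G sl sb) t (nis t).
Proof. by apply: (sem_mom G20) => n; [exact: Gop_subl|exact: Gop_mom]. Qed.

Lemma nis_semigroup (s t : R) f L y : 0 <= s -> 0 <= t -> lip L f -> 0 <= L ->
  nis (s + t) f y = nis s (nis t f) y.
Proof. by apply: (sem_semigroup G20) => n; [exact: Gop_subl|exact: Gop_mom]. Qed.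

Lemma nis0 f y L : lip L f -> 0 <= L -> nis 0 f y = f y.
Proof.
by move=> fL L0; rewrite /nis /sem /stepop /steps -[RHS]ulim_cst; congr ulim;
  apply/funext => n; rewrite mul0r truncn0.
Qed.

End Instances.

(** * Short-time expansions *)

Section Expansion.
Variables (R : realType) (T : (R -> R) -> R -> R) (g : R -> R) (tau : R).
Hypotheses (sT : subl T) (tau0 : 0 <= tau) (mT : mom g tau T).

Lemma quad_pow4 (c p q C : R) : 0 <= C ->
  T (fun x => quad c p q x + C * x ^+ 4) 0 <= c + g (2 * q) * tau + 3 * C * (g 2 * tau) ^+ 2.
Proof.
move=> C0; apply: le_trans (sl_add sT _ (gr_quad c p q) (grZ C (@gr_pow4 R))) _.
rewrite (sl_hom sT 0 C0 (@gr_pow4 R)) mT.1 {1}/quad.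
have := ler_wpM2l C0 (mom_pow4 mT); lra.
Qed.

Lemma gr_add_l f (y : R) : gr f -> gr (fun x => f (y + x)).
Proof. by move=> gf; have := gr_tr y gf; congr gr; apply/funext => x; rewrite addrC. Qed.

(** Quadratics are propagated exactly and the quartic remainder costs only order [tau ^+ 2], so the
    rate in tau is read off from the quadratic part. *)
Lemma expand_up f y (c p q C : R) : 0 <= C -> gr f ->
  (forall x, f (y + x) <= c + p * x + q * x ^+ 2 + C * x ^+ 4) ->
  T f y <= c + g (2 * q) * tau + 3 * C * (g 2 * tau) ^+ 2.
Proof.
move=> C0 gf H; rewrite (sl_at sT)//; apply: le_trans (quad_pow4 c p q C0).
apply: (sl_mono sT); [exact: gr_add_l|apply: grD; [exact: gr_quad|apply: grZ; exact: gr_pow4]|].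
exact: H.
Qed.

Lemma expand_lo f y (c p q C : R) : 0 <= C -> gr f ->
  (forall x, c + p * x + q * x ^+ 2 - C * x ^+ 4 <= f (y + x)) ->
  c + g (2 * q) * tau - 3 * C * (g 2 * tau) ^+ 2 <= T f y.
Proof.
move=> C0 gf H; rewrite (sl_at sT)//.
have := @sl_le_add _ _ sT (quad c p q) (fun x => f (y + x)) (fun x => C * x ^+ 4) 0
  (gr_quad _ _ _) (gr_add_l y gf) (grZ C (@gr_pow4 R)).
rewrite (sl_hom sT 0 C0 (@gr_pow4 R)) mT.1 {2}/quad => /(_ _) h.
have {}h : quad c p q 0 + g (2 * q) * tau <= T (fun x => f (y + x)) 0 + C * T (fun x => x ^+ 4) 0.
  by apply: h => x; have := H x; rewrite /quad; lra.
move: h; rewrite /quad; have := ler_wpM2l C0 (mom_pow4 mT); lra.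
Qed.

Lemma cube_le (x d : R) : 0 < d -> `|x| ^+ 3 <= d * x ^+ 2 + d^-1 * x ^+ 4.
Proof.
move=> d0; rewrite -(@ler_pM2l _ d)//.
have -> : d * (d * x ^+ 2 + d^-1 * x ^+ 4) = d ^+ 2 * `|x| ^+ 2 + `|x| ^+ 4.
  rewrite (_ : `|x| ^+ 4 = (`|x| ^+ 2) ^+ 2); last by ring.
  by rewrite real_normK ?num_real//; field; rewrite gt_eqF.
have := normr_ge0 x; set z := `|x| => z0.
have : 0 <= (d * z - z ^+ 2) ^+ 2 by exact: sqr_ge0.
have : 0 <= d * z ^+ 3 by rewrite mulr_ge0 ?exprn_ge0// ltW.
lra.
Qed.

(** By [cube_le] a cubic remainder splits into a perturbation [C * d] of the quadratic coefficient
    and a quartic term, which is of second order in tau for fixed d. *)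
Lemma expand_lo3 f y (c p q C d : R) : 0 <= C -> 0 < d -> gr f ->
  (forall x, c + p * x + q * x ^+ 2 - C * `|x| ^+ 3 <= f (y + x)) ->
  c + g (2 * (q - C * d)) * tau - 3 * (C / d) * (g 2 * tau) ^+ 2 <= T f y.
Proof.
move=> C0 d0 gf H; apply: (@expand_lo _ _ _ p) => //; first by rewrite divr_ge0// ltW.
move=> x; apply: le_trans (H x).
have := ler_wpM2l C0 (cube_le x d0); lra.
Qed.

End Expansion.

Section Modulus.
Variables (R : realType) (T : R -> (R -> R) -> R -> R) (g : R -> R).
Hypotheses (g0 : 0 <= g 2) (sT : forall h : R, 0 <= h -> subl (T h))
  (mT : forall h : R, 0 <= h -> mom g h (T h))
  (semT : forall (s t : R) f L y, 0 <= s -> 0 <= t -> lip L f -> 0 <= L ->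
     T (s + t) f y = T s (T t f) y).
Variables (phi : R -> R) (L : R).
Hypotheses (phiL : lip L phi) (L0 : 0 <= L).

Lemma semi_time (t h d : R) y : 0 <= t -> 0 <= h -> 0 < d ->
  `|T (t + h) phi y - T t phi y| <= L * (d + g 2 * h / d).
Proof.
move=> t0 h0 d0; rewrite (addrC t h) (semT _ h0 t0 phiL L0).
by apply: (lip_mom (sT h0) (mT h0)) => //; exact: (sl_lip (sT t0)).
Qed.

Lemma semi_modulus (e : R) : 0 < e -> exists2 r : R, 0 < r & forall t s y z,
  0 <= t -> 0 <= s -> `|t - s| < r -> `|y - z| < r -> `|T t phi y - T s phi z| <= e.
Proof.
move=> e0; pose d := e / (4 * (L + 1)).
have L1 : 0 < L + 1 by rewrite ltr_wpDl.
have d0 : 0 < d by rewrite divr_gt0// mulr_gt0.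
have Ld : L * d <= e / 4.
  rewrite /d mulrA ler_pdivrMr ?mulr_gt0//; nra.
have sb1 : 0 < g 2 + 1 by rewrite ltr_wpDl.
exists (Num.min d (d ^+ 2 / (g 2 + 1))).
  by rewrite lt_min d0 divr_gt0// exprn_gt0.
move=> t s y z t0 s0; rewrite !lt_min => /andP[_ ts] /andP[yz _].
have key (u v : R) : 0 <= u -> u <= v -> `|u - v| < d ^+ 2 / (g 2 + 1) ->
    `|T v phi y - T u phi y| <= e / 2.
  move=> u0 uv; rewrite distrC ger0_norm ?subr_ge0// => vu.
  have h0 : 0 <= v - u by rewrite subr_ge0.
  have := semi_time y u0 h0 d0; rewrite (_ : u + (v - u) = v); last by ring.
  move=> /le_trans; apply.
  have : g 2 * (v - u) / d <= d.
    rewrite ler_pdivrMr// -expr2; move: vu; rewrite ltr_pdivlMr// => vu.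
    nra.
  by move=> k; rewrite mulrDr; have := ler_wpM2l L0 k; lra.
have h1 : `|T t phi y - T s phi y| <= e / 2.
  have [st|ts'] := leP s t; last by rewrite distrC; apply: key => //; exact: ltW.
  by apply: key => //; rewrite distrC.
have h2 : `|T s phi y - T s phi z| <= e / 2.
  apply: le_trans (sl_lip (sT s0) phiL y z) _; have := ler_wpM2l L0 (ltW yz); lra.
by apply: le_trans (ler_distD (T s phi y) _ _) _; lra.
Qed.

End Modulus.

(** * Viscosity solutions *)

Section FrechetDerivative.
Variable R : realType.
Implicit Types f : R -> R.

(** The little-o form of differentiability: it is checked by direct estimates, and glued functions
    and difference quotients are handled without unfolding a limit. *)
Definition isD f (x l : R) := forall e : R, 0 < e -> exists2 r : R, 0 < r &
  forall h, `|h| < r -> `|f (x + h) - f x - l * h| <= e * `|h|.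

Lemma isD_is_derive f (x l : R) : isD f x l -> is_derive x 1 f l.
Proof.
move=> H.
have C : (fun h : R => h^-1 *: ((f \o shift x) (h *: (1 : R)) - f x)) @ 0^' --> l.
  apply/cvgrPdist_le => e e0; have [r r0 Hr] := H _ e0.
  apply/nbhs_ballP; exists r => //= h; rewrite /ball/= sub0r normrN => hr h0.
  have hn : 0 < `|h| by rewrite normr_gt0.
  rewrite -(@ler_pM2r _ `|h|)// -normrM.
  have := Hr _ hr; rewrite distrC; congr (`|_| <= _).
  by rewrite /GRing.scale/= mulr1 [h + x]addrC; field.
by apply: DeriveDef; [apply/cvg_ex; exists l|apply: cvg_lim].
Qed.

Lemma is_derive_isD f (x l : R) : is_derive x 1 f l -> isD f x l.
Proof.
move=> [df <-] e e0.
have : (fun h : R => h^-1 *: ((f \o shift x) (h *: (1 : R)) - f x)) @ 0^' --> 'D_1 f x by exact: df.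
move/cvgrPdist_le => /(_ _ e0)/nbhs_ballP[r /= r0 Hr]; exists r => // h hr.
have [->|h0] := eqVneq h 0; first by rewrite addr0 subrr mulr0 subr0 normr0 mulr0.
have := Hr h; rewrite /ball/= sub0r normrN => /(_ hr h0).
have hn : 0 < `|h| by rewrite normr_gt0.
rewrite -(@ler_pM2r _ `|h|)// -normrM -normrN; congr (`|_| <= _).
by rewrite /GRing.scale/= mulr1 [h + x]addrC; field.
Qed.

Lemma isD_derive1 f (x l : R) : isD f x l -> derivable f x 1 /\ derive1 f x = l.
Proof. by move=> /isD_is_derive[df dl]; rewrite derive1E. Qed.

Lemma derivable_isD f (x : R) : derivable f x 1 -> isD f x (derive1 f x).
Proof. by move=> df; apply: is_derive_isD; rewrite derive1E; apply: DeriveDef. Qed.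

Lemma isD_quadratic f x l K r : 0 < r ->
  (forall h, `|h| < r -> `|f (x + h) - f x - l * h| <= K * h ^+ 2) -> isD f x l.
Proof.
move=> r0 H e e0; pose K1 := `|K| + 1.
have K10 : 0 < K1 by rewrite /K1 ltr_wpDl.
exists (Num.min r (e / K1)); first by rewrite lt_min r0 divr_gt0.
move=> h; rewrite lt_min => /andP[hr he]; apply: le_trans (H _ hr) _.
rewrite -(real_normK (num_real h)) expr2 mulrA ler_wpM2r//.
apply: (@le_trans _ _ (K1 * `|h|)).
  by rewrite ler_wpM2r// /K1 (le_trans (ler_norm _))// lerDl.
by rewrite mulrC -ler_pdivlMr// ltW.
Qed.

Lemma mvt f (f' : R -> R) : (forall z, isD f z (f' z)) ->
  forall x y, exists c, [/\ f x - f y = f' c * (x - y), `|c - y| <= `|x - y| &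
    0 <= (c - y) * (x - y)].
Proof.
move=> df.
have dfi (z : R) : is_derive z 1 f (f' z) by exact: isD_is_derive.
have cf (a b : R) : {within `[a, b], continuous f}.
  by apply: derivable_within_continuous => z _; exact: (@ex_derive _ _ _ _ _ _ _ (dfi z)).
have key (a b : R) : a < b -> exists2 c, a < c < b & f b - f a = f' c * (b - a).
  move=> ab; have [c] := @MVT R f f' a b ab (fun z _ => dfi z) (cf a b).
  by rewrite in_itv /= => cab ->; exists c.
move=> x y; have [xy|yx|->] := ltgtP x y.
- have [c /andP[xc cy] E] := key _ _ xy; exists c; split.
  + by rewrite -opprB E; ring.
  + by rewrite !ltr0_norm ?subr_lt0//; lra.
  + by nra.
- have [c /andP[yc cx] E] := key _ _ yx; exists c; split => //.
  + by rewrite !gtr0_norm ?subr_gt0//; lra.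
  + by nra.
- by exists y; rewrite !subrr mulr0.
Qed.

Lemma isD_sub_quad f (x l y p q : R) : isD f x l ->
  isD (fun z => f z - p * (z - y) - q * (z - y) ^+ 2) x (l - p - 2 * q * (x - y)).
Proof.
move=> H e e0; have e20 : 0 < e / 2 by rewrite divr_gt0.
have [r r0 Hr] := H _ e20.
pose q1 := `|q| + 1.
have q10 : 0 < q1 by rewrite /q1 ltr_wpDl.
exists (Num.min r (e / 2 / q1)); first by rewrite lt_min r0 divr_gt0.
move=> h; rewrite lt_min => /andP[hr he].
rewrite (_ : _ - _ = (f (x + h) - f x - l * h) - q * h ^+ 2); last by ring.
apply: le_trans (ler_normB _ _) _; rewrite [e]splitr mulrDl lerD ?Hr//.
rewrite normrM normrX expr2 mulrA ler_wpM2r//.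
rewrite ltr_pdivlMr// in he; apply: le_trans (ltW he); rewrite mulrC ler_wpM2l//.
by rewrite /q1 lerDl.
Qed.

Lemma taylor2 f (f1 f2 : R -> R) y r e X :
  (forall z, isD f z (f1 z)) -> (forall z, isD f1 z (f2 z)) ->
  (forall z, `|z - y| < r -> `|f2 z - X| <= e) ->
  forall x, `|x| < r -> `|f (y + x) - (f y + f1 y * x + 2^-1 * X * x ^+ 2)| <= e * x ^+ 2.
Proof.
move=> d1 d2 H x xr.
pose k z := f z - f1 y * (z - y) - 2^-1 * X * (z - y) ^+ 2.
have dk z : isD k z (f1 z - f1 y - 2 * (2^-1 * X) * (z - y)) by exact: isD_sub_quad.
have [c [E cx _]] := mvt dk (y + x) y.
have [b [E2 bc _]] := mvt d2 c y.
have -> : f (y + x) - (f y + f1 y * x + 2^-1 * X * x ^+ 2) = k (y + x) - k y.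
  by rewrite /k; ring.
rewrite E E2 mulrA divff// mul1r -mulrBl !normrM.
have hb : `|f2 b - X| <= e.
  by apply: H; apply: le_lt_trans bc _; apply: le_lt_trans cx _; rewrite addrAC subrr add0r.
move: cx; rewrite (_ : y + x - y = x); last by ring.
rewrite -(real_normK (num_real x)) expr2 => cx.
by rewrite -mulrA ler_pM// ler_wpM2r.
Qed.

End FrechetDerivative.

Section JetC12.
Variable R : realType.

(** The expansion is taken at the earlier times [t - h], since the semigroup expresses the value at
    t through the one at [t - h]. Joint continuity of the second derivative gives one quadratic
    coefficient, that at (t, y), for all small h. *)
Lemma C12_jet (psi : R -> R -> R) (t y e : R) : C12 psi -> 0 < t -> 0 < e ->
  exists r A : R, [/\ 0 < r, r < t, 0 <= A & forall h, 0 <= h < r ->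
   [/\ `|psi (t - h) y| <= A, `|d_y psi (t - h) y| <= A & forall x, `|x| < r ->
    `|psi (t - h) (y + x) - (psi (t - h) y + d_y psi (t - h) y * x + 2^-1 * d_yy psi t y * x ^+ 2)|
      <= e * x ^+ 2]].
Proof.
move=> C t0 e0; have [[dt dy dyy] [ct cy cyy]] := C t y t0.
have D1 s : 0 < s -> forall z, isD (psi s) z (d_y psi s z).
  by move=> s0 z; apply: derivable_isD; have [[_ +] _] := C s z s0.
have D2 s : 0 < s -> forall z, isD (d_y psi s) z (d_yy psi s z).
  by move=> s0 z; apply: derivable_isD; have [[_ _ +] _] := C s z s0.
have [r1 r10 H1] : exists2 r1, 0 < r1 & forall s z, `|t - s| < r1 -> `|y - z| < r1 ->
    `|d_yy psi s z - d_yy psi t y| <= e.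
  move/cvgrPdist_le : cyy => /(_ _ e0)/nbhs_ballP[r r0 H]; exists r => // s z ts yz.
  by rewrite distrC; apply: (H (s, z)); split.
have [r2 r20 H2] : exists2 r2, 0 < r2 & forall s z, `|t - s| < r2 -> `|y - z| < r2 ->
    `|d_y psi s z - d_y psi t y| <= 1.
  move/cvgrPdist_le : cy => /(_ _ ltr01)/nbhs_ballP[r r0 H]; exists r => // s z ts yz.
  by rewrite distrC; apply: (H (s, z)); split.
have [r3 r30 H3] := derivable_isD dt ltr01.
pose A := `|psi t y| + `|d_y psi t y| + 1 + (`|d_t psi t y| + 1) * r3.
have A0 : 0 <= A by rewrite !addr_ge0// mulr_ge0 ?addr_ge0// ltW.
exists (Num.min (t / 2) (Num.min r1 (Num.min r2 r3))), A.
split=> //; first by rewrite !lt_min r10 r20 r30 divr_gt0.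
  by rewrite gt_min; apply/orP; left; lra.
move=> h; rewrite !lt_min => /andP[h0 /and4P[ht h1 h2 h3]].
have th : 0 < t - h by lra.
have hh : `|t - (t - h)| = h by rewrite (_ : t - (t - h) = h) ?ger0_norm//; ring.
split.
- have := H3 (- h); rewrite normrN ger0_norm// => /(_ h3).
  rewrite -/(d_t psi t y) mul1r => k.
  have : `|psi (t - h) y| <= `|psi t y| + (`|d_t psi t y| + 1) * h.
    rewrite (_ : psi (t - h) y = (psi (t - h) y - psi t y - d_t psi t y * - h) + (psi t y - d_t psi t y * h)); last by ring.
    apply: le_trans (ler_normD _ _) _; have := ler_normB (psi t y) (d_t psi t y * h).
    by rewrite normrM (ger0_norm h0); lra.
  have := ler_wpM2l (addr_ge0 (normr_ge0 (d_t psi t y)) ler01) (ltW h3).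
  by have := normr_ge0 (d_y psi t y); rewrite /A; lra.
- have := H2 (t - h) y; rewrite hh subrr normr0 => /(_ h2 r20) k.
  have := ler_normD (d_y psi (t - h) y - d_y psi t y) (d_y psi t y); rewrite subrK.
  have := normr_ge0 (psi t y).
  have := mulr_ge0 (addr_ge0 (normr_ge0 (d_t psi t y)) ler01) (ltW r30).
  by rewrite /A; lra.
- move=> x; rewrite !lt_min => /and4P[_ x1 _ _].
  apply: (taylor2 (D1 _ th) (D2 _ th) _ x1) => z zy; apply: H1; first by rewrite hh.
  by rewrite distrC.
Qed.

(** Turns a comparison on a ball into a global one: off the ball the quartic absorbs all lower
    terms, uniformly over bounded c and p. *)
Lemma quartic_dominates (r A M q : R) : 0 < r -> 0 <= A -> exists2 C, 0 <= C &
  forall c p x, `|c| <= A -> `|p| <= A -> r <= `|x| ->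
  M <= c + p * x + q * x ^+ 2 + C * x ^+ 4.
Proof.
move=> r0 A0; exists ((`|M| + A) / r ^+ 4 + A / r ^+ 3 + `|q| / r ^+ 2).
  by rewrite !addr_ge0// divr_ge0 ?addr_ge0// exprn_ge0// ltW.
move=> c p x cA pA rx; have x0 : 0 <= `|x| by [].
have x4 : x ^+ 4 = `|x| ^+ 4 by rewrite -[RHS]normrX ger0_norm// exprn_even_ge0.
have x2 : x ^+ 2 = `|x| ^+ 2 by rewrite real_normK ?num_real.
have k1 : `|M| + A <= (`|M| + A) / r ^+ 4 * `|x| ^+ 4.
  rewrite -mulrA ler_peMr ?addr_ge0// mulrC ler_pdivlMr ?exprn_gt0// mul1r.
  by rewrite lerXn2r ?nnegrE// ltW.
have k2 : A * `|x| <= A / r ^+ 3 * `|x| ^+ 4.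
  rewrite -mulrA ler_wpM2l// mulrC ler_pdivlMr ?exprn_gt0// (exprSr _ 3) mulrC ler_wpM2r//.
  by rewrite lerXn2r ?nnegrE// ltW.
have k3 : `|q| * `|x| ^+ 2 <= `|q| / r ^+ 2 * `|x| ^+ 4.
  rewrite -mulrA ler_wpM2l// mulrC ler_pdivlMr ?exprn_gt0// (exprD _ 2 2) ler_wpM2l ?exprn_ge0//.
  by rewrite lerXn2r ?nnegrE// ltW.
have k4 : - (A * `|x|) <= p * x.
  by rewrite lerNl; apply: le_trans (ler_norm _) _; rewrite normrN normrM ler_wpM2r.
have k5 : - (`|q| * `|x| ^+ 2) <= q * x ^+ 2.
  by rewrite x2 -mulNr ler_wpM2r ?exprn_ge0// lerNl -normrN ler_norm.
have k6 : - A <= c by move: cA; rewrite ler_norml => /andP[].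
have := ler_norm M; rewrite x4 !mulrDl; lra.
Qed.

(** Difference quotients to the left, with a second-order error that disappears after division by
    h. *)
Lemma left_rate (f : R -> R) t (l a K : R) r : isD f t l -> 0 < r ->
  (forall h, 0 < h < r -> f t <= f (t - h) + h * a + K * h ^+ 2) -> l <= a.
Proof.
move=> df r0 H; apply/ler_addgt0Pr => e e0; have e20 : 0 < e / 2 by rewrite divr_gt0.
have [r1 r10 H1] := df _ e20.
pose K1 := `|K| + 1; have K10 : 0 < K1 by rewrite /K1 ltr_wpDl.
pose h := Num.min (r / 2) (Num.min (r1 / 2) (e / 2 / K1)).
have h0 : 0 < h by rewrite !lt_min !divr_gt0.
have hr : h < r by rewrite /h gt_min; apply/orP; left; lra.
have hr1 : h < r1.
  by rewrite /h !gt_min; apply/orP; right; apply/orP; left; lra.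
have hK : K1 * h <= e / 2.
  by rewrite mulrC -ler_pdivlMr// /h !ge_min lexx !orbT.
have := H1 (- h); rewrite normrN gtr0_norm// => /(_ hr1).
rewrite ler_norml mulrN => /andP[_ k1].
have := H h; rewrite h0 hr => /(_ isT) k2.
have k3 : K * h ^+ 2 <= h * (e / 2).
  apply: (@le_trans _ _ (K1 * h ^+ 2)).
    by rewrite ler_wpM2r ?sqr_ge0// /K1 (le_trans (ler_norm _))// lerDl.
  by rewrite expr2 mulrA mulrC ler_pM2l.
rewrite -(ler_pM2l h0) mulrDr; lra.
Qed.

End JetC12.

(** * The limit semigroup solves the G-heat equation *)

Section NisioViscosity.
Variables (R : realType) (sl sb : R).
Hypotheses (sl0 : 0 <= sl) (slb : sl <= sb).
Variables (phi : R -> R) (L M : R).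
Hypotheses (phiL : lip L phi) (L0 : 0 <= L) (phiM : forall y, `|phi y| <= M).

Local Notation S t := (nis sl sb t phi).

Lemma nis_bd t y : 0 <= t -> `|S t y| <= M.
Proof. by move=> t0; exact: (sl_bd (nis_subl sl0 slb t0)). Qed.

Lemma nis_lip t : 0 <= t -> lip L (S t).
Proof. by move=> t0; exact: (sl_lip (nis_subl sl0 slb t0)). Qed.

Lemma nis_step (t h : R) y : 0 <= t -> 0 <= h -> S (t + h) y = nis sl sb h (S t) y.
Proof. by move=> t0 h0; rewrite addrC; apply: nis_semigroup. Qed.

Lemma nis_modulus (e : R) : 0 < e -> exists2 r : R, 0 < r & forall t s y z,
  0 <= t -> 0 <= s -> `|t - s| < r -> `|y - z| < r -> `|S t y - S s z| <= e.
Proof.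
move=> e0; have := @semi_modulus _ (nis sl sb) (G sl sb) (G20 sl0 slb)
  (nis_subl sl0 slb) (nis_mom sl0 slb) (nis_semigroup sl0 slb) _ _ phiL L0 e e0.
exact.
Qed.

Lemma nis_continuous :
  {within [set p : R * R | 0 <= p.1], continuous (fun p : R * R => nis sl sb p.1 phi p.2)}.
Proof.
apply/subspace_continuousP => -[t y] /= t0; apply/cvgrPdist_le => e e0.
have [r r0 H] := nis_modulus e0.
rewrite /within/=; apply/nbhs_ballP; exists r => //= -[s z] [/= ts yz] s0.
exact: H.
Qed.

(** Write [S t] as the flow over time h of [S (t - h)], bound the latter by the Taylor polynomial of
    psi near y and by the constant M far away, expand in h, and divide by h. *)
Lemma nis_touch (psi : R -> R -> R) t y : C12 psi -> 0 < t -> psi t y = S t y ->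
  ((forall s z, 0 < s -> S s z <= psi s z) -> d_t psi t y <= G sl sb (d_yy psi t y)) /\
  ((forall s z, 0 < s -> psi s z <= S s z) -> G sl sb (d_yy psi t y) <= d_t psi t y).
Proof.
move=> C t0 pS; have [[dt _ _] _] := C t y t0; have sb20 : 0 <= sb ^+ 2 by exact: sqr_ge0.
have Gh e X : 0 < e -> G sl sb (2 * (2^-1 * X + e)) <= G sl sb X + 2 * sb ^+ 2 * e /\
   G sl sb X <= G sl sb (2 * (2^-1 * X - e)) + 2 * sb ^+ 2 * e.
  move=> e0; have e20 : 0 <= 2 * e by rewrite mulr_ge0// ltW.
  split.
    rewrite (_ : 2 * (2^-1 * X + e) = X + 2 * e); last by field.
    by apply: le_trans (G_add sl0 slb _ e20) _; rewrite lerD2l; lra.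
  have := G_add sl0 slb (2 * (2^-1 * X - e)) e20.
  by rewrite (_ : _ + 2 * e = X); [lra|field].
split=> H; apply/ler_addgt0Pr => e e0; pose e1 := e / (2 * (sb ^+ 2 + 1)).
all: have sb1 : 0 < sb ^+ 2 + 1 by rewrite ltr_wpDl.
all: have e10 : 0 < e1 by rewrite divr_gt0// mulr_gt0.
all: have e1e : 2 * sb ^+ 2 * e1 <= e by rewrite /e1 mulrA ler_pdivrMr ?mulr_gt0//; nra.
all: have [r [A [r0 rt A0 HT]]] := C12_jet y C t0 e10.
- have [Cq C0 Hq] := quartic_dominates M (2^-1 * d_yy psi t y + e1) r0 A0.
  apply: (@left_rate _ (psi^~ y) t _ _ (3 * Cq * (sb ^+ 2) ^+ 2) r (derivable_isD dt) r0).
  move=> h /andP[h0 hr].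
  have [|hA hp hT] := HT h; first by rewrite ltW.
  have th0 : 0 < t - h by rewrite subr_gt0 (lt_trans hr).
  have := @expand_up _ _ _ h (nis_subl sl0 slb (ltW h0)) (nis_mom sl0 slb (ltW h0)) (S (t - h)) y
    (psi (t - h) y) (d_y psi (t - h) y) (2^-1 * d_yy psi t y + e1) Cq C0 (gr_lip (nis_lip (ltW th0))).
  rewrite -nis_step ?(ltW th0) ?(ltW h0)// subrK -pS (G2 sl0 slb) => k.
  apply: le_trans (k _) _.
    move=> x; have [xr|xr] := ltP `|x| r.
      apply: le_trans (H _ _ th0) _; have := hT x xr.
      rewrite ler_distl => /andP[_]; have : 0 <= Cq * x ^+ 4 by rewrite mulr_ge0// exprn_even_ge0.
      lra.
    apply: le_trans (Hq _ _ x hA hp xr).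
    by have := nis_bd (y + x) (ltW th0); rewrite ler_norml => /andP[].
  have [g1 _] := Gh e1 (d_yy psi t y) e10.
  have := ler_wpM2l (ltW h0) g1; have := ler_wpM2l (ltW h0) e1e; lra.
- have [Cq C0 Hq] := quartic_dominates M (- (2^-1 * d_yy psi t y - e1)) r0 A0.
  have dt' : isD (fun s => - psi s y) t (- d_t psi t y).
    move=> e' e'0; have [r' r'0 Hr'] := derivable_isD dt e'0; exists r' => // h hr.
    by rewrite -normrN; have := Hr' h hr; congr (`|_| <= _); rewrite /d_t; ring.
  rewrite -lerBlDr -lerN2.
  apply: (@left_rate _ (fun s => - psi s y) t _ _ (3 * Cq * (sb ^+ 2) ^+ 2) r dt' r0).
  move=> h /andP[h0 hr].
  have [|hA hp hT] := HT h; first by rewrite ltW.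
  have th0 : 0 < t - h by rewrite subr_gt0 (lt_trans hr).
  have := @expand_lo _ _ _ h (nis_subl sl0 slb (ltW h0)) (nis_mom sl0 slb (ltW h0)) (S (t - h)) y
    (psi (t - h) y) (d_y psi (t - h) y) (2^-1 * d_yy psi t y - e1) Cq C0 (gr_lip (nis_lip (ltW th0))).
  rewrite -nis_step ?(ltW th0) ?(ltW h0)// subrK -pS (G2 sl0 slb) => k.
  have {}k := k _; rewrite lerNl; apply: le_trans (k _).
    have [_ g1] := Gh e1 (d_yy psi t y) e10.
    have := ler_wpM2l (ltW h0) g1; have := ler_wpM2l (ltW h0) e1e; lra.
  move=> x; have [xr|xr] := ltP `|x| r.
    apply: le_trans (H _ _ th0); have := hT x xr.
    rewrite ler_distl => /andP[+ _]; have : 0 <= Cq * x ^+ 4 by rewrite mulr_ge0// exprn_even_ge0.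
    lra.
  have := Hq (- psi (t - h) y) (- d_y psi (t - h) y) x; rewrite !normrN => /(_ hA hp xr).
  by have := nis_bd (y + x) (ltW th0); rewrite ler_norml => /andP[+ _]; lra.
Qed.

Lemma nis_viscosity : viscosity_solution sl sb phi (fun t => S t).
Proof.
split.
- by move=> y; exact: nis0 phiL L0.
- exact: nis_continuous.
- by exists M => t y; exact: nis_bd.
- by move=> psi t y C t0 H pS; exact: (nis_touch C t0 pS).1.
- by move=> psi t y C t0 H pS; exact: (nis_touch C t0 pS).2.
Qed.

End NisioViscosity.

(** * Local quadratic jets *)

Section Jets.
Variables (R : realType) (sl sb : R).

(* Viscosity subsolutions of [u_t = F u_yy] through quadratic jets, a local
   and hence time-shift invariant notion. *)
Definition jetsub (F : R -> R) (u : R -> R -> R) := forall t y a p X C r : R, 0 < t -> 0 < r ->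
  (forall s z, 0 < s -> `|s - t| < r -> `|z - y| < r ->
    u s z <= u t y + a * (s - t) + p * (z - y) + 2^-1 * X * (z - y) ^+ 2 + C * (s - t) ^+ 2) ->
  a <= F X.

Definition polyt (c a p X C K t y s z : R) := c + a * (s - t) + p * (z - y)
  + 2^-1 * X * (z - y) ^+ 2 + C * (s - t) ^+ 2 + K * (z - y) ^+ 4.

Lemma polyt_C12 c a p X C K t y : C12 (polyt c a p X C K t y) /\
  forall s z, d_t (polyt c a p X C K t y) s z = a + 2 * C * (s - t) /\
   d_yy (polyt c a p X C K t y) s z = X + 12 * K * (z - y) ^+ 2.
Proof.
set psi := polyt _ _ _ _ _ _ _ _.
have D1 s z : isD (psi^~ z) s (a + 2 * C * (s - t)).
  apply: (@isD_quadratic _ _ _ _ `|C| 1) => // h h1.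
  rewrite (_ : _ - _ = C * h ^+ 2); last by rewrite /psi /polyt; ring.
  by rewrite normrM (ger0_norm (sqr_ge0 h)).
have D2 s z : isD (psi s) z (p + X * (z - y) + 4 * K * (z - y) ^+ 3).
  pose B := `|2^-1 * X + 6 * K * (z - y) ^+ 2| + `|4 * K * (z - y)| + `|K|.
  apply: (@isD_quadratic _ _ _ _ B 1) => // h h1.
  rewrite (_ : _ - _ = (2^-1 * X + 6 * K * (z - y) ^+ 2 + 4 * K * (z - y) * h + K * h ^+ 2) * h ^+ 2); last first.
    by rewrite /psi /polyt; field.
  rewrite normrM (ger0_norm (sqr_ge0 h)) ler_wpM2r ?sqr_ge0// /B.
  apply: le_trans (ler_normD _ _) _; rewrite lerD//.
    apply: le_trans (ler_normD _ _) _; rewrite lerD2l normrM ler_piMr// ltW//.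
  by rewrite normrM normrX ler_piMr// exprn_ile1// ltW.
have E2 s : d_y psi s = fun z => p + X * (z - y) + 4 * K * (z - y) ^+ 3.
  by apply/funext => z; exact: (isD_derive1 (D2 s z)).2.
have D3 s z : isD (d_y psi s) z (X + 12 * K * (z - y) ^+ 2).
  pose B := `|12 * K * (z - y)| + `|4 * K|.
  apply: (@isD_quadratic _ _ _ _ B 1) => // h h1.
  rewrite E2 (_ : _ - _ = (12 * K * (z - y) + 4 * K * h) * h ^+ 2); last by ring.
  rewrite normrM (ger0_norm (sqr_ge0 h)) ler_wpM2r ?sqr_ge0// /B.
  by apply: le_trans (ler_normD _ _) _; rewrite lerD2l normrM ler_piMr// ltW.
have E1 s z : d_t psi s z = a + 2 * C * (s - t) by exact: (isD_derive1 (D1 s z)).2.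
have E3 s z : d_yy psi s z = X + 12 * K * (z - y) ^+ 2 by exact: (isD_derive1 (D3 s z)).2.
split=> [s z s0|s z]; last by [].
split; first by split; [exact: (isD_derive1 (D1 s z)).1|exact: (isD_derive1 (D2 s z)).1|
  exact: (isD_derive1 (D3 s z)).1].
have ec (f h : R * R -> R) : f = h -> {for (s, z), continuous h} -> {for (s, z), continuous f}.
  by move->.
have cn n : {for (s, z), continuous (fun q : R * R => (q.2 - y) ^+ n)}.
  apply: (@continuous_comp _ _ _ (fun q : R * R => q.2 - y) (fun v : R => v ^+ n)).
    by apply: cvgB; [exact: cvg_snd|exact: cvg_cst].
  exact: exprn_continuous.
split.
- apply: (@ec _ (fun q => a + 2 * C * (q.1 - t))); first by apply/funext => q; rewrite E1.
  by apply: cvgD; [exact: cvg_cst|apply: cvgM; [exact: cvg_cst|apply: cvgB; [exact: cvg_fst|exact: cvg_cst]]].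
- apply: (@ec _ (fun q => p + X * (q.2 - y) ^+ 1 + 4 * K * (q.2 - y) ^+ 3)).
    by apply/funext => q; rewrite E2 expr1.
  apply: cvgD; first (apply: cvgD; [exact: cvg_cst|apply: cvgM; [exact: cvg_cst|exact: cn]]).
  by apply: cvgM; [exact: cvg_cst|exact: cn].
- apply: (@ec _ (fun q => X + 12 * K * (q.2 - y) ^+ 2)); first by apply/funext => q; rewrite E3.
  by apply: cvgD; [exact: cvg_cst|apply: cvgM; [exact: cvg_cst|exact: cn]].
Qed.

(** A local touching polynomial becomes a global test function since u is bounded: steep penalties
    in time and space take over away from the contact point. *)
Lemma touch_quadratic (u : R -> R -> R) (M t y a p X C r : R) : 0 < t -> 0 < r ->
  (forall s z, 0 < s -> `|u s z| <= M) ->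
  (forall s z, 0 < s -> `|s - t| < r -> `|z - y| < r ->
    u s z <= u t y + a * (s - t) + p * (z - y) + 2^-1 * X * (z - y) ^+ 2 + C * (s - t) ^+ 2) ->
  exists C' K, forall s z, 0 < s -> u s z <= polyt (u t y) a p X C' K t y s z.
Proof.
move=> t0 r0 uM H; have M0 : 0 <= M by exact: le_trans (uM t y t0).
pose Q := `|p| + `|X|; have Q0 : 0 <= Q by exact: addr_ge0.
(* The time coefficient pays for [a * (s - t)], for the oscillation 2M and for Q when
   [|s - t| >= r]; the quartic one pays for the same terms when only [|z - y| >= r], and its summand
   Q for the first and second order terms in space. *)
exists (`|C| + `|a| / r + (Q + 2 * M) / r ^+ 2), (Q + (`|a| * r + 2 * M + Q) / r ^+ 4).
move=> s z s0; rewrite /polyt; set sg := s - t; set ze := z - y.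
have r2 : 0 < r ^+ 2 by exact: exprn_gt0.
have r4 : 0 < r ^+ 4 by exact: exprn_gt0.
have z4 : 0 <= ze ^+ 4 by exact: exprn_even_ge0.
have s2 : 0 <= sg ^+ 2 by exact: sqr_ge0.
have r0' := ltW r0; have w0 : 0 <= `|a| * r by exact: mulr_ge0.
have w1 : 0 <= `|a| / r by exact: divr_ge0.
have w2 : 0 <= 2 * M by exact: mulr_ge0.
have w3 : 0 <= (Q + 2 * M) / r ^+ 2 by rewrite divr_ge0 ?addr_ge0// ltW.
have w4 : 0 <= (`|a| * r + 2 * M + Q) / r ^+ 4 by rewrite divr_ge0 ?(ltW r4)// addr_ge0// addr_ge0.
have e1 : 0 <= (`|a| * r + 2 * M + Q) / r ^+ 4 * ze ^+ 4 by exact: mulr_ge0.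
have e2 : 0 <= (`|a| / r + (Q + 2 * M) / r ^+ 2) * sg ^+ 2 by rewrite mulr_ge0// addr_ge0.
have e3 : 0 <= Q * ze ^+ 4 by exact: mulr_ge0.
have e4 : C * sg ^+ 2 <= `|C| * sg ^+ 2 by rewrite ler_wpM2r ?ler_norm.
have [szr|] := boolP ((`|sg| < r) && (`|ze| < r)).
  move/andP: szr => [sr zr]; apply: le_trans (H s z s0 sr zr) _; rewrite -/sg -/ze; lra.
have a1 : - (`|a| * `|sg|) <= a * sg by rewrite lerNl -normrM -normrN ler_norm.
have p1 : - (Q * (1 + ze ^+ 4)) <= p * ze + 2^-1 * X * ze ^+ 2.
  rewrite lerNl; apply: le_trans (ler_norm _) _; rewrite normrN.
  apply: le_trans (ler_normD _ _) _; rewrite /Q mulrDl; apply: lerD.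
    by rewrite normrM; apply: ler_wpM2l => //; exact: norm_le4.
  rewrite normrM (ger0_norm (sqr_ge0 ze)) normrM (@gtr0_norm _ 2^-1) ?invr_gt0//.
  rewrite -mulrA mulrCA; apply: ler_wpM2l => //.
  by have := sqr_le4 ze; have := sqr_ge0 ze; lra.
have u1 : u s z - u t y <= 2 * M.
  have := uM s z s0; have := uM t y t0; rewrite !ler_norml => /andP[? ?] /andP[? ?]; lra.
have C0 : 0 <= `|C| * sg ^+ 2 by rewrite mulr_ge0.
rewrite negb_and -!leNgt => /orP[sr|].
  have k1 : `|a| * `|sg| <= `|a| / r * sg ^+ 2.
    rewrite -mulrA ler_wpM2l// -(real_normK (num_real sg)) expr2 mulrA ler_peMl//.
    by rewrite mulrC ler_pdivlMr// mul1r.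
  have k2 : Q + 2 * M <= (Q + 2 * M) / r ^+ 2 * sg ^+ 2.
    rewrite -mulrA ler_peMr ?addr_ge0// mulrC ler_pdivlMr// mul1r.
    by rewrite -(real_normK (num_real sg)) lerXn2r ?nnegrE// ltW.
  lra.
move=> zr; have [sr|sr] := leP r `|sg|.
  have k1 : `|a| * `|sg| <= `|a| / r * sg ^+ 2.
    rewrite -mulrA ler_wpM2l// -(real_normK (num_real sg)) expr2 mulrA ler_peMl//.
    by rewrite mulrC ler_pdivlMr// mul1r.
  have k2 : Q + 2 * M <= (Q + 2 * M) / r ^+ 2 * sg ^+ 2.
    rewrite -mulrA ler_peMr ?addr_ge0// mulrC ler_pdivlMr// mul1r.
    by rewrite -(real_normK (num_real sg)) lerXn2r ?nnegrE// ltW.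
  lra.
have k1 : `|a| * `|sg| <= `|a| * r by rewrite ler_wpM2l// ltW.
have k2 : `|a| * r + 2 * M + Q <= (`|a| * r + 2 * M + Q) / r ^+ 4 * ze ^+ 4.
  rewrite -mulrA ler_peMr ?(addr_ge0 (addr_ge0 w0 w2) Q0)// mulrC ler_pdivlMr// mul1r.
  have -> : ze ^+ 4 = `|ze| ^+ 4 by rewrite -[RHS]normrX ger0_norm.
  by rewrite lerXn2r ?nnegrE// ltW.
lra.
Qed.

Lemma viscosity_sub_jet (u : R -> R -> R) M : (forall t y, 0 <= t -> `|u t y| <= M) ->
  viscosity_subsolution sl sb u -> jetsub (G sl sb) u.
Proof.
move=> uM Hu t y a p X C r t0 r0 H.
have uM' s z : 0 < s -> `|u s z| <= M by move=> s0; apply: uM; exact: ltW.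
have [C' [K HK]] := touch_quadratic t0 r0 uM' H.
have [C12p E] := polyt_C12 (u t y) a p X C' K t y.
have := Hu _ t y C12p t0 HK; have [-> ->] := E t y.
rewrite !subrr !mulr0 !expr0n/= !mulr0 !addr0; apply.
by rewrite /polyt !subrr !expr0n/= !mulr0 !addr0.
Qed.

(** Passing to [- u] and to [X |-> - G (- X)] lets a single comparison principle for subsolutions
    serve both bounds. *)
Lemma viscosity_super_jet (u : R -> R -> R) M : (forall t y, 0 <= t -> `|u t y| <= M) ->
  viscosity_supersolution sl sb u -> jetsub (fun X => - G sl sb (- X)) (fun t y => - u t y).
Proof.
move=> uM Hu t y a p X C r t0 r0 H.
have uM' s z : 0 < s -> `|- u s z| <= M by move=> s0; rewrite normrN; apply: uM; exact: ltW.
have [C' [K HK]] := touch_quadratic t0 r0 uM' H.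
have [C12p E] := polyt_C12 (u t y) (- a) (- p) (- X) (- C') (- K) t y.
have := Hu _ t y C12p t0; have [-> ->] := E t y.
rewrite !subrr !mulr0 !expr0n/= !mulr0 !addr0 lerNr; apply.
  by move=> s z s0; have := HK s z s0; rewrite /polyt; lra.
by rewrite /polyt !subrr !expr0n/= !mulr0 !addr0.
Qed.

End Jets.

(** * Steklov averages *)

Section Steklov.
Variable R : realType.
Implicit Types f : R -> R.

Lemma lip_continuous L f : 0 <= L -> lip L f -> continuous f.
Proof.
move=> L0 fL x; apply/cvgrPdist_le => e e0.
have L1 : 0 < L + 1 by rewrite ltr_wpDl.
apply/nbhs_ballP; exists (e / (L + 1)); first by rewrite /= divr_gt0.
move=> y; rewrite /ball/= ltr_pdivlMr// => xy; apply: le_trans (fL _ _) _.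
have := normr_ge0 (x - y); lra.
Qed.

Lemma half_antiderivative f : continuous f -> exists F, forall x, -1 < x -> isD F x (f x).
Proof.
move=> cf; exists (fun x => (\int[lebesgue_measure]_(t in [set` `[-1, x]]) (f t))%R) => x x1.
have xu : x < x + 1 by rewrite ltrDl.
have [] := @continuous_FTC1_closed R f (-1) x (x + 1) xu _ x1 (cf x).
  apply: continuous_compact_integrable; first exact: segment_compact.
  exact: continuous_subspaceT.
by move=> dF E; rewrite -E; exact: derivable_isD.
Qed.

(** The fundamental theorem is applied on a half-line starting at -1, once to f and once to its
    reflection; the two pieces are valid on an overlap around 0, where they are glued. *)
Lemma antiderivative f : continuous f -> exists F, forall x, isD F x (f x).
Proof.
move=> cf; have [P HP] := half_antiderivative cf.
have cg : continuous (fun x => f (- x)).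
  by move=> x; apply: continuous_comp; [exact: oppr_continuous|exact: cf].
have [N HN] := half_antiderivative cg.
pose F x := if 0 <= x then P x - P 0 else N 0 - N (- x).
have HN' x : x < 1 -> isD (fun x => N 0 - N (- x)) x (f x).
  move=> x1 e e0; have [|r r0 H] := HN (- x) _ _ e0; first by rewrite ltrN2.
  exists r => // h hr; have := H (- h); rewrite normrN opprK => /(_ hr).
  move=> k; rewrite (_ : _ - _ = - (N (- x - h) - N (- x) - f x * - h)) ?normrN//.
  by rewrite (opprD x h); ring.
have HP' x : -1 < x -> isD (fun x => P x - P 0) x (f x).
  move=> x1 e e0; have [r r0 H] := HP _ x1 _ e0; exists r => // h hr.
  by have := H h hr; congr (`|_| <= _); ring.
have F0 : N 0 - N (- 0) = P 0 - P 0 by rewrite oppr0 !subrr.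
exists F => x e e0.
have [x0|x0|x0] := ltgtP x 0.
- have [|r r0 H] := HN' x _ _ e0; first by rewrite (lt_trans x0).
  exists (Num.min r (- x)) => [|h]; first by rewrite lt_min r0 oppr_gt0.
  rewrite lt_min => /andP[hr hx]; rewrite /F.
  have xh : x + h < 0 by move: hx; rewrite ltr_norml => /andP[]; lra.
  by rewrite (leNgt 0 (x + h)) (leNgt 0 x) xh x0/=; exact: H.
- have [|r r0 H] := HP' x _ _ e0; first by rewrite (lt_trans _ x0)// oppr_lt0.
  exists (Num.min r x) => [|h]; first by rewrite lt_min r0.
  rewrite lt_min => /andP[hr hx]; rewrite /F (ltW x0).
  have -> : 0 <= x + h by move: hx; rewrite ltr_norml => /andP[]; lra.
  exact: H.
- subst x; have [|r r0 H] := HP' 0 _ _ e0; first by rewrite oppr_lt0.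
  have [|r' r'0 H'] := HN' 0 _ _ e0; first by [].
  exists (Num.min r r') => [|h]; first by rewrite lt_min r0.
  rewrite lt_min => /andP[hr hr']; rewrite /F lexx add0r.
  have [h0|h0] := leP 0 h; first by have := H h hr; rewrite add0r.
  by have := H' h hr'; rewrite F0 add0r.
Qed.

Definition prim f : R -> R := xget (fun x : R => x) [set F : R -> R | forall x, isD F x (f x)].

Lemma primP f : continuous f -> forall x, isD (prim f) x (f x).
Proof. by move=> /antiderivative[F HF]; exact: (@xgetPex _ _ [set F : R -> R | forall x, isD F x (f x)] (ex_intro _ F HF)). Qed.

(** The mean of f over [y, y + e], written with a primitive so that its derivative is an explicit
    difference quotient. *)
Definition steklov (e : R) f (y : R) : R := (prim f (y + e) - prim f y) / e.

(** Riemann sums of the Steklov average. They are finite combinations of translates, so sublinear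
    operators act on them directly; every property of [steklov] on Lipschitz functions is
    transferred from them with an error of order [1 / n.+1]. *)
Definition ravg (e : R) n f (y : R) : R :=
  n.+1%:R^-1 * \sum_(i < n.+1) f (y + i%:R * (e / n.+1%:R)).

Lemma isD_shift f (x l a : R) : isD f (x + a) l -> isD (fun y => f (y + a)) x l.
Proof.
move=> H e e0; have [r r0 Hr] := H _ e0; exists r => // h hr.
by rewrite (addrAC x h a); exact: Hr.
Qed.

Lemma isD_diffquot f (x l m a b : R) : isD f (x + a) l -> isD f x m ->
  isD (fun y => (f (y + a) - f y) / b) x ((l - m) / b).
Proof.
move=> /isD_shift H1 H2 e e0.
have b1 : 0 < `|b^-1| + 1 by rewrite ltr_wpDl.
have e20 : 0 < e / (2 * (`|b^-1| + 1)) by rewrite divr_gt0// mulr_gt0.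
have [r r0 Hr] := H1 _ e20; have [s s0 Hs] := H2 _ e20.
exists (Num.min r s) => [|h]; first by rewrite lt_min r0.
rewrite lt_min => /andP[hr hs]; have := Hr _ hr; have := Hs _ hs.
set A := f (x + h) - _ - _; set B := f (x + h + a) - _ - _ => hA hB.
rewrite (_ : _ - _ = (B - A) * b^-1); last by rewrite /A /B; ring.
rewrite normrM; have hAB : `|B - A| <= 2 * (e / (2 * (`|b^-1| + 1)) * `|h|).
  by apply: le_trans (ler_normB _ _) _; lra.
apply: (@le_trans _ _ (2 * (e / (2 * (`|b^-1| + 1)) * `|h|) * (`|b^-1| + 1))).
  by apply: ler_pM => //; rewrite lerDl.
by rewrite le_eqVlt; apply/orP; left; apply/eqP; field; rewrite gt_eqF.
Qed.

Lemma steklov_isD e f y : continuous f -> isD (steklov e f) y ((f (y + e) - f y) / e).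
Proof. by move=> cf; apply: isD_diffquot; exact: primP. Qed.

Variable e : R.
Hypothesis e0 : 0 < e.

Lemma ravg_steklov (L : R) f n (y : R) : 0 <= L -> lip L f ->
  `|steklov e f y - ravg e n f y| <= L * e / n.+1%:R.
Proof.
move=> L0 fL; have cf := lip_continuous L0 fL.
pose t i := y + i%:R * (e / n.+1%:R).
have n0 : (n.+1%:R : R) != 0 by rewrite pnatr_eq0.
have tn : t n.+1 = y + e by rewrite /t mulrC divfK.
have t0 : t 0%N = y by rewrite /t mul0r addr0.
have st : steklov e f y = n.+1%:R^-1 * \sum_(i < n.+1) ((prim f (t i.+1) - prim f (t i)) * (n.+1%:R / e)).
  rewrite -mulr_suml -(big_mkord xpredT (fun i => prim f (t i.+1) - prim f (t i))).
  rewrite telescope_sumr// tn t0 /steklov; move: n0; set N : R := n.+1%:R => n0.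
  by field; rewrite gt_eqF// nat1r pnatr_eq0.
rewrite st /ravg -mulrBr -sumrB normrM (@ger0_norm _ n.+1%:R^-1)// mulrC ler_pdivrMr//.
rewrite divfK//; apply: le_trans (ler_norm_sum _ _ _) _.
apply: (@le_trans _ _ (\sum_(i < n.+1) (L * (e / n.+1%:R)))); last first.
  by rewrite sumr_const card_ord -(mulr_natr (L * _)) mulrA divfK.
apply: ler_sum => i _.
have [c [E ct _]] := mvt (primP cf) (t i.+1) (t i).
have dt : t i.+1 - t i = e / n.+1%:R by rewrite /t -natr1; ring.
have Ni : e / n.+1%:R * (n.+1%:R / e) = 1 by rewrite mulrA divfK// divff// gt_eqF.
rewrite E dt -mulrA Ni mulr1.
apply: le_trans (fL _ _) _; rewrite ler_wpM2l//; apply: le_trans ct _.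
by rewrite dt ger0_norm// divr_ge0// ltW.
Qed.

Lemma small_of (C x : R) : (forall n, x <= C / n.+1%:R) -> x <= 0.
Proof.
move=> H; apply/ler_addgt0Pr => d d0; rewrite add0r.
pose n := Num.truncn (`|C| / d); apply: le_trans (H n) _.
rewrite ler_pdivrMr// mulrC -ler_pdivrMr//.
have := truncnS_gt (`|C| / d); rewrite -/n => h; apply: le_trans (ltW h).
by rewrite ler_pM2r ?invr_gt0// ler_norm.
Qed.

Lemma ravg_le f g n (y : R) : (forall x, f x <= g x) -> ravg e n f y <= ravg e n g y.
Proof. by move=> fg; rewrite /ravg ler_pM2l ?invr_gt0//; apply: ler_sum. Qed.

Lemma ravg_cst (c : R) n y : ravg e n (fun=> c) y = c.
Proof. by rewrite /ravg sumr_const card_ord -(mulr_natr c) mulrCA mulVf ?mulr1. Qed.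

Lemma ravgD f g n y : ravg e n (fun x => f x + g x) y = ravg e n f y + ravg e n g y.
Proof. by rewrite /ravg big_split/= mulrDr. Qed.

Lemma ravg_lip (L : R) f n : lip L f -> lip L (ravg e n f).
Proof.
move=> fL x y; rewrite /ravg -mulrBr -sumrB normrM (@ger0_norm _ n.+1%:R^-1)// mulrC ler_pdivrMr//.
apply: le_trans (ler_norm_sum _ _ _) _.
apply: (@le_trans _ _ (\sum_(i < n.+1) (L * `|x - y|))).
  by apply: ler_sum => i _; apply: le_trans (fL _ _) _; rewrite opprD addrACA subrr addr0.
by rewrite sumr_const card_ord -(mulr_natr (L * _)).
Qed.

Section Lip.
Variables (L : R) (f : R -> R).
Hypotheses (L0 : 0 <= L) (fL : lip L f).

Lemma steklov_mono (L' : R) g (y : R) : 0 <= L' -> lip L' g -> (forall x, f x <= g x) ->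
  steklov e f y <= steklov e g y.
Proof.
move=> L'0 gL fg; rewrite -subr_le0; apply: (@small_of (L * e + L' * e)) => n.
have := ravg_steklov n y L0 fL; have := ravg_steklov n y L'0 gL; have := ravg_le n y fg.
rewrite !ler_distl (mulrDl (L * e)) => h1 /andP[h2 h3] /andP[h4 h5]; move: (L * e / n.+1%:R) (L' * e / n.+1%:R) h2 h3 h4 h5 => a b *; lra.
Qed.

Lemma steklov_lip : lip L (steklov e f).
Proof.
move=> x y; rewrite -subr_le0; apply: (@small_of (L * e + L * e)) => n.
have h1 := ravg_steklov n x L0 fL; have h2 := ravg_steklov n y L0 fL.
have h3 := ravg_lip n fL x y; rewrite (mulrDl (L * e)) lerBlDr.
set a := L * e / _ in h1 h2 *.
have -> : steklov e f x - steklov e f y = (steklov e f x - ravg e n f x) +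
   (ravg e n f x - ravg e n f y) - (steklov e f y - ravg e n f y) by ring.
apply: le_trans (ler_normB _ _) _; apply: le_trans (lerD (ler_normD _ _) (lexx _)) _; lra.
Qed.

Lemma steklov_bd (M y : R) : (forall x, `|f x| <= M) -> `|steklov e f y| <= M.
Proof.
move=> fM; rewrite -subr_le0; apply: (@small_of (L * e)) => n; rewrite lerBlDr.
have h1 := ravg_steklov n y L0 fL.
have h2 : `|ravg e n f y| <= M.
  have k1 := ravg_cst (- M) n y; have k2 := ravg_cst M n y.
  rewrite ler_norml; apply/andP; split; [rewrite -k1|rewrite -k2]; apply: ravg_le;
    by move=> x; have := fM x; rewrite ler_norml => /andP[].
rewrite -[steklov _ _ _](subrK (ravg e n f y)).
by apply: le_trans (ler_normD _ _) _; exact: lerD.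
Qed.

Lemma steklov_near y : `|steklov e f y - f y| <= L * e.
Proof.
rewrite -subr_le0; apply: (@small_of (L * e)) => n; rewrite lerBlDr.
have h1 := ravg_steklov n y L0 fL.
have h2 : `|ravg e n f y - f y| <= L * e.
  rewrite -(ravg_cst (f y) n y) /ravg -mulrBr -sumrB normrM (@ger0_norm _ n.+1%:R^-1)//.
  rewrite mulrC ler_pdivrMr//; apply: le_trans (ler_norm_sum _ _ _) _.
  apply: (@le_trans _ _ (\sum_(i < n.+1) (L * e))); last by rewrite sumr_const card_ord -(mulr_natr (L * _)).
  apply: ler_sum => i _; apply: le_trans (fL _ _) _; rewrite ler_wpM2l//.
  rewrite addrAC subrr add0r ger0_norm ?mulr_ge0 ?divr_ge0// ?(ltW e0)//.
  rewrite mulrCA -[leRHS]mulr1 ler_pM2l// ler_pdivrMr// mul1r ler_nat ltnW//.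
rewrite (_ : _ - _ = (steklov e f y - ravg e n f y) + (ravg e n f y - f y)); last by ring.
by apply: le_trans (ler_normD _ _) _; exact: lerD.
Qed.

Lemma steklovD (L' : R) g (y : R) : 0 <= L' -> lip L' g ->
  steklov e (fun x => f x + g x) y = steklov e f y + steklov e g y.
Proof.
move=> L'0 gL; have sL : lip (L + L') (fun x => f x + g x).
  move=> a b; rewrite mulrDl opprD addrACA.
  by apply: le_trans (ler_normD _ _) _; apply: lerD.
apply/eqP; rewrite -subr_eq0 -normr_le0.
apply: (@small_of (L * e + L' * e + L * e + L' * e)) => n.
have h1 := ravg_steklov n y L0 fL; have h2 := ravg_steklov n y L'0 gL.
have h3 := ravg_steklov n y (addr_ge0 L0 L'0) sL.
rewrite ravgD (mulrDl L) (mulrDl (L * e)) in h3.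
rewrite (mulrDl (L * e + L' * e + L * e)) (mulrDl (L * e + L' * e)) (mulrDl (L * e)).
move: (L * e / n.+1%:R) (L' * e / n.+1%:R) h1 h2 h3 => a b h1 h2 h3.
have -> : steklov e (fun x => f x + g x) y - (steklov e f y + steklov e g y) =
 (steklov e (fun x => f x + g x) y - (ravg e n f y + ravg e n g y)) - (steklov e f y - ravg e n f y)
   - (steklov e g y - ravg e n g y) by ring.
apply: le_trans (ler_normB _ _) _; apply: le_trans (lerD (ler_normB _ _) (lexx _)) _; lra.
Qed.

(** A sublinear operator of a mean of translates is at most the mean of its values on the
    translates, which are translates of [T f]. *)
Lemma steklov_jensen T y : subl T -> T (steklov e f) y <= steklov e (T f) y.
Proof.
move=> sT; rewrite -subr_le0; apply: (@small_of (L * e + L * e)) => n.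
have gf := gr_lip fL.
have h1 : T (steklov e f) y <= T (ravg e n f) y + L * e / n.+1%:R.
  apply: (sl_le_shift sT); [exact: (gr_lip steklov_lip)|exact: (gr_lip (ravg_lip n fL))|].
  by move=> x; have := ravg_steklov n x L0 fL; rewrite ler_distl => /andP[_].
have h2 := ravg_steklov n y L0 (sl_lip sT fL).
have h3 : T (ravg e n f) y <= ravg e n (T f) y.
  have gS k : gr (fun x => \sum_(i < k) f (x + i%:R * (e / n.+1%:R))).
    elim: k => [|k IH]; first by under eq_fun do rewrite big_ord0; exact: gr_cst.
    by under eq_fun do rewrite big_ord_recr/=; apply: grD => //; exact: gr_tr.
  have hS k : T (fun x => \sum_(i < k) f (x + i%:R * (e / n.+1%:R))) y <=
      \sum_(i < k) T f (y + i%:R * (e / n.+1%:R)).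
    elim: k => [|k IH]; first by under eq_fun do rewrite big_ord0; rewrite big_ord0 (sl_cst sT).
    under eq_fun do rewrite big_ord_recr/=; rewrite big_ord_recr/=.
    apply: le_trans (sl_add sT _ (gS k) (gr_tr _ gf)) _; apply: lerD => //.
    by rewrite (sl_tr sT).
  by rewrite /ravg (sl_hom sT _ _ (gS n.+1)) ?invr_ge0// ler_pM2l ?invr_gt0.
move: h2; rewrite (mulrDl (L * e)) ler_distl => /andP[h2 _].
move: (L * e / n.+1%:R) h1 h2 => a h1 h2; lra.
Qed.

End Lip.
End Steklov.

(** * Comparison and uniqueness *)

Section Comparison.
Variable R : realType.

Lemma cube_small (C x e : R) : 0 < e -> `|x| < e / (`|C| + 1) -> C * `|x| ^+ 3 <= e * x ^+ 2.
Proof.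
move=> e0; rewrite ltr_pdivlMr ?ltr_wpDl// => h.
rewrite -(real_normK (num_real x)) (exprSr _ 2) mulrCA mulrC ler_wpM2r ?exprn_ge0//.
apply: le_trans (ltW h); rewrite mulrC ler_wpM2l//.
by apply: le_trans (ler_norm _) _; rewrite lerDl.
Qed.

Variables (F : R -> R) (K0 : R) (u v v1 v2 : R -> R -> R) (M K C : R).
Hypotheses (K00 : 0 <= K0) (FK : forall a b : R, 0 <= b -> F (a + b) <= F a + K0 * b).
Hypotheses (M0 : 0 <= M) (Kge : 0 <= K).
Hypotheses (uF : jetsub F u) (uM : forall t y : R, 0 <= t -> `|u t y| <= M)
  (uc : {within [set p : R * R | 0 <= p.1], continuous (fun p : R * R => u p.1 p.2)}).
Hypotheses
  (vlow : forall s z t : R, 0 <= t -> - v s z <= M + K * `|t - s|)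
  (vc : continuous (fun p : R * R => v p.1 p.2))
  (v0 : forall s z, v 0 z - K * `|s| <= v s z)
  (vT : forall s z x, v s (z + x) <= v s z + v1 s z * x + 2^-1 * v2 s z * x ^+ 2 + C * `|x| ^+ 3)
  (vF : forall s z e : R, 0 < e -> exists2 h0 : R, 0 < h0 &
     forall h : R, 0 < h < h0 -> h * (F (v2 s z) - e) <= v s z - v (s - h) z).
Hypothesis uv0 : forall y, u 0 y <= v 0 y.

(* The doubling only concerns time: [v] is smooth in space but only
   one-sidedly differentiable in time. *)
Definition doubled (d k eta : R) (q : R * R * R) :=
  u q.1.1 q.2 - v q.1.2 q.2 - ((q.1.1 - q.1.2) ^+ 2 / (2 * d) + k * q.2 ^+ 2 + eta * q.1.1).

(** Half of the penalty in [t - s] absorbs the linear growth [K * |t - s|] allowed to [- v]; the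
    other half, with the two remaining penalties, confines the positive values to a compact box. *)
Lemma doubled_max (d k eta : R) (q0 : R * R * R) : 0 < d -> 0 < k -> 0 < eta -> 0 <= q0.1.1 ->
  0 < doubled d k eta q0 -> exists q, [/\ 0 <= q.1.1, doubled d k eta q0 <= doubled d k eta q &
    forall q', 0 <= q'.1.1 -> doubled d k eta q' <= doubled d k eta q].
Proof.
move=> d0 k0 e0 q00 qpos.
pose N := 2 * M + K ^+ 2 * d.
have N0 : 0 <= N by rewrite addr_ge0 ?mulr_ge0 ?sqr_ge0// ltW.
have bd q : 0 <= q.1.1 -> doubled d k eta q <=
    N - ((q.1.1 - q.1.2) ^+ 2 / (4 * d) + k * q.2 ^+ 2 + eta * q.1.1).
  case: q => -[t s] z /= t0; rewrite /doubled/=.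
  have h1 : u t z <= M by have := uM z t0; rewrite ler_norml => /andP[].
  have h2 := vlow s z t0.
  have h3 : K * `|t - s| <= (t - s) ^+ 2 / (4 * d) + K ^+ 2 * d.
    rewrite -(real_normK (num_real (t - s))); move: `|t - s| => x.
    rewrite -(@ler_pM2r _ (4 * d)) ?mulr_gt0//.
    have -> : (x ^+ 2 / (4 * d) + K ^+ 2 * d) * (4 * d) = x ^+ 2 + 4 * K ^+ 2 * d ^+ 2.
      by field; rewrite gt_eqF.
    by have := sqr_ge0 (x - 2 * K * d); lra.
  have -> : (t - s) ^+ 2 / (2 * d) = (t - s) ^+ 2 / (4 * d) + (t - s) ^+ 2 / (4 * d).
    by field; rewrite gt_eqF.
  rewrite /N; lra.
(* The bound [bd] is nonpositive as soon as one of the three penalties exceeds N; these are the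
   resulting sides of the box. *)
pose a := N / eta + 1; pose b := N / k + 1; pose c := N * (4 * d) + 1.
have a1 : 1 <= a by rewrite lerDr divr_ge0// ltW.
have b1 : 1 <= b by rewrite lerDr divr_ge0// ltW.
have c1 : 1 <= c by rewrite lerDr mulr_ge0// mulr_ge0// ltW.
pose A := (`[0, a]%classic `*` `[- c, a + c]%classic) `*` `[- b, b]%classic : set (R * R * R).
have inA q : 0 <= q.1.1 -> 0 < doubled d k eta q -> A q.
  move=> q0' /lt_le_trans/(_ (bd _ q0')); case: q q0' => -[t s] z /= t0; rewrite subr_gt0 => h.
  have s1 : 0 <= (t - s) ^+ 2 / (4 * d) by rewrite divr_ge0 ?sqr_ge0// mulr_ge0// ltW.
  have s2 : 0 <= k * z ^+ 2 by rewrite mulr_ge0 ?sqr_ge0// ltW.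
  have s3 : 0 <= eta * t by rewrite mulr_ge0// ltW.
  have ta : t <= a.
    have : eta * t <= N by lra.
    by rewrite mulrC -ler_pdivlMr// => /le_trans; apply; rewrite lerDl.
  have sq_le x y : 0 <= y -> x ^+ 2 <= y -> `|x| <= y + 1 :> R.
    move=> y0; rewrite -(real_normK (num_real x)); move: `|x| (normr_ge0 x) => w w0 h'.
    by have := sqr_ge0 (w - 1); nra.
  have zb : `|z| <= b.
    have : k * z ^+ 2 <= N by lra.
    rewrite mulrC -ler_pdivlMr//; apply: sq_le; by rewrite divr_ge0// ltW.
  have sc : `|t - s| <= c.
    have : (t - s) ^+ 2 / (4 * d) <= N by lra.
    rewrite ler_pdivrMr ?mulr_gt0//; apply: sq_le; by rewrite mulr_ge0// mulr_ge0// ltW.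
  move: zb sc; rewrite !ler_norml => /andP[? ?] /andP[? ?].
  by split; [split|] => /=; rewrite in_itv/=; apply/andP; split; lra.
have cA : compact A.
  by apply: compact_setX; [apply: compact_setX|]; exact: segment_compact.
have [||q qA qmax] := compact_EVT_max (f := doubled d k eta) _ cA _.
- by exists q0; exact: inA.
- apply/subspace_continuousP => -[[t s] z] [[/= tA _] _].
  have t0 : 0 <= t by move: tA; rewrite in_itv/= => /andP[].
  have w (f : R * R * R -> R) x : {for x, continuous f} -> f @ within A (nbhs x) --> f x.
    by move=> cf; apply: cvg_trans cf; apply: cvg_app; exact: cvg_within.
  apply: cvgB.
    apply: cvgB.
      apply/cvgrPdist_le => e e0'.
      have := (subspace_continuousP _ _).1 uc (t, z) t0.
      move/cvgrPdist_le => /(_ _ e0')/nbhs_ballP[r /= r0 Hr].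
      rewrite /within/=; apply/nbhs_ballP; exists r => //= -[[t' s'] z'] [[/= tt _] zz] [[/= t'A _] _].
      apply: (Hr (t', z')) => //=.
      by move: t'A; rewrite in_itv/= => /andP[].
    have H : {for ((t, s, z) : R * R * R), continuous (fun q : R * R * R => v q.1.2 q.2)}.
      apply/cvgrPdist_le => e e0'; have := @vc (s, z).
      move/cvgrPdist_le => /(_ _ e0')/nbhs_ballP[r /= r0 Hr].
      suff : nbhs ((t, s, z) : R * R * R) [set q | `|v s z - v q.1.2 q.2| <= e] by [].
      apply/nbhs_ballP; exists r => //= -[[t' s'] z'] [[/= _ ss] zz].
      exact: (Hr (s', z')).
    exact: (w _ _ H).
  apply: w.
  have c1' : {for (t, s, z), continuous (fun q : R * R * R => q.1.1)}.
    by apply: (@continuous_comp _ _ _ (fun q : R * R * R => q.1) fst); [exact: cvg_fst|exact: cvg_fst].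
  have c2' : {for (t, s, z), continuous (fun q : R * R * R => q.1.2)}.
    by apply: (@continuous_comp _ _ _ (fun q : R * R * R => q.1) snd); [exact: cvg_fst|exact: cvg_snd].
  have c3' : {for (t, s, z), continuous (fun q : R * R * R => q.2)} by exact: cvg_snd.
  apply: cvgD; first (apply: cvgD).
  + apply: cvgM; last exact: cvg_cst.
    by apply: (@continuous_comp _ _ _ (fun q : R * R * R => q.1.1 - q.1.2) (fun x => x ^+ 2));
      [exact: cvgB|exact: exprn_continuous].
  + apply: cvgM; first exact: cvg_cst.
    by apply: (@continuous_comp _ _ _ (fun q : R * R * R => q.2) (fun x => x ^+ 2));
      [exact: c3'|exact: exprn_continuous].
  + by apply: cvgM; first exact: cvg_cst.
have /set_mem[[/= qA1 _] _] := qA.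
have q11 : 0 <= q.1.1 by move: qA1; rewrite in_itv/= => /andP[].
have qq : doubled d k eta q0 <= doubled d k eta q by apply: qmax; apply/mem_set; exact: inA.
exists q; split=> // q' q'0.
have [/(inA _ q'0) q'A|] := ltP 0 (doubled d k eta q'); first by apply: qmax; exact/mem_set.
by move=> /le_trans; apply; apply: ltW; exact: lt_le_trans qq.
Qed.

(** At a maximum of the doubled function the smooth spatial expansion of v, plus the penalties, is a
    jet of u from above, while moving the second time back by h bounds the left increment of v. The
    two inequalities contradict each other by a quarter of eta. *)
Lemma comparison t y : 0 <= t -> u t y <= v t y.
Proof.
move=> t0; rewrite leNgt; apply/negP => uv.
pose th := u t y - v t y; have th0 : 0 < th by rewrite subr_gt0.
(* The penalties in eta and k each cost at most [th / 4] at (t, y), so the maximum stays above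
   [th / 2]. The term [eta * t] supplies the strict gain in the equation, and k and e below are
   small enough relative to eta not to consume it. *)
pose eta := th / (4 * (t + 1)).
have t1 : 0 < t + 1 by rewrite ltr_wpDl.
have eta0 : 0 < eta by rewrite divr_gt0// mulr_gt0.
have etat : eta * t <= th / 4.
  by rewrite /eta mulrAC ler_pdivrMr ?mulr_gt0//; nra.
pose k := Num.min (th / (4 * (y ^+ 2 + 1))) (eta / (8 * (K0 + 1))).
have y1 : 0 < y ^+ 2 + 1 by rewrite ltr_wpDl// sqr_ge0.
have K1 : 0 < K0 + 1 by rewrite ltr_wpDl.
have k0 : 0 < k by rewrite lt_min !divr_gt0// mulr_gt0.
have ky : k * y ^+ 2 <= th / 4.
  apply: (@le_trans _ _ (th / (4 * (y ^+ 2 + 1)) * y ^+ 2)).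
    by rewrite ler_wpM2r ?sqr_ge0// ge_min lexx.
  by rewrite mulrAC ler_pdivrMr ?mulr_gt0//; nra.
have kK : K0 * (2 * k) <= eta / 4.
  apply: (@le_trans _ _ ((K0 + 1) * (2 * (eta / (8 * (K0 + 1)))))).
    apply: ler_pM => //; [by rewrite mulr_ge0// ltW|by rewrite lerDl|].
    by rewrite ler_pM2l// ge_min lexx orbT.
  by rewrite le_eqVlt; apply/orP; left; apply/eqP; field; rewrite gt_eqF.
pose e := eta / (8 * (K0 + 1)).
have e0 : 0 < e by rewrite divr_gt0// mulr_gt0.
have eK : K0 * e <= eta / 8.
  by rewrite /e mulrA ler_pdivrMr ?mulr_gt0//; nra.
(* Small enough that at time 0 the drift [K * |sb|] of v cannot beat the doubling penalty; the
   maximum is therefore at a positive time. *)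
pose d := th / (2 * (K ^+ 2 + 1)).
have Kq : 0 < K ^+ 2 + 1 by rewrite ltr_wpDl// sqr_ge0.
have d0 : 0 < d by rewrite divr_gt0// mulr_gt0.
have d20 : 0 < 2 * d by exact: mulr_gt0.
have dK : K ^+ 2 * d <= th / 2.
  by rewrite /d mulrA ler_pdivrMr ?mulr_gt0//; nra.
have pos : th / 2 <= doubled d k eta (t, t, y).
  by rewrite /doubled/= subrr expr0n/= mul0r add0r -/th; lra.
have [|[[tb sb] zb] [/= tb0 qq qmax]] := doubled_max (q0 := (t, t, y)) d0 k0 eta0 t0.
  by apply: lt_le_trans pos; rewrite divr_gt0.
have {}tb0 : 0 < tb.
  rewrite lt_neqAle tb0 andbT; apply/eqP => tbE.
  have := le_trans pos qq; rewrite /doubled/= -tbE sub0r sqrrN mulr0 addr0.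
  have h1 := uv0 zb; have h2 := v0 sb zb.
  have h3 : K * `|sb| <= sb ^+ 2 / (2 * d) + K ^+ 2 * d / 2.
    rewrite -(real_normK (num_real sb)); move: `|sb| => x.
    rewrite -(@ler_pM2r _ (2 * d))//.
    have -> : (x ^+ 2 / (2 * d) + K ^+ 2 * d / 2) * (2 * d) = x ^+ 2 + K ^+ 2 * d ^+ 2.
      by field; rewrite gt_eqF.
    by have := sqr_ge0 (x - K * d); lra.
  have h4 : 0 <= k * zb ^+ 2 by rewrite mulr_ge0 ?sqr_ge0// ltW.
  lra.
(* The slope in time comes from the doubling and eta; the second derivative gains 2k from the
   penalty in space and 2e from absorbing the cubic Taylor error near zb. *)
have jet : (tb - sb) / d + eta <= F (v2 sb zb + (2 * k + 2 * e)).
  apply: (uF (t := tb) (y := zb) (p := v1 sb zb + 2 * k * zb) (C := (2 * d)^-1)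
    (r := e / (`|C| + 1)) tb0).
    by rewrite divr_gt0// ltr_wpDl.
  move=> s z s0 _ zr; have := qmax (s, sb, z) (ltW s0); rewrite /doubled/=.
  have := vT sb zb (z - zb); rewrite (addrC zb) subrK.
  have := cube_small e0 zr.
  have -> : (s - sb) ^+ 2 / (2 * d) = (tb - sb) ^+ 2 / (2 * d) + (tb - sb) / d * (s - tb) + (2 * d)^-1 * (s - tb) ^+ 2.
    by field; rewrite gt_eqF.
  lra.
(* Only left increments of v in time are available, so the second time is moved back by h; the
   curvature [h / (2 * d)] of the doubling penalty is kept below [eta / 8]. *)
have [h0 h00 H] := vF sb zb (divr_gt0 eta0 (ltr0n R 8)).
pose h := Num.min (h0 / 2) (eta * d / 4).
have hp : 0 < h by rewrite lt_min !divr_gt0// mulr_gt0.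
have hh0 : h < h0 by rewrite gt_min; apply/orP; left; lra.
have hd : h / (2 * d) <= eta / 8.
  rewrite ler_pdivrMr//; apply: (@le_trans _ _ (eta * d / 4)).
    by rewrite ge_min lexx orbT.
  by rewrite le_eqVlt; apply/orP; left; apply/eqP; field.
have := H h; rewrite hp hh0 => /(_ isT) h1.
have := qmax (tb, sb - h, zb) (ltW tb0); rewrite /doubled/= => h2.
have h3 : h * (F (v2 sb zb) - eta / 8) <= h * ((tb - sb) / d + h / (2 * d)).
  apply: le_trans h1 _.
  have -> : h * ((tb - sb) / d + h / (2 * d)) = (tb - (sb - h)) ^+ 2 / (2 * d) - (tb - sb) ^+ 2 / (2 * d).
    by field; rewrite gt_eqF.
  lra.
rewrite ler_pM2l// in h3.
have h4 := FK (v2 sb zb) (addr_ge0 (mulr_ge0 (ler0n R 2) (ltW k0)) (mulr_ge0 (ler0n R 2) (ltW e0))).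
have h5 : F (v2 sb zb + (2 * k + 2 * e)) <= F (v2 sb zb) + eta / 2 by rewrite mulrDr in h4; lra.
lra.
Qed.

End Comparison.

(** * Comparison with a supersolution flow *)

Section Flow.
Variable R : realType.
Variables (F gT : R -> R) (K0 : R) (T : R -> (R -> R) -> R -> R) (u v v1 v2 : R -> R -> R) (M K2 C : R).
Hypotheses (K00 : 0 <= K0) (M0 : 0 <= M) (C0 : 0 <= C) (g0 : 0 <= gT 2).
Hypotheses (FK : forall a b : R, 0 <= b -> F (a + b) <= F a + K0 * b)
  (Fm : forall a b : R, a <= b -> F a <= F b) (Fg : forall a, F a <= gT a).
Hypotheses (sT : forall h : R, 0 <= h -> subl (T h)) (mT : forall h : R, 0 <= h -> mom gT h (T h)).
Hypotheses (uF : jetsub F u) (uM : forall t y : R, 0 <= t -> `|u t y| <= M)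
  (uc : {within [set p : R * R | 0 <= p.1], continuous (fun p : R * R => u p.1 p.2)}).
Hypotheses
  (vM : forall t y : R, 0 <= t -> `|v t y| <= M)
  (vflow : forall t h y : R, 0 <= t -> 0 <= h -> T h (v t) y <= v (t + h) y)
  (vmod : forall e : R, 0 < e -> exists2 r : R, 0 < r & forall t s y z,
     0 <= t -> 0 <= s -> `|t - s| < r -> `|y - z| < r -> `|v t y - v s z| <= e)
  (v2mod : forall y e : R, 0 < e -> exists2 r : R, 0 < r & forall t s,
     0 <= t -> 0 <= s -> `|t - s| < r -> `|v2 t y - v2 s y| <= e)
  (vT : forall t y x : R, 0 <= t ->
     `|v t (y + x) - (v t y + v1 t y * x + 2^-1 * v2 t y * x ^+ 2)| <= C * `|x| ^+ 3)
  (v2b : forall t y : R, 0 <= t -> `|v2 t y| <= K2).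
Hypothesis uv0 : forall y, u 0 y <= v 0 y.

Lemma flow_expand (t h d y : R) : 0 <= t -> 0 <= h -> 0 < d ->
  v t y + gT (v2 t y - 2 * C * d) * h - 3 * (C / d) * (gT 2 * h) ^+ 2 <= v (t + h) y.
Proof.
move=> t0 h0 d0; apply: le_trans (vflow y t0 h0).
have -> : v2 t y - 2 * C * d = 2 * (2^-1 * v2 t y - C * d) by field.
apply: (@expand_lo3 _ _ _ _ (sT h0) (mT h0) _ _ _ (v1 t y)) => //.
  by apply: gr_bd => x; exact: vM.
by move=> x; have := vT y x t0; rewrite ler_distl => /andP[+ _].
Qed.

Let K3_ge0 : 0 <= 3 * C * gT 2 ^+ 2.
Proof. by rewrite mulr_ge0 ?sqr_ge0// mulr_ge0. Qed.

Let M2_ge0 : 0 <= 2 * M. Proof. exact: mulr_ge0. Qed.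

(** Large enough for two purposes: v loses at most [K * s] between times 0 and s, and the extension
    of v to negative times with slope K in time is a supersolution there. *)
Let K := `|F (- K2 - 2 * C)| + 3 * C * gT 2 ^+ 2 + 2 * M + `|F K2|.

(** The doubled time of the comparison ranges over the whole line, so v is prolonged to negative
    times. *)
Let vx s z := v (Num.max s 0) z + K * Num.min s 0.

Let K_ge0 : 0 <= K.
Proof. by rewrite /K !addr_ge0. Qed.

Let flow_low s z : 0 <= s -> v 0 z - K * s <= v s z.
Proof.
move=> s0; have [s1|s1] := leP s 1.
  have := flow_expand z (lexx 0) s0 ltr01; rewrite add0r divr1 mulr1; apply: le_trans.
  have h1 : - `|F (- K2 - 2 * C)| <= gT (v2 0 z - 2 * C).
    apply: le_trans (Fg _); apply: (@le_trans _ _ (F (- K2 - 2 * C))).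
      by rewrite lerNl -normrN ler_norm.
    by apply: Fm; have := v2b z (lexx 0); rewrite ler_norml => /andP[]; lra.
  have h2 := ler_wpM2r s0 h1.
  have h3 : 3 * C * (gT 2 * s) ^+ 2 <= 3 * C * gT 2 ^+ 2 * s.
    by rewrite exprMn mulrA ler_wpM2l// expr2 ler_piMr.
  have h4 : 0 <= (2 * M + `|F K2|) * s by rewrite mulr_ge0// addr_ge0.
  rewrite /K; lra.
have := vM z s0; have := vM z (lexx 0); rewrite !ler_norml => /andP[_ a1] /andP[a2 _].
have : 2 * M * 1 <= 2 * M * s by rewrite ler_wpM2l ?mulr_ge0// ltW.
have : 0 <= (`|F (- K2 - 2 * C)| + 3 * C * gT 2 ^+ 2 + `|F K2|) * s.
  by rewrite mulr_ge0// !addr_ge0.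
rewrite /K; lra.
Qed.

Let vx_pos s z : 0 <= s -> vx s z = v s z.
Proof. by move=> s0; rewrite /vx (max_l s0) (min_r s0) mulr0 addr0. Qed.

Let vx_neg s z : s <= 0 -> vx s z = v 0 z + K * s.
Proof. by move=> s0; rewrite /vx (max_r s0) (min_l s0). Qed.

Let vx_cont : continuous (fun p : R * R => vx p.1 p.2).
Proof.
move=> [s z]; apply: cvgD; last first.
  apply: cvgM; first exact: cvg_cst.
  apply: (@continuous_comp _ _ _ (fun p : R * R => p.1) (fun x : R => Num.min x 0)); first exact: cvg_fst.
  by apply: continuous_min; [exact: cvg_id|exact: cvg_cst].
apply/cvgrPdist_le => e e0; have [r r0 H] := vmod e0.
suff : nbhs ((s, z) : R * R) [set q | `|v (Num.max s 0) z - v (Num.max q.1 0) q.2| <= e] by [].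
apply/nbhs_ballP; exists r => //= -[s' z'] [/= ss zz]; apply: H => //; try by rewrite le_max lexx orbT.
apply: le_lt_trans ss; have [h1|h1] := leP s 0; have [h2|h2] := leP s' 0.
- by rewrite subrr normr0.
- by rewrite sub0r normrN (gtr0_norm h2) distrC; apply: le_trans (ler_norm _); rewrite lerBrDr gerDl.
- by rewrite subr0 (gtr0_norm h1); apply: le_trans (ler_norm _); rewrite lerBrDr gerDl.
- by [].
Qed.

Lemma comparison_flow t y : 0 <= t -> u t y <= v t y.
Proof.
move=> t0; rewrite -vx_pos//.
have mx s : 0 <= Num.max s 0 :> R by rewrite le_max lexx orbT.
apply: (@comparison _ F K0 u vx (fun s => v1 (Num.max s 0)) (fun s => v2 (Num.max s 0)) M K C) => //.
- move=> s z t' t'0; have [s0|/ltW s0] := leP 0 s.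
    rewrite vx_pos//; have := vM z s0; rewrite ler_norml => /andP[+ _].
    by have := mulr_ge0 K_ge0 (normr_ge0 (t' - s)); lra.
  rewrite vx_neg//; have := vM z (lexx 0); rewrite ler_norml => /andP[+ _].
  have h : - s <= `|t' - s| by apply: le_trans (ler_norm _); rewrite lerDr.
  by have := ler_wpM2l K_ge0 h; lra.
- move=> s z; rewrite (vx_pos _ (lexx 0)); have [s0|/ltW s0] := leP 0 s.
    by rewrite vx_pos// ger0_norm// flow_low.
  by rewrite vx_neg// ler0_norm// mulrN opprK.
- move=> s z x; have := vT z x (mx s); rewrite ler_distl => /andP[_]; rewrite /vx; lra.
- move=> s z e e0; have [s0|s0] := ltP 0 s; last first.
    exists 1 => // h /andP[h0 _]; rewrite !vx_neg// ?(max_r s0); last by lra.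
    have -> : v 0 z + K * s - (v 0 z + K * (s - h)) = h * K by ring.
    rewrite ler_pM2l//; apply: (@le_trans _ _ (F K2)).
      have : F (v2 0 z) <= F K2 by apply: Fm; have := v2b z (lexx 0); rewrite ler_norml => /andP[].
      lra.
    rewrite /K; apply: le_trans (ler_norm _) _; by rewrite lerDr !addr_ge0.
  have C1 : 0 < C + 1 by rewrite ltr_wpDl.
  have K1 : 0 < K0 + 1 by rewrite ltr_wpDl.
  (* The cubic error is traded with this parameter: [K0 * (2 * C * D)] and the variation of the
     second derivative in time each use at most [e / 4], and [e / 4] remains for the term of order
     [h ^+ 2]. *)
  pose D := e / (8 * (C + 1) * (K0 + 1)).
  have D0 : 0 < D by rewrite divr_gt0// !mulr_gt0.
  have dl0 : 0 < e / (4 * (K0 + 1)) by rewrite divr_gt0// mulr_gt0.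
  have [r r0 Hr] := v2mod z dl0.
  pose B := 3 * (C / D) * gT 2 ^+ 2 + 1.
  have B0 : 0 < B by rewrite ltr_wpDl// mulr_ge0 ?sqr_ge0// mulr_ge0// divr_ge0// ltW.
  exists (Num.min s (Num.min r (e / 4 / B))); first by rewrite !lt_min s0 r0 !divr_gt0.
  move=> h; rewrite !lt_min => /andP[h0 /and3P[hs hr hB]].
  have sh0 : 0 <= s - h by rewrite subr_ge0 ltW.
  rewrite (vx_pos _ (ltW s0)) (vx_pos _ sh0) ?(max_l (ltW s0)).
  have := flow_expand z sh0 (ltW h0) D0; rewrite subrK => fe.
  have v2d : `|v2 s z - v2 (s - h) z| <= e / (4 * (K0 + 1)).
    by apply: Hr => //; [exact: ltW|rewrite opprB addrC subrK gtr0_norm].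
  have bpos : 0 <= e / (4 * (K0 + 1)) + 2 * C * D.
    by rewrite addr_ge0 ?(ltW dl0)// mulr_ge0 ?(ltW D0)// mulr_ge0.
  have f1 : F (v2 s z) <= F (v2 (s - h) z - 2 * C * D) + K0 * (e / (4 * (K0 + 1)) + 2 * C * D).
    apply: le_trans (FK _ bpos); apply: Fm.
    by move: v2d; rewrite ler_distl => /andP[_]; lra.
  have f2 : K0 * (e / (4 * (K0 + 1)) + 2 * C * D) <= e / 2.
    apply: (@le_trans _ _ ((K0 + 1) * (e / (4 * (K0 + 1)) + 2 * (C + 1) * D))).
      apply: ler_pM => //; first by rewrite lerDl.
      by rewrite lerD2l ler_wpM2r ?(ltW D0)// ler_pM2l// lerDl.
    by rewrite le_eqVlt; apply/orP; left; apply/eqP; rewrite /D; field; rewrite !gt_eqF.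
  have f3 := le_trans f1 (lerD (Fg _) f2).
  have f4 : 3 * (C / D) * (gT 2 * h) ^+ 2 <= h * (e / 4).
    have hB' : B * h <= e / 4 by rewrite mulrC -ler_pdivlMr// ltW.
    have -> : 3 * (C / D) * (gT 2 * h) ^+ 2 = h * (B * h - h) by rewrite /B; ring.
    by rewrite ler_pM2l//; lra.
  by have := ler_wpM2l (ltW h0) f3; have := mulr_gt0 h0 e0; lra.
- by move=> z; rewrite vx_pos.
Qed.

End Flow.

(** * Functions averaged twice *)

Section Smoothing.
Variable R : realType.
Variable e : R.
Hypothesis e0 : 0 < e.
Variables (f : R -> R) (L : R).
Hypotheses (L0 : 0 <= L) (fL : lip L f).

(** Two averages turn a Lipschitz function into one with a Lipschitz second derivative; [smooth1]
    and [smooth2] are its derivatives as explicit difference quotients. *)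
Definition smooth (h : R) (f : R -> R) : R -> R := steklov h (steklov h f).
Definition smooth1 (h : R) (f : R -> R) (y : R) : R := (steklov h f (y + h) - steklov h f y) / h.
Definition smooth2 (h : R) (f : R -> R) (y : R) : R :=
  ((f (y + h + h) - f (y + h)) / h - (f (y + h) - f y) / h) / h.

Lemma smooth_lip : lip L (smooth e f).
Proof. by apply: steklov_lip => //; exact: steklov_lip. Qed.

Lemma smooth_near y : `|smooth e f y - f y| <= 2 * L * e.
Proof.
have h1 := steklov_near e0 L0 fL y; have h2 := steklov_near e0 L0 (steklov_lip e0 L0 fL) y.
apply: le_trans (ler_distD (steklov e f y) _ _) _; rewrite /smooth.
by rewrite -mulrA mulr2n mulrDl mul1r lerD.
Qed.

Lemma smooth_bd M y : (forall x, `|f x| <= M) -> `|smooth e f y| <= M.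
Proof.
move=> fM; apply: (steklov_bd e0 L0 (steklov_lip e0 L0 fL)) => x.
exact: (steklov_bd e0 L0 fL).
Qed.

Lemma diffquot_le y : `|(f (y + e) - f y) / e| <= L.
Proof.
rewrite normrM (@ger0_norm _ e^-1) ?invr_ge0 ?(ltW e0)// ler_pdivrMr//.
by apply: le_trans (fL _ _) _; rewrite addrAC subrr add0r gtr0_norm.
Qed.

Lemma smooth2_bd y : `|smooth2 e f y| <= 2 * L / e.
Proof.
rewrite /smooth2 normrM (@ger0_norm _ e^-1) ?invr_ge0 ?(ltW e0)// ler_pM2r ?invr_gt0//.
apply: le_trans (ler_normB _ _) _.
have := diffquot_le (y + e); have := diffquot_le y; lra.
Qed.

Lemma smooth2_lip : lip (4 * L / e ^+ 2) (smooth2 e f).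
Proof.
move=> x y.
have -> : smooth2 e f x - smooth2 e f y = ((f (x + e + e) - f (y + e + e)) - (f (x + e) - f (y + e))
   - (f (x + e) - f (y + e)) + (f x - f y)) / e ^+ 2 by rewrite /smooth2; field; rewrite gt_eqF.
rewrite normrM (@ger0_norm _ (e ^+ 2)^-1) ?invr_ge0 ?sqr_ge0// mulrAC ler_pM2r ?invr_gt0 ?exprn_gt0//.
have h1 := fL (x + e + e) (y + e + e); have h2 := fL (x + e) (y + e); have h3 := fL x y.
have E1 : x + e + e - (y + e + e) = x - y by ring.
have E2 : x + e - (y + e) = x - y by ring.
rewrite E1 in h1; rewrite E2 in h2.
apply: le_trans (ler_normD _ _) _; apply: le_trans (lerD (ler_normB _ _) (lexx _)) _.
apply: le_trans (lerD (lerD (ler_normB _ _) (lexx _)) (lexx _)) _; lra.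
Qed.

Lemma smooth_taylor y x :
  `|smooth e f (y + x) - (smooth e f y + smooth1 e f y * x + 2^-1 * smooth2 e f y * x ^+ 2)|
    <= 8 * L / e ^+ 2 * `|x| ^+ 3.
Proof.
have [->|x0] := eqVneq x 0.
  by rewrite addr0 expr0n/= !mulr0 !addr0 subrr normr0 expr0n/= mulr0.
have cf := lip_continuous L0 fL.
have cs := lip_continuous L0 (steklov_lip e0 L0 fL).
have d1 z : isD (smooth e f) z (smooth1 e f z) by exact: steklov_isD.
have d2 z : isD (smooth1 e f) z (smooth2 e f z).
  by apply: isD_diffquot; exact: steklov_isD.
have xp : 0 < `|x| by rewrite normr_gt0.
have := @taylor2 _ _ _ _ y (2 * `|x|) (4 * L / e ^+ 2 * (2 * `|x|)) (smooth2 e f y) d1 d2 _ x.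
move=> /(_ _ _)/le_trans; apply.
- move=> z zy; apply: le_trans (smooth2_lip _ _) _.
  by rewrite ler_wpM2l ?(ltW zy)// divr_ge0 ?sqr_ge0// mulr_ge0.
- by rewrite mulr2n mulrDl mul1r ltrDl.
- rewrite -(real_normK (num_real x)) le_eqVlt; apply/orP; left; apply/eqP.
  by field; rewrite gt_eqF.
Qed.

(** Averaging in space keeps the supersolution property of a sublinear flow: this is how a merely
    Lipschitz semigroup yields a smooth competitor in the comparison. *)
Lemma smooth_jensen T y : subl T -> T (smooth e f) y <= smooth e (T f) y.
Proof.
move=> sT; apply: le_trans (steklov_jensen e0 L0 (steklov_lip e0 L0 fL) y sT) _.
apply: (@steklov_mono _ _ e0 L _ L0 _ L) => //.
- by apply: (sl_lip sT); exact: steklov_lip.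
- by apply: steklov_lip => //; exact: (sl_lip sT).
- by move=> x; exact: (steklov_jensen e0 L0 fL x sT).
Qed.

End Smoothing.

(** * Upper bound of a solution by the semigroup *)

Section Uniqueness.
Variables (R : realType) (sl sb : R).
Hypotheses (sl0 : 0 <= sl) (slb : sl <= sb).

Lemma lip_shift (L c : R) f : lip L f -> lip L (fun x => f x + c).
Proof. by move=> fL x y; rewrite opprD addrACA subrr addr0. Qed.

Lemma steklov_dist (e L L' c : R) f g y : 0 < e -> 0 <= L -> 0 <= L' -> lip L f -> lip L' g ->
  (forall x, `|f x - g x| <= c) -> `|steklov e f y - steklov e g y| <= c.
Proof.
move=> e0 L0 L'0 fL gL fg.
have cL : lip 0 (fun=> c) by move=> a b; rewrite subrr normr0 mul0r.
have cE z : steklov e (fun=> c) z = c.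
  by have := steklov_near e0 (lexx 0) cL z; rewrite mul0r normr_le0 subr_eq0 => /eqP.
have key (h k : R -> R) (A D : R) : 0 <= A -> 0 <= D -> lip A h -> lip D k ->
    (forall x, `|h x - k x| <= c) -> steklov e h y <= steklov e k y + c.
  move=> A0 D0 hA kD hk; rewrite -[X in _ + X](cE y) -(steklovD e0 D0 kD _ (lexx 0) cL).
  apply: (steklov_mono e0 A0 hA (L' := D)) => //; first exact: lip_shift.
  by move=> x; have := hk x; rewrite ler_distl => /andP[_]; rewrite addrC.
have h1 := key f g L L' L0 L'0 fL gL fg.
have h2 : steklov e g y <= steklov e f y + c.
  by apply: (key g f L' L) => // x; rewrite distrC.
by rewrite ler_distl lerBlDr h1 h2.
Qed.

Lemma jetsub_shift F (u : R -> R -> R) a : 0 <= a -> jetsub F u -> jetsub F (fun t => u (a + t)).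
Proof.
move=> a0 H t y b p X C r t0 r0 K; apply: (H (a + t) y b p X C (Num.min r t)).
- by rewrite ltr_wpDl.
- by rewrite lt_min r0.
move=> s z s0; rewrite !lt_min => /andP[sr st] /andP[zr _]; have := K (s - a) z.
rewrite (addrC a (s - a)) subrK (_ : s - a - t = s - (a + t)); last by ring.
apply=> //.
by move: st; rewrite ltr_norml => /andP[]; lra.
Qed.

Section Fixed.
Variables (u : R -> R -> R) (phi : R -> R) (L M : R).
Hypotheses (phiL : lip L phi) (L0 : 0 <= L) (phiM : forall y, `|phi y| <= M).
Hypothesis uS : viscosity_solution sl sb phi u.

(** The flow averaged in space is a smooth supersolution by Jensen's inequality, so it dominates u;
    letting the averaging length go to 0 removes the average. *)
Lemma solution_le_nis t y : 0 <= t -> u t y <= nis sl sb t phi y.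
Proof.
move=> t0; have [u0 uc [N uN] usub _] := uS; apply/ler_addgt0Pr => d d0.
have M0 : 0 <= M by exact: le_trans (phiM 0).
have N0 : 0 <= N by exact: le_trans (uN 0 0 (lexx 0)).
pose e := d / (4 * (L + 1)).
have L1 : 0 < L + 1 by rewrite ltr_wpDl.
have e0 : 0 < e by rewrite divr_gt0// mulr_gt0.
have Le : 4 * L * e <= d by rewrite /e mulrA ler_pdivrMr ?mulr_gt0//; nra.
(* Averaging twice moves an L-Lipschitz function by at most [2 * L * e]; raising the data by this
   amount restores the order at time 0. *)
pose psi x := phi x + 2 * L * e.
have Le0 : 0 <= 2 * L * e by rewrite mulr_ge0 ?(ltW e0)// mulr_ge0.
have psiL : lip L psi by exact: lip_shift.
have psiM x : `|psi x| <= M + 2 * L * e.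
  by apply: le_trans (ler_normD _ _) _; rewrite (ger0_norm Le0) lerD2r.
pose S s := nis sl sb s psi.
have SL s : 0 <= s -> lip L (S s) by move=> s0; exact: (nis_lip sl0 slb psiL).
have : u t y <= smooth e (S t) y.
  apply: (@comparison_flow _ (G sl sb) (G sl sb) (sb ^+ 2) (nis sl sb) u (fun s => smooth e (S s))
    (fun s => smooth1 e (S s)) (fun s => smooth2 e (S s)) (M + 2 * L * e + N) (2 * L / e) (8 * L / e ^+ 2)) => //.
  - exact: sqr_ge0.
  - by rewrite !addr_ge0.
  - by rewrite divr_ge0 ?sqr_ge0// mulr_ge0.
  - by move=> a b; exact: G_add.
  - by move=> a b; exact: G_mono.
  - by move=> h; exact: nis_subl.
  - by move=> h; exact: nis_mom.
  - exact: (viscosity_sub_jet uN).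
  - by move=> s x s0; apply: le_trans (uN s x s0) _; rewrite lerDr addr_ge0.
  - move=> s x s0; apply: (@le_trans _ _ (M + 2 * L * e)); last by rewrite lerDl.
    by apply: (smooth_bd e0 L0 (SL _ s0)) => z; exact: (nis_bd sl0 slb psiM).
  - move=> s h x s0 h0; apply: le_trans (smooth_jensen e0 L0 (SL _ s0) x (nis_subl sl0 slb h0)) _.
    rewrite le_eqVlt; apply/orP; left; apply/eqP; congr (smooth e _ x); apply/funext => z.
    by rewrite /S -(nis_step sl0 slb psiL L0).
  - move=> r r0; have r20 : 0 < r / 2 by rewrite divr_gt0.
    have [q q0 Hq] := nis_modulus sl0 slb psiL L0 r20.
    exists (Num.min q (r / 2 / (L + 1))); first by rewrite lt_min q0 divr_gt0.
    move=> a b x z a0 b0; rewrite !lt_min => /andP[ab _] /andP[_ xz].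
    apply: le_trans (ler_distD (smooth e (S b) x) _ _) _.
    have h1 : `|smooth e (S a) x - smooth e (S b) x| <= r / 2.
      apply: (steklov_dist _ e0 L0 L0); try by apply: steklov_lip => //; exact: SL.
      move=> w; apply: (steklov_dist _ e0 L0 L0); try exact: SL.
      by move=> w'; apply: Hq => //; rewrite subrr normr0.
    have h2 := smooth_lip e0 L0 (SL _ b0) x z.
    move: xz; rewrite ltr_pdivlMr// => xz; have := normr_ge0 (x - z); lra.
  - move=> x r r0; pose c := r * e ^+ 2 / 4.
    have c0 : 0 < c by rewrite divr_gt0// mulr_gt0// exprn_gt0.
    have [q q0 Hq] := nis_modulus sl0 slb psiL L0 c0.
    exists q => // a b a0 b0 ab.
    have H z : `|S a z - S b z| <= c by apply: Hq => //; rewrite subrr normr0.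
    have -> : smooth2 e (S a) x - smooth2 e (S b) x = ((S a (x + e + e) - S b (x + e + e))
      - (S a (x + e) - S b (x + e)) - (S a (x + e) - S b (x + e)) + (S a x - S b x)) / e ^+ 2.
      by rewrite /smooth2; field; rewrite gt_eqF.
    rewrite normrM (@ger0_norm _ (e ^+ 2)^-1) ?invr_ge0 ?sqr_ge0// ler_pdivrMr ?exprn_gt0//.
    have h1 := H (x + e + e); have h2 := H (x + e); have h3 := H x.
    apply: le_trans (ler_normD _ _) _; apply: le_trans (lerD (ler_normB _ _) (lexx _)) _.
    apply: le_trans (lerD (lerD (ler_normB _ _) (lexx _)) (lexx _)) _.
    by rewrite /c in h1 h2 h3; lra.
  - by move=> s x z s0; exact: (smooth_taylor e0 L0 (SL _ s0)).
  - by move=> s x s0; exact: (smooth2_bd e0 (SL _ s0)).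
  - move=> z; rewrite u0; have := smooth_near e0 L0 (SL _ (lexx 0)) z.
    by rewrite {2}/S (nis0 _ _ _ psiL L0) ler_distl /psi => /andP[]; lra.
have := smooth_near e0 L0 (SL _ t0) y; rewrite ler_distl => /andP[_].
have -> : S t y = nis sl sb t phi y + 2 * L * e.
  by rewrite /S /psi (sl_shift (nis_subl sl0 slb t0))//; exact: gr_lip phiL.
lra.
Qed.

End Fixed.
End Uniqueness.

Section HeatFlow.
Variables (R : realType) (sg : R).

Lemma heat0 f y : heat sg 0 f y = f y.
Proof.
rewrite /heat /sem /stepop /steps -[RHS]ulim_cst; congr ulim.
by apply/funext => n; rewrite mul0r truncn0.
Qed.

Lemma heat_taylor (t C : R) f f1 f2 : 0 <= t -> gr f -> gr f1 -> gr f2 ->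
  (forall y x, `|f (y + x) - (f y + f1 y * x + 2^-1 * f2 y * x ^+ 2)| <= C * `|x| ^+ 3) ->
  forall y x, `|heat sg t f (y + x) - (heat sg t f y + heat sg t f1 y * x +
     2^-1 * heat sg t f2 y * x ^+ 2)| <= C * `|x| ^+ 3.
Proof.
move=> t0 gf g1 g2 H y x; have sT := heat_subl sg t0.
have hZ (a : R) h : gr h -> heat sg t (fun z => a * h z) y = a * heat sg t h y.
  move=> gh; have [a0|a0] := leP 0 a; first exact: (sl_hom sT).
  rewrite -[a]opprK mulNr -(sl_hom sT) ?oppr_ge0 ?ltW// -(heatN sg y t0); last exact: grZ.
  by congr (heat _ _ _ y); apply/funext => z; rewrite !mulNr opprK.
have -> : heat sg t f (y + x) = heat sg t (fun z => f (z + x)) y by rewrite (sl_tr sT).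
have g3 : gr (fun z => x * f1 z + 2^-1 * x ^+ 2 * f2 z) by apply: grD; exact: grZ.
have g4 : gr (fun z => f z + (x * f1 z + 2^-1 * x ^+ 2 * f2 z)) by exact: grD.
have -> : heat sg t f y + heat sg t f1 y * x + 2^-1 * heat sg t f2 y * x ^+ 2 =
   heat sg t (fun z => f z + (x * f1 z + 2^-1 * x ^+ 2 * f2 z)) y.
  rewrite (heatD sg y t0 gf g3) (heatD sg y t0 (grZ _ g1) (grZ _ g2)) !hZ//; ring.
rewrite -[X in _ <= X](sl_cst sT _ y); apply: sl_dist => //.
- exact: gr_tr.
- exact: gr_cst.
- move=> z; have := H z x; rewrite [x * _]mulrC [2^-1 * x ^+ 2 * _]mulrAC addrA; exact.
Qed.

Lemma heat_modulus f (L e : R) : lip L f -> 0 <= L -> 0 < e -> exists2 r : R, 0 < r &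
  forall t s y z, 0 <= t -> 0 <= s -> `|t - s| < r -> `|y - z| < r ->
   `|heat sg t f y - heat sg s f z| <= e.
Proof.
move=> fL L0 e0; have := @semi_modulus _ (heat sg) (linG sg) (linG0 sg)
  (@heat_subl _ sg) (@heat_mom _ sg) (@heat_semigroup _ sg) f L fL L0 e e0.
exact.
Qed.

End HeatFlow.

(** * Lower bound and identification of [Gheat] *)

Section LowerBound.
Variables (R : realType) (sl sb : R).
Hypotheses (sl0 : 0 <= sl) (slb : sl <= sb).

Let F (X : R) := - G sl sb (- X).

(** The comparison is applied to [- U] and to minus a heat flow. The heat flow is linear, so it
    commutes with Taylor expansion and smoothing the initial value once is enough; the shift by
    [2 * L * e] goes downwards here. *)
Lemma heat_le_super sg (U : R -> R -> R) (f : R -> R) (L M N h y : R) :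
  (forall a, linG sg a <= G sl sb a) ->
  jetsub F (fun t x => - U t x) -> (forall t x : R, 0 <= t -> `|U t x| <= N) ->
  {within [set p : R * R | 0 <= p.1], continuous (fun p : R * R => U p.1 p.2)} ->
  0 <= L -> lip L f -> (forall x, `|f x| <= M) -> (forall x, f x <= U 0 x) ->
  0 <= h -> heat sg h f y <= U h y.
Proof.
move=> sgG Uj UN Uc L0 fL fM fU h0; apply/ler_addgt0Pr => d d0.
have M0 : 0 <= M by exact: le_trans (fM 0).
have N0 : 0 <= N by exact: le_trans (UN 0 0 (lexx 0)).
pose e := d / (4 * (L + 1)).
have L1 : 0 < L + 1 by rewrite ltr_wpDl.
have e0 : 0 < e by rewrite divr_gt0// mulr_gt0.
have Le : 4 * L * e <= d by rewrite /e mulrA ler_pdivrMr ?mulr_gt0//; nra.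
have Le0 : 0 <= 2 * L * e by rewrite mulr_ge0 ?(ltW e0)// mulr_ge0.
pose psi x := f x + - (2 * L * e).
have psiL : lip L psi by exact: lip_shift.
have psiM x : `|psi x| <= M + 2 * L * e.
  by apply: le_trans (ler_normD _ _) _; rewrite normrN (ger0_norm Le0) lerD2r.
pose P := smooth e psi.
have PL : lip L P by exact: (smooth_lip e0 L0 psiL).
have PM x : `|P x| <= M + 2 * L * e by exact: (smooth_bd e0 L0 psiL _ psiM).
have gP : gr P by exact: gr_lip PL.
have gP1 : gr (smooth1 e psi).
  by apply: (@gr_bd _ _ L) => x; apply: (diffquot_le e0); exact: steklov_lip.
have P2b x : `|smooth2 e psi x| <= 2 * L / e by exact: (smooth2_bd e0 psiL).
have gP2 : gr (smooth2 e psi) by exact: gr_bd P2b.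
have P2L : lip (4 * L / e ^+ 2) (smooth2 e psi) by exact: (smooth2_lip e0 psiL).
have L20 : 0 <= 4 * L / e ^+ 2 by rewrite divr_ge0 ?sqr_ge0// mulr_ge0.
have FE a : F a <= linG sg a.
  by rewrite /F lerNl; apply: le_trans (sgG _); rewrite /linG mulrN.
have : - U h y <= - heat sg h P y.
  apply: (@comparison_flow _ F (linG sg) (sb ^+ 2) (heat sg) (fun t x => - U t x)
    (fun s x => - heat sg s P x) (fun s x => - heat sg s (smooth1 e psi) x)
    (fun s x => - heat sg s (smooth2 e psi) x) (M + 2 * L * e + N) (2 * L / e) (8 * L / e ^+ 2)) => //.
  - exact: sqr_ge0.
  - by rewrite !addr_ge0.
  - by rewrite divr_ge0 ?sqr_ge0// mulr_ge0.
  - move=> a b b0; rewrite /F; have := G_add sl0 slb (- a - b) b0; rewrite subrK opprD; lra.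
  - by move=> a b ab; rewrite /F lerN2; apply: G_mono; rewrite // lerN2.
  - by move=> t; exact: heat_subl.
  - by move=> t; exact: heat_mom.
  - by move=> s x s0; rewrite normrN; apply: le_trans (UN s x s0) _; rewrite lerDr addr_ge0.
  - by move=> p; apply: cvgN; exact: Uc.
  - move=> s x s0; rewrite normrN; apply: (@le_trans _ _ (M + 2 * L * e)); last by rewrite lerDl.
    exact: (sl_bd (heat_subl sg s0)).
  - move=> s t x s0 t0; rewrite (heatN sg x t0); last by apply: (sl_gr (heat_subl sg s0)).
    by rewrite (addrC s t) (heat_semigroup sg _ t0 s0 PL L0).
  - move=> r r0; have [q q0 Hq] := heat_modulus sg PL L0 r0; exists q => // a b x z a0 b0 ab xz.
    by rewrite -opprD normrN; exact: Hq.
  - move=> x r r0; have [q q0 Hq] := heat_modulus sg P2L L20 r0; exists q => // a b a0 b0 ab.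
    by rewrite -opprD normrN; apply: Hq => //; rewrite subrr normr0.
  - move=> s x z s0.
    have := heat_taylor sg s0 gP gP1 gP2 (smooth_taylor e0 L0 psiL) x z.
    rewrite -normrN; congr (`|_| <= _); ring.
  - by move=> s x s0; rewrite normrN; exact: (sl_bd (heat_subl sg s0)).
  - move=> x; rewrite lerN2 heat0; apply: le_trans (fU x).
    by have := smooth_near e0 L0 psiL x; rewrite -/P ler_distl /psi => /andP[]; lra.
rewrite lerN2 => hP; have sT := heat_subl sg h0.
have : heat sg h f y <= heat sg h P y + 4 * L * e.
  apply: (sl_le_shift sT) => //; first exact: gr_lip fL.
  by move=> x; have := smooth_near e0 L0 psiL x; rewrite -/P ler_distl /psi => /andP[]; lra.
lra.
Qed.

Lemma within_shift (u : R -> R -> R) a : 0 <= a ->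
  {within [set p : R * R | 0 <= p.1], continuous (fun p : R * R => u p.1 p.2)} ->
  {within [set p : R * R | 0 <= p.1], continuous (fun p : R * R => u (a + p.1) p.2)}.
Proof.
move=> a0 /subspace_continuousP uc; apply/subspace_continuousP => -[t y] /= t0.
apply/cvgrPdist_le => e e0.
have at0 : 0 <= a + t by exact: addr_ge0.
have := uc (a + t, y) at0; move/cvgrPdist_le => /(_ _ e0)/nbhs_ballP[r /= r0 Hr].
rewrite /within/=; apply/nbhs_ballP; exists r => //= -[s z] [/= ts yz] s0.
apply: (Hr (a + s, z)); last by rewrite /= addr_ge0.
by split=> //=; rewrite /ball/= opprD addrACA subrr add0r.
Qed.

Section Fixed.
Variables (u : R -> R -> R) (phi : R -> R) (L M : R).
Hypotheses (phiL : lip L phi) (L0 : 0 <= L) (phiM : forall y, `|phi y| <= M).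
Hypothesis uS : viscosity_solution sl sb phi u.

(** Induction over the steps of the scheme: the equation restarted at a grid time dominates either
    heat flow over the next step, hence their maximum [Gop]. Continuity of u then allows the limit
    along the grids. *)
Lemma nis_le_solution t y : 0 <= t -> nis sl sb t phi y <= u t y.
Proof.
move=> t0; have [u0 uc [N uN] _ usup] := uS.
have uj := viscosity_super_jet uN usup.
have step n k z : iter k (Gop sl sb n) phi z <= u (k%:R * n.+1%:R^-1) z.
  elim: k z => [|k IH] z; first by rewrite mul0r u0.
  have a0 : 0 <= k%:R * n.+1%:R^-1 :> R by exact: mulr_ge0.
  have n0 : 0 <= n.+1%:R^-1 :> R by [].
  have kE : k.+1%:R * n.+1%:R^-1 = k%:R * n.+1%:R^-1 + n.+1%:R^-1 :> R by rewrite -natr1 mulrDl mul1r.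
  have sI := iter_subl k (Gop_subl sl sb n).
  rewrite iterS kE {1}/Gop ge_max.
  have cmp sg : (forall a, linG sg a <= G sl sb a) ->
      heat sg n.+1%:R^-1 (iter k (Gop sl sb n) phi) z <= u (k%:R * n.+1%:R^-1 + n.+1%:R^-1) z.
    move=> Hsg; apply: (@heat_le_super sg (fun t => u (k%:R * n.+1%:R^-1 + t)) _ L M N) => //.
    - exact: (jetsub_shift a0 uj).
    - by move=> s x s0; apply: uN; exact: addr_ge0.
    - exact: within_shift.
    - exact: (sl_lip sI).
    - by move=> x; exact: (sl_bd sI).
    - by move=> x; rewrite addr0.
  by rewrite !cmp// => a; rewrite -(G_max sl0 slb) le_max lexx ?orbT.
have gphi := gr_lip phiL.
rewrite -(@cvg_ulim _ (fun n => u ((steps n t)%:R * n.+1%:R^-1) y) (u t y)).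
  apply: ulim_le.
  - by apply: (ubd_stepop (G20 sl0 slb)) => // n; [exact: Gop_subl|exact: Gop_mom].
  - by exists N => n; apply: uN; exact: steps_ge0.
  - by move=> n; exact: step.
apply/cvgrPdist_le => e e0.
have := (subspace_continuousP _ _).1 uc (t, y) t0.
move/cvgrPdist_le => /(_ _ e0)/nbhs_ballP[r /= r0 Hr].
have /cvgrPdist_lt/(_ _ r0) := cvg_steps t0; apply: filterS => n tn.
apply: (Hr ((steps n t)%:R * n.+1%:R^-1, y)); last exact: steps_ge0.
by split=> //=; exact: ballxx.
Qed.

End Fixed.

Lemma Gheat_nis (phi : R -> R) (L M t y : R) : lip L phi -> 0 <= L -> (forall x, `|phi x| <= M) ->
  0 <= t -> Gheat sl sb phi t y = nis sl sb t phi y.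
Proof.
move=> phiL L0 phiM t0; have ex := nis_viscosity sl0 slb phiL L0 phiM.
have H : viscosity_solution sl sb phi (Gheat sl sb phi).
  by apply: (@xgetPex _ _ [set u : R -> R -> R | viscosity_solution sl sb phi u]); exists (nis sl sb ^~ phi).
apply/le_anti/andP; split; first exact: (solution_le_nis sl0 slb phiL L0 phiM H).
exact: (nis_le_solution phiL L0 phiM H).
Qed.

End LowerBound.

(** * Conditional expectations of cylinder functionals *)

Section Paths.
Variable R : realType.
Local Notation Om := (Omega R).
Implicit Types (w : Om) (a t s y : R).

Lemma path_C0 w : C0 (fun s => B s w).
Proof. exact: set_mem (valP (w : pathspace R)). Qed.

Lemma path_cont w : continuous (fun s => B s w).
Proof. exact: (path_C0 w).1. Qed.

Lemma path_le0 w s : s <= 0 -> B s w = 0.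
Proof. exact: (path_C0 w).2. Qed.

Lemma path_ext w w' : (forall s, B s w = B s w') -> w = w'.
Proof. by move=> H; apply: val_inj; apply/funext. Qed.

Definition mkpath (f : R -> R) : Om :=
  if pselect (C0 (f : {family compact, R -> R})) is left h then SigSub (mem_set h) : pathspace R
  else SigSub (mem_set (@C0_0 R)) : pathspace R.

Lemma B_mkpath (f : R -> R) s : continuous f -> (forall t, t <= 0 -> f t = 0) -> B s (mkpath f) = f s.
Proof.
move=> cf f0; rewrite /mkpath; case: pselect => [h|[]]; first by [].
by split.
Qed.

Lemma B_stop a s w : B s (stop a w) = B (Num.min s a) w.
Proof. by []. Qed.

Definition ramp a t s : R := Num.max 0 (Num.min 1 ((s - a) / (t - a))).

(** The path frozen at time a that gains y on [a, t]: the variables of the recursion are stored in a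
    genuine path. For [a = t] the ramp divides by 0 and y is lost. *)
Definition bump a t y w : Om := mkpath (fun s => B (Num.min s a) w + y * ramp a t s).

Lemma ramp01 a t s : 0 <= ramp a t s <= 1.
Proof. by rewrite /ramp le_max lexx/= ge_max ler01 ge_min lexx. Qed.

Lemma ramp_le a t s : a <= t -> s <= a -> ramp a t s = 0.
Proof.
move=> at_ sa; rewrite /ramp; apply: max_l; rewrite ge_min; apply/orP; right.
by rewrite mulr_le0_ge0 ?invr_ge0 ?subr_ge0 ?subr_le0.
Qed.

Lemma ramp_ge a t s : a < t -> t <= s -> ramp a t s = 1.
Proof.
move=> at_ ts; rewrite /ramp min_l; first by apply: max_r.
by rewrite ler_pdivlMr ?subr_gt0// mul1r lerD2r.
Qed.

Lemma ramp_cont a t : continuous (ramp a t).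
Proof.
have c1 (s : R) : {for s, continuous (fun s : R => (s - a) / (t - a))}.
  by apply: cvgM; [apply: cvgB; [exact: cvg_id|exact: cvg_cst]|exact: cvg_cst].
have c2 (s : R) : {for s, continuous (fun s : R => Num.min 1 ((s - a) / (t - a)))}.
  by apply: (@continuous_min _ _ (fun=> 1) (fun s => (s - a) / (t - a)) s); [exact: cvg_cst|exact: c1].
move=> s; apply: (@continuous_max _ _ (fun=> 0) (fun s => Num.min 1 ((s - a) / (t - a))) s); [exact: cvg_cst|exact: c2].
Qed.

Lemma B_bump a t y w s : 0 <= a -> a <= t ->
  B s (bump a t y w) = B (Num.min s a) w + y * ramp a t s.
Proof.
move=> a0 at_; rewrite /bump B_mkpath// => [|r r0].
  move=> s'; apply: cvgD.
    apply: (@continuous_comp _ _ _ (fun s => Num.min s a) (fun s => B s w)); last exact: path_cont.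
    by apply: continuous_min; [exact: cvg_id|exact: cvg_cst].
  apply: cvgM; first exact: cvg_cst.
  exact: ramp_cont.
rewrite ramp_le// ?(le_trans r0)// mulr0 addr0; apply: path_le0.
by rewrite ge_min r0.
Qed.

Lemma B_bump_le a t y w s : 0 <= a -> a <= t -> s <= a -> B s (bump a t y w) = B s w.
Proof. by move=> a0 at_ sa; rewrite B_bump// ramp_le// mulr0 addr0 min_l. Qed.

Lemma B_bump_ge a t y w s : 0 <= a -> a < t -> t <= s -> B s (bump a t y w) = B a w + y.
Proof.
move=> a0 at_ ts; rewrite B_bump ?(ltW at_)// ramp_ge// mulr1 min_r//.
by rewrite (le_trans (ltW at_)).
Qed.

Definition close (D : seq R) (d : R) w w' := forall s, s \in D -> `|B s w - B s w'| <= d.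

(** Bounded Lipschitz cylinder functionals without coordinates: D is any list of times containing
    those at which X looks, so that several functionals can share it. *)
Definition SL (D : seq R) (K M : R) (X : Om -> R) :=
  [/\ 0 <= K, 0 <= M, forall w, `|X w| <= M &
      forall w w' d, 0 <= d -> close D d w w' -> `|X w - X w'| <= K * d].

Lemma SL_dep D K M X w w' : SL D K M X -> (forall s, s \in D -> B s w = B s w') -> X w = X w'.
Proof.
move=> [_ _ _ H] E; have := H w w' 0 (lexx 0); rewrite mulr0 normr_le0 subr_eq0 => h.
by apply/eqP; apply: h => s sD; rewrite E// subrr normr0.
Qed.

Lemma SL_sub D D' K K' M M' X : {subset D <= D'} -> K <= K' -> M <= M' -> SL D K M X -> SL D' K' M' X.
Proof.
move=> DD KK MM [K0 M0 XM XK]; split.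
- exact: le_trans KK.
- exact: le_trans MM.
- by move=> w; apply: le_trans MM.
- move=> w w' d d0 cl; apply: (@le_trans _ _ (K * d)); last by rewrite ler_wpM2r.
  by apply: XK => // s sD; apply: cl; exact: DD.
Qed.

End Paths.

(** * The backward recursion on paths *)

Section Phi.
Variables (R : realType) (sl sb : R).
Hypotheses (sl0 : 0 <= sl) (slb : sl <= sb).
Local Notation Om := (Omega R).
Implicit Types (w : Om) (a t s y : R) (D us : seq R).

(** The recursion defining the conditional expectation, run on paths instead of vectors of
    increments. Its value turns out to depend on X alone and not on the list us that covers its
    times, which makes different representations of X comparable. *)
Fixpoint Phi us a (X : Om -> R) w : R :=
  if us is t :: us' then nis sl sb (t - a) (fun y => Phi us' t X (bump a t y w)) 0
  else X (stop a w).

Definition covers D us a := forall s, s \in D -> a < s -> s \in us.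

(** For [d = 0] the functions may differ away from 0, which is what happens to a bumped path over an
    empty interval; the flow over time 0 looks only at 0. *)
Lemma nis_eq0 (d : R) (f g : R -> R) (L L' : R) : 0 <= d -> lip L f -> 0 <= L -> lip L' g -> 0 <= L' ->
  f 0 = g 0 -> (0 < d -> forall y, f y = g y) -> nis sl sb d f 0 = nis sl sb d g 0.
Proof.
move=> d0 fL L0 gL L'0 fg0 fg; have [dp|dn] := ltP 0 d.
  by congr (nis _ _ _ _ 0); apply/funext => y; exact: fg.
have -> : d = 0 by apply/le_anti; rewrite dn.
by rewrite (nis0 _ _ _ fL)// (nis0 _ _ _ gL).
Qed.

(** The constant K is kept through the recursion because a changed increment y shifts all later
    values of the path by the same amount, which is counted once. *)
Lemma Phi_lip D K M X us a w w' d : SL D K M X -> 0 <= a -> path <=%R a us -> covers D us a ->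
  0 <= d -> (forall s, s \in D -> s <= a -> `|B s w - B s w'| <= d) -> `|B a w - B a w'| <= d ->
  `|Phi us a X w - Phi us a X w'| <= K * d.
Proof.
move=> SX; elim: us a w w' d => [|t us IH] a w w' d a0 /= pth cov d0 Hs Ha.
  have [_ _ _ XK] := SX; apply: XK => // s sD; rewrite !B_stop.
  have [sa|/(cov _ sD)//] := leP s a; exact: Hs.
move: pth => /andP[at_ pth].
have t0 : 0 <= t by exact: le_trans at_.
have covt : covers D us t.
  move=> s sD ts; have := cov s sD (le_lt_trans at_ ts); rewrite inE => /orP[/eqP E|//].
  by rewrite E ltxx in ts.
have key y y' v v' e : 0 <= e -> (forall s, s \in D -> s <= a -> `|B s v - B s v'| <= e) ->
    `|B a v - B a v'| <= e ->
    `|Phi us t X (bump a t y v) - Phi us t X (bump a t y' v')| <= K * (e + `|y - y'|).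
  move=> e0 hs ha; apply: IH => //; first exact: addr_ge0.
    move=> s sD st; have [sa|sa] := leP s a.
      by rewrite !B_bump_le//; apply: le_trans (hs s sD sa) _; rewrite lerDl.
    have sE : s = t.
      have := cov s sD sa; rewrite inE => /orP[/eqP//|su].
      have /allP/(_ _ su) := order_path_min le_trans pth.
      by move=> ts; apply/le_anti; rewrite st ts.
    rewrite sE in sa *; rewrite !B_bump_ge//.
    rewrite (_ : _ - _ = (B a v - B a v') + (y - y')); last by ring.
    by apply: le_trans (ler_normD _ _) _; rewrite lerD2r.
  rewrite !B_bump// (min_r at_).
  rewrite (_ : _ - _ = (B a v - B a v') + (y - y') * ramp a t t); last by ring.
  apply: le_trans (ler_normD _ _) _; apply: lerD => //.
  by rewrite normrM ler_piMr// ger0_norm; have /andP[] := ramp01 a t t.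
have [K0 _ _ _] := SX.
have Lp v : lip K (fun y => Phi us t X (bump a t y v)).
  move=> y y'; have := key y y' v v 0 (lexx 0); rewrite add0r; apply.
    by move=> s _ _; rewrite subrr normr0.
  by rewrite subrr normr0.
have ta : 0 <= t - a by rewrite subr_ge0.
have sT := nis_subl sl0 slb ta.
rewrite -[leRHS](sl_cst sT _ 0); apply: (sl_dist sT); try exact: gr_cst; try exact: (gr_lip (Lp _)).
by move=> y; have := key y y w w' d d0 Hs Ha; rewrite subrr normr0 addr0.
Qed.

Section OneFunctional.
Variables (D : seq R) (K M : R) (X : Om -> R).
Hypothesis SX : SL D K M X.

Lemma covers_cons t us a : a <= t -> covers D (t :: us) a -> covers D us t.
Proof.
move=> at_ cov s sD ts; have := cov s sD (le_lt_trans at_ ts); rewrite inE => /orP[/eqP E|//].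
by rewrite E ltxx in ts.
Qed.

Lemma Phi_bump_lip us t a w : 0 <= a -> a <= t -> path <=%R t us -> covers D (t :: us) a ->
  lip K (fun y => Phi us t X (bump a t y w)).
Proof.
move=> a0 at_ pth cov y y'; have t0 := le_trans a0 at_.
have dist s : `|B s (bump a t y w) - B s (bump a t y' w)| <= `|y - y'|.
  rewrite !B_bump// (_ : _ - _ = (y - y') * ramp a t s); last by ring.
  by rewrite normrM ler_piMr// ger0_norm; have /andP[] := ramp01 a t s.
apply: (Phi_lip SX) => //.
exact: (covers_cons at_ cov).
Qed.

Lemma Phi_agree us a w w' : 0 <= a -> path <=%R a us -> covers D us a ->
  (forall s, s \in D -> s <= a -> B s w = B s w') -> B a w = B a w' -> Phi us a X w = Phi us a X w'.
Proof.
move=> a0 pth cov Hs Ha; apply/eqP; rewrite -subr_eq0 -normr_le0.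
have := @Phi_lip D K M X us a w w' 0 SX a0 pth cov (lexx 0); rewrite mulr0; apply.
  by move=> s sD sa; rewrite Hs// subrr normr0.
by rewrite Ha subrr normr0.
Qed.

Lemma Phi_bd us a w : path <=%R a us -> 0 <= a -> covers D us a -> `|Phi us a X w| <= M.
Proof.
have [_ _ XM _] := SX.
elim: us a w => [|t us IH] a w /=; first by move=> *; exact: XM.
move=> /andP[at_ pth] a0 cov; have ta : 0 <= t - a by rewrite subr_ge0.
apply: (sl_bd (nis_subl sl0 slb ta)) => y; apply: IH => //; first exact: le_trans at_.
exact: covers_cons cov.
Qed.

(* A time [s] at which [X] does not look can be inserted: this is the
   semigroup property [S_(t-a) = S_(s-a) S_(t-s)]. *)
Lemma Phi_insert s us a w : 0 <= a -> a <= s -> path <=%R s us -> covers D us a ->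
  Phi (s :: us) a X w = Phi us a X w.
Proof.
move=> a0 as_ pth cov; have [K0 _ _ _] := SX.
have s0 := le_trans a0 as_; have sa : 0 <= s - a by rewrite subr_ge0.
have sT := nis_subl sl0 slb sa.
case: us pth cov => [|t us] /= pth cov.
  have -> : (fun y => X (stop s (bump a s y w))) = fun=> X (stop a w).
    apply/funext => y; apply: (SL_dep SX) => r rD; rewrite !B_stop.
    have [ra|/(cov _ rD)//] := leP r a.
    by rewrite (min_l (le_trans ra as_)) B_bump_le.
  exact: (sl_cst sT).
move: pth => /andP[st pth]; have at_ := le_trans as_ st; have t0 := le_trans s0 st.
have ts : 0 <= t - s by rewrite subr_ge0.
pose g y := Phi us t X (bump a t y w).
have covt := covers_cons at_ cov.
have gL : lip K g by exact: Phi_bump_lip.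
have cov1 : covers D (t :: us) s.
  by move=> r rD sr; apply: cov => //; exact: le_lt_trans sr.
have hL v : lip K (fun z => Phi us t X (bump s t z v)) by exact: Phi_bump_lip.
have gap r : r \in D -> a < r -> t <= r.
  move=> rD ar; have := cov r rD ar; rewrite inE => /orP[/eqP ->//|ru].
  by have /allP/(_ _ ru) := order_path_min le_trans pth.
have inner y : a < s \/ y = 0 ->
  nis sl sb (t - s) (fun z => Phi us t X (bump s t z (bump a s y w))) 0 = nis sl sb (t - s) g y.
  move=> yc; rewrite (sl_at (nis_subl sl0 slb ts) y (gr_lip gL)).
  have gyL : lip K (fun z => g (y + z)).
    by move=> z z'; apply: le_trans (gL _ _) _; rewrite opprD addrACA subrr add0r.
  have E z : (s < t \/ z = 0) -> Phi us t X (bump s t z (bump a s y w)) = g (y + z).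
    move=> zc; rewrite /g; apply: Phi_agree => //.
      move=> r rD rt; have [ra|/(gap r rD) tr] := leP r a.
        by rewrite B_bump_le// ?(le_trans ra)// !B_bump_le.
      have -> : r = t by apply/le_anti; rewrite rt tr.
      rewrite !B_bump// (min_r st) (min_r at_) (min_r as_).
      case: zc => [st'|->]; case: yc => [as'|->]; rewrite ?(add0r, addr0, mul0r).
      - by rewrite !ramp_ge// ?(lt_trans as')//; lra.
      - have [ts'|] := ltP a s.
          by rewrite !ramp_ge// ?(lt_trans ts').
        by move=> sa'; rewrite !ramp_ge//; lra.
      - by rewrite !ramp_ge//; lra.
      - by [].
    rewrite !B_bump// (min_r st) (min_r at_) (min_r as_).
    case: zc => [st'|->]; case: yc => [as'|->]; rewrite ?(add0r, addr0, mul0r).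
    - by rewrite !ramp_ge// ?(lt_trans as')//; lra.
    - by rewrite !ramp_ge//; lra.
    - by rewrite !ramp_ge//; lra.
    - by [].
  apply: (nis_eq0 ts (hL _) K0 gyL K0); first by apply: E; right.
  by move=> tsp z; apply: E; left; rewrite -subr_gt0.
have -> : t - a = (s - a) + (t - s) by ring.
rewrite (nis_semigroup sl0 slb 0 sa ts gL K0).
apply: (@nis_eq0 _ _ _ K K) => //.
- move=> y y'; have := Phi_bump_lip (us := t :: us) (t := s) w a0 as_ _ _ y y'; apply => /=; first by rewrite st.
  by move=> r rD ar; rewrite inE; apply/orP; right; exact: cov.
- exact: (sl_lip (nis_subl sl0 slb ts)).
- by apply: inner; right.
- by move=> sap y; apply: inner; left; rewrite -subr_gt0.
Qed.

(** Induction on the total length. The smaller of two different heads is a time that the other list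
    does not contain, so X does not look there and [Phi_insert] removes it; equal heads are
    processed together. *)
Lemma Phi_indep us vs a w : 0 <= a -> path <=%R a us -> path <=%R a vs ->
  covers D us a -> covers D vs a -> Phi us a X w = Phi vs a X w.
Proof.
have [n] := ubnP (size us + size vs); elim: n us vs a w => // n IH us vs a w.
have drop_head s us' vs' : 0 <= a -> path <=%R a (s :: us') -> path <=%R a vs' ->
    covers D (s :: us') a -> covers D vs' a -> (forall v, v \in vs' -> s < v) ->
    path <=%R a us' /\ covers D us' a /\ Phi (s :: us') a X w = Phi us' a X w.
  move=> a0 /= /andP[as_ pu] pv cu cv sv.
  have cov : covers D us' a.
    move=> r rD ar; have := cu r rD ar; rewrite inE => /orP[/eqP E|//].
    by have := sv r (cv r rD ar); rewrite E ltxx.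
  split; first by case: us' pu {cu cov} => //= t us' /andP[/(le_trans as_) -> ->].
  by split=> //; exact: Phi_insert.
have lt_head s (t : R) vs' : s < t -> path <=%R t vs' -> forall v, v \in t :: vs' -> s < v.
  move=> st pv v; rewrite inE => /orP[/eqP ->//|vv].
  by have /allP/(_ _ vv) := order_path_min le_trans pv; exact: lt_le_trans.
case: us vs => [|s us] [|t vs] //= sz a0 pu pv cu cv.
- have [//|p1 [c1 E]] := drop_head t vs [::] a0 pv pu cv cu _.
  by rewrite -[RHS]/(Phi (t :: vs) a X w) E -[LHS]/(Phi [::] a X w); apply: IH.
- have [//|p1 [c1 E]] := drop_head s us [::] a0 pu pv cu cv _.
  by rewrite -[LHS]/(Phi (s :: us) a X w) E -[RHS]/(Phi [::] a X w); apply: IH.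
have /andP[as_ pus] := pu; have /andP[at_ pvt] := pv.
have [st|ts|E] := ltgtP s t.
- have [p1 [c1 E]] := drop_head s us (t :: vs) a0 pu pv cu cv (lt_head _ _ _ st pvt).
  rewrite -[LHS]/(Phi (s :: us) a X w) E -[RHS]/(Phi (t :: vs) a X w); apply: IH => //.
- have [p1 [c1 E]] := drop_head t vs (s :: us) a0 pv pu cv cu (lt_head _ _ _ ts pus).
  rewrite -[RHS]/(Phi (t :: vs) a X w) E -[LHS]/(Phi (s :: us) a X w); apply: IH => //.
  by move: sz; rewrite /= addnS.
subst t; congr (nis _ _ _ _ 0); apply/funext => y; apply: IH => //.
- by move: sz; rewrite addSn addnS ltnS => /ltnW.
- exact: le_trans as_.
- exact: covers_cons cu.
- exact: covers_cons cv.
Qed.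

End OneFunctional.
End Phi.

(** * Bounded Lipschitz functions and cylinder functionals *)

Section BoundedLipschitz.
Variable R : realType.

Lemma bounded_lipschitzP n (phi : 'rV[R]_n -> R) : bounded_lipschitz phi <->
  exists K M, [/\ 0 <= K, forall x, `|phi x| <= M & forall x y, `|phi x - phi y| <= K * `|x - y|].
Proof.
split=> [[[M [_ Mb]] [K [_ Kb]]]|[K [M [K0 Mb Kb]]]].
  exists (`|K| + 1), (M + 1); split=> [|x|x y].
  - by rewrite addr_ge0.
  - by apply: Mb; rewrite ?ltrDl.
  - have : K < `|K| + 1 by rewrite (le_lt_trans (ler_norm _))// ltrDl.
    by move=> /Kb /(_ (x, y)); apply; split.
split.
  by exists M; split; rewrite ?num_real// => N MN x _; exact: le_trans (ltW MN).
exists K; split; rewrite ?num_real// => N KN [x y] _ /=.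
by apply: le_trans (Kb x y) _; rewrite ler_wpM2r// ltW.
Qed.

Lemma row_norm_le n (x : 'rV[R]_n) (d : R) : 0 <= d -> (forall i, `|x 0 i| <= d) -> `|x| <= d.
Proof.
move=> d0 H; rewrite [`|x|]mx_normrE; apply: bigmax_le => // -[i j] _ /=.
by rewrite (ord1 i).
Qed.

Lemma row_norm_ge n (x : 'rV[R]_n) i : `|x 0 i| <= `|x|.
Proof. by rewrite [leRHS]mx_normrE; apply: (le_bigmax _ (fun ij => `|x ij.1 ij.2|) (0, i)). Qed.

(** The McShane inf-convolution, clipped at M, extends X from the range of r to all vectors, as the
    definitions of [Lip] and [cond_Lip] require a function on the whole space. *)
Lemma McShane (T : Type) n (r : T -> 'rV[R]_n) (X : T -> R) (w0 : T) (K M : R) : 0 <= K ->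
  (forall w, `|X w| <= M) -> (forall w w', `|X w - X w'| <= K * `|r w - r w'|) ->
  exists2 phi, bounded_lipschitz phi & forall w, X w = phi (r w).
Proof.
move=> K0 XM XK; have M0 : 0 <= M by exact: le_trans (XM w0).
pose A x := [set Num.min M (X w + K * `|x - r w|) | w in [set: T]].
have Alb x : lbound (A x) (- M).
  move=> _ [w _ <-]; rewrite le_min; apply/andP; split; first lra.
  by have := XM w; rewrite ler_norml => /andP[h _]; rewrite (le_trans h)// lerDl mulr_ge0.
have Ai x : has_inf (A x) by split; [exists (Num.min M (X w0 + K * `|x - r w0|)), w0|exists (- M)].
have Ale x w : inf (A x) <= X w + K * `|x - r w|.
  apply: (@le_trans _ _ (Num.min M (X w + K * `|x - r w|))).
    by apply: ge_inf; [exact: (Ai x).2|exists w].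
  by rewrite ge_min lexx orbT.
exists (fun x => inf (A x)).
  apply/bounded_lipschitzP; exists K, M; split=> // [x|x y].
    rewrite ler_norml; apply/andP; split; first exact: (lb_le_inf (Ai x).1 (@Alb x)).
    apply: (@le_trans _ _ (Num.min M (X w0 + K * `|x - r w0|))); last by rewrite ge_min lexx.
    by apply: ge_inf; [exact: (Ai x).2|exists w0].
  have key u v : inf (A u) <= inf (A v) + K * `|u - v|.
    rewrite -lerBlDr; apply: lb_le_inf; first exact: (Ai v).1.
    move=> _ [w _ <-]; rewrite lerBlDr.
    apply: (@le_trans _ _ (Num.min M (X w + K * `|u - r w|))).
      by apply: ge_inf; [exact: (Ai u).2|exists w].
    have h : K * `|u - r w| <= K * `|v - r w| + K * `|u - v|.
      by rewrite -mulrDr ler_wpM2l// [leRHS]addrC ler_distD.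
    have h2 : 0 <= K * `|u - v| by rewrite mulr_ge0.
    rewrite addr_minl le_min !ge_min; apply/andP; split; apply/orP; [left|right]; lra.
  by rewrite ler_distl lerBlDr key/= [X in K * X]distrC key.
move=> w; apply/le_anti/andP; split; last first.
  by have := Ale (r w) w; rewrite subrr normr0 mulr0 addr0.
apply: lb_le_inf; first exact: (Ai _).1.
move=> _ [w' _ <-]; rewrite le_min; apply/andP; split.
  by have := XM w; rewrite ler_norml => /andP[].
by have := XK w w'; rewrite ler_distl => /andP[_].
Qed.

End BoundedLipschitz.

Section CylinderLip.
Variable R : realType.
Local Notation Om := (Omega R).
Implicit Types (w : Om) (a t s y : R) (D us ts : seq R) (X Y Z : Om -> R).

Definition inc (D : seq R) (h : \bar R) := forall s, s \in D -> 0 <= s /\ (s%:E <= h)%E.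

Lemma Lip_SL h X : Lip h X -> exists D K M, inc D h /\ SL D K M X.
Proof.
move=> [n [ts [phi [tsh /bounded_lipschitzP[K [M [K0 pM pK]]] ->]]]].
exists (map ts (enum 'I_n.+1)), K, M; split=> [s /mapP[i _ ->]//|]; split=> //.
  exact: le_trans (pM 0).
move=> w w' d d0 cl; apply: le_trans (pK _ _) _; rewrite ler_wpM2l//.
by apply: row_norm_le => // i; rewrite !mxE; apply: cl; apply: map_f; rewrite mem_enum.
Qed.

Lemma SL_Lip h D K M X : (0 <= h)%E -> inc D h -> SL D K M X -> Lip h X.
Proof.
move=> h0 Dh [K0 M0 XM XK].
pose ts (i : 'I_(size D).+1) := (0 :: D)`_i.
have tsD i : ts i \in 0 :: D by rewrite /ts; apply: mem_nth; exact: ltn_ord.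
have [|phi bphi E] := @McShane R Om _ (fun w => \row_i B (ts i) w) X point K M K0 XM.
  move=> w w'; apply: XK => // s sD; have := sD; rewrite -index_mem => iD.
  have := row_norm_ge (\row_i B (ts i) w - \row_i B (ts i) w') (lift ord0 (Ordinal iD)).
  by rewrite !mxE /ts /= nth_index.
exists (size D), ts, phi; split=> //; last exact/funext.
move=> i; have := tsD i; rewrite inE => /orP[/eqP ->|/Dh//]; by split.
Qed.

Lemma increments_cat us vs w : increments (us ++ vs) w =
  increments us w ++ pairmap (fun r s => B s w - B r w) (last 0 us) vs.
Proof. exact: pairmap_cat. Qed.

Lemma pairmap_B_agree us a w w' : B a w = B a w' -> (forall s, s \in us -> B s w = B s w') ->
  pairmap (fun r s => B s w - B r w) a us = pairmap (fun r s => B s w' - B r w') a us.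
Proof.
elim: us a => //= s us IH a Ha H; rewrite Ha (H s) ?mem_head//; congr (_ :: _).
by apply: IH; [apply: H; exact: mem_head|move=> r ru; apply: H; rewrite inE ru orbT].
Qed.

Lemma B0 w : B 0 w = 0. Proof. exact: path_le0. Qed.

Lemma increments_agree us w w' : (forall s, s \in us -> B s w = B s w') ->
  increments us w = increments us w'.
Proof. by move=> H; apply: pairmap_B_agree => //; rewrite !B0. Qed.

Lemma pairmap_B_close us a w w' d i : `|B a w - B a w'| <= d -> close us d w w' -> 0 <= d ->
  `|(pairmap (fun r s => B s w - B r w) a us)`_i - (pairmap (fun r s => B s w' - B r w') a us)`_i|
    <= 2 * d.
Proof.
move=> Ha cl d0; elim: us a i Ha cl => [|s us IH] a [|i] Ha cl /=;
  try by rewrite ?nth_nil subrr normr0 mulr_ge0.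
  have := cl s (mem_head _ _) => hs.
  rewrite (_ : _ - _ = (B s w - B s w') - (B a w - B a w')); last by ring.
  by apply: le_trans (ler_normB _ _) _; lra.
apply: IH; first exact: cl (mem_head _ _).
by move=> r ru; apply: cl; rewrite inE ru orbT.
Qed.

Lemma close_of_increments us a w w' (d c : R) : 0 <= d -> `|B a w - B a w'| <= c ->
  (forall i, (i < size us)%N ->
    `|(pairmap (fun r s => B s w - B r w) a us)`_i - (pairmap (fun r s => B s w' - B r w') a us)`_i| <= d) ->
  forall s, s \in us -> `|B s w - B s w'| <= c + (size us)%:R * d.
Proof.
move=> d0; elim: us a c => //= t us IH a c Ha H s.
have h0 : `|B t w - B t w'| <= c + d.
  have := H 0%N isT => /= h.
  rewrite (_ : _ - _ = (B t w - B a w - (B t w' - B a w')) + (B a w - B a w')); last by ring.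
  by apply: le_trans (ler_normD _ _) _; lra.
have E : c + (size us).+1%:R * d = c + d + (size us)%:R * d by rewrite -natr1; ring.
rewrite inE E => /orP[/eqP ->|su]; first by apply: le_trans h0 _; rewrite lerDl mulr_ge0.
by apply: (IH t (c + d)) => // i iu; exact: (H i.+1).
Qed.

End CylinderLip.

Section PhiTheory.
Variables (R : realType) (sl sb : R).
Hypotheses (sl0 : 0 <= sl) (slb : sl <= sb).
Local Notation Om := (Omega R).
Local Notation Phi := (Phi sl sb).
Implicit Types (w : Om) (a t s y : R) (D us ts : seq R) (X Y Z : Om -> R).

Definition agree a w w' := forall s, s <= a -> B s w = B s w'.

Lemma agree_trans a t w w' w'' : a <= t -> agree a w w' -> agree t w' w'' -> agree a w w''.
Proof. by move=> at_ h1 h2 s sa; rewrite h1// h2// (le_trans sa). Qed.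

Lemma agree_bump a t y w : 0 <= a -> a <= t -> agree a w (bump a t y w).
Proof. by move=> a0 at_ s sa; rewrite B_bump_le. Qed.

(** The hypothesis concerns only paths that agree with w up to a; hence quantities known at time a
    may appear as the constants c1, c2 and k. *)
Lemma Phi_le_add D K M X X1 X2 (c1 c2 k : R) us a w :
  SL D K M X -> SL D K M X1 -> SL D K M X2 -> 0 <= c1 -> 0 <= c2 ->
  0 <= a -> path <=%R a us -> covers D us a ->
  (forall w', agree a w w' -> X w' <= c1 * X1 w' + c2 * X2 w' + k) ->
  Phi us a X w <= c1 * Phi us a X1 w + c2 * Phi us a X2 w + k.
Proof.
move=> S0 S1 S2 c10 c20; elim: us a w => [|t us IH] a w a0 /=.
  by move=> _ _; apply => s sa; rewrite B_stop min_l.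
move=> /andP[at_ pth] cov H; have t0 := le_trans a0 at_.
have ta : 0 <= t - a by rewrite subr_ge0.
have sT := nis_subl sl0 slb ta.
have cov' := covers_cons at_ cov.
have gr0 Z : SL D K M Z -> gr (fun y => Phi us t Z (bump a t y w)).
  by move=> SZ; apply: (@gr_lip _ K); exact: (Phi_bump_lip sl0 slb SZ).
pose f1 y := c1 * Phi us t X1 (bump a t y w); pose f2 y := c2 * Phi us t X2 (bump a t y w).
have g1 : gr f1 by apply: grZ; exact: gr0.
have g2 : gr f2 by apply: grZ; exact: gr0.
have : nis sl sb (t - a) (fun y => Phi us t X (bump a t y w)) 0 <=
       nis sl sb (t - a) f1 0 + nis sl sb (t - a) (fun y => f2 y + k) 0.
  apply: (sl_le_add sT) => //; [exact: gr0|by apply: grD => //; exact: gr_cst|].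
  move=> y; rewrite addrA; apply: IH => // w' ag; apply: H.
  exact: (agree_trans at_ (agree_bump y w a0 at_) ag).
rewrite (sl_shift sT)// (sl_hom sT)//; last exact: gr0.
by rewrite (sl_hom sT) ?addrA//; exact: gr0.
Qed.

Lemma SL_cst D (c : R) : SL D 0 `|c| (fun=> c).
Proof. by split=> // w w' d d0 _; rewrite subrr normr0 mul0r. Qed.

Lemma Phi_cat D K M X us vs a w : SL D K M X -> 0 <= a -> path <=%R a (us ++ vs) ->
  covers D (us ++ vs) a -> Phi (us ++ vs) a X w = Phi us a (Phi vs (last a us) X) w.
Proof.
move=> SX; elim: us a w => [|t us IH] a w a0 /= pth cov.
  apply: (Phi_agree sl0 slb SX) => //; last by rewrite B_stop minxx.
  by move=> s sD sa; rewrite B_stop min_l.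
have /andP[at_ pth'] := pth.
congr (nis _ _ _ _ 0); apply/funext => y; apply: IH => //; first exact: le_trans at_.
exact: covers_cons cov.
Qed.

Lemma SL_Phi D K M X us a : SL D K M X -> 0 <= a -> path <=%R a us -> covers D us a ->
  SL (a :: [seq s <- D | s <= a]) K M (Phi us a X).
Proof.
move=> SX a0 pth cov; have [K0 M0 _ _] := SX; split=> // [w|w w' d d0 cl].
  exact: (Phi_bd sl0 slb SX).
apply: (Phi_lip sl0 slb SX) => // [s sD sa|]; apply: cl; last exact: mem_head.
by rewrite inE mem_filter sa sD orbT.
Qed.

Definition slipF (K M : R) (F : seq R -> R) := [/\ 0 <= K, forall xs, `|F xs| <= M &
  forall xs xs' d, 0 <= d -> (forall i, `|xs`_i - xs'`_i| <= d) -> `|F xs - F xs'| <= K * d].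

Lemma slipF_cons K M F y : slipF K M F -> slipF K M (fun xs => F (y :: xs)).
Proof.
move=> [K0 FM FK]; split=> // xs xs' d d0 H; apply: FK => // -[|i] //=.
by rewrite subrr normr0.
Qed.

Lemma Gvalue_lip K M ds F : all (>= 0) ds -> slipF K M F -> `|Gvalue sl sb ds F| <= M /\
  forall F' c, slipF K M F' -> (forall xs, `|F xs - F' xs| <= c) ->
    `|Gvalue sl sb ds F - Gvalue sl sb ds F'| <= c.
Proof.
elim: ds F => [|d ds IH] F /=; first by move=> _ [K0 FM FK]; split=> // F' c _; apply.
move=> /andP[d0 ds0] SF.
have lp F0 : slipF K M F0 -> lip K (fun y => Gvalue sl sb ds (fun xs => F0 (y :: xs))).
  move=> SF0 y y'; have [_ ] := IH _ ds0 (slipF_cons y SF0); apply; first exact: slipF_cons.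
  move=> xs; have [_ _ FK] := SF0; apply: FK => // -[|i] //=.
  by rewrite subrr normr0.
have bd F0 : slipF K M F0 -> forall y, `|Gvalue sl sb ds (fun xs => F0 (y :: xs))| <= M.
  by move=> SF0 y; have [] := IH _ ds0 (slipF_cons y SF0).
have [K0 _ _] := SF.
have sT := nis_subl sl0 slb d0.
have E F0 : slipF K M F0 -> Gheat sl sb (fun y => Gvalue sl sb ds (fun xs => F0 (y :: xs))) d 0 =
    nis sl sb d (fun y => Gvalue sl sb ds (fun xs => F0 (y :: xs))) 0.
  by move=> SF0; apply: (Gheat_nis sl0 slb 0 (lp _ SF0) K0 (bd _ SF0)).
rewrite E//; split; first by apply: (sl_bd sT); exact: bd.
move=> F' c SF' FF'; rewrite E//.
rewrite -(sl_cst sT c 0); apply: (sl_dist sT); try exact: gr_cst; try exact: (gr_lip (lp _ _)).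
move=> y; have [_ ] := IH _ ds0 (slipF_cons y SF); apply; first exact: slipF_cons.
by move=> xs.
Qed.

(** Links the recursion of the definition, over increments, with the one over paths; the latter
    inherits the viscosity solution through [Gheat_nis]. Repeated times are covered by [nis_eq0]. *)
Lemma Gvalue_Phi K M F us ts w : slipF K M F -> path <=%R 0 (us ++ ts) ->
  Gvalue sl sb (pairmap (fun r s => s - r) (last 0 us) ts) (fun xs => F (increments us w ++ xs)) =
  Phi ts (last 0 us) (fun w => F (increments (us ++ ts) w)) w.
Proof.
move=> SF; elim: ts us w => [|t ts IH] us w /= pth.
  rewrite !cats0 in pth *; congr F; apply: increments_agree => s su.
  rewrite B_stop min_l//; case/splitPr: su pth => p1 p2.
  rewrite cat_path last_cat /= => /and3P[_ _ /(order_path_min le_trans) h].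
  by case: p2 h => // x p2 /allP h; apply: h; exact: (mem_last x p2).
set a := last 0 us.
have pth2 : path <=%R a (t :: ts) by move: pth; rewrite cat_path => /andP[].
have pth1 : path <=%R 0 us by move: pth; rewrite cat_path => /andP[].
have a0 : 0 <= a.
  have := order_path_min le_trans pth1; rewrite /a.
  by case: (us) => // x u /allP h; apply: h; exact: (mem_last x u).
have usa s : s \in us -> s <= a.
  move=> su; move: pth1; rewrite /a; case/splitPr: su => p1 p2.
  rewrite cat_path last_cat /= => /and3P[_ _ /(order_path_min le_trans) h].
  by case: p2 h => // x p2 /allP h; apply: h; exact: (mem_last x p2).
move: (pth2) => /= /andP[at_ pth3].
have t0 := le_trans a0 at_.
have [K0 FM FK] := SF.
have M0 : 0 <= M by exact: le_trans (FM [::]).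
have SX : SL (us ++ t :: ts) (K * 2) M (fun w => F (increments (us ++ t :: ts) w)).
  split=> //; first exact: mulr_ge0.
  move=> v v' d d0 cl; rewrite -mulrA; apply: FK; first exact: mulr_ge0.
  by move=> i; apply: pairmap_B_close => //; rewrite !B0 subrr normr0.
have cov : covers (us ++ t :: ts) (t :: ts) a.
  by move=> s; rewrite mem_cat => /orP[/usa sa|//] as_; rewrite ltNge sa in as_.
have gz : all (>= 0) (pairmap (fun r s => s - r) t ts).
  elim: (ts) (t) pth3 => //= x u IHu r /andP[rx pu].
  by rewrite subr_ge0 rx; exact: IHu.
pose F1 xs := F (increments us w ++ xs).
have SF1 : slipF K M F1.
  split=> [//|xs|xs xs' d d0 H]; [exact: FM|apply: FK => // i; rewrite !nth_cat].
  by case: ifP => // _; rewrite subrr normr0.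
have lp : lip K (fun y => Gvalue sl sb (pairmap (fun r s => s - r) t ts) (fun xs => F1 (y :: xs))).
  move=> y y'; have [_ ] := Gvalue_lip gz (slipF_cons y SF1); apply; first exact: slipF_cons.
  by move=> xs; have [_ _ FK1] := SF1; apply: FK1 => // -[|i] //=; rewrite subrr normr0.
have bd y : `|Gvalue sl sb (pairmap (fun r s => s - r) t ts) (fun xs => F1 (y :: xs))| <= M.
  by have [] := Gvalue_lip gz (slipF_cons y SF1).
have ta : 0 <= t - a by rewrite subr_ge0.
rewrite (Gheat_nis sl0 slb 0 lp K0 bd ta).
have K20 : 0 <= K * 2 by exact: mulr_ge0.
have E y : a < t \/ y = 0 -> Gvalue sl sb (pairmap (fun r s => s - r) t ts) (fun xs => F1 (y :: xs)) =
    Phi ts t (fun w => F (increments (us ++ t :: ts) w)) (bump a t y w).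
  move=> yc; have := IH (rcons us t) (bump a t y w); rewrite last_rcons cat_rcons => /(_ pth) <-.
  congr (Gvalue sl sb _ _); apply/funext => xs.
  rewrite /F1 -cats1 increments_cat /= -catA /=; congr (F (_ ++ _ :: _)).
    by apply: increments_agree => s /usa sa; rewrite B_bump_le.
  rewrite -/a (B_bump_le _ _ a0 at_ (lexx a)) B_bump// (min_r at_).
  case: yc => [at'|->]; last by rewrite mul0r addr0 subrr.
  by rewrite ramp_ge//; ring.
apply: (nis_eq0 sl sb ta lp K0 (Phi_bump_lip sl0 slb SX w a0 at_ pth3 cov) K20).
  by apply: E; right.
by move=> tp y; apply: E; left; rewrite -subr_gt0.
Qed.

End PhiTheory.

(** * Conditional expectations of cylinder functionals: calculus *)

Section CondLip.
Variables (R : realType) (sl sb : R).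
Hypotheses (sl0 : 0 <= sl) (slb : sl <= sb).
Local Notation Om := (Omega R).
Local Notation Phi := (Phi sl sb).
Local Notation cond_Lip := (cond_Lip sl sb).
Implicit Types (w : Om) (a t s y : R) (D us ts : seq R) (X Y Z : Om -> R).

Lemma nth_last_take (ts : seq R) j : (j <= size ts)%N -> (0 :: ts)`_j = last 0 (take j ts).
Proof.
case: j => [|j] jts; first by rewrite take0.
rewrite (take_nth 0 jts) last_rcons//.
Qed.

Lemma drop_time_steps (ts : seq R) j : (j <= size ts)%N ->
  drop j (time_steps ts) = pairmap (fun r s => s - r) (last 0 (take j ts)) (drop j ts).
Proof.
move=> jts; rewrite /time_steps -{1}(cat_take_drop j ts) pairmap_cat drop_size_cat//.
by rewrite size_pairmap size_takel.
Qed.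

Lemma take_increments (ts : seq R) j w : (j <= size ts)%N ->
  take j (increments ts w) = increments (take j ts) w.
Proof.
move=> jts; rewrite -{1}(cat_take_drop j ts) increments_cat take_size_cat//.
by rewrite size_pairmap size_takel.
Qed.

Lemma path_ge a us s : path <=%R a us -> s \in us -> a <= s.
Proof. by move=> /(order_path_min le_trans)/allP; apply. Qed.

Lemma path_le_last a us s : path <=%R a us -> s \in us -> s <= last a us.
Proof.
move=> pth su; case/splitPr: su pth => p1 p2.
rewrite cat_path last_cat /= => /and3P[_ _ /(order_path_min le_trans) h].
by case: p2 h => // x p2 /allP h; apply: h; exact: (mem_last x p2).
Qed.

Lemma slipF_phi n (phi : 'rV[R]_n -> R) : bounded_lipschitz phi ->
  exists K M, slipF K M (fun xs => phi (row_of n xs)).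
Proof.
move=> /bounded_lipschitzP[K [M [K0 pM pK]]]; exists K, M; split=> // xs xs' d d0 H.
apply: le_trans (pK _ _) _; rewrite ler_wpM2l//.
by apply: row_norm_le => // i; rewrite !mxE.
Qed.

Lemma SL_increments K M F us : slipF K M F -> SL us (K * 2) M (fun w => F (increments us w)).
Proof.
move=> [K0 FM FK]; split=> [||w|w w' d d0 cl]; rewrite ?mulr_ge0//.
- exact: le_trans (FM [::]).
- by rewrite -mulrA; apply: FK => [|i]; rewrite ?mulr_ge0//;
  apply: pairmap_B_close => //; rewrite !B0 subrr normr0.
Qed.

Lemma cond_Lip_Phi t X Y : cond_Lip t X Y -> exists D K M us,
  [/\ inc D +oo%E, SL D K M X, 0 <= t, path <=%R t us & covers D us t /\ Y = Phi us t X].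
Proof.
move=> [n [ts [j [phi [[pth jn tE bphi] [XE YE]]]]]].
have [K [M SF]] := slipF_phi bphi.
have szts : size ts = n.+1 by exact: size_tuple.
have pth' : path <=%R 0 (take j ts ++ drop j ts) by rewrite cat_take_drop.
have tl : t = last 0 (take j ts) by rewrite tE nth_last_take// szts.
have := pth'; rewrite cat_path -tl => /andP[p1 p2].
have t0 : 0 <= t.
  by rewrite tl; case: (take j ts) p1 => // x u p1; apply: (path_ge p1); exact: (mem_last x u).
exists ts, (K * 2), M, (drop j ts); split=> //.
- by move=> s sts; split; [exact: (path_ge pth sts)|exact: leey].
- by rewrite XE; exact: (SL_increments ts SF).
split.
- move=> s; rewrite -{1}(cat_take_drop j ts) mem_cat => /orP[st|//] ts'.
  by have := path_le_last p1 st; rewrite -tl leNgt ts'.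
rewrite YE XE; apply/funext => w.
have := @Gvalue_Phi _ _ _ sl0 slb K M _ (take j ts) (drop j ts) w SF pth'.
rewrite -tl cat_take_drop => <-.
by rewrite drop_time_steps ?szts// take_increments ?szts// -tl.
Qed.

Lemma sort_path a us : (forall s, s \in us -> a <= s) -> path <=%R a (sort <=%R us).
Proof.
move=> H; have := sort_le_sorted us; rewrite /sorted; case E : (sort _ us) => [//|x u] p.
by rewrite /= p andbT; apply: H; rewrite -(mem_sort <=%R) E mem_head.
Qed.

(** The times of D together with t are sorted, and X is rewritten as a bounded Lipschitz function of
    the increments along them. *)
Lemma ex_cond_Lip D K M X t : inc D +oo%E -> SL D K M X -> 0 <= t ->
  exists us, [/\ path <=%R t us, covers D us t & cond_Lip t X (Phi us t X)].
Proof.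
move=> D0 SX t0; have [K0 M0 XM XK] := SX.
pose ts := sort <=%R (t :: D).
have szt : size ts == (size D).+1 by rewrite size_sort.
have pth : path <=%R 0 ts.
  by apply: sort_path => s; rewrite inE => /orP[/eqP ->//|/D0[]].
have tts : t \in ts by rewrite mem_sort mem_head.
(* Shifted by one because [cond_Lip] counts positions in [0 :: ts]. *)
pose j := (index t ts).+1.
have jn : (j <= size ts)%N by rewrite index_mem.
have tl : t = last 0 (take j ts) by rewrite -nth_last_take// /j/= nth_index.
have pth' : path <=%R 0 (take j ts ++ drop j ts) by rewrite cat_take_drop.
have := pth'; rewrite cat_path -tl => /andP[p1 p2].
have cov : covers D (drop j ts) t.
  move=> s sD ts'; have : s \in ts by rewrite mem_sort inE sD orbT.
  rewrite -{1}(cat_take_drop j ts) mem_cat => /orP[st|//].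
  by have := path_le_last p1 st; rewrite -tl leNgt ts'.
exists (drop j ts); split=> //.
pose n := size D; pose N : R := n.+1%:R.
have [|w|w w'|phi bphi E] := @McShane R Om n.+1 (fun w => row_of n.+1 (increments ts w)) X point (K * N) M.
- by rewrite mulr_ge0.
- exact: XM.
- rewrite -mulrA; apply: XK; first by rewrite mulr_ge0.
  move=> s sD; have sts : s \in ts by rewrite mem_sort inE sD orbT.
  have := @close_of_increments R ts 0 w w' `|row_of n.+1 (increments ts w) - row_of n.+1 (increments ts w')| 0.
  rewrite add0r (eqP szt) -/N; apply => //; first by rewrite !B0 subrr normr0.
  move=> i iN; have := row_norm_ge (row_of n.+1 (increments ts w) - row_of n.+1 (increments ts w')) (Ordinal iN).
  by rewrite !mxE.
exists n, (Tuple szt), j, phi; split; first split=> //.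
- by rewrite -(eqP szt).
- exact: (etrans tl (esym (nth_last_take jn))).
split; first exact/funext.
have [K1 [M1 SF]] := slipF_phi bphi.
apply/funext => w; have := @Gvalue_Phi _ _ _ sl0 slb K1 M1 _ (take j ts) (drop j ts) w SF pth'.
rewrite -tl cat_take_drop.
have -> : (fun w => phi (row_of n.+1 (increments ts w))) = X by exact/funext.
by move=> <-; rewrite drop_time_steps// take_increments// -tl.
Qed.

(** Both lists are compared with the sorted union of the two sets of times, which covers either
    representation. *)
Lemma Phi_indep2 D K M D' K' M' X us vs a w : SL D K M X -> SL D' K' M' X -> 0 <= a ->
  path <=%R a us -> path <=%R a vs -> covers D us a -> covers D' vs a -> Phi us a X w = Phi vs a X w.
Proof.
move=> S1 S2 a0 pu pv cu cv.
pose ws := sort <=%R [seq s <- D ++ D' | a < s].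
have pw : path <=%R a ws by apply: sort_path => s; rewrite mem_filter => /andP[/ltW].
have cw : covers D ws a by move=> s sD as_; rewrite mem_sort mem_filter as_ mem_cat sD.
have cw' : covers D' ws a by move=> s sD as_; rewrite mem_sort mem_filter as_ mem_cat sD orbT.
by rewrite (Phi_indep sl0 slb S1 w a0 pu pw)// (Phi_indep sl0 slb S2 w a0 pv pw).
Qed.

Lemma cond_Lip_uniq t X Y Y' : cond_Lip t X Y -> cond_Lip t X Y' -> Y = Y'.
Proof.
move=> /cond_Lip_Phi[D [K [M [us [D0 SX t0 pu [cu ->]]]]]] /cond_Lip_Phi[D' [K' [M' [us' [_ SX' _ pu' [cu' ->]]]]]].
by apply/funext => w; exact: (Phi_indep2 w SX SX').
Qed.

Lemma cond_Lip_exists t X : Lip +oo%E X -> 0 <= t -> exists Y, cond_Lip t X Y.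
Proof.
move=> /Lip_SL[D [K [M [D0 SX]]]] t0; have [us [_ _ h]] := ex_cond_Lip D0 SX t0.
by exists (Phi us t X).
Qed.

Lemma cond_Lip_Lip t X Y : cond_Lip t X Y -> [/\ 0 <= t, Lip +oo%E X & Lip t%:E Y].
Proof.
move=> /cond_Lip_Phi[D [K [M [us [D0 SX t0 pu [cu ->]]]]]]; split=> //.
  exact: (SL_Lip _ D0 SX).
apply: (SL_Lip _ _ (SL_Phi sl0 slb SX t0 pu cu)) => //.
move=> s; rewrite inE mem_filter => /orP[/eqP ->|/andP[st sD]]; first by [].
by split; [have [] := D0 s sD|rewrite lee_fin].
Qed.

Lemma Lip_le h k X : (h <= k)%E -> Lip h X -> Lip k X.
Proof.
move=> hk [n [ts [phi [tsh bp XE]]]]; exists n, ts, phi; split=> // i.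
by have [h1 h2] := tsh i; split=> //; exact: le_trans hk.
Qed.

Lemma SL_common X1 X2 h : Lip h X1 -> Lip h X2 -> exists D K M, [/\ inc D h, SL D K M X1 & SL D K M X2].
Proof.
move=> /Lip_SL[D1 [K1 [M1 [i1 S1]]]] /Lip_SL[D2 [K2 [M2 [i2 S2]]]].
have [a1 b1 _ _] := S1; have [a2 b2 _ _] := S2.
exists (D1 ++ D2), (K1 + K2), (M1 + M2); split.
- by move=> s; rewrite mem_cat => /orP[/i1|/i2].
- by apply: SL_sub S1; [move=> s; rewrite mem_cat => ->|rewrite lerDl|rewrite lerDl].
- by apply: SL_sub S2; [move=> s; rewrite mem_cat orbC => ->|rewrite lerDr|rewrite lerDr].
Qed.

Lemma LipP0 h X : Lip h X -> (0 <= h)%E.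
Proof. by move=> [n [ts [phi [H _ _]]]]; have [h1 h2] := H ord0; apply: le_trans h2; rewrite lee_fin. Qed.

Lemma LipD h X1 X2 : Lip h X1 -> Lip h X2 -> Lip h (fun w => X1 w + X2 w).
Proof.
move=> L1 L2; have [D [K [M [iD [K0 M0 XM XK] [_ _ YM YK]]]]] := SL_common L1 L2.
apply: (@SL_Lip _ _ D (K + K) (M + M)); [exact: LipP0 L1|exact: iD|split].
- exact: addr_ge0.
- exact: addr_ge0.
- by move=> w; apply: le_trans (ler_normD _ _) _; exact: lerD.
- move=> w w' d d0 cl; rewrite opprD addrACA mulrDl.
  by apply: le_trans (ler_normD _ _) _; apply: lerD; [exact: XK|exact: YK].
Qed.

Lemma LipM h X1 X2 : Lip h X1 -> Lip h X2 -> Lip h (fun w => X1 w * X2 w).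
Proof.
move=> L1 L2; have [D [K [M [iD [K0 M0 XM XK] [_ _ YM YK]]]]] := SL_common L1 L2.
apply: (@SL_Lip _ _ D (M * K + K * M) (M * M)); [exact: LipP0 L1|exact: iD|split].
- by rewrite addr_ge0// mulr_ge0.
- exact: mulr_ge0.
- by move=> w; rewrite normrM ler_pM.
- move=> w w' d d0 cl.
  rewrite (_ : _ - _ = X1 w * (X2 w - X2 w') + (X1 w - X1 w') * X2 w'); last by ring.
  apply: le_trans (ler_normD _ _) _; rewrite !normrM mulrDl; apply: lerD.
    by rewrite -mulrA ler_pM//; exact: YK.
  by rewrite mulrAC ler_pM//; exact: XK.
Qed.

Lemma Lip_cst h (c : R) : (0 <= h)%E -> Lip h (fun=> c).
Proof. by move=> h0; apply: (SL_Lip h0 _ (SL_cst [::] c)). Qed.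

Lemma LipZ h (c : R) X : Lip h X -> Lip h (fun w => c * X w).
Proof. by move=> LX; apply: LipM => //; apply: Lip_cst; exact: LipP0 LX. Qed.

Lemma LipN h X : Lip h X -> Lip h (fun w => - X w).
Proof. by move=> /(LipZ (-1)); congr (Lip h _); apply/funext => w; rewrite mulN1r. Qed.

Lemma Lip_comp h X (f : R -> R) (L : R) : lip L f -> 0 <= L -> Lip h X -> Lip h (fun w => f (X w)).
Proof.
move=> fL L0 LX; have h0 := LipP0 LX; have [D [K [M [iD [K0 M0 XM XK]]]]] := Lip_SL LX.
apply: (@SL_Lip _ _ D (L * K) (`|f 0| + L * M)) => //; split.
- exact: mulr_ge0.
- by rewrite addr_ge0// mulr_ge0.
- move=> w; have h1 := fL (X w) 0; rewrite subr0 in h1.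
  have h2 := ler_wpM2l L0 (XM w).
  by have := ler_normD (f (X w) - f 0) (f 0); rewrite subrK; lra.
- move=> w w' d d0 cl; apply: le_trans (fL _ _) _.
  by rewrite -mulrA ler_wpM2l//; exact: XK.
Qed.

Lemma lip_maxc (c : R) : lip 1 (fun x : R => Num.max x c).
Proof.
move=> x y; rewrite mul1r.
have n1 : x - y <= `|x - y| by exact: ler_norm.
have n2 : y - x <= `|x - y| by rewrite distrC ler_norm.
by have [h1|h1] := leP x c; have [h2|h2] := leP y c; rewrite ler_norml; apply/andP; split; lra.
Qed.

Lemma Lip_maxc h (c : R) X : Lip h X -> Lip h (fun w => Num.max (X w) c).
Proof. by move=> LX; exact: (Lip_comp (lip_maxc c) ler01 LX). Qed.

Lemma Lip_max h X Y : Lip h X -> Lip h Y -> Lip h (fun w => Num.max (X w) (Y w)).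
Proof.
move=> LX LY; have -> : (fun w => Num.max (X w) (Y w)) = (fun w => Num.max (X w + - Y w) 0 + Y w).
  by apply/funext => w; rewrite addr_maxl subrK add0r.
by apply: LipD => //; apply: Lip_maxc; apply: LipD => //; exact: LipN.
Qed.

Lemma Lip_min h X Y : Lip h X -> Lip h Y -> Lip h (fun w => Num.min (X w) (Y w)).
Proof.
move=> LX LY; have -> : (fun w => Num.min (X w) (Y w)) = (fun w => - Num.max (- X w) (- Y w)).
  by apply/funext => w; rewrite oppr_max !opprK.
by apply: LipN; apply: Lip_max; exact: LipN.
Qed.

Lemma cond_Lip_le t (c1 c2 k : R) X Y X1 Y1 X2 Y2 : cond_Lip t X Y -> cond_Lip t X1 Y1 -> cond_Lip t X2 Y2 ->
  0 <= c1 -> 0 <= c2 -> (forall w, X w <= c1 * X1 w + c2 * X2 w + k) ->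
  forall w, Y w <= c1 * Y1 w + c2 * Y2 w + k.
Proof.
move=> C0 C1 C2 c10 c20 H w.
have [t0 L0 _] := cond_Lip_Lip C0; have [_ L1 _] := cond_Lip_Lip C1; have [_ L2 _] := cond_Lip_Lip C2.
have [D [K [M [iD S1 S2]]]] := SL_common L1 L2.
have [D' [K' [M' [iD' S0]]]] := Lip_SL L0.
have [a1 b1 _ _] := S1; have [a2 b2 _ _] := S0.
have S0' : SL (D ++ D') (K + K') (M + M') X.
  by apply: SL_sub S0; [move=> s; rewrite mem_cat orbC => ->|rewrite lerDr|rewrite lerDr].
have S1' : SL (D ++ D') (K + K') (M + M') X1.
  by apply: SL_sub S1; [move=> s; rewrite mem_cat => ->|rewrite lerDl|rewrite lerDl].
have S2' : SL (D ++ D') (K + K') (M + M') X2.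
  by apply: SL_sub S2; [move=> s; rewrite mem_cat => ->|rewrite lerDl|rewrite lerDl].
have iDD : inc (D ++ D') +oo%E by move=> s; rewrite mem_cat => /orP[/iD|/iD'].
have [us [pu cu]] := ex_cond_Lip iDD S0' t0.
move=> /(cond_Lip_uniq C0) ->.
have e1 : Y1 = Phi us t X1.
  have /cond_Lip_Phi[D1 [K1 [M1 [u1 [_ T1 _ p1 [v1 ->]]]]]] := C1.
  by apply/funext => w'; exact: (Phi_indep2 w' T1 S1').
have e2 : Y2 = Phi us t X2.
  have /cond_Lip_Phi[D1 [K1 [M1 [u1 [_ T1 _ p1 [v1 ->]]]]]] := C2.
  by apply/funext => w'; exact: (Phi_indep2 w' T1 S2').
by rewrite e1 e2; apply: (Phi_le_add sl0 slb S0' S1' S2').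
Qed.

Lemma cond_Lip_id t X : Lip t%:E X -> cond_Lip t X X.
Proof.
move=> LX; have t0 : 0 <= t by have := LipP0 LX; rewrite lee_fin.
have [D [K [M [iD SX]]]] := Lip_SL LX.
have iD' : inc D +oo%E by move=> s /iD[h _]; split=> //; exact: leey.
have [us [pu cu]] := ex_cond_Lip iD' SX t0.
suff -> : Phi us t X = X by [].
apply/funext => w; rewrite (@Phi_indep2 _ _ _ _ _ _ X us [::] t w SX SX)//=.
  by apply: (SL_dep SX) => s /iD[_]; rewrite lee_fin => st; rewrite B_stop min_l.
by move=> s /iD[_]; rewrite lee_fin leNgt => /negP.
Qed.

Lemma cond_Lip_tower t X Y Z : cond_Lip t X Y -> cond_Lip 0 Y Z -> cond_Lip 0 X Z.
Proof.
move=> C1 C2; have [D [K [M [us [D0 SX t0 pu [cu YE]]]]]] := cond_Lip_Phi C1.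
have [D' [K' [M' [vs [D0' SY _ pv [cv ZE]]]]]] := cond_Lip_Phi C2.
have [ws [pw cw CX]] := ex_cond_Lip D0 SX (lexx 0).
suff -> : Z = Phi ws 0 X by [].
have SY' := SL_Phi sl0 slb SX t0 pu cu; rewrite -YE in SY'.
pose D1 := t :: [seq s <- D | s <= t].
pose v0 := sort <=%R D1.
have D1t s : s \in D1 -> 0 <= s <= t.
  rewrite inE mem_filter => /orP[/eqP ->|/andP[st /D0[-> _]]]; first by rewrite t0 lexx.
  by rewrite st.
have p0 : path <=%R 0 v0 by apply: sort_path => s /D1t/andP[].
have tv : t \in v0 by rewrite mem_sort mem_head.
have l0 : last 0 v0 = t.
  apply/le_anti/andP; split; last exact: path_le_last.
  case E : v0 tv => [//|x u] _ /=.
  have : last x u \in v0 by rewrite E; exact: mem_last.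
  by rewrite mem_sort => /D1t/andP[].
have pc : path <=%R 0 (v0 ++ us) by rewrite cat_path p0 l0.
have cc : covers D (v0 ++ us) 0.
  move=> s sD s0; rewrite mem_cat mem_sort inE mem_filter sD andbT.
  by have [st|/(cu _ sD) ->] := leP s t; rewrite ?orbT.
apply/funext => w; rewrite ZE (Phi_indep2 w SX SX (lexx 0) pw pc cw cc).
rewrite (Phi_cat sl0 slb w SX (lexx 0) pc cc) l0 -YE.
apply: (Phi_indep2 w SY SY') => //.
by move=> s sD _; rewrite mem_sort.
Qed.

(** On paths that agree up to t both Y and g are constants, so conditioning at t gives
    [g * Y - Y * g = 0] as an upper bound; the tower property carries it to time 0. *)
Lemma cond_Lip_pull t X Y g Z : cond_Lip t X Y -> Lip t%:E g -> (forall w, 0 <= g w) ->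
  cond_Lip 0 (fun w => (X w - Y w) * g w) Z -> forall w, Z w <= 0.
Proof.
move=> C1 Lg g0 C2; have [t0 LX LY] := cond_Lip_Lip C1.
have LY' := Lip_le (leey _) LY; have Lg' := Lip_le (leey _) Lg.
have LZ : Lip +oo%E (fun w => (X w - Y w) * g w).
  by apply: LipM => //; apply: LipD => //; exact: LipN.
have [W CW] := cond_Lip_exists LZ t0.
have W0 : forall w, W w <= 0.
  have [D [K [M [us [iD SX _ pu [cu YE]]]]]] := cond_Lip_Phi C1.
  have [D' [K' [M' [iD' SZ]]]] := Lip_SL LZ.
  have [Dg [Kg [Mg [iDg Sg]]]] := Lip_SL Lg.
  have [a1 b1 _ _] := SX; have [a2 b2 _ _] := SZ.
  have SX2 : SL (D ++ D') (K + K') (M + M') X.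
    by apply: SL_sub SX; [move=> s; rewrite mem_cat => ->|rewrite lerDl|rewrite lerDl].
  have SZ2 : SL (D ++ D') (K + K') (M + M') (fun w => (X w - Y w) * g w).
    by apply: SL_sub SZ; [move=> s; rewrite mem_cat orbC => ->|rewrite lerDr|rewrite lerDr].
  have iDD : inc (D ++ D') +oo%E by move=> s; rewrite mem_cat => /orP[/iD|/iD'].
  have [vs [pv cv]] := ex_cond_Lip iDD SZ2 t0.
  move=> /(cond_Lip_uniq CW) -> w.
  have YE2 : Y w = Phi vs t X w by rewrite YE; exact: (Phi_indep2 w SX SX2).
  have dep V : Lip t%:E V -> forall w', agree t w w' -> V w' = V w.
    move=> /Lip_SL[D1 [K1 [M1 [i1 S1]]]] w' ag; apply: (SL_dep S1) => s /i1[_].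
    by rewrite lee_fin => st; rewrite ag.
  have := @Phi_le_add _ _ _ sl0 slb _ _ _ _ X X (g w) 0 (- (Y w * g w)) vs t w SZ2 SX2 SX2 (g0 w) (lexx 0) t0 pv cv.
  move=> /(_ _)/le_trans; apply.
    by move=> w' ag; rewrite (dep _ LY _ ag) (dep _ Lg _ ag); lra.
  by rewrite -YE2; lra.
have [_ _ LW] := cond_Lip_Lip CW.
have [Z' CZ'] := cond_Lip_exists (Lip_le (leey _) LW) (lexx 0).
have := cond_Lip_tower CW CZ'; move=> /(cond_Lip_uniq C2) -> w.
have C00 : cond_Lip 0 (fun=> 0) (fun=> 0) by apply: cond_Lip_id; exact: Lip_cst.
have := cond_Lip_le CZ' C00 C00 (lexx 0) (lexx 0) (k := 0) _ w; rewrite !mul0r !addr0; apply.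
by move=> v; rewrite ?mul0r ?addr0; exact: W0.
Qed.

Lemma cond_Lip0_cst X Y : cond_Lip 0 X Y -> forall w w', Y w = Y w'.
Proof.
move=> /cond_Lip_Phi[D [K [M [us [iD SX _ pu [cu ->]]]]]] w w'.
apply: (Phi_agree sl0 slb SX) => // [s _ s0|]; rewrite !path_le0//.
Qed.

(** The cut at 1 makes the fourth power a bounded Lipschitz functional. The value at s cancels in
    the increment, and the Gaussian bound for the fourth moment with variance [sb ^+ 2 * (t - s)]
    remains. *)
Lemma cond_Lip_moment (s t a : R) Y : 0 <= s -> s < t -> 0 < a ->
  cond_Lip 0 (fun w => Num.min 1 ((a^-1 * (B t w - B s w)) ^+ 4)) Y ->
  forall w, Y w <= 3 * (sb ^+ 2 * (t - s)) ^+ 2 / a ^+ 4.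
Proof.
move=> s0 st a0 C w; have [_ LX _] := cond_Lip_Lip C.
have [D [K [M [iD SX]]]] := Lip_SL LX.
have [D1 [K1 [M1 [us [iD1 S1 _ pu [cu ->]]]]]] := cond_Lip_Phi C.
set X := (fun w => _) in SX S1 *.
have ai : 0 < a^-1 by rewrite invr_gt0.
have XE v v' : B s v = B s v' -> B t v = B t v' -> X v = X v' by rewrite /X => -> ->.
have lp : lip 4 (fun x : R => Num.min 1 (x ^+ 4)).
  move=> x y; wlog xy : x y / `|x| <= `|y|.
    move=> H; have [/H//|/ltW/H] := leP `|x| `|y|; by rewrite distrC [`|y - x|]distrC.
  have x4 z : z ^+ 4 = `|z| ^+ 4 :> R by rewrite -[RHS]normrX ger0_norm// exprn_even_ge0.
  have le4 : x ^+ 4 <= y ^+ 4 by rewrite (x4 x) (x4 y) lerXn2r ?nnegrE.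
  have d : `|y| - `|x| <= `|x - y| by rewrite distrC lerB_dist.
  rewrite distrC ger0_norm; last by rewrite subr_ge0 le_min !ge_min lexx/= le4 orbT.
  have [h|h] := leP 1 (x ^+ 4).
    by rewrite min_l ?subrr ?mulr_ge0// (le_trans h).
  have x1 : `|x| <= 1 by move: h; rewrite x4 ltNge; apply: contraR; rewrite -ltNge => /ltW; exact: exprn_ege1.
  have [h'|h'] := leP 1 (y ^+ 4).
    have : 1 - x ^+ 4 <= 4 * (1 - `|x|).
      rewrite x4; have := normr_ge0 x; move: `|x| x1 => z z1 z0.
      have : 0 <= (1 - z) ^+ 2 by exact: sqr_ge0.
      have : 0 <= z * (1 - z) ^+ 2 by rewrite mulr_ge0// sqr_ge0.
      have : 0 <= z ^+ 2 * (1 - z) ^+ 2 by rewrite mulr_ge0// sqr_ge0.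
      nra.
    have y1 : 1 <= `|y|.
      by move: h'; rewrite x4; apply: contraTT; rewrite -!ltNge => h1; rewrite exprn_ilt1.
    lra.
  have y1 : `|y| <= 1 by move: h'; rewrite x4 ltNge; apply: contraR; rewrite -ltNge => /ltW; exact: exprn_ege1.
  have : y ^+ 4 - x ^+ 4 <= 4 * (`|y| - `|x|).
    rewrite (x4 x) (x4 y); have := normr_ge0 x; move: `|x| `|y| xy x1 y1 {d} => z v zv z1 v1 z0.
    have -> : v ^+ 4 - z ^+ 4 = (v - z) * (v ^+ 3 + v ^+ 2 * z + v * z ^+ 2 + z ^+ 3) by ring.
    rewrite mulrC ler_wpM2r ?subr_ge0//.
    have v0 : 0 <= v by exact: le_trans zv.
    have : v ^+ 3 <= 1 by exact: exprn_ile1.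
    have : z ^+ 3 <= 1 by exact: exprn_ile1.
    have : v ^+ 2 * z <= 1 by rewrite -[leRHS]mulr1 ler_pM ?exprn_ge0 ?exprn_ile1.
    have : v * z ^+ 2 <= 1 by rewrite -[leRHS]mulr1 ler_pM ?exprn_ge0 ?exprn_ile1.
    lra.
  lra.
have SX2 : SL [:: s; t] (4 * a^-1 * 2) 1 X.
  split=> //; first by rewrite !mulr_ge0// ltW.
    by move=> v; rewrite /X ger0_norm ?le_min ?ler01 ?exprn_even_ge0// ge_min lexx.
  move=> v v' d d0 cl; apply: le_trans (lp _ _) _.
  rewrite -mulrBr normrM (gtr0_norm ai) -!mulrA ler_pM2l// ler_pM2l//.
  rewrite (_ : _ - _ = (B t v - B t v') - (B s v - B s v')); last by ring.
  apply: le_trans (ler_normB _ _) _.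
  have := cl s (mem_head _ _); have := cl t; rewrite inE mem_head orbT => /(_ isT); lra.
have pst : path <=%R 0 [:: s; t] by rewrite /= s0 ltW.
have cst : covers [:: s; t] [:: s; t] 0 by [].
rewrite (Phi_indep2 w S1 SX2 (lexx 0) pu pst cu cst) /=.
have ts : 0 <= t - s by rewrite subr_ge0 ltW.
have sT1 := nis_subl sl0 slb ts.
have s00 : 0 <= s - 0 by rewrite subr0.
have sT0 := nis_subl sl0 slb s00.
set m := 3 * _ / _.
have in1 y : nis sl sb (t - s) (fun z => X (stop t (bump s t z (bump 0 s y w)))) 0 <= m.
  have gX : gr (fun z => X (stop t (bump s t z (bump 0 s y w)))).
    apply: (@gr_bd _ _ 1) => z.
    by rewrite /X ger0_norm ?le_min ?ler01 ?exprn_even_ge0// ge_min lexx.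
  have ai4 : 0 <= a^-1 ^+ 4 by rewrite exprn_ge0// ltW.
  apply: (@le_trans _ _ (nis sl sb (t - s) (fun z => a^-1 ^+ 4 * z ^+ 4) 0)).
    apply: (sl_mono sT1) => //; first by apply: grZ; exact: gr_pow4.
    move=> z; rewrite /X !B_stop minxx (min_l (ltW st)) (B_bump_ge _ _ s0 st (lexx t)).
    rewrite (B_bump_le _ _ s0 (ltW st) (lexx s)) addrAC subrr add0r exprMn.
    by rewrite ge_min lexx orbT.
  rewrite (sl_hom sT1 0 ai4 (@gr_pow4 R)).
  have := mom_pow4 (nis_mom sl0 slb ts); rewrite (G2 sl0 slb) => /(ler_wpM2l ai4)/le_trans; apply.
  by rewrite /m exprVn mulrC.
rewrite -[leRHS](sl_cst sT0 m 0); apply: (sl_mono sT0) => //; last exact: gr_cst.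
have cov0 : covers [:: s; t] [:: s; t] 0 by [].
by apply: (gr_lip (Phi_bump_lip sl0 slb SX2 w (lexx 0) s0 _ cov0)); rewrite /= ltW.
Qed.

End CondLip.

(** * Representation by measures *)

Section Chaining.
Variable R : realType.
Implicit Types (f : R -> R) (s t A : R).

(** The admissible increment on the dyadic intervals of level j is [A * rho ^+ j]. Summability of
    the costs asks for [1 < 2 * rho ^+ 4]; at the value 9/10 also [rho / (1 - rho) = 9], the
    constant of [chain1]. *)
Definition rho : R := 9 / 10.

Lemma rho_gt0 : 0 < rho. Proof. by rewrite /rho divr_gt0. Qed.
Lemma rho_lt1 : rho < 1. Proof. by rewrite /rho; lra. Qed.

Lemma near_expr (x c e : R) : 0 <= x -> x < 1 -> 0 < e -> \forall n \near \oo, c * x ^+ n <= e.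
Proof.
move=> x0 x1 e0.
have h : c * x ^+ n @[n --> \oo] --> c * 0.
  by apply: cvgM; [exact: cvg_cst|apply: cvg_expr; rewrite ger0_norm].
rewrite mulr0 in h; move/cvgrPdist_le : h => /(_ _ e0); apply: filterS => n.
by rewrite sub0r normrN; apply: le_trans; exact: ler_norm.
Qed.

Definition dya (m : nat) s : R := (Num.truncn (s * 2 ^+ m))%:R / 2 ^+ m.

Lemma p2_gt0 m : 0 < 2 ^+ m :> R. Proof. exact: exprn_gt0. Qed.

Lemma dya_itv m s : 0 <= s -> dya m s <= s /\ s < dya m s + (2 ^+ m)^-1.
Proof.
move=> s0; have /truncn_itv/andP[h1 h2] : 0 <= s * 2 ^+ m by rewrite mulr_ge0// ltW// p2_gt0.
split; first by rewrite /dya ler_pdivrMr ?p2_gt0.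
have -> : dya m s + (2 ^+ m)^-1 = (Num.truncn (s * 2 ^+ m)).+1%:R / 2 ^+ m.
  by rewrite /dya -(natr1 (Num.truncn (s * 2 ^+ m))) mulrDl mul1r.
by rewrite ltr_pdivlMr ?p2_gt0.
Qed.

Lemma dya_ge0 m s : 0 <= dya m s.
Proof. by rewrite /dya divr_ge0// ltW// p2_gt0. Qed.

Lemma dya_dist m s : 0 <= s -> `|s - dya m s| <= (2 ^+ m)^-1.
Proof.
move=> /(dya_itv m)[h1 h2]; rewrite ger0_norm ?subr_ge0// lerBlDl; exact: ltW.
Qed.

Lemma dya_step m s : 0 <= s -> Num.truncn (s * 2 ^+ m.+1) = (2 * Num.truncn (s * 2 ^+ m))%N \/
  Num.truncn (s * 2 ^+ m.+1) = (2 * Num.truncn (s * 2 ^+ m)).+1.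
Proof.
move=> s0; have s0m : 0 <= s * 2 ^+ m by rewrite mulr_ge0// ltW// p2_gt0.
have /andP[h1 h2] := truncn_itv s0m; set T := Num.truncn _ in h1 h2 *.
rewrite exprS mulrCA; move: h2; rewrite -(natr1 T) => h2.
have [h|h] := ltP (2 * (s * 2 ^+ m)) (2 * T).+1%:R.
  by left; apply: truncn_def; rewrite h andbT natrM ler_pM2l.
right; apply: truncn_def; rewrite h /=; move: h2; set x := s * _; have -> : (2 * T).+2%:R = 2 * (T%:R + 1) :> R; last first.
  by move=> h2; rewrite ltr_pM2l.
by rewrite -(natr1 (2 * T).+1) -(natr1 (2 * T)) natrM; ring.
Qed.

(** The horizon [j.+1] grows with the level, so a single A controls the path on the whole
    half-line. *)
Definition good f A m := forall j k, (j <= m)%N -> (k < j.+1 * 2 ^ j)%N ->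
  `|f (k.+1%:R / 2 ^+ j) - f (k%:R / 2 ^+ j)| <= A * rho ^+ j.

Lemma trunc_lt n m s : 0 <= s -> s < n.+1%:R -> (Num.truncn (s * 2 ^+ m) < n.+1 * 2 ^ m)%N.
Proof.
move=> s0 sn; rewrite truncn_lt_nat; last by rewrite mulr_ge0// ltW// p2_gt0.
by rewrite natrM natrX ltr_pM2r// p2_gt0.
Qed.

(** The geometric sum of the increments between the dyadic truncations of s of levels n and
    [n + d]. *)
Lemma chain1 f A n d s : 0 <= A -> good f A (n + d) -> 0 <= s -> s < n.+1%:R ->
  `|f (dya (n + d) s) - f (dya n s)| <= 9 * A * rho ^+ n - 9 * A * rho ^+ (n + d).
Proof.
move=> A0 + s0 sn; elim: d => [|d IH] H; first by rewrite addn0 !subrr normr0.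
have {}IH : `|f (dya (n + d) s) - f (dya n s)| <= 9 * A * rho ^+ n - 9 * A * rho ^+ (n + d).
  by apply: IH => j k jn kj; apply: H => //; rewrite addnS leqW.
have h : `|f (dya (n + d).+1 s) - f (dya (n + d) s)| <= A * rho ^+ (n + d).+1.
  rewrite /dya; set T := Num.truncn (s * 2 ^+ (n + d)).
  have E : T%:R / 2 ^+ (n + d) = (2 * T)%:R / 2 ^+ (n + d).+1 :> R.
    by rewrite natrM exprS; field; rewrite gt_eqF// p2_gt0.
  rewrite E; case: (dya_step (n + d) s0) => ->.
    by rewrite subrr normr0 mulr_ge0// exprn_ge0// ltW// rho_gt0.
  apply: H; first by rewrite addnS.
  have := @trunc_lt n (n + d) s s0 sn; rewrite -/T => TT.
  rewrite expnS mulnCA ltn_pmul2l//; apply: leq_trans TT _.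
  by rewrite leq_mul2r ltnS (leq_trans (leq_addr d n))// orbT.
rewrite addnS; apply: le_trans (ler_distD (f (dya (n + d) s)) _ _) _.
have : A * rho ^+ (n + d).+1 = 9 * A * rho ^+ (n + d) - 9 * A * rho ^+ (n + d).+1.
  by rewrite exprS /rho; field.
by move=> ?; lra.
Qed.

Lemma chain2 f A n s s' : good f A n -> 0 <= A -> 0 <= s -> 0 <= s' -> s < n.+1%:R -> s' < n.+1%:R ->
  `|s - s'| <= (2 ^+ n)^-1 -> `|f (dya n s) - f (dya n s')| <= A * rho ^+ n.
Proof.
move=> H A0; wlog ss : s s' / s <= s'.
  move=> W s0 s0' sn sn' d; have [?|/ltW ?] := leP s s'; first exact: W.
  by rewrite distrC; apply: W => //; rewrite distrC.
move=> s0 s0' sn sn'; rewrite distrC ger0_norm ?subr_ge0// => d.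
have a0 : 0 <= s * 2 ^+ n by rewrite mulr_ge0// ltW// p2_gt0.
have a0' : 0 <= s' * 2 ^+ n by rewrite mulr_ge0// ltW// p2_gt0.
have /andP[h1 h2] := truncn_itv a0; have /andP[h1' h2'] := truncn_itv a0'.
have d' : s' * 2 ^+ n <= s * 2 ^+ n + 1.
  by rewrite -lerBlDl -mulrBl -ler_pdivlMr ?p2_gt0// mul1r.
have T1 : (Num.truncn (s * 2 ^+ n) <= Num.truncn (s' * 2 ^+ n))%N.
  by apply: le_truncn; rewrite ler_pM2r ?p2_gt0.
have T2 : (Num.truncn (s' * 2 ^+ n) <= (Num.truncn (s * 2 ^+ n)).+1)%N.
  rewrite truncn_le_nat; apply: le_lt_trans d' _.
  by rewrite -(natr1 (Num.truncn (s * 2 ^+ n)).+1) ltrD2r.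
rewrite /dya; move: T1; rewrite leq_eqVlt => /orP[/eqP ->|T1].
  by rewrite subrr normr0 mulr_ge0// exprn_ge0// ltW// rho_gt0.
have -> : Num.truncn (s' * 2 ^+ n) = (Num.truncn (s * 2 ^+ n)).+1 by apply/eqP; rewrite eqn_leq T2.
by rewrite distrC; apply: H => //; exact: trunc_lt.
Qed.

Lemma good_le f A n m : (n <= m)%N -> good f A m -> good f A n.
Proof. by move=> nm H j k jn; apply: H; exact: leq_trans nm. Qed.

Lemma chain f A n m s s' : (n <= m)%N -> good f A m -> 0 <= A -> 0 <= s -> 0 <= s' ->
  s < n.+1%:R -> s' < n.+1%:R -> `|s - s'| <= (2 ^+ n)^-1 ->
  `|f (dya m s) - f (dya m s')| <= 20 * A * rho ^+ n.
Proof.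
move=> nm H A0 s0 s0' sn sn' d.
have g := H; rewrite -(subnKC nm) in g.
have h1 := chain1 A0 g s0 sn; have h2 := chain1 A0 g s0' sn'.
have h3 := chain2 (good_le nm H) A0 s0 s0' sn sn' d.
rewrite (subnKC nm) in h1 h2.
have p1 : 0 <= A * rho ^+ n by rewrite mulr_ge0// exprn_ge0// ltW// rho_gt0.
have p2 : 0 <= A * rho ^+ m by rewrite mulr_ge0// exprn_ge0// ltW// rho_gt0.
rewrite (_ : _ - _ = (f (dya m s) - f (dya n s)) + (f (dya n s) - f (dya n s')) - (f (dya m s') - f (dya n s'))); last by ring.
apply: le_trans (ler_normB _ _) _; apply: le_trans (lerD (ler_normD _ _) (lexx _)) _; lra.
Qed.

Lemma cvg_dya s : 0 <= s -> dya m s @[m --> \oo] --> s.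
Proof.
move=> s0; apply/cvgrPdist_le => e e0.
have h : 0 <= 2^-1 :> R by rewrite invr_ge0.
have h1 : 2^-1 < 1 :> R by lra.
have := near_expr 1 h h1 e0; apply: filterS => m; rewrite mul1r exprVn.
by apply: le_trans; exact: dya_dist.
Qed.

Lemma good_modulus f A n s s' : continuous f -> (forall m, good f A m) -> 0 <= A -> 0 <= s -> 0 <= s' ->
  s < n.+1%:R -> s' < n.+1%:R -> `|s - s'| <= (2 ^+ n)^-1 -> `|f s - f s'| <= 20 * A * rho ^+ n.
Proof.
move=> cf H A0 s0 s0' sn sn' d.
have c r : 0 <= r -> f (dya m r) @[m --> \oo] --> f r.
  by move=> r0; exact: (cvg_comp _ _ (cvg_dya r0) (cf r)).
have : `|f (dya m s) - f (dya m s')| @[m --> \oo] --> `|f s - f s'|.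
  by apply: cvg_norm; apply: cvgB; exact: c.
move=> /cvgr_to_le; apply.
by exists n => // m /= nm; exact: (chain nm).
Qed.

Lemma ubd_ev (u : nat -> R) n M : (forall m, (n <= m)%N -> `|u m| <= M) -> ubd u.
Proof.
move=> H; exists (`|M| + \sum_(i < n) `|u i|) => m.
have [nm|mn] := leqP n m.
  apply: le_trans (H m nm) _; apply: le_trans (ler_norm _) _.
  by rewrite lerDl sumr_ge0.
by rewrite (bigD1 (Ordinal mn))//= addrCA lerDl addr_ge0// sumr_ge0.
Qed.

Lemma good_bound f A n s : f 0 = 0 -> good f A n -> 0 <= A -> 0 <= s -> s < n.+1%:R ->
  `|f (dya n s)| <= n.+1%:R * 2 ^+ n * (A * rho ^+ n).
Proof.
move=> f0 H A0 s0 sn.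
have key k : (k <= n.+1 * 2 ^ n)%N -> `|f (k%:R / 2 ^+ n)| <= k%:R * (A * rho ^+ n).
  elim: k => [|k IH] kn; first by rewrite mul0r f0 normr0 mul0r.
  rewrite -[f _](subrK (f (k%:R / 2 ^+ n))).
  apply: le_trans (ler_normD _ _) _; have -> : k.+1%:R * (A * rho ^+ n) = A * rho ^+ n + k%:R * (A * rho ^+ n).
    by rewrite -(natr1 k); ring.
  by apply: lerD; [exact: H|apply: IH; exact: ltnW].
apply: le_trans (key _ (ltnW (trunc_lt n s0 sn))) _.
have := ltnW (trunc_lt n s0 sn); rewrite -(ler_nat R) natrM natrX => h.
by rewrite ler_wpM2r// mulr_ge0// exprn_ge0// ltW// rho_gt0.
Qed.

Section Limit.
Variables (f : nat -> R -> R) (A : R).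
Hypotheses (A0 : 0 <= A) (f0 : forall m, f m 0 = 0) (fg : forall m, good (f m) A m).

(** The path [f m] is controlled only down to level m, so it is evaluated at the truncation of s of
    that level; the limit then has the full modulus. *)
Definition limpath s : R := ulim (fun m => f m (dya m (Num.max s 0))).

Lemma limpath_ubd s : 0 <= s -> ubd (fun m => f m (dya m s)).
Proof.
move=> s0; pose n := Num.truncn s.
have sn : s < n.+1%:R by exact: truncnS_gt.
apply: (@ubd_ev _ n (9 * A * rho ^+ n + n.+1%:R * 2 ^+ n * (A * rho ^+ n))) => m nm.
have g : good (f m) A m by exact: fg. 
have g' := g; rewrite -(subnKC nm) in g'.
have h1 := chain1 A0 g' s0 sn; rewrite (subnKC nm) in h1.
have h2 := good_bound (f0 m) (good_le nm g) A0 s0 sn.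
have p2 : 0 <= A * rho ^+ m by rewrite mulr_ge0// exprn_ge0// ltW// rho_gt0.
rewrite -[f m _](subrK (f m (dya n s))); apply: le_trans (ler_normD _ _) _.
by apply: lerD => //; lra.
Qed.

Lemma limpath_modulus n s s' : 0 <= s -> 0 <= s' -> s < n.+1%:R -> s' < n.+1%:R ->
  `|s - s'| <= (2 ^+ n)^-1 -> `|limpath s - limpath s'| <= 20 * A * rho ^+ n.
Proof.
move=> s0 s0' sn sn' d; rewrite /limpath (max_l s0) (max_l s0').
have u1 := limpath_ubd s0; have u2 := limpath_ubd s0'.
have key r r' : 0 <= r -> 0 <= r' -> r < n.+1%:R -> r' < n.+1%:R -> `|r - r'| <= (2 ^+ n)^-1 ->
    ulim (fun m => f m (dya m r)) <= ulim (fun m => f m (dya m r')) + 20 * A * rho ^+ n.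
  move=> r0 r0' rn rn' rr; rewrite -[X in _ + X]ulim_cst -ulimD; [|exact: limpath_ubd|exact: ubd_cst].
  apply: ulim_near_le; [exact: limpath_ubd|apply: ubdD; [exact: limpath_ubd|exact: ubd_cst]|].
  apply: ultra_eventually; exists n => // m /= nm.
  by have := chain nm (@fg m) A0 r0 r0' rn rn' rr; rewrite ler_distl => /andP[_].
by rewrite ler_distl lerBlDr !key// distrC.
Qed.

Lemma limpath_C0 : C0 (limpath : {family compact, R -> R}).
Proof.
split; last first.
  move=> t t0; rewrite /limpath (max_r t0) -[RHS]ulim_cst; congr ulim.
  by apply/funext => m; rewrite /dya mul0r truncn0 mul0r f0.
have mx (x y : R) : `|Num.max x 0 - Num.max y 0| <= `|x - y|.
  by have := lip_maxc 0 x y; rewrite mul1r.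
have E s : limpath s = limpath (Num.max s 0).
  by rewrite /limpath; congr ulim; apply/funext => m; rewrite -maxA maxxx.
move=> s; apply/cvgrPdist_le => e e0.
have r1 := near_expr (20 * A) (ltW rho_gt0) rho_lt1 e0.
have [n [ns ne]] : exists n, Num.max s 0 + 1 < n.+1%:R /\ 20 * A * rho ^+ n <= e.
  have [N _ HN] := r1; exists (maxn N (Num.truncn (Num.max s 0 + 1))); split.
    apply: lt_le_trans (truncnS_gt _) _; rewrite ler_nat ltnS leq_maxr//.
  by apply: HN; rewrite /= leq_maxl.
suff : nbhs s [set t | `|limpath s - limpath t| <= e] by [].
apply/nbhs_ballP; exists ((2 ^+ n)^-1); first by rewrite /= invr_gt0 p2_gt0.
move=> t; rewrite /ball/= => st; rewrite (E s) (E t); apply: le_trans ne.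
have d1 := le_trans (mx s t) (ltW st).
have p1 : (2 ^+ n)^-1 <= 1 :> R by rewrite invf_le1 ?p2_gt0// exprn_ege1// ler1n.
apply: limpath_modulus => //; rewrite ?le_max ?lexx ?orbT//.
  by apply: lt_trans ns; rewrite ltrDl.
by move: d1; rewrite ler_norml => /andP[d1 _]; lra.
Qed.

Lemma limpath_dyadic (j k : nat) : ulim (fun m => f m (k%:R / 2 ^+ j)) = limpath (k%:R / 2 ^+ j) /\
  ubd (fun m => f m (k%:R / 2 ^+ j)).
Proof.
have s0 : 0 <= k%:R / 2 ^+ j :> R by rewrite divr_ge0// ltW// p2_gt0.
have E m : (j <= m)%N -> dya m (k%:R / 2 ^+ j) = k%:R / 2 ^+ j.
  move=> jm; rewrite /dya; have -> : k%:R / 2 ^+ j * 2 ^+ m = (k * 2 ^ (m - j))%:R :> R.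
    rewrite -{1}(subnK jm) exprD natrM natrX [2 ^+ (m - j) * _]mulrC mulrA divfK//.
  rewrite natrK natrM natrX -{2}(subnKC jm) exprD; field.
  by rewrite !gt_eqF ?p2_gt0.
have [M HM] := limpath_ubd s0.
have ub : ubd (fun m => f m (k%:R / 2 ^+ j)).
  by apply: (@ubd_ev _ j M) => m jm; have := HM m; rewrite E.
split=> //; rewrite /limpath (max_l s0); apply: ulim_eq_near => //; first exact: limpath_ubd.
move=> e e0; apply: ultra_eventually; exists j => // m /= jm.
by rewrite E// subrr normr0 ltW.
Qed.

End Limit.

End Chaining.

(** * Daniell continuity of functionals with a fourth moment bound *)

Section Daniell.
Variable R : realType.
Local Notation Om := (Omega R).
Implicit Types (w : Om) (X Y : Om -> R).

Lemma lip_min4 : lip 4 (fun x : R => Num.min 1 (x ^+ 4)).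
Proof.
have E (x : R) : Num.min 1 (x ^+ 4) = (Num.min 1 `|x|) ^+ 4.
  have e4 : `|x| ^+ 4 = x ^+ 4 by rewrite -normrX ger0_norm// exprn_even_ge0.
  have [h|h] := leP `|x| 1; first by rewrite min_r// -e4 exprn_ile1.
  by rewrite expr1n min_l// -e4 exprn_ege1// ltW.
move=> x y; rewrite !E.
have l (a b : R) : a <= b -> a <= 1 -> Num.min 1 b - Num.min 1 a <= b - a.
  by move=> ab a1; rewrite (min_r a1) lerD2r ge_min lexx orbT.
have dd : `|Num.min 1 `|x| - Num.min 1 `|y| | <= `|x - y|.
  have h1 : `|x| - `|y| <= `|x - y| by exact: lerB_dist.
  have h2 : `|y| - `|x| <= `|x - y| by rewrite distrC; exact: lerB_dist.
  have n0 := normr_ge0 (x - y).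
  by rewrite ler_norml; case: (leP 1 `|x|) => ?; case: (leP 1 `|y|) => ?; apply/andP; split; lra.
have b (z : R) : 0 <= Num.min 1 `|z| <= 1 by rewrite le_min ler01 normr_ge0 ge_min lexx.
move: (b x) (b y) dd; set u := Num.min _ _; set v := Num.min _ _ => /andP[u0 u1] /andP[v0 v1] dd.
have -> : u ^+ 4 - v ^+ 4 = (u - v) * ((u + v) * (u ^+ 2 + v ^+ 2)) by ring.
rewrite normrM mulrC ler_pM//.
have u2 : u ^+ 2 <= 1 by exact: exprn_ile1.
have v2 : v ^+ 2 <= 1 by exact: exprn_ile1.
rewrite ger0_norm; last by rewrite mulr_ge0// addr_ge0// sqr_ge0.
have -> : (4 : R) = 2 * 2 by ring.
by rewrite ler_pM// ?addr_ge0 ?sqr_ge0//; lra.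
Qed.

(** A Lipschitz substitute for the indicator that the increment between the times [p.1.2] and [p.2]
    exceeds [p.1.1]: a value below 1 certifies that it does not. *)
Definition penalty (p : R * R * R) w : R := Num.min 1 ((p.1.1^-1 * (B p.2 w - B p.1.2 w)) ^+ 4).

Lemma penalty_ge0 p w : 0 <= penalty p w.
Proof. by rewrite /penalty le_min ler01 exprn_even_ge0. Qed.

Lemma Lip_penalty h p : (0 <= h)%E -> inc [:: p.1.2; p.2] h -> Lip h (penalty p).
Proof.
move=> h0 ip; apply: (@SL_Lip _ _ [:: p.1.2; p.2] (4 * (`|p.1.1^-1| * 2)) 1) => //; split=> //.
- by move=> w; rewrite ger0_norm ?penalty_ge0// /penalty ge_min lexx.
- move=> w w' d d0 cl; apply: le_trans (lip_min4 _ _) _; rewrite -mulrA ler_wpM2l//.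
  rewrite -mulrBr normrM -mulrA ler_wpM2l//.
  have h1 := cl p.1.2 (mem_head _ _); have h2 := cl p.2 (mem_last p.1.2 [:: p.2]).
  rewrite (_ : _ - _ = (B p.2 w - B p.2 w') - (B p.1.2 w - B p.1.2 w')); last by ring.
  by apply: le_trans (ler_normB _ _) _; lra.
Qed.

Lemma penalty_lt1 p w : 0 < p.1.1 -> penalty p w < 1 -> `|B p.2 w - B p.1.2 w| <= p.1.1.
Proof.
move=> a0; rewrite /penalty gt_min ltxx /= => h; rewrite leNgt; apply/negP => h'.
suff : 1 <= (p.1.1^-1 * (B p.2 w - B p.1.2 w)) ^+ 4 by rewrite leNgt h.
have -> x : x ^+ 4 = `|x| ^+ 4 :> R by rewrite -normrX ger0_norm// exprn_even_ge0.
by rewrite exprn_ege1// normrM normfV (gtr0_norm a0) mulrC ler_pdivlMr// mul1r ltW.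
Qed.

Definition pensum (F : nat -> seq (R * R * R)) m w : R := \sum_(j < m.+1) \sum_(p <- F j) penalty p w.

Lemma pensum_ge0 F m w : 0 <= pensum F m w.
Proof. by rewrite !sumr_ge0// => i _; rewrite sumr_ge0// => p _; exact: penalty_ge0. Qed.

Lemma pensum_ge (F : nat -> seq (R * R * R)) m w j p : (j <= m)%N -> p \in F j -> penalty p w <= pensum F m w.
Proof.
move=> jm pF; rewrite /pensum (bigD1 (Ordinal (jm : (j < m.+1)%N)))//= (big_rem _ pF)/=.
rewrite -addrA lerDl addr_ge0 ?sumr_ge0// => [q _|i _]; first exact: penalty_ge0.
by rewrite sumr_ge0// => q _; exact: penalty_ge0.
Qed.

Lemma pensum_mono F m w : pensum F m w <= pensum F m.+1 w.
Proof. by rewrite /pensum (big_ord_recr m.+1)/= lerDl sumr_ge0// => p _; exact: penalty_ge0. Qed.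

Definition dyatrip A j : seq (R * R * R) :=
  [seq (A * rho R ^+ j, k%:R / 2 ^+ j, k.+1%:R / 2 ^+ j) | k <- iota 0 (j.+1 * 2 ^ j)].

Lemma pensum_good (F : nat -> seq (R * R * R)) (A : R) m w : 0 < A -> (forall j, {subset dyatrip A j <= F j}) -> pensum F m w < 1 ->
  good (fun s : R => B s w) A m.
Proof.
move=> A0 FA h j k jm kj.
pose p : R * R * R := (A * rho R ^+ j, k%:R / 2 ^+ j, k.+1%:R / 2 ^+ j).
apply: (@penalty_lt1 p); first by rewrite /= mulr_gt0// exprn_gt0// rho_gt0.
apply: le_lt_trans h; apply: (@pensum_ge _ _ _ j) => //; apply: FA.
by apply/mapP; exists k => //; rewrite mem_iota.
Qed.

Variables (L : (Om -> R) -> R) (C : R).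
Local Notation Lp := (Lip +oo%E).
Hypotheses (LD : forall X Y, Lp X -> Lp Y -> L (fun w => X w + Y w) = L X + L Y).
Hypotheses (LZ : forall (c : R) X, Lp X -> L (fun w => c * X w) = c * L X).
Hypotheses (L1 : L (fun=> 1) = 1) (Lpos : forall X, Lp X -> (forall w, 0 <= X w) -> 0 <= L X).
Hypotheses (C0 : 0 <= C).
Hypothesis Lmom : forall s t a : R, 0 <= s -> s < t -> 0 < a ->
  L (penalty (a, s, t)) <= C * (t - s) ^+ 2 / a ^+ 4.

Lemma Lcst c : L (fun=> c) = c.
Proof. by rewrite -[RHS]mulr1 -L1 -LZ; [congr L; apply/funext => w; rewrite mulr1|exact: Lip_cst]. Qed.

Lemma Lle X Y : Lp X -> Lp Y -> (forall w, X w <= Y w) -> L X <= L Y.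
Proof.
move=> LX LY XY; have NX := LipZ (-1) LX.
have : 0 <= L (fun w => Y w + -1 * X w).
  by apply: Lpos; [exact: LipD|move=> w; rewrite mulN1r subr_ge0].
by rewrite LD// LZ// mulN1r subr_ge0.
Qed.

Lemma Lip_sum (I : Type) (r : seq I) (F : I -> Om -> R) : (forall i, Lp (F i)) ->
  Lp (fun w => \sum_(i <- r) F i w).
Proof.
move=> LF; elim: r => [|i r IH].
  by under eq_fun do rewrite big_nil; apply: Lip_cst.
by under eq_fun do rewrite big_cons; exact: LipD.
Qed.

Lemma Lsum (I : Type) (r : seq I) (F : I -> Om -> R) : (forall i, Lp (F i)) ->
  L (fun w => \sum_(i <- r) F i w) = \sum_(i <- r) L (F i).
Proof.
move=> LF; elim: r => [|i r IH].
  by under eq_fun do rewrite big_nil; rewrite big_nil Lcst.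
under eq_fun do rewrite big_cons.
by rewrite LD ?IH ?big_cons//; exact: Lip_sum.
Qed.

Definition tripok (p : R * R * R) := [/\ 0 < p.1.1, 0 <= p.1.2 & p.1.2 <= p.2].

Lemma Lip_pen p : tripok p -> Lp (penalty p).
Proof.
move=> [p0 p1 p2]; apply: Lip_penalty => // s; rewrite !inE => /orP[] /eqP ->.
  by split=> //; exact: leey.
by split; [exact: le_trans p2|exact: leey].
Qed.

Lemma Lpen p : tripok p -> L (penalty p) <= C * (p.2 - p.1.2) ^+ 2 / p.1.1 ^+ 4.
Proof.
case: p => [[a s] t] [/= a0 s0]; rewrite le_eqVlt => /predU1P[<-|st]; last exact: Lmom.
rewrite subrr expr0n mulr0 mul0r (_ : penalty _ = fun=> 0) ?Lcst//.
by apply/funext => w; rewrite /penalty /= subrr mulr0 expr0n /= min_r.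
Qed.

Lemma sum_memE (I : eqType) (r : seq I) (f : I -> R) :
  \sum_(p <- r) f p = \sum_(p <- r) if p \in r then f p else 0.
Proof. by rewrite big_seq [RHS]big_seq; apply: eq_bigr => p ->. Qed.

Lemma Lip_pensum (F : nat -> seq (R * R * R)) m : (forall j p, p \in F j -> tripok p) -> Lp (pensum F m).
Proof.
move=> ok; rewrite /pensum.
suff H j : Lp (fun w => \sum_(p <- F j) penalty p w) by exact: Lip_sum.
have -> : (fun w => \sum_(p <- F j) penalty p w) =
    fun w => \sum_(p <- F j) if p \in F j then penalty p w else 0.
  by apply/funext => w; exact: sum_memE.
by apply: Lip_sum => p; case pF : (p \in F j); [exact: Lip_pen (ok _ _ pF)|exact: Lip_cst].
Qed.

Lemma Lpensum (F : nat -> seq (R * R * R)) m : (forall j p, p \in F j -> tripok p) ->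
  L (pensum F m) <= \sum_(j < m.+1) \sum_(p <- F j) C * (p.2 - p.1.2) ^+ 2 / p.1.1 ^+ 4.
Proof.
move=> ok; pose G j w := \sum_(p <- F j) if p \in F j then penalty p w else 0.
have LG j p : Lp (fun w => if p \in F j then penalty p w else 0).
  by case pF : (p \in F j); [exact: Lip_pen (ok _ _ pF)|exact: Lip_cst].
have -> : pensum F m = fun w => \sum_(j < m.+1) G j w.
  by apply/funext => w; apply: eq_bigr => j _; exact: sum_memE.
rewrite Lsum => [|j]; last by apply: Lip_sum => p.
apply: ler_sum => j _; rewrite /G Lsum//.
rewrite big_seq [leRHS]big_seq; apply: ler_sum => p pF; rewrite pF; exact: Lpen (ok _ _ pF).
Qed.

Lemma dyatrip_ok (A : R) j p : 0 < A -> p \in dyatrip A j -> tripok p.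
Proof.
move=> A0 /mapP[k _ ->]; split=> /=; first by rewrite mulr_gt0// exprn_gt0// rho_gt0.
  by rewrite divr_ge0// ltW// p2_gt0.
by rewrite ler_pM2r ?invr_gt0 ?p2_gt0// ler_nat.
Qed.

(** The ratio [11 / (20 * rho ^+ 4)], rounded up to 21/25. The factor 11/10 absorbs the [j.+1] in
    the number of intervals of level j; the series sums to 25/4. *)
Definition xi : R := 21 / 25.

Lemma dyatrip_cost A j : 0 < A ->
  \sum_(p <- dyatrip A j) C * (p.2 - p.1.2) ^+ 2 / p.1.1 ^+ 4 <= 10 * C / A ^+ 4 * xi ^+ j.
Proof.
move=> A0; rewrite big_map /=; have r0 : 0 < rho R ^+ j by rewrite exprn_gt0// rho_gt0.
under eq_bigr => k _.
  have -> : k.+1%:R / 2 ^+ j - k%:R / 2 ^+ j = (2 ^+ j)^-1 :> R.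
    by rewrite -mulrBl -(natr1 k) addrAC subrr add0r mul1r.
  over.
rewrite big_const_seq count_predT size_iota iter_addr_0 -(mulr_natl (C * _ / _)) natrM natrX.
have -> : j.+1%:R * 2 ^+ j * (C * (2 ^+ j)^-1 ^+ 2 / (A * rho R ^+ j) ^+ 4) =
    C / A ^+ 4 * (j.+1%:R * ((2 ^+ j)^-1 * (rho R ^+ j)^-1 ^+ 4)).
  by field; rewrite !gt_eqF ?p2_gt0.
rewrite (_ : 10 * C / A ^+ 4 * xi ^+ j = C / A ^+ 4 * (10 * xi ^+ j)); last by ring.
apply: ler_wpM2l; first by rewrite divr_ge0// exprn_ge0// ltW.
have bern : j.+1%:R <= 10 * (11 / 10) ^+ j :> R.
  elim: j {r0} => [|j IH]; first by rewrite expr0; lra.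
  rewrite exprS -(natr1 j.+1); have : 1 <= (11 / 10) ^+ j :> R by rewrite exprn_ege1//; lra.
  by move: IH; set y := (11 / 10) ^+ j => ? ?; lra.
apply: le_trans (_ : 10 * (11 / 10) ^+ j * ((2 ^+ j)^-1 * (rho R ^+ j)^-1 ^+ 4) <= _).
  by rewrite ler_wpM2r// mulr_ge0// ?exprn_ge0 ?invr_ge0 ?ltW ?p2_gt0.
rewrite -mulrA ler_pM2l// -exprVn -[(rho R ^+ j)^-1]exprVn -exprM mulnC exprM -!exprMn.
rewrite lerXn2r ?nnegrE ?mulr_ge0 ?exprn_ge0 ?invr_ge0// /xi /rho; lra.
Qed.

Lemma xi_sum m : \sum_(j < m) xi ^+ j <= 25 / 4.
Proof.
suff : \sum_(j < m) xi ^+ j <= 25 / 4 - 25 / 4 * xi ^+ m.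
  have : 0 <= xi ^+ m by rewrite exprn_ge0// /xi; lra.
  by move=> ? ?; lra.
elim: m => [|m IH]; first by rewrite big_ord0 expr0; lra.
rewrite big_ord_recr /= exprS; move: IH; rewrite /xi; lra.
Qed.

Lemma near_seq (I : eqType) (T : Type) (F : set_system T) (FF : Filter F) (r : seq I) (P : I -> T -> Prop) :
  (forall i, i \in r -> F [set x | P i x]) -> F [set x | forall i, i \in r -> P i x].
Proof.
elim: r => [|i r IH] H; first by apply: filterE => m i.
have h1 := H i (mem_head _ _); have h2 := IH (fun j jr => H j (mem_behead (s := i :: r) jr)).
by apply: filterS (filterI h1 h2) => x [p1 p2] j; rewrite inE => /predU1P[->|/p2].
Qed.

(** It suffices that some [X m] is below [e / 2] plus a multiple of a sum of penalties that L makes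
    small. Otherwise each m has a path with [X m] large and penalties below 1; such paths are
    equicontinuous, and a limit path keeps every [X n] above [e / 4], against the pointwise
    convergence. *)
Theorem Daniell_cont (X : nat -> Om -> R) : (forall n, Lp (X n)) -> (forall n w, X n.+1 w <= X n w) ->
  (forall w, X n w @[n --> \oo] --> (0 : R)) -> forall e : R, 0 < e -> exists n, L (X n) <= e.
Proof.
move=> LX Xd X0 e e0.
have /choice[D /choice[K /choice[M SLX]]] n : exists D K M, inc D +oo%E /\ SL D K M (X n) by exact: Lip_SL.
have Xmn m n w : (n <= m)%N -> X m w <= X n w.
  move=> nm; rewrite -(subnKC nm); elim: (m - n)%N => [|k IH]; first by rewrite addn0.
  by rewrite addnS; exact: le_trans (Xd _ _) IH.
pose M0 := M 0%N + 1.
have M00 : 0 < M0.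
  have [_ [_ h _ _]] := SLX 0%N; rewrite /M0; lra.
have XM n w : X n w <= M0.
  apply: le_trans (Xmn _ 0%N w (leq0n _)) _; have [_ [_ _ h _]] := SLX 0%N.
  by apply: le_trans (ler_norm _) _; apply: le_trans (h w) _; rewrite lerDl.
(* All penalties together cost at most [d * (25 / 2)]: two families per level, each bounded by
   [d * xi ^+ j]. Multiplied by M0 this is [e / 4]. *)
pose d := e / (4 * (25 / 2) * M0).
have d0 : 0 < d by rewrite divr_gt0// !mulr_gt0.
have [A A0 AC] : exists2 A : R, 0 < A & 10 * C / A ^+ 4 <= d.
  have z0 : 0 <= 10 * C / d by apply: divr_ge0; [exact: mulr_ge0|exact: ltW].
  exists (1 + 10 * C / d); first by rewrite ltr_pwDl.
  set z := 10 * C / d in z0 *.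
  rewrite ler_pdivrMr; last by rewrite exprn_gt0// ltr_pwDl.
  have -> : 10 * C = d * z by rewrite /z mulrCA divff ?mulr1// gt_eqF.
  rewrite ler_pM2l//; apply: le_trans (_ : 1 + z <= _); first by rewrite lerDr.
  by apply: ler_eXnr => //; rewrite lerDl.
have K0 n : 0 <= K n by have [_ []] := SLX n.
(* The tolerated deviation at the times of [X n], weighted by its Lipschitz constant. *)
pose eta n := e / (32 * (K n + 1)).
have eta0 n : 0 < eta n by rewrite divr_gt0// mulr_gt0// ltr_wpDl.
have etaK n : K n * eta n <= e / 32.
  have k1 : 0 < K n + 1 by rewrite ltr_wpDl.
  have -> : K n * eta n = e / 32 * (K n / (K n + 1)) by rewrite /eta; field; rewrite gt_eqF.
  by rewrite ler_piMr ?ltW ?divr_gt0// ltr_pdivrMr// mul1r ltrDl.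
(* The times at which [X n] looks need not be dyadic. Each is replaced by its truncation of level
   [mm n], deep enough for three things: the modulus there is negligible for [X n], the times lie
   below the horizon, and penalizing the replacement is cheap, its cost containing the squared
   distance [4^-1 ^+ mm n]. *)
have /choice[mm Hm] n : exists k, [/\ K n * (20 * A * rho R ^+ k) <= e / 16, forall s, s \in D n -> s < k.+1%:R &
    (size (D n))%:R * (C / (eta n) ^+ 4) * (4^-1) ^+ k <= d * xi ^+ n].
  have e16 : 0 < e / 16 by rewrite divr_gt0.
  have dx : 0 < d * xi ^+ n by rewrite mulr_gt0// exprn_gt0// /xi; lra.
  have a1 := near_expr (K n * (20 * A)) (ltW (rho_gt0 R)) (rho_lt1 R) e16.
  have q0 : 0 <= 4^-1 :> R by rewrite invr_ge0.
  have q1 : 4^-1 < 1 :> R by lra.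
  have a2 := near_expr ((size (D n))%:R * (C / (eta n) ^+ 4)) q0 q1 dx.
  have [N1 _ h1] := a1; have [N2 _ h2] := a2.
  pose N3 := Num.truncn (\sum_(s <- D n) `|s|).
  exists (maxn (maxn N1 N2) N3); split.
  - by rewrite mulrA; apply: h1; rewrite /= -maxnA leq_maxl.
  - move=> s sD; apply: le_lt_trans (_ : \sum_(s <- D n) `|s| < _).
      by rewrite (big_rem _ sD)/= ler_wpDr ?sumr_ge0// ler_norm.
    by apply: lt_le_trans (truncnS_gt _) _; rewrite ler_nat ltnS leq_maxr.
  - by apply: h2; rewrite /= -maxnA maxnCA leq_maxl.
pose F j := dyatrip A j ++ [seq (eta j, dya (mm j) s, s) | s <- D j].
have Dge n s : s \in D n -> 0 <= s by move=> sD; have [h _] := SLX n; have [] := h s sD.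
have Fok j p : p \in F j -> tripok p.
  rewrite mem_cat => /orP[|/mapP[s sD ->]]; first exact: dyatrip_ok.
  by split=> //=; [exact: dya_ge0|have [] := dya_itv (mm j) (Dge _ _ sD)].
have cost m : L (pensum F m) <= d * (25 / 2).
  apply: le_trans (Lpensum m Fok) _.
  apply: le_trans (_ : \sum_(j < m.+1) 2 * d * xi ^+ j <= _); last first.
    by rewrite -mulr_sumr; have := xi_sum m.+1; rewrite -(ler_pM2l d0); lra.
  apply: ler_sum => j _; rewrite big_cat /=.
  have x0 : 0 <= xi ^+ j by rewrite exprn_ge0// /xi; lra.
  have c1 := dyatrip_cost j A0; have c1' : 10 * C / A ^+ 4 * xi ^+ j <= d * xi ^+ j by rewrite ler_wpM2r.
  have [_ _ c2] := Hm j.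
  suff : \sum_(p <- [seq (eta j, dya (mm j) s, s) | s <- D j]) C * (p.2 - p.1.2) ^+ 2 / p.1.1 ^+ 4 <= d * xi ^+ j.
    by move=> ?; lra.
  rewrite big_map /=; apply: le_trans c2.
  apply: le_trans (_ : \sum_(s <- D j) (C / eta j ^+ 4) * (4^-1) ^+ mm j <= _).
    rewrite big_seq [leRHS]big_seq; apply: ler_sum => s sD.
    rewrite mulrAC; apply: ler_wpM2l; first by rewrite divr_ge0// exprn_ge0// ltW.
    have -> : (4^-1) ^+ mm j = ((2 ^+ mm j)^-1) ^+ 2 :> R.
      by rewrite -exprVn exprAC; congr (_ ^+ _); lra.
    have [h1 _] := dya_itv (mm j) (Dge _ _ sD).
    have := dya_dist (mm j) (Dge _ _ sD); rewrite ger0_norm ?subr_ge0// => h2.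
    rewrite /= in h2 *; apply: lerXn2r h2; rewrite nnegrE; first by rewrite subr_ge0.
    by apply: ltW; rewrite invr_gt0 p2_gt0.
  by rewrite big_const_seq count_predT iter_addr_0 -(mulr_natl (C / eta j ^+ 4 * _)) mulrA.
suff [m Hmm] : exists m, forall w, X m w <= e / 2 + M0 * pensum F m w.
  exists m; have Lq := Lip_pensum m Fok.
  have := Lle (LX m) (LipD (Lip_cst (e / 2) (leey _)) (LipZ M0 Lq)) Hmm.
  rewrite LD; [|exact: Lip_cst|exact: LipZ]; rewrite Lcst LZ//.
  move=> h; apply: le_trans h _.
  have : M0 * L (pensum F m) <= M0 * (d * (25 / 2)) by rewrite ler_pM2l.
  have -> : M0 * (d * (25 / 2)) = e / 4 by rewrite /d; field; rewrite gt_eqF.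
  by move=> ?; lra.
(* From here on a failing path [w m] is fixed for every m and the limit path is built. *)
apply: contrapT => /forallNP H.
have /choice[w Hw] m : exists w, e / 2 + M0 * pensum F m w < X m w.
  have /existsNP[w /negP] := H m; rewrite -ltNge; by exists w.
have H1 m : pensum F m (w m) < 1.
  rewrite -(ltr_pM2l M00) mulr1; have := Hw m; have := XM m (w m); have : 0 < e / 2 by rewrite divr_gt0.
  by move=> ? ? ?; lra.
have fg m : good (fun s : R => B s (w m)) A m.
  by apply: (pensum_good A0 _ (H1 m)) => j p pj; rewrite mem_cat pj.
have f0 m : B 0 (w m) = 0 by exact: path_le0.
pose lp := limpath (fun m (s : R) => B s (w m)).
have [lpc lp0] := limpath_C0 (ltW A0) f0 fg.
pose om := mkpath lp.
have Bom s : B s om = lp s by apply: B_mkpath.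
suff Xom n : e / 4 <= X n om.
  have : e / 4 <= 0 by apply: (cvgr_to_ge (X0 om)); exact: nearW.
  by rewrite leNgt divr_gt0.
have [iD [_ _ _ Xn]] := SLX n; have [m1 m2 _] := Hm n.
have : \forall m \near ultra, close (D n) (20 * A * rho R ^+ mm n + 2 * eta n) om (w m).
  apply: near_seq => s sD /=; have s0 := Dge _ _ sD.
  set q := dya (mm n) s.
  have [E ub] : ulim (fun m => B q (w m)) = lp q /\ ubd (fun m => B q (w m)).
    exact: (limpath_dyadic (ltW A0) f0 fg).
  have cq : (B q (w m)) @[m --> ultra] --> lp q by rewrite -E; exact: ulim_cvg.
  have h1 : \forall m \near ultra, `|lp q - B q (w m)| <= eta n by move/cvgrPdist_le : cq; apply.
  have h2 : \forall m \near ultra, (n <= m)%N by apply: ultra_eventually; exists n.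
  near=> m.
  have t2 : `|lp q - B q (w m)| <= eta n by near: m.
  have nm : (n <= m)%N by near: m.
  have t3 : `|B s (w m) - B q (w m)| <= eta n.
    apply: (@penalty_lt1 (eta n, q, s)); [exact: eta0|apply: le_lt_trans _ (H1 m)].
    by apply: (pensum_ge _ nm); rewrite mem_cat; apply/orP; right; apply/mapP; exists s.
  have t1 : `|lp s - lp q| <= 20 * A * rho R ^+ mm n.
    have [q1 q2] := dya_itv (mm n) s0.
    apply: (limpath_modulus (ltW A0) f0 fg) => //; [exact: dya_ge0|exact: m2| |exact: dya_dist].
    by apply: le_lt_trans q1 _; exact: m2.
  rewrite /= Bom (_ : _ - _ = (lp s - lp q) + (lp q - B q (w m)) - (B s (w m) - B q (w m))); last by ring.
  apply: le_trans (ler_normB _ _) _; apply: le_trans (lerD (ler_normD _ _) (lexx _)) _.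
  by lra.
have h2 : \forall m \near ultra, (n <= m)%N by apply: ultra_eventually; exists n.
move=> h1; have [m [c1 c2]] := filter_ex (filterI h1 h2).
have dd : 0 <= 20 * A * rho R ^+ mm n + 2 * eta n.
  have r0 : 0 <= rho R ^+ mm n by rewrite exprn_ge0// ltW// rho_gt0.
  have := mulr_ge0 (ltW A0) r0; have := ltW (eta0 n); lra.
have := Xn _ _ _ dd c1; rewrite mulrDr ler_distl => /andP[t1 _].
have t2 := Xmn m n (w m) c2; have t3 := Hw m.
have t4 : 0 <= M0 * pensum F m (w m) by rewrite mulr_ge0 ?pensum_ge0// ltW.
have t5 := etaK n; rewrite mulrCA in t1; lra.
Unshelve. all: by end_near. Qed.

End Daniell.

(** * The Borel field of the path space *)

Section Borel.
Variable R : realType.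
Local Notation Om := (Omega R).
Implicit Types (w u v : Om) (s t c : R).

Definition near_unif (f : R -> R) : set_system (R -> R) := fun A =>
  exists n : nat, [set g | forall s, `|s| <= n%:R -> `|f s - g s| < n.+1%:R^-1] `<=` A.

Lemma near_unif_filter f : Filter (near_unif f).
Proof.
split; first by exists 0%N.
- move=> P Q [n Pn] [m Qm]; exists (maxn n m) => g Hg; split.
    apply: Pn => s sn; apply: lt_le_trans (Hg s _) _.
      by apply: le_trans sn _; rewrite ler_nat leq_maxl.
    by rewrite lef_pV2 ?posrE ?ltr0n// ler_nat ltnS leq_maxl.
  apply: Qm => s sn; apply: lt_le_trans (Hg s _) _.
    by apply: le_trans sn _; rewrite ler_nat leq_maxr.
  by rewrite lef_pV2 ?posrE ?ltr0n// ler_nat ltnS leq_maxr.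
- by move=> P Q PQ [n Pn]; exists n; exact: subset_trans PQ.
Qed.

Lemma near_unif_cvg f : {family compact, near_unif f --> f}.
Proof.
have FF := near_unif_filter f; apply/fam_cvgP => K cK P /uniform_nbhs[E [entE EP]].
have [e e0 He] : exists2 e : R, 0 < e & [set xy : R * R | ball xy.1 e xy.2] `<=` E.
  by move: entE; rewrite -entourage_ballE => -[e /= e0 h]; exists e.
have [M [_ HM]] := compact_bounded cK.
have HM' : forall s, K s -> `|s| <= `|M| + 1.
  by apply: HM; apply: le_lt_trans (ler_norm _) _; rewrite ltrDl.
exists (maxn (Num.truncn (`|M| + 1)).+1 (Num.truncn e^-1)).
move=> g Hg; apply: EP => s Ks; apply: He => /=; rewrite /ball/=.
apply: lt_le_trans (Hg s _) _.
  apply: le_trans (HM' s Ks) _; apply: ltW; apply: lt_le_trans (truncnS_gt _) _.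
  by rewrite ler_nat leq_maxl.
rewrite invf_ple ?posrE ?ltr0n//; apply: ltW; apply: lt_le_trans (truncnS_gt _) _.
by rewrite ler_nat ltnS leq_maxr.
Qed.

Lemma open_unif (O : set (pathspace R)) v : open O -> O v ->
  exists (n : nat), forall u, (forall s, 0 <= s -> s <= n%:R -> `|B s v - B s u| < n.+1%:R^-1) -> O u.
Proof.
case=> O' oO' <- Ov; have FF := near_unif_filter (\val (v : pathspace R)).
have [n Hn] : near_unif (\val (v : pathspace R)) O'.
  by apply: (@near_unif_cvg (\val (v : pathspace R))); exact: open_nbhs_nbhs.
exists n => u Hu; apply: Hn => s sn.
have [s0|/ltW s0] := leP 0 s; first by apply: Hu => //; apply: le_trans (ler_norm _) sn.
change (`|B s v - B s u| < n.+1%:R^-1); rewrite (path_le0 v s0) (path_le0 u s0) subrr normr0.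
by rewrite invr_gt0 ltr0n.
Qed.

Lemma open_coord s c : open ([set w | c < B s w] : set (pathspace R)).
Proof.
exists [set g : {family compact, R -> R} | c < g s] => //.
rewrite openE => g /= cg; rewrite /interior.
have ent : entourage [set xy : R * R | ball xy.1 (g s - c) xy.2].
  by rewrite -entourage_ballE; exists (g s - c) => //=; rewrite subr_gt0.
have := fam_nbhs g ent (@compact_set1 _ s).
apply: filterS => h /(_ s erefl) /=; rewrite /ball/= => hh.
by have := ler_norm (g s - h s); lra.
Qed.

Lemma measurable_B s : measurable_fun setT (B s : Om -> R).
Proof.
apply: (measurability _ (RGenOInfty.measurableE R)) => _ [_ [c ->] <-].
rewrite setTI; apply: sub_sigma_algebra.
rewrite (_ : _ @^-1` _ = [set w | c < B s w]); first exact: open_coord.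
by apply/seteqP; split=> w /=; rewrite in_itv /= andbT.
Qed.

Lemma unif_cont (f : R -> R) (a e : R) : continuous f -> 0 < e ->
  \forall m \near \oo, forall s t, 0 <= s -> s <= a -> `|s - t| <= (2 ^+ m)^-1 -> `|f s - f t| <= e.
Proof.
move=> cf e0; have : compact `[0, a] by exact: segment_compact.
move/compact_near_coveringP/(_ nat \oo (fun m s => forall t, `|s - t| <= (2 ^+ m)^-1 -> `|f s - f t| <= e)).
move=> /(_ _ _)[]//; last first.
  by move=> N _ HN; exists N => // m Nm s t s0 sa; apply: HN => //; rewrite /= in_itv /= s0.
move=> s _; have e20 : 0 < e / 2 by rewrite divr_gt0.
have /cvgrPdist_le/(_ _ e20)/nbhs_ballP[d /= d0 Hd] := cf s.
have d20 : 0 < d / 2 by rewrite divr_gt0.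
exists (ball s (d / 2), [set m | (2 ^+ m)^-1 < d / 2]); first split => /=.
- exact: nbhsx_ballx.
- have h0 : 0 <= 2^-1 :> R by rewrite invr_ge0.
  have h1 : 2^-1 < 1 :> R by lra.
  have d40 : 0 < d / 4 by rewrite divr_gt0.
  have := near_expr 1 h0 h1 d40; apply: filterS => m; rewrite mul1r exprVn => hm /=.
  by apply: le_lt_trans hm _; lra.
- move=> [s' m] /= [ss mm] t st; rewrite /ball/= in ss.
  have t1 : `|f s - f s'| <= e / 2 by apply: Hd; rewrite /ball/=; lra.
  have t2 : `|f s - f t| <= e / 2.
    apply: Hd; rewrite /ball/= (_ : s - t = (s - s') + (s' - t)); last by ring.
    by apply: le_lt_trans (ler_normD _ _) _; lra.
  rewrite (_ : f s' - f t = (f s - f t) - (f s - f s')); last by ring.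
  by apply: le_trans (ler_normB _ _) _; lra.
Qed.

Definition code := (nat * nat * nat * seq rat)%type.

(** Conditions at dyadic times only, hence measurable for the coordinates; by continuity two paths
    of a cell differ by at most [4 / l.+1] on [0, n]. There are countably many codes, and an open
    set is the union of the cells that it contains. *)
Definition cell (c : code) : set Om := let: (n, j, l, a) := c in
  [set w | forall k, (k < n.+1 * 2 ^ j)%N -> `|B (k%:R / 2 ^+ j) w - ratr a`_k| <= l.+1%:R^-1 /\
    forall i i', (i' <= 2 ^ i)%N -> `|B ((k%:R + i'%:R / 2 ^+ i) / 2 ^+ j) w - B (k%:R / 2 ^+ j) w| <= l.+1%:R^-1].

Lemma cell_dist n j l a u v s : cell (n, j, l, a) u -> cell (n, j, l, a) v -> 0 <= s -> s <= n%:R ->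
  `|B s u - B s v| <= 4 * l.+1%:R^-1.
Proof.
move=> Hu Hv s0 sn; have p0 : 0 < 2 ^+ j :> R by exact: p2_gt0.
have sp : 0 <= s * 2 ^+ j by rewrite mulr_ge0// ltW.
pose k := Num.truncn (s * 2 ^+ j); have /andP[k1 k2] := truncn_itv sp; rewrite -/k in k1 k2.
have kn : (k < n.+1 * 2 ^ j)%N.
  by apply: trunc_lt => //; apply: le_lt_trans sn _; rewrite ltr_nat.
pose r := s * 2 ^+ j - k%:R.
have r0 : 0 <= r by rewrite subr_ge0.
have r1 : r < 1 by rewrite ltrBlDr addrC natr1.
have sE : s = (k%:R + r) / 2 ^+ j by rewrite /r addrC subrK mulfK// gt_eqF.
have key w : cell (n, j, l, a) w -> `|B s w - B (k%:R / 2 ^+ j) w| <= l.+1%:R^-1.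
  move=> Hw; have [_ h] := Hw k kn.
  have : `|B ((k%:R + dya i r) / 2 ^+ j) w - B (k%:R / 2 ^+ j) w| @[i --> \oo] --> `|B s w - B (k%:R / 2 ^+ j) w|.
    apply: cvg_norm; apply: cvgB; last exact: cvg_cst.
    have h1 : (k%:R + dya i r) / 2 ^+ j @[i --> \oo] --> s.
      rewrite [X in _ --> X]sE; apply: cvgM; last exact: cvg_cst.
      by apply: cvgD; [exact: cvg_cst|exact: cvg_dya].
    exact: (cvg_comp _ _ h1 (@path_cont _ w s)).
  move=> /cvgr_to_le; apply; apply: nearW => i; apply: h.
  have : (Num.truncn (r * 2 ^+ i) < 1 * 2 ^ i)%N by apply: trunc_lt.
  by rewrite mul1n => /ltnW.
have [hu _] := Hu k kn; have [hv _] := Hv k kn.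
have ku := key _ Hu; have kv := key _ Hv.
set lv := l.+1%:R^-1 in hu hv ku kv *.
rewrite (_ : B s u - B s v = (B s u - B (k%:R / 2 ^+ j) u) + (B (k%:R / 2 ^+ j) u - ratr a`_k) -
  (B (k%:R / 2 ^+ j) v - ratr a`_k) - (B s v - B (k%:R / 2 ^+ j) v)); last by ring.
apply: le_trans (ler_normB _ _) _; apply: le_trans (lerD (ler_normB _ _) (lexx _)) _.
apply: le_trans (lerD (lerD (ler_normD _ _) (lexx _)) (lexx _)) _; lra.
Qed.

Lemma cell_exists n l v : exists j a, cell (n, j, l, a) v.
Proof.
have e0 : 0 < l.+1%:R^-1 :> R by rewrite invr_gt0 ltr0n.
have [j _ Hj] := unif_cont n.+1%:R (@path_cont _ v) e0.
have /(_ j (leqnn j)) {}Hj := Hj.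
have p0 : 0 < 2 ^+ j :> R by exact: p2_gt0.
have /choice[q Hq] k : exists q : rat, `|B (k%:R / 2 ^+ j) v - ratr q| <= l.+1%:R^-1.
  have h : B (k%:R / 2 ^+ j) v - l.+1%:R^-1 < B (k%:R / 2 ^+ j) v + l.+1%:R^-1.
    by rewrite ltrBlDr -addrA ltrDl addr_gt0.
  have [q] := rat_in_itvoo h.
  rewrite in_itv /= => /andP[q1 q2]; exists q.
  by rewrite distrC ler_distl (ltW q1) (ltW q2).
exists j, (mkseq q (n.+1 * 2 ^ j)) => k kn; split; first by rewrite nth_mkseq.
move=> i i' ii; rewrite distrC.
have kn' : k%:R <= n.+1%:R * 2 ^+ j :> R by rewrite -natrX -natrM ler_nat ltnW.
apply: Hj; [by apply: divr_ge0 => //; exact: ltW|by rewrite ler_pdivrMr|].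
have i0 : 0 <= i'%:R / 2 ^+ i / 2 ^+ j :> R by apply: divr_ge0; [apply: divr_ge0 => //; apply: ltW; exact: p2_gt0|exact: ltW].
rewrite mulrDl opprD addNKr normrN ger0_norm//.
apply: ler_piMl; first by rewrite invr_ge0 ltW.
by rewrite ler_pdivrMr ?p2_gt0// mul1r -natrX ler_nat.
Qed.

Lemma open_cells (O : set (pathspace R)) : open O ->
  O = \bigcup_(c in [set c | cell c `<=` O]) cell c.
Proof.
move=> oO; apply/seteqP; split=> [v Ov|v [c cO cv]]; last exact: cO.
have [n Hn] := open_unif oO Ov.
have [j [a Ha]] := cell_exists n (4 * n.+1) v.
exists (n, j, (4 * n.+1)%N, a) => // u Hu; apply: Hn => s s0 sn.
apply: le_lt_trans (cell_dist Ha Hu s0 sn) _.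
have n0 : 0 < n.+1%:R :> R by rewrite ltr0n.
rewrite -(natr1 (4 * n.+1)) natrM ltr_pdivrMr; last by rewrite addr_gt0// mulr_gt0.
by rewrite mulrC ltr_pdivlMr// ltrDl.
Qed.

Lemma measurable_norm_le d (U : measurableType d) (f : U -> R) c :
  measurable_fun setT f -> measurable [set w | `|f w| <= c].
Proof.
move=> mf; have := mf measurableT _ (measurable_itv `[- c, c]).
rewrite setTI (_ : _ @^-1` _ = [set w | `|f w| <= c])//.
by apply/seteqP; split=> w /=; rewrite in_itv /= ler_norml.
Qed.

Section Gen.
Variable G : set (set Om).
Hypotheses (sG : sigma_algebra setT G) (Gc : forall s c, 0 <= s -> G [set w | c < B s w]).

Let T := g_sigma_algebraType G.

Lemma G_measurable (A : set T) : measurable A <-> G A.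
Proof. by rewrite /measurable /= sigma_algebra_id. Qed.

Lemma G_measurable_B s : 0 <= s -> measurable_fun setT (B s : T -> R).
Proof.
move=> s0; apply: (measurability _ (RGenOInfty.measurableE R)) => _ [_ [c ->] <-].
rewrite setTI; apply/G_measurable.
rewrite (_ : _ @^-1` _ = [set w | c < B s w]); first exact: Gc.
by apply/seteqP; split=> w /=; rewrite in_itv /= andbT.
Qed.

Lemma cell_G (c : code) : G (cell c).
Proof.
case: c => [[[n j] l] a]; apply/G_measurable.
have p0 : 0 < 2 ^+ j :> R by exact: p2_gt0.
rewrite (_ : cell _ = \bigcap_(k in [set k | (k < n.+1 * 2 ^ j)%N])
   ([set w : T | `|B (k%:R / 2 ^+ j) w - ratr a`_k| <= l.+1%:R^-1] `&`
   \bigcap_i \bigcap_(i' in [set i' | (i' <= 2 ^ i)%N])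
     [set w : T | `|B ((k%:R + i'%:R / 2 ^+ i) / 2 ^+ j) w - B (k%:R / 2 ^+ j) w| <= l.+1%:R^-1])); last first.
  apply/seteqP; split=> w H k kn; have [h1 h2] := H k kn; split=> //.
    by move=> i _ i' ii; exact: h2.
  by move=> i i' ii; exact: (h2 i).
apply: bigcap_measurable => [|k _]; first by exists 0%N; rewrite /= muln_gt0 expn_gt0.
have k0 : 0 <= k%:R / 2 ^+ j :> R by apply: divr_ge0 => //; exact: ltW.
apply: measurableI.
  by apply: measurable_norm_le; apply: measurable_funB => //; exact: G_measurable_B.
apply: bigcap_measurable => [|i _]; first by exists 0%N.
apply: bigcap_measurable => [|i' _]; first by exists 0%N.
apply: measurable_norm_le; apply: measurable_funB; last exact: G_measurable_B.
by apply: G_measurable_B; apply: divr_ge0; [apply: addr_ge0 => //; apply: divr_ge0 => //; apply: ltW; exact: p2_gt0|exact: ltW].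
Qed.

(** The induction principle for Borel sets of paths: a sigma-algebra that contains the half-spaces
    of the coordinates contains every open set, as a countable union of cells. *)
Lemma Borel_sub : @measurable _ Om `<=` G.
Proof.
apply: smallest_sub => // O oO; rewrite (open_cells oO).
have -> : \bigcup_(c in [set c | cell c `<=` O]) cell c =
   \bigcup_n (if (unpickle n : option code) is Some c then
      if `[< cell c `<=` O >] then cell c else set0 else set0).
  apply/seteqP; split=> [w [c cO cw]|w [n _]].
    exists (pickle c); first exact: Logic.I.
    by rewrite pickleK; case: asboolP.
  by case: unpickle => // c; case: asboolP => // cO cw; exists c.
apply/G_measurable; apply: bigcupT_measurable => n.
case: unpickle => [c|]; last exact: measurable0.
case: asboolP => _; last exact: measurable0.
by apply/G_measurable; exact: cell_G.
Qed.

End Gen.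

End Borel.

(** * Measures from positive functionals *)

Section Repr.
Variable R : realType.
Local Notation Om := (Omega R).
Local Notation Lp := (Lip (R := R) +oo%E).
Implicit Types (w : Om) (X Y Z : Om -> R) (A : set Om) (P : probability Om R).

Lemma near_coord s w (e : R) : 0 < e -> nbhs (w : pathspace R) [set u : pathspace R | `|B s w - B s u| < e].
Proof.
move=> e0; have ent : entourage [set xy : R * R | ball xy.1 e xy.2].
  by rewrite -entourage_ballE; exists e.
have h := fam_nbhs (\val (w : pathspace R)) ent (@compact_set1 _ s).
have : nbhs (w : pathspace R) (set_val @^-1` [set g : {family compact, R -> R} | ball (B s w) e (g s)]).
  apply: (@initial_continuous (C0 (R:=R)) {family compact, R -> R} set_val).
  by apply: filterS h => g /(_ s erefl).
by apply: filterS => u.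
Qed.

Lemma Lip_continuous h X : Lip h X -> continuous (X : pathspace R -> R).
Proof.
move=> /Lip_SL[D [K [M [_ [K0 _ _ XK]]]]] w U /nbhs_ballP[e /= e0 He].
have d0 : 0 < e / (K + 1) by rewrite divr_gt0// ltr_wpDl.
have : nbhs (w : pathspace R) [set u : pathspace R | close D (e / (K + 1)) w u].
  have FF := @nbhs_filter (pathspace R) w.
  by apply: (@near_seq _ _ _ FF) => s _; apply: (@filterS _ _ FF _ _ _ (near_coord s w d0)) => u; exact: ltW.
apply: (@filterS _ _ (@nbhs_filter (pathspace R) w)) => u /(XK _ _ _ (ltW d0)) h2; apply: He; rewrite /ball/=.
apply: le_lt_trans h2 _; rewrite mulrA ltr_pdivrMr ?ltr_wpDl// mulrC ltr_pM2l// ltrDl//.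
Qed.

Lemma Lip_measurable h X : Lip h X -> measurable_fun setT X.
Proof.
move=> /Lip_continuous cX.
apply: (measurability _ (RGenOInfty.measurableE R)) => _ [_ [c ->] <-].
rewrite setTI; apply: sub_sigma_algebra.
apply: (@open_comp (pathspace R) R^o X) => [w _|]; first exact: cX.
by rewrite set_itvE; exact: open_gt.
Qed.

Record posfun (L : (Om -> R) -> R) (C : R) : Prop := Posfun {
  pfD : forall X Y, Lp X -> Lp Y -> L (fun w => X w + Y w) = L X + L Y;
  pfZ : forall (c : R) X, Lp X -> L (fun w => c * X w) = c * L X;
  pf1 : L (fun=> 1) = 1;
  pf_pos : forall X, Lp X -> (forall w, 0 <= X w) -> 0 <= L X;
  pf_C : 0 <= C;
  pf_mom : forall s t a : R, 0 <= s -> s < t -> 0 < a ->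
    L (penalty (a, s, t)) <= C * (t - s) ^+ 2 / a ^+ 4 }.

Variables (L : (Om -> R) -> R) (C : R).
Hypothesis PL : posfun L C.
Let LD := pfD PL.
Let LZ := pfZ PL.
Let L1 := pf1 PL.
Let Lpos := pf_pos PL.
Lemma pf_le X Y : Lp X -> Lp Y -> (forall w, X w <= Y w) -> L X <= L Y.
Proof. exact: Lle. Qed.

(** Increasing sequences of nonnegative cylinder functionals whose limit is at least 1 on A. The
    infimum of the limits of L over them is the Daniell outer measure. *)
Definition upper A : set (nat -> Om -> R) := [set U | [/\ forall n, Lp (U n), forall n w, 0 <= U n w,
  forall n w, U n w <= U n.+1 w & forall w, A w -> forall e, 0 < e -> exists n, 1 - e < U n w]].

Definition Lsup (U : nat -> Om -> R) : \bar R := ereal_sup [set (L (U n))%:E | n in setT].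

Lemma Lsup_ge0 U : (forall n, Lp (U n)) -> (forall n w, 0 <= U n w) -> (0 <= Lsup U)%E.
Proof.
move=> LU U0; apply: le_trans (_ : (L (U 0%N))%:E <= _)%E; first by rewrite lee_fin; apply: Lpos.
by apply: ereal_sup_ubound; exists 0%N.
Qed.

Definition outer A : \bar R := ereal_inf [set Lsup U | U in upper A].

Lemma outer_ge0 A : (0 <= outer A)%E.
Proof.
by apply: le_ereal_inf_tmp => _ [U [LU U0 _ _] <-]; exact: Lsup_ge0.
Qed.

Lemma outer_le_L A X : Lp X -> (forall w, 0 <= X w) -> (forall w, A w -> 1 <= X w) -> (outer A <= (L X)%:E)%E.
Proof.
move=> LX X0 XA; apply: ereal_inf_lbound; exists (fun=> X).
  split=> // w Aw e e0; exists 0%N; apply: lt_le_trans (XA w Aw); lra.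
by apply/eqP; rewrite eq_le; apply/andP; split;
  [apply: ge_ereal_sup => _ [n _ <-]|apply: ereal_sup_ubound; exists 0%N].
Qed.

Lemma outer_le1 A : (outer A <= 1%:E)%E.
Proof. by rewrite -[in X in (_ <= X%:E)%E]L1; apply: outer_le_L => //; exact: Lip_cst. Qed.

Lemma outer_fin A : outer A \is a fin_num.
Proof. by rewrite ge0_fin_numE ?outer_ge0//; apply: le_lt_trans (outer_le1 A) _; rewrite ltry. Qed.

(** The positive parts of [X - U n] decrease to 0 everywhere, so Daniell continuity makes their
    L-values vanish. This is the only bound from below for [outer]. *)
Lemma L_le_outer A X : Lp X -> (forall w, X w <= 1) -> (forall w, ~ A w -> X w <= 0) -> ((L X)%:E <= outer A)%E.
Proof.
move=> LX X1 XA; apply: le_ereal_inf_tmp => _ [U [LU U0 Um UA] <-].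
apply/lee_addgt0Pr => e e0.
pose Y n w := Num.max (X w - U n w) 0.
have LY n : Lp (Y n) by apply: Lip_maxc; apply: LipD => //; exact: LipN.
have Y0 n w : 0 <= Y n w by rewrite /Y le_max lexx orbT.
have Ymono n m w : (n <= m)%N -> Y m w <= Y n w.
  move=> /subnKC <-; elim: (m - n)%N => [|k IH]; first by rewrite addn0.
  rewrite addnS; apply: le_trans _ IH; rewrite /Y ge_max !le_max lexx !orbT andbT.
  by rewrite lerB// Um.
have [n Hn] : exists n, L (Y n) <= e.
  apply: (Daniell_cont LD LZ L1 Lpos (pf_C PL) (pf_mom PL)) => //.
    by move=> n w; exact: Ymono.
  move=> w; apply/cvgrPdist_le => d d0; have [Aw|nAw] := pselect (A w).
    have [n Hn] := UA w Aw d d0; exists n => // m /= nm.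
    rewrite sub0r normrN ger0_norm//; apply: le_trans (Ymono _ _ w nm) _.
    by rewrite /Y ge_max (ltW d0) andbT; have := X1 w; lra.
  apply: nearW => n; rewrite /Y (_ : Num.max _ _ = 0) ?subrr ?normr0 ?ltW//.
  by apply: max_r; have := XA w nAw; have := U0 n w; lra.
apply: le_trans (_ : (L (U n))%:E + e%:E <= _)%E; last first.
  by apply: leeD2r; apply: ereal_sup_ubound; exists n.
rewrite -EFinD lee_fin; apply: le_trans (_ : L (U n) + L (Y n) <= _); last by rewrite lerD2l.
rewrite -LD//; apply: pf_le => //; first exact: LipD.
by move=> w; rewrite addrC -lerBlDr /Y le_max lexx.
Qed.

Lemma outer0 : outer set0 = 0%E.
Proof.
apply/eqP; rewrite eq_le outer_ge0 andbT.
rewrite (_ : 0%E = (L (fun=> 0))%:E); last by rewrite (Lcst LZ L1).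
by apply: outer_le_L => //; exact: Lip_cst.
Qed.

Lemma le_outer : {homo outer : A B / A `<=` B >-> (A <= B)%E}.
Proof.
move=> A A' AA; apply: ereal_inf_le_tmp => _ [U [h1 h2 h3 h4] <-]; exists U => //.
by split=> // w /AA; exact: h4.
Qed.

Lemma outer_sub : sigma_subadditive outer.
Proof.
move=> F; apply/lee_addgt0Pr => e e0.
have /choice[U HU] i : exists U, upper (F i) U /\ (Lsup U <= outer (F i) + (e / (2 ^ i.+1)%:R)%:E)%E.
  have e'0 : 0 < e / (2 ^ i.+1)%:R by rewrite divr_gt0// ltr0n expn_gt0.
  have [_ [U UF <-] h] := lb_ereal_inf_adherent e'0 (outer_fin (F i)).
  by exists U; split=> //; exact: ltW.
pose V n w := \sum_(i < n.+1) U i n w.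
have LU i n : Lp (U i n) by have [[]] := HU i.
have U0 i n w : 0 <= U i n w by have [[_ h]] := HU i.
have Um i n w : U i n w <= U i n.+1 w by have [[_ _ h]] := HU i.
have LV n : Lp (V n) by apply: Lip_sum.
have mono i n m w : (n <= m)%N -> U i n w <= U i m w.
  move=> /subnKC <-; elim: (m - n)%N => [|k IH]; first by rewrite addn0.
  by rewrite addnS; exact: le_trans IH _.
apply: le_trans (_ : Lsup V <= _)%E.
  apply: ereal_inf_lbound; exists V => //; split=> //.
  - by move=> n w; rewrite sumr_ge0.
  - by move=> n w; rewrite /V (big_ord_recr n.+1)/= ler_wpDr//; apply: ler_sum => i _; exact: Um.
  - move=> w [i _ Fi] d d0; have [[_ _ _ /(_ w Fi d d0)[n Hn]] _] := HU i.
    exists (maxn i n); apply: lt_le_trans Hn _.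
    have im : (i < (maxn i n).+1)%N by rewrite ltnS leq_maxl.
    rewrite /V (bigD1 (Ordinal im))//=; apply: le_trans (mono i n (maxn i n) w _) _.
      by rewrite leq_maxr.
    by rewrite lerDl sumr_ge0.
apply: ge_ereal_sup => _ [n _ <-].
rewrite /V (Lsum LD LZ L1)// -sumEFin.
apply: le_trans (_ : \sum_(i < n.+1) (outer (F i) + (e / (2 ^ i.+1)%:R)%:E) <= _)%E.
  apply: lee_sum => i _; have [_ h] := HU i; apply: le_trans h.
  by apply: ereal_sup_ubound; exists n.
have ge i : (0 <= (e / (2 ^ i.+1)%:R)%:E)%E by rewrite lee_fin divr_ge0// ltW.
rewrite big_split /=; apply: leeD.
  rewrite -(big_mkord xpredT (fun i => outer (F i))).
  by apply: nneseries_lim_ge => i _ _; exact: outer_ge0.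
rewrite -(big_mkord xpredT (fun i => (e / (2 ^ i.+1)%:R)%:E)).
apply: le_trans (epsilon_trick0 xpredT (ltW e0)).
by apply: nneseries_lim_ge => i _ _; exact: ge.
Qed.

Let om : {outer_measure set Om -> \bar R} :=
  HB.pack outer (isOuterMeasure.Build R Om outer outer0 outer_ge0 le_outer outer_sub).

Lemma Lip_clamp h X (a b : R) : Lip h X -> Lip h (fun w => Num.max (Num.min (X w) b) a).
Proof.
by move=> LX; apply: Lip_maxc; apply: Lip_min => //; apply: Lip_cst; exact: LipP0 LX.
Qed.

(** The functionals [g k] increase to the indicator of [0 < Z]. A competitor U for A splits into
    [U * g] and [U * (1 - g)], competitors for the two parts; k is fixed for the second one before n
    grows. *)
Lemma cara_pos Z : Lp Z -> outer.-caratheodory [set w | 0 < Z w].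
Proof.
move=> LZ'; apply: (@le_caratheodory_measurable _ _ om) => A /=.
set O := [set w | 0 < Z w].
pose g (k : nat) w := Num.max (Num.min (k%:R * Z w) 1) 0.
have Lg k : Lp (g k) by apply: Lip_clamp; exact: LipZ.
have g0 k w : 0 <= g k w by rewrite le_max lexx orbT.
have g1 k w : g k w <= 1 by rewrite /g ge_max ler01 ge_min lexx orbT.
have gm k k' w : (k <= k')%N -> g k w <= g k' w.
  move=> kk; have [Z0|Z0] := leP 0 (Z w).
    rewrite /g ge_max !le_max lexx orbT andbT le_min !ge_min lexx orbT andbT.
    by rewrite ler_wpM2r ?ler_nat.
  rewrite /g ge_max !le_max lexx !orbT andbT; apply/orP; right; rewrite ge_min; apply/orP; left.
  by rewrite mulr_ge0_le0// ltW.
have gO w : ~ O w -> forall k, g k w = 0.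
  move=> /negP; rewrite -leNgt => Z0 k; apply: max_r; rewrite ge_min; apply/orP; left.
  by rewrite mulr_ge0_le0.
apply: le_ereal_inf_tmp => _ [U [LU U0 Um UA] <-].
have mono n m w : (n <= m)%N -> U n w <= U m w.
  move=> /subnKC <-; elim: (m - n)%N => [|k IH]; first by rewrite addn0.
  by rewrite addnS; exact: le_trans IH _.
pose V n w := U n w * g n w.
have LV n : Lp (V n) by exact: LipM.
have S1 : (outer (A `&` O) <= Lsup V)%E.
  apply: ereal_inf_lbound; exists V => //; split=> //.
  - by move=> n w; rewrite mulr_ge0.
  - by move=> n w; rewrite ler_pM// gm.
  - move=> w [Aw Ow] e e0; have [n Hn] := UA w Aw e e0.
    pose N := maxn n (Num.truncn (Z w)^-1).+1.
    exists N; rewrite /V; have -> : g N w = 1.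
      rewrite /g (@min_r _ _ _ 1) ?max_l//.
      rewrite -ler_pdivrMr// mul1r; apply: ltW; apply: lt_le_trans (truncnS_gt _) _.
      by rewrite ler_nat leq_maxr.
    by rewrite mulr1; apply: lt_le_trans Hn _; apply: mono; rewrite leq_maxl.
have S2 k : (outer (A `&` ~` O) <= Lsup (fun n w => U n w * (1 - g k w))%R)%E.
  apply: ereal_inf_lbound; exists (fun n w => U n w * (1 - g k w)) => //; split=> //.
  - by move=> n; apply: LipM => //; apply: LipD; [exact: Lip_cst|exact: LipN].
  - by move=> n w; rewrite mulr_ge0// subr_ge0.
  - by move=> n w; rewrite ler_wpM2r// subr_ge0.
  - move=> w [Aw Ow] e e0; have [n Hn] := UA w Aw e e0.
    by exists n; rewrite gO// subr0 mulr1.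
have [->|fin] := eqVneq (Lsup U) +oo%E; first by rewrite leey.
have finU : (Lsup U < +oo)%E by rewrite lt_neqAle fin leey.
have VU : (Lsup V <= Lsup U)%E.
  apply: ge_ereal_sup => _ [n _ <-]; apply: le_trans (_ : (L (U n))%:E <= _)%E.
    by rewrite lee_fin; apply: pf_le => // w; rewrite /V ler_piMr.
  by apply: ereal_sup_ubound; exists n.
have finV : Lsup V \is a fin_num.
  rewrite ge0_fin_numE; first exact: le_lt_trans finU.
  by apply: Lsup_ge0 => // n w; rewrite /V mulr_ge0.
apply/lee_addgt0Pr => e e0.
have [_ [k _ <-] Hk] := ub_ereal_sup_adherent e0 finV.
apply: le_trans (leeD S1 (S2 k)) _.
rewrite addeC -leeBrDr//; apply: ge_ereal_sup => _ [n _ <-].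
rewrite leeBrDr//.
pose m := maxn n k.
apply: le_trans (_ : (L (fun w => U m w * (1 - g k w))%R)%:E + ((L (V k))%:E + e%:E) <= _)%E.
  apply: leeD.
    rewrite lee_fin; apply: pf_le.
    - by apply: LipM => //; apply: LipD; [exact: Lip_cst|exact: LipN].
    - by apply: LipM => //; apply: LipD; [exact: Lip_cst|exact: LipN].
    - by move=> w; rewrite ler_wpM2r ?subr_ge0// mono// leq_maxl.
  by rewrite -leeBlDr//; exact: ltW.
apply: le_trans (_ : (L (U m))%:E + e%:E <= _)%E; last first.
  by apply: leeD2r; apply: ereal_sup_ubound; exists m.
rewrite addeA; apply: leeD2r; rewrite -EFinD lee_fin.
rewrite -LD//; last by apply: LipM => //; apply: LipD; [exact: Lip_cst|exact: LipN].
apply: pf_le => //.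
  by apply: LipD => //; apply: LipM => //; apply: LipD; [exact: Lip_cst|exact: LipN].
move=> w; rewrite /V mulrBr mulr1 -addrA gerDl addrC subr_le0 ler_wpM2r//.
by apply: mono; rewrite leq_maxr.
Qed.

Lemma Borel_cara : @measurable _ Om `<=` outer.-caratheodory.
Proof.
have := Borel_sub; move=> /(_ _ outer.-caratheodory); apply.
  have [h0 hC hU] : [/\ outer.-caratheodory set0, forall A, outer.-caratheodory A -> outer.-caratheodory (~` A) &
     forall A : (set Om)^nat, (forall n, outer.-caratheodory (A n)) -> outer.-caratheodory (\bigcup_k A k)].
    split; [exact: (caratheodory_measurable_set0 om)|exact: (@caratheodory_measurable_setC _ _ om)|].
    exact: (@caratheodory_measurable_bigcup _ _ om).
  by split=> // A cA; rewrite setTD; exact: hC.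
move=> s c s0; rewrite (_ : [set w | _] = [set w : Om | 0 < Num.max (Num.min (B s w - c) 1) 0]).
  apply: cara_pos; apply: (@SL_Lip _ _ [:: s] 1 1) => //.
    by move=> r; rewrite inE => /eqP ->; split=> //; exact: leey.
  split=> // [w|w w' d d0 cl].
    by rewrite ger0_norm ?le_max ?lexx ?orbT// ge_max ler01 ge_min lexx orbT.
  rewrite mul1r; apply: le_trans (cl s (mem_head _ _)).
  apply: le_trans (lip_maxc _ _ _) _; rewrite mul1r.
  have E x : Num.min x 1 = - Num.max (- x) (- 1) :> R by rewrite oppr_max !opprK.
  rewrite !E -opprD normrN; apply: le_trans (lip_maxc _ _ _) _.
  by rewrite mul1r -opprD normrN (_ : _ - _ = B s w - B s w')//; ring.
by apply/seteqP; split=> w /=; rewrite lt_max ltxx orbF lt_min ltr01 andbT subr_gt0.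
Qed.

Lemma outer_add : semi_sigma_additive (outer : set Om -> \bar R).
Proof.
move=> F mF tF mbF; apply: (@caratheodory_measure_sigma_additive _ _ om) => //.
  by move=> i; exact: Borel_cara.
exact: Borel_cara.
Qed.

Lemma outerT : outer setT = 1%E.
Proof.
apply/eqP; rewrite eq_le outer_le1 /=.
by rewrite -[X in (X%:E <= _)%E]L1; apply: L_le_outer => [|//|w []//]; exact: Lip_cst.
Qed.

Lemma clamp_sum (x : R) n : 0 <= x -> \sum_(k < n) Num.max (Num.min (x - k%:R) 1) 0 = Num.min x n%:R.
Proof.
move=> x0; elim: n => [|n IH]; first by rewrite big_ord0 min_r.
rewrite big_ord_recr /= IH -(natr1 n); have : 0 <= n%:R :> R by [].
set a := n%:R => a0.
case: (leP x a) => h; case: (leP (x - a) 1) => h'; case: (leP x (a + 1)) => h''; try lra;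
  case: leP => h3; lra.
Qed.

Lemma sum_shift (p : nat -> R) n : \sum_(k < n) p k - \sum_(k < n) p k.+1 = p 0%N - p n.
Proof.
elim: n => [|n IH]; first by rewrite !big_ord0 !subrr.
by rewrite !big_ord_recr /= opprD addrACA IH; ring.
Qed.

Lemma Rint_Lip (P : probability Om R) h X : Lip h X -> P.-integrable setT (EFin \o X).
Proof.
move=> LX; apply: measurable_bounded_integrable => //.
- by rewrite -ge0_fin_numE// fin_num_measure.
- exact: Lip_measurable LX.
- have [D [K [M [_ [_ _ XM _]]]]] := Lip_SL LX.
  by exists M; split; [exact: num_real|move=> x xM w _; exact: le_trans (XM w) (ltW xM)].
Qed.

Definition EL (P : probability Om R) X : R := \int[P]_w X w.

Lemma EL_EFin P h X : Lip h X -> (\int[P]_w (X w)%:E)%E = (EL P X)%:E.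
Proof. by move=> LX; rewrite /EL /Rintegral fineK//; apply: integrable_fin_num => //; exact: Rint_Lip LX. Qed.

Lemma ELD P h X Y : Lip h X -> Lip h Y -> EL P (fun w => X w + Y w) = EL P X + EL P Y.
Proof. by move=> LX LY; rewrite /EL RintegralD//; [exact: Rint_Lip LX|exact: Rint_Lip LY]. Qed.

Lemma ELZ P h (c : R) X : Lip h X -> EL P (fun w => c * X w) = c * EL P X.
Proof. by move=> LX; rewrite /EL RintegralZl//; exact: Rint_Lip LX. Qed.

Lemma EL_cst P (c : R) : EL P (fun=> c) = c.
Proof.
rewrite /EL Rintegral_cst//; have -> : fine _ = 1 := congr1 fine (probability_setT P).
exact: mulr1.
Qed.

Lemma EL_ge0 P X : (forall w, 0 <= X w) -> 0 <= EL P X.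
Proof. by move=> X0; apply: Rintegral_ge0. Qed.

Lemma EL_le P h X Y : Lip h X -> Lip h Y -> (forall w, X w <= Y w) -> EL P X <= EL P Y.
Proof. by move=> LX LY XY; apply: le_Rintegral => //; [exact: Rint_Lip LX|exact: Rint_Lip LY]. Qed.

Lemma int_mono P (f g : Om -> R) : measurable_fun setT f -> measurable_fun setT g ->
  (forall w, 0 <= f w <= g w) -> (\int[P]_w (f w)%:E <= \int[P]_w (g w)%:E)%E.
Proof.
move=> mf mg fg; apply: ge0_le_integral => //; try exact/measurable_EFinP; move=> w _; rewrite lee_fin;
  by have /andP[] := fg w => // h; exact: le_trans h.
Qed.

Lemma Pindic P A : measurable A -> P A = (\int[P]_w (\1_A w)%:E)%E.
Proof. by move=> mA; rewrite integral_indic// setIT. Qed.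

(** A layer-cake argument. For X with values in [0, 1], [n * X] is a sum of n clamps, and both
    functionals of the k-th clamp lie between the measures of the level sets [k+1 < n X] and
    [k < n X]; the sums telescope to an error of at most 1 in [n * X]. *)
Lemma EL_outer (P : probability Om R) X : (forall A, measurable A -> P A = outer A) -> Lp X -> EL P X = L X.
Proof.
move=> PE LX.
have key (c : Om -> R) (A B : set Om) : Lp c -> measurable A -> measurable B -> (forall w, 0 <= c w <= 1) ->
    (forall w, B w -> 1 <= c w) -> (forall w, ~ A w -> c w <= 0) ->
    [/\ fine (P B) <= L c, L c <= fine (P A), fine (P B) <= EL P c & EL P c <= fine (P A)].
  move=> Lc mA mB c01 cB cA.
  have fA : (fine (P A))%:E = P A by rewrite fineK// fin_num_measure.
  have fB : (fine (P B))%:E = P B by rewrite fineK// fin_num_measure.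
  have c0 w : 0 <= c w by have /andP[] := c01 w.
  have c1 w : c w <= 1 by have /andP[] := c01 w.
  have mc := Lip_measurable Lc.
  rewrite -!lee_fin fA fB -(EL_EFin P Lc); split.
  - by rewrite PE//; exact: outer_le_L.
  - by rewrite PE//; exact: L_le_outer.
  - rewrite (Pindic P mB); apply: int_mono => //.
    move=> w; rewrite indicE; case: (pselect (B w)) => Bw; first by rewrite mem_set// ler01 cB.
    by rewrite memNset// lexx c0.
  - rewrite (Pindic P mA); apply: int_mono => //.
    move=> w; rewrite c0 indicE; case: (pselect (A w)) => Aw; first by rewrite mem_set// c1.
    by rewrite memNset//; exact: cA.
wlog X01 : X LX / forall w, 0 <= X w <= 1.
  move=> W; have [D [K [M [_ [_ M0 XM _]]]]] := Lip_SL LX.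
  pose b := (2 * (M + 1))^-1.
  have b0 : 0 < b by rewrite invr_gt0 mulr_gt0// ltr_wpDl.
  have LY : Lp (fun w => b * X w + 2^-1) by apply: LipD; [exact: LipZ|exact: Lip_cst].
  have : EL P (fun w => b * X w + 2^-1) = L (fun w => b * X w + 2^-1).
    apply: W => // w; have : `|b * X w| <= 2^-1.
      rewrite normrM (gtr0_norm b0) mulrC -ler_pdivlMr// /b invrK mulrA mulVf// mul1r.
      by apply: le_trans (XM w) _; rewrite lerDl.
    by rewrite ler_norml => /andP[? ?]; lra.
  rewrite (@ELD P +oo%E)//; [|exact: LipZ|exact: Lip_cst].
  rewrite LD//; [|exact: LipZ|exact: Lip_cst].
  rewrite (ELZ P _ LX) LZ// (Lcst LZ L1).
  rewrite EL_cst.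
  by move/addIr/mulfI; apply; rewrite gt_eqF.
have mX := Lip_measurable LX.
have X0 w : 0 <= X w by have /andP[] := X01 w.
have X1 w : X w <= 1 by have /andP[] := X01 w.
have bound n : (0 < n)%N -> n%:R * `|EL P X - L X| <= 1.
  move=> n0; pose c (k : nat) w := Num.max (Num.min (n%:R * X w - k%:R) 1) 0.
  have Lc k : Lp (c k).
    by apply: Lip_clamp; apply: LipD; [exact: LipZ|apply: Lip_cst].
  pose A (k : nat) : set Om := [set w | k%:R < n%:R * X w].
  have mA k : measurable (A k).
    have mf : measurable_fun setT (fun w => n%:R * X w) by apply: measurable_funM.
    have := mf measurableT _ (measurable_itv `]k%:R, +oo[).
    rewrite setTI (_ : _ @^-1` _ = A k)//.
    by apply/seteqP; split=> w; rewrite /A /= in_itv /= andbT.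
  pose p k := fine (P (A k)).
  have nX : (fun w => n%:R * X w) = fun w => \sum_(k < n) c k w.
    apply/funext => w; rewrite clamp_sum; last by rewrite mulr_ge0.
    by rewrite min_l// ler_piMr.
  have kk k : [/\ p k.+1 <= L (c k), L (c k) <= p k, p k.+1 <= EL P (c k) & EL P (c k) <= p k].
    apply: key => // w.
    - by rewrite /c le_max lexx orbT ge_max ler01 ge_min lexx orbT.
    - by rewrite /A /= -(natr1 k) => h; rewrite le_max le_min lexx andbT; apply/orP; left; lra.
    - move=> /negP; rewrite -leNgt => h; rewrite ge_max lexx andbT ge_min; apply/orP; left; lra.
  have e1 : n%:R * L X = \sum_(k < n) L (c k) by rewrite -LZ// nX (Lsum LD LZ L1).
  have e2 : n%:R * EL P X = \sum_(k < n) EL P (c k).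
    rewrite -(ELZ P _ LX) nX; apply: (@Lsum _ (EL P)) => //.
    - by move=> ? ?; exact: ELD.
    - by move=> ? ?; exact: ELZ.
    - exact: EL_cst.
  have tel : \sum_(k < n) p k - \sum_(k < n) p k.+1 <= 1.
    rewrite sum_shift.
    have : p 0%N <= 1 by rewrite -lee_fin fineK ?fin_num_measure//; exact: probability_le1.
    have : 0 <= p n by exact: fine_ge0.
    by move=> ? ?; lra.
  have l1 : \sum_(k < n) L (c k) <= \sum_(k < n) p k by apply: ler_sum => k _; have [] := kk k.
  have l2 : \sum_(k < n) p k.+1 <= \sum_(k < n) L (c k) by apply: ler_sum => k _; have [] := kk k.
  have l3 : \sum_(k < n) EL P (c k) <= \sum_(k < n) p k by apply: ler_sum => k _; have [] := kk k.
  have l4 : \sum_(k < n) p k.+1 <= \sum_(k < n) EL P (c k) by apply: ler_sum => k _; have [] := kk k.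
  have -> : n%:R * `|EL P X - L X| = `|n%:R * EL P X - n%:R * L X|.
    by rewrite -mulrBr normrM ger0_norm.
  by rewrite e1 e2 ler_norml; apply/andP; split; lra.
apply/eqP; rewrite -subr_eq0 -normr_eq0 eq_le normr_ge0 andbT leNgt; apply/negP => h.
have := bound (Num.truncn (`|EL P X - L X|^-1)).+1 isT.
by rewrite leNgt => /negP; apply; rewrite -ltr_pdivrMr// mul1r; exact: truncnS_gt.
Qed.

HB.instance Definition _ := isMeasure.Build _ Om R outer outer0 outer_ge0 outer_add.
HB.instance Definition _ := Measure_isProbability.Build _ Om R outer outerT.

Theorem representation : exists P : probability Om R, forall X, Lp X -> EL P X = L X.
Proof.
by exists (outer : probability Om R) => X LX; exact: EL_outer.
Qed.

End Repr.

(** * Hahn-Banach theorem by minimal sublinear functionals *)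

Section HahnBanach.
Variables (R : realType) (V : lmodType R) (D : set V).
Hypotheses (DD : forall x y, D x -> D y -> D (x + y)) (DZ : forall (c : R) x, D x -> D (c *: x)).
Implicit Types (p q : V -> R) (x y : V).

Definition sublin p := (forall x y, D x -> D y -> p (x + y) <= p x + p y) /\
  (forall (c : R) x, 0 <= c -> D x -> p (c *: x) <= c * p x).

Lemma sublin0 p x : sublin p -> D x -> p 0 = 0.
Proof.
move=> [pD pZ] Dx; have D0 : D 0 by rewrite -(scale0r x); exact: DZ.
apply/eqP; rewrite eq_le; apply/andP; split.
  by have := pZ 0 x (lexx 0) Dx; rewrite scale0r mul0r.
by have := pD 0 0 D0 D0; rewrite addr0; lra.
Qed.

Lemma sublinZ p c x : sublin p -> 0 < c -> D x -> p (c *: x) = c * p x.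
Proof.
move=> [pD pZ] c0 Dx; apply/eqP; rewrite eq_le pZ ?(ltW c0)//=.
have ci : 0 <= c^-1 by rewrite invr_ge0 ltW.
have := pZ c^-1 (c *: x) ci (DZ c Dx).
by rewrite scalerA mulVf ?gt_eqF// scale1r -(ler_pM2l c0) mulrA mulfV ?gt_eqF// mul1r.
Qed.

Lemma sublin_ge p x : sublin p -> D x -> - p (- x) <= p x.
Proof.
move=> Sp Dx; have [pD _] := Sp; have DN : D (- x) by rewrite -scaleN1r; exact: DZ.
by have := pD x (- x) Dx DN; rewrite subrr (sublin0 Sp Dx); lra.
Qed.

(** A sublinear functional below q whose value at [- x1] is at most [- q x1]. A minimal q thus
    equals its own slides, which makes it odd and hence linear. *)
Definition slide q x1 x : R := inf [set q (x + t *: x1) - t * q x1 | t in [set t : R | 0 <= t]].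

Lemma slide_lb q x1 x (t : R) : sublin q -> D x1 -> D x -> 0 <= t ->
  - q (- x) <= q (x + t *: x1) - t * q x1.
Proof.
move=> Sq D1 Dx; rewrite le_eqVlt => /predU1P[<-|t0].
  by rewrite scale0r addr0 mul0r subr0; exact: sublin_ge.
have DN : D (- x) by rewrite -scaleN1r; exact: DZ.
have Dt := DZ t D1.
have [qD _] := Sq; have := qD (x + t *: x1) (- x) (DD Dx Dt) DN.
by rewrite addrAC subrr add0r (sublinZ Sq t0 D1); lra.
Qed.

Lemma slide_le q x1 x (t : R) : sublin q -> D x1 -> D x -> 0 <= t ->
  slide q x1 x <= q (x + t *: x1) - t * q x1.
Proof.
move=> Sq D1 Dx t0; apply: ge_inf; last by exists t.
by exists (- q (- x)) => _ [s /= s0 <-]; exact: slide_lb.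
Qed.

Lemma slide_ge q x1 x (r : R) : (forall t, 0 <= t -> r <= q (x + t *: x1) - t * q x1) -> r <= slide q x1 x.
Proof.
move=> H; apply: lb_le_inf; last by move=> _ [t t0 <-]; exact: H.
by exists (q (x + 0 *: x1) - 0 * q x1), 0 => //=.
Qed.

Lemma slide_sublin q x1 : sublin q -> D x1 -> sublin (slide q x1).
Proof.
move=> Sq D1; have [qD qZ] := Sq; split=> [x y Dx Dy|c x].
  rewrite -lerBlDr; apply: slide_ge => t t0; rewrite lerBlDr -lerBlDl.
  apply: slide_ge => s s0; rewrite lerBlDl.
  apply: le_trans (slide_le Sq D1 (DD Dx Dy) (addr_ge0 t0 s0)) _.
  have := qD (x + t *: x1) (y + s *: x1) (DD Dx (DZ t D1)) (DD Dy (DZ s D1)).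
  rewrite addrACA -scalerDl; lra.
rewrite le_eqVlt => /predU1P[<-|c0] Dx.
  rewrite scale0r mul0r; apply: le_trans (slide_le Sq D1 _ (lexx 0)) _.
    by rewrite -(scale0r x); exact: DZ.
  by rewrite scale0r addr0 mul0r subr0 (sublin0 Sq Dx).
rewrite mulrC -ler_pdivrMr//; apply: slide_ge => t t0; rewrite ler_pdivrMr// mulrC.
have ct : 0 <= c * t by rewrite mulr_ge0// ltW.
apply: le_trans (slide_le Sq D1 (DZ c Dx) ct) _.
rewrite -scalerA -scalerDr (sublinZ Sq c0); last by apply: DD => //; exact: DZ.
by rewrite mulrBr mulrA.
Qed.

Lemma slide_leq q x1 x : sublin q -> D x1 -> D x -> slide q x1 x <= q x.
Proof.
move=> Sq D1 Dx; have := slide_le Sq D1 Dx (lexx 0).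
by rewrite scale0r addr0 mul0r subr0.
Qed.

Lemma slide_opp q x1 : sublin q -> D x1 -> slide q x1 (- x1) <= - q x1.
Proof.
move=> Sq D1; have DN : D (- x1) by rewrite -scaleN1r; exact: DZ.
have := slide_le Sq D1 DN ler01; rewrite scale1r addNr (sublin0 Sq D1); lra.
Qed.

(** Zorn's lemma runs below [slide p x0] instead of p: every linear functional there takes the value
    [p x0] at x0. *)
Theorem hahn_banach p x0 : sublin p -> D x0 -> exists L : V -> R,
  [/\ forall x y, D x -> D y -> L (x + y) = L x + L y,
      forall c x, D x -> L (c *: x) = c * L x,
      forall x, D x -> L x <= p x & L x0 = p x0].
Proof.
move=> Sp D0; pose p0 := slide p x0.
have S0 : sublin p0 by exact: slide_sublin.
(* Functionals are normalized to 0 off D so that the order of values on D is antisymmetric. *)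
pose ok q := sublin q /\ (forall x, D x -> q x <= p0 x) /\ (forall x, ~ D x -> q x = 0).
pose T := {q : V -> R | ok q}.
pose rT (q r : T) := `[< forall x, D x -> sval r x <= sval q x >].
have cut q : sublin q -> (forall x, D x -> q x <= p0 x) -> exists r : T, forall x, D x -> sval r x = q x.
  move=> Sq qp; pose r x := if pselect (D x) then q x else 0.
  have rE x : D x -> r x = q x by rewrite /r; case: pselect.
  suff okr : ok r by exists (exist _ r okr).
  split; last by split=> x Dx; [rewrite rE//; exact: qp|rewrite /r; case: pselect].
  split=> [x y Dx Dy|c x c0 Dx]; first by rewrite !rE//; [case: Sq => + _; apply|exact: DD].
  by rewrite !rE//; [case: Sq => _; apply|exact: DZ].
have [[q [Sq [qp q0]]] qmin] : exists t, forall s, rT t s -> s = t.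
  apply: Zorn => [t|r s t|s t|A totA].
  - exact/asboolP.
  - by move=> /asboolP h1 /asboolP h2; apply/asboolP => x Dx; apply: le_trans (h2 x Dx) (h1 x Dx).
  - case: s t => [s [s1 [s2 s3]]] [t [t1 [t2 t3]]] /asboolP h1 /asboolP h2; apply: eq_exist.
    apply/funext => x; have [Dx|nD] := pselect (D x); last by rewrite s3// t3.
    by apply/eqP; rewrite eq_le h2//= h1.
  - have [[q0 Aq0]|nA] := pselect (exists q : T, A q); last first.
      have [r rE] := cut p0 S0 (fun x _ => lexx _); exists r => s As.
      by case: nA; exists s.
    pose E x := [set sval r x | r in A].
    have E0 x : E x !=set0 by exists (sval q0 x), q0.
    have El x (q : T) : D x -> A q -> inf (E x) <= sval q x.
      move=> Dx Aq; apply: ge_inf; last by exists q.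
      exists (- p0 (- x)) => _ [r Ar <-]; case: (svalP r) => Sr [rp _].
      apply: le_trans (sublin_ge Sr Dx); rewrite lerN2 rp// -scaleN1r; exact: DZ.
    have EE : sublin (fun x => inf (E x)).
      split=> [x y Dx Dy|c x c0 Dx].
        rewrite -lerBlDr; apply: lb_le_inf => // _ [q Aq <-]; rewrite lerBlDr -lerBlDl.
        apply: lb_le_inf => // _ [r Ar <-]; rewrite lerBlDl.
        have Dxy := DD Dx Dy.
        have [/asboolP h|/asboolP h] := totA q r Aq Ar.
          apply: le_trans (El _ r Dxy Ar) _; case: (svalP r) => [[rD _] _].
          by apply: le_trans (rD _ _ Dx Dy) _; rewrite lerD2r h.
        apply: le_trans (El _ q Dxy Aq) _; case: (svalP q) => [[qD _] _].
        by apply: le_trans (qD _ _ Dx Dy) _; rewrite lerD2l h.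
      move: c0; rewrite le_eqVlt => /predU1P[<-|c0].
        have D00 : D 0 by rewrite -(scale0r x); exact: DZ.
        rewrite scale0r mul0r; apply: le_trans (El _ q0 D00 Aq0) _.
        by case: (svalP q0) => S _; rewrite (sublin0 S Dx).
      rewrite mulrC -ler_pdivrMr//; apply: lb_le_inf => // _ [q Aq <-]; rewrite ler_pdivrMr// mulrC.
      apply: le_trans (El _ q (DZ c Dx) Aq) _; case: (svalP q) => [[_ qZ] _].
      by apply: qZ => //; exact: ltW.
    have Ep x : D x -> inf (E x) <= p0 x.
      move=> Dx; apply: le_trans (El x q0 Dx Aq0) _; case: (svalP q0) => _ [h _]; exact: h.
    have [r rE] := cut _ EE Ep; exists r => s As; apply/asboolP => x Dx.
    by rewrite rE//; exact: El.
have qN x : D x -> q (- x) = - q x.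
  move=> Dx; have DN : D (- x) by rewrite -scaleN1r; exact: DZ.
  have Ss := slide_sublin Sq Dx.
  have sp y : D y -> slide q x y <= p0 y by move=> Dy; apply: le_trans (qp _ Dy); exact: slide_leq.
  have [r rE] := cut _ Ss sp.
  have /(congr1 sval) /= rq : r = exist _ q (conj Sq (conj qp q0)).
    by apply: qmin; apply/asboolP => y Dy /=; rewrite rE//; exact: slide_leq.
  apply/eqP; rewrite eq_le; apply/andP; split; last first.
    by have := sublin_ge Sq DN; rewrite opprK; lra.
  by rewrite -rq (rE _ DN) (rE _ Dx); apply: le_trans (slide_opp Sq Dx) _; rewrite lerN2 slide_leq.
have [qD qZ] := Sq.
have qDD x y : D x -> D y -> q (x + y) = q x + q y.
  move=> Dx Dy; have DNy : D (- y) by rewrite -scaleN1r; exact: DZ.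
  apply/eqP; rewrite eq_le qD//=.
  by have := qD (x + y) (- y) (DD Dx Dy) DNy; rewrite addrK qN//; lra.
have q00 : q 0 = 0 := sublin0 Sq D0.
exists q; split=> //.
- move=> c x Dx; have [c0|c0|->] := ltgtP c 0; last by rewrite scale0r mul0r.
    have Nc : 0 < - c by rewrite oppr_gt0.
    have := sublinZ Sq Nc Dx; rewrite scaleNr (qN _ (DZ c Dx)) mulNr; exact: oppr_inj.
  exact: sublinZ.
- by move=> x Dx; apply: le_trans (qp x Dx) _; exact: slide_leq.
- have DN : D (- x0) by rewrite -scaleN1r; exact: DZ.
  apply/eqP; rewrite eq_le; apply/andP; split; first by apply: le_trans (qp _ D0) _; exact: slide_leq.
  by have := le_trans (qp _ DN) (slide_opp Sp D0); rewrite qN// lerN2.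
Qed.

End HahnBanach.

(** * Stopped paths and the sigma-fields F_t *)

Section Stop.
Variable R : realType.
Local Notation Om := (Omega R).
Implicit Types (A : set Om) (w : Om) (t : R).

Lemma stopK t w : stop t (stop t w) = stop t w.
Proof. by apply: path_ext => s; rewrite !B_stop -minA minxx. Qed.

Lemma stop_le s t w : s <= t -> stop s (stop t w) = stop s w.
Proof. by move=> st; apply: path_ext => r; rewrite !B_stop -minA (min_l st). Qed.

Lemma measurable_stop t : measurable_fun setT (stop t : Om -> Om).
Proof.
suff H : @measurable _ Om `<=` [set A | measurable (stop t @^-1` A)].
  by move=> _ A mA; rewrite setTI; exact: H.
apply: Borel_sub.
  split=> [|A|A HA] /=; first by rewrite preimage_set0.
    by rewrite setTD preimage_setC => mA; exact: measurableC.
  by rewrite preimage_bigcup; exact: bigcupT_measurable.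
move=> s c _ /=; have := @measurable_B R (Num.min s t) measurableT _ (measurable_itv `]c, +oo[).
rewrite setTI (_ : _ @^-1` _ = stop t @^-1` [set w | c < B s w])//.
by apply/seteqP; split=> w /=; rewrite in_itv /= andbT B_stop.
Qed.

(** Stopping at t is an idempotent measurable map, so the preimages under it are exactly the
    measurable sets that it leaves invariant. *)
Lemma F_P t A : F_ t%:E A <-> measurable A /\ stop t @^-1` A = A.
Proof.
split=> [[A' mA' <-]|[mA <-]]; last by exists A.
split; first by rewrite -[X in measurable X]setTI; exact: measurable_stop.
by apply/seteqP; split=> w /=; rewrite stopK.
Qed.

Lemma L0P t (X : Om -> \bar R) : L0 t%:E X <-> measurable_fun setT X /\ forall w, X (stop t w) = X w.
Proof.
split=> [H|[mX XE] A mA].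
  split=> [_ A mA|w]; first by rewrite setTI; have /F_P[] := H A mA.
  have /F_P[_] := H [set X w] (emeasurable_set1 _).
  by move=> /seteqP[_ h]; have := h w erefl.
apply/F_P; split; first by rewrite -[X in measurable X]setTI; exact: mX.
by apply/seteqP; split=> w /=; rewrite XE.
Qed.

Lemma L0oo (X : Om -> \bar R) : L0 +oo%E X <-> measurable_fun setT X.
Proof.
split=> [H _ A mA|H A mA]; first by rewrite setTI; exact: H.
by rewrite /F_ /= -[X in measurable X]setTI; exact: H.
Qed.

Lemma L0_le s t (X : Om -> \bar R) : s <= t -> L0 s%:E X -> L0 t%:E X.
Proof.
move=> st /L0P[mX XE]; apply/L0P; split=> // w.
by rewrite -XE stop_le// XE.
Qed.

Lemma F_le s t A : s <= t -> F_ s%:E A -> F_ t%:E A.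
Proof.
move=> st /F_P[mA AE]; apply/F_P; split=> //.
have E w : A w = A (stop s w) by rewrite -[in LHS]AE.
by apply/funext => w; rewrite /preimage /= [RHS]E E stop_le.
Qed.

Lemma F_C t A : F_ t%:E A -> F_ t%:E (~` A).
Proof.
by move=> /F_P[mA AE]; apply/F_P; split; [exact: measurableC|rewrite -preimage_setC AE].
Qed.

Lemma F_T t : F_ t%:E (@setT Om).
Proof. by apply/F_P; split. Qed.

Lemma Lip_stop (X : Om -> R) h t : 0 <= t -> Lip h X -> Lip t%:E (fun w => X (stop t w)).
Proof.
move=> t0 /Lip_SL[D [K [M [iD [K0 M0 XM XK]]]]].
apply: (@SL_Lip _ _ [seq Num.min s t | s <- D] K M) => //.
  move=> _ /mapP[s sD ->]; have [s0 _] := iD s sD.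
  by rewrite le_min s0 t0 lee_fin ge_min lexx orbT.
split=> // w w' d d0 cl; apply: XK => // s sD; rewrite !B_stop.
by apply: cl; apply/mapP; exists s.
Qed.

Lemma Lip_stopE (X : Om -> R) t w : Lip t%:E X -> X (stop t w) = X w.
Proof.
move=> /Lip_SL[D [K [M [iD SX]]]]; apply: (SL_dep SX) => s /iD[_].
by rewrite lee_fin B_stop => st; rewrite min_l.
Qed.

End Stop.

(** Apart from the shortfall [max (a - u) 0] the bound is linear in u, so a small excess of the mean
    and a small mean shortfall suffice. *)
Lemma clip_dist (R : realType) (u a : R) : 0 <= u -> a = 0 \/ a = 1 ->
  `|Num.min u 1 - a| <= u - a + 2 * Num.max (a - u) 0.
Proof.
move=> u0 [->|->]; case: (leP u 1) => h.
- by case: (leP (0 - u) 0) => h'; rewrite ler_norml; apply/andP; split; lra.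
- by case: (leP (0 - u) 0) => h'; rewrite ler_norml; apply/andP; split; lra.
- by case: (leP (1 - u) 0) => h'; rewrite ler_norml; apply/andP; split; lra.
- by case: (leP (1 - u) 0) => h'; rewrite ler_norml; apply/andP; split; lra.
Qed.

(** * Approximation of indicators by cylinder functionals *)

Section Density.
Variable R : realType.
Local Notation Om := (Omega R).
Local Notation Lp := (Lip (R := R) +oo%E).
Variables (P : probability Om R) (C : R).
Hypothesis PP : posfun (EL P) C.

Lemma bounded_int (f : Om -> R) (M : R) : measurable_fun setT f -> (forall w, `|f w| <= M) ->
  P.-integrable setT (EFin \o f).
Proof.
move=> mf fM; apply: measurable_bounded_integrable => //.
- by rewrite -ge0_fin_numE// fin_num_measure.
- by exists M; split; [exact: num_real|move=> x xM w _; exact: le_trans (fM w) (ltW xM)].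
Qed.

Lemma upper_cvg (A : set Om) (U : nat -> Om -> R) : measurable A -> upper A U ->
  EL P (fun w => Num.max (\1_A w - U n w) 0) @[n --> \oo] --> (0 : R).
Proof.
move=> mA [LU U0 Um UA].
pose f n w : \bar R := (Num.max (\1_A w - U n w) 0)%:E.
have b n w : 0 <= Num.max (\1_A w - U n w) 0 <= 1.
  rewrite le_max lexx orbT ge_max ler01 andbT; have := U0 n w.
  have : \1_A w <= 1 :> R by rewrite indicE lern1 leq_b1.
  by move=> ? ?; lra.
have mf n : measurable_fun setT (fun w => Num.max (\1_A w - U n w) 0).
  apply: measurable_maxr => //; apply: measurable_funB; first exact: measurable_indic.
  exact: Lip_measurable (LU n).
have mono n m w : (n <= m)%N -> U n w <= U m w.
  move=> /subnKC <-; elim: (m - n)%N => [|k IH]; first by rewrite addn0.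
  by rewrite addnS; exact: le_trans IH _.
have ff w : f n w @[n --> \oo] --> (0 : \bar R)%E.
  apply/fine_cvgP; split; first exact: nearW.
  apply/cvgrPdist_le => e e0; have [Aw|nAw] := pselect (A w).
    have [n Hn] := UA w Aw e e0; exists n => // m /= nm.
    rewrite sub0r normrN ger0_norm /=; last by have /andP[] := b m w.
    rewrite ge_max (ltW e0) andbT indicE mem_set//=.
    by have := mono n m w nm; lra.
  apply: nearW => n /=; rewrite indicE memNset//= max_r; last by have := U0 n w; lra.
  by rewrite subrr normr0 ltW.
have [_ _] : [/\ P.-integrable setT (cst 0%E), [sequence (\int[P]_w `|f n w - 0|)%E]_n @ \oo --> 0%E &
    [sequence (\int[P]_w f n w)%E]_n @ \oo --> (\int[P]_w (cst 0%E w))%E].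
  apply: (@dominated_convergence _ _ _ P setT measurableT f (cst 0%E) (cst 1%E)) => //.
  - by move=> n; exact/measurable_EFinP.
  - by apply: aeW => w _; exact: ff.
  - exact: (finite_measure_integrable_cst P 1 measurableT).
  - by apply: aeW => w n _; rewrite /f gee0_abs lee_fin; have /andP[] := b n w.
rewrite integral0 => /fine_cvgP[_]; apply: cvg_trans.
by apply: near_eq_cvg; apply: nearW.
Qed.

(** Dominated convergence gives P below the outer measure on every Borel set; the same inequality
    for the complement, with total mass 1 on both sides, gives equality. *)
Lemma posfun_outer A : measurable A -> P A = outer (EL P) A.
Proof.
suff H B : measurable B -> (P B <= outer (EL P) B)%E.
  move=> mA; apply/eqP; rewrite eq_le H//=.
  have HC := H _ (measurableC mA).
  have cA := Borel_cara PP mA setT; rewrite !setTI (outerT PP) in cA.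
  have fA := outer_fin PP A; have fC := outer_fin PP (~` A).
  rewrite probability_setC// in HC; have fP : P A \is a fin_num by exact: fin_num_measure.
  move: cA HC; rewrite -(fineK fA) -(fineK fC) -(fineK fP) -EFinD -EFinB.
  by move=> [e]; rewrite !lee_fin; lra.
move=> mB; apply: le_ereal_inf_tmp => _ [U UB <-]; have [LU U0 Um UA] := UB.
apply/lee_addgt0Pr => e e0.
have /cvgrPdist_le/(_ e e0)[n _ /(_ n (leqnn n))] := upper_cvg mB UB.
rewrite sub0r normrN ger0_norm => [Hn|]; last by apply: EL_ge0 => w; rewrite le_max lexx orbT.
apply: le_trans (_ : (EL P (U n))%:E + e%:E <= _)%E; last first.
  by apply: leeD2r; apply: ereal_sup_ubound; exists n.
have mU := Lip_measurable (LU n).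
have mM : measurable_fun setT (fun w => Num.max (\1_B w - U n w) 0).
  by apply: measurable_maxr => //; apply: measurable_funB => //; exact: measurable_indic.
have iU : P.-integrable setT (EFin \o U n) by exact: Rint_Lip (LU n).
have iM : P.-integrable setT (EFin \o (fun w => Num.max (\1_B w - U n w) 0)).
  apply: (@bounded_int _ 1) => // w; rewrite ger0_norm ?le_max ?lexx ?orbT// ge_max ler01 andbT.
  have := U0 n w; have : \1_B w <= 1 :> R by rewrite indicE lern1 leq_b1.
  by move=> ? ?; lra.
apply: le_trans (_ : (EL P (U n) + EL P (fun w => Num.max (\1_B w - U n w) 0))%:E <= _)%E; last first.
  by rewrite -EFinD lee_fin lerD2l.
rewrite /EL -RintegralD// /Rintegral fineK; last first.
  by apply: integrable_fin_num => //; exact: (integrableD measurableT iU iM).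
rewrite Pindic//; apply: int_mono; first exact: measurable_indic.
  exact: measurable_funD.
by move=> w; rewrite indicE ler0n /= -lerBlDl le_max lexx.
Qed.

(** A nearly optimal competitor for the outer measure, clipped at 1, approximates the indicator in
    mean. *)
Lemma density A (e : R) : measurable A -> 0 < e -> exists g : Om -> R,
  [/\ Lp g, forall w, 0 <= g w <= 1 & EL P (fun w => `|g w - \1_A w|) <= e].
Proof.
move=> mA e0; have e4 : 0 < e / 4 by rewrite divr_gt0.
have [_ [U UA <-]] := lb_ereal_inf_adherent e4 (outer_fin PP A).
rewrite -/(outer _ _) -posfun_outer// => HU; have [LU U0 Um _] := UA.
have /cvgrPdist_le/(_ _ e4)[n _ /(_ n (leqnn n))] := upper_cvg mA UA.
rewrite sub0r normrN ger0_norm => [Hn|]; last by apply: EL_ge0 => w; rewrite le_max lexx orbT.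
pose g w := Num.min (U n w) 1.
have Lg : Lp g by apply: Lip_min => //; exact: Lip_cst.
have mU := Lip_measurable (LU n); have mg := Lip_measurable Lg.
have g01 w : 0 <= g w <= 1 by rewrite /g le_min U0 ler01 ge_min lexx orbT.
exists g; split=> //.
pose M w := Num.max (\1_A w - U n w) 0.
have i1 w : 0 <= (\1_A w : R) <= 1 by rewrite indicE ler0n lern1 leq_b1.
have mI : measurable_fun setT (\1_A : Om -> R) by exact: measurable_indic.
have mM : measurable_fun setT M by apply: measurable_maxr => //; exact: measurable_funB.
have iU : P.-integrable setT (EFin \o U n) by exact: Rint_Lip (LU n).
have iI : P.-integrable setT (EFin \o (\1_A : Om -> R)).
  by apply: (@bounded_int _ 1) => // w; rewrite ger0_norm; have /andP[] := i1 w.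
have iM : P.-integrable setT (EFin \o M).
  apply: (@bounded_int _ 1) => // w; rewrite ger0_norm /M ?le_max ?lexx ?orbT// ge_max ler01 andbT.
  by have := U0 n w; have := i1 w; move=> /andP[? ?] ?; lra.
have iL : P.-integrable setT (EFin \o (fun w => `|g w - \1_A w|)).
  apply: (@bounded_int _ 1) => [|w].
    by apply: measurableT_comp => //; exact: measurable_funB.
  by rewrite normr_id ler_norml; move: (g01 w) (i1 w) => /andP[? ?] /andP[? ?]; apply/andP; split; lra.
have i2M : P.-integrable setT (EFin \o (fun w => 2 * M w)) by exact: (integrableZl measurableT 2 iM).
have iUI : P.-integrable setT (EFin \o (fun w => U n w - \1_A w)) by exact: (integrableB measurableT iU iI).
have UP : EL P (U n) - EL P (\1_A : Om -> R) <= e / 4.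
  have : ((EL P (U n))%:E <= P A + (e / 4)%:E)%E.
    by apply: le_trans (ltW HU); apply: ereal_sup_ubound; exists n.
  have -> : P A = (EL P (\1_A : Om -> R))%:E.
    by rewrite /EL /Rintegral fineK -?Pindic// fin_num_measure.
  by rewrite -EFinD lee_fin; lra.
apply: le_trans (_ : EL P (fun w => (U n w - \1_A w) + 2 * M w) <= _).
  apply: le_Rintegral => //; first exact: (integrableD measurableT iUI i2M).
  move=> w _; rewrite /M /g; move: (U0 n w); rewrite indicE; case: (w \in A) => /=; rewrite ?mulr1n ?mulr0n => u0.
    exact: (@clip_dist _ _ 1 u0 (or_intror erefl)).
  exact: (@clip_dist _ _ 0 u0 (or_introl erefl)).
rewrite /EL RintegralD// RintegralB// RintegralZl//.
by move: UP Hn; rewrite /EL => ? ?; lra.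
Qed.

End Density.

HB.instance Definition _ (R : realType) (t : R) :=
  isMeasurableFun.Build _ _ (Omega R) (Omega R) (stop t : Omega R -> Omega R) (measurable_stop t).

(** * Laws on F_t *)

Section Law.
Variable R : realType.
Local Notation Om := (Omega R).
Local Notation Lp := (Lip (R := R) +oo%E).
Implicit Types (P Q : probability Om R) (t : R) (X Y : Om -> R).

(** The restriction of P to F_t, realized as a probability on the same path space so that the
    Daniell description applies to it. *)
Definition stopped P t : probability Om R := distribution P (stop t : {mfun Om >-> Om}).

Lemma stoppedE P t A : stopped P t A = P (stop t @^-1` A). Proof. by []. Qed.

Lemma EL_stopped P t X : 0 <= t -> Lp X -> EL (stopped P t) X = EL P (fun w => X (stop t w)).
Proof.
move=> t0 LX; rewrite /EL /Rintegral /stopped integral_distribution//.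
  by apply/measurable_EFinP; exact: Lip_measurable LX.
exact: Rint_Lip (Lip_stop t0 LX).
Qed.

Lemma posfun_EL P C : 0 <= C -> (forall s t a : R, 0 <= s -> s < t -> 0 < a ->
    EL P (penalty (a, s, t)) <= C * (t - s) ^+ 2 / a ^+ 4) -> posfun (EL P) C.
Proof.
move=> C0 H; split=> //.
- by move=> X Y LX LY; exact: ELD LX LY.
- by move=> c X LX; exact: ELZ LX.
- exact: EL_cst.
- by move=> X _; exact: EL_ge0.
Qed.

Lemma posfun_stopped P C t : 0 <= t -> posfun (EL P) C -> posfun (EL (stopped P t)) C.
Proof.
move=> t0 PP; have C0 := pf_C PP; apply: posfun_EL => // s r a s0 sr a0.
have r0 : 0 <= r by rewrite ltW// (le_lt_trans s0).
have ok : tripok (a, s, r) by split=> //; exact: ltW.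
rewrite EL_stopped//; last exact: Lip_pen.
have -> : (fun w => penalty (a, s, r) (stop t w)) = penalty (a, Num.min s t, Num.min r t).
  by apply/funext => w; rewrite /penalty /= !B_stop.
have m0 : 0 <= Num.min s t by rewrite le_min s0.
have h : Num.min s t <= Num.min r t by rewrite le_min !ge_min (ltW sr) lexx orbT.
have ok' : tripok (a, Num.min s t, Num.min r t) by split.
apply: le_trans (Lpen (pfZ PP) (pf1 PP) (pf_mom PP) ok') _.
rewrite /= ler_pM2r ?invr_gt0 ?exprn_gt0//; apply: ler_wpM2l => //.
apply: lerXn2r; rewrite ?nnegrE ?subr_ge0 ?(ltW sr)//.
by case: (leP s t) => h1; case: (leP r t) => h2; lra.
Qed.

Lemma outer_eq (L L' : (Om -> R) -> R) A : (forall X, Lp X -> L X = L' X) -> outer L A = outer L' A.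
Proof.
move=> H; rewrite /outer; congr ereal_inf; apply/seteqP.
by split=> _ [U UA <-]; exists U => //; have [LU _ _ _] := UA; rewrite /Lsup; congr ereal_sup;
  apply/seteqP; split=> _ [n _ <-]; exists n => //; rewrite H.
Qed.

Definition same_upto t P Q := forall A, F_ t%:E A -> Q A = P A.

(** Both stopped laws are the outer measure of the same functional on cylinder functionals. *)
Lemma same_Lip P Q C t : 0 <= t -> posfun (EL P) C -> posfun (EL Q) C ->
  (forall Z, Lip t%:E Z -> EL Q Z = EL P Z) -> same_upto t P Q.
Proof.
move=> t0 pP pQ H A /F_P[mA AE]; rewrite -AE -!stoppedE.
rewrite (posfun_outer (posfun_stopped t0 pQ))// (posfun_outer (posfun_stopped t0 pP))//.
apply: outer_eq => X LX; rewrite !EL_stopped// H//; exact: Lip_stop LX.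
Qed.

Lemma same_ge0 P Q t (X : Om -> \bar R) : same_upto t P Q -> L0 t%:E X -> (forall w, 0 <= X w)%E ->
  (\int[Q]_w X w = \int[P]_w X w)%E.
Proof.
move=> H /L0P[mX XE] X0.
have E (P' : probability Om R) : (\int[P']_w X w = \int[stopped P' t]_w X w)%E.
  rewrite /stopped ge0_integral_distribution//; by apply: eq_integral => w _ /=; rewrite XE.
rewrite (E P) (E Q); apply: eq_measure_integral => A mA _.
change (Q (stop t @^-1` A) = P (stop t @^-1` A)).
apply: H; apply/F_P; split; first by rewrite -[X in measurable X]setTI; exact: measurable_stop.
by apply/seteqP; split=> w /=; rewrite stopK.
Qed.

Lemma F_mem t (A : set Om) w : stop t @^-1` A = A -> (stop t w \in A) = (w \in A).
Proof.
move=> AE; have E : A w = A (stop t w) by rewrite -{1}AE.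
by apply/idP/idP => /set_mem h; apply/mem_set; [rewrite E|rewrite -E].
Qed.

Lemma L0_restrict t A (X : Om -> \bar R) : F_ t%:E A -> L0 t%:E X -> L0 t%:E (X \_ A).
Proof.
move=> /F_P[mA AE] /L0P[mX XE]; apply/L0P; split.
  apply/(measurable_restrictT _ mA); exact: measurable_funTS.
by move=> w; rewrite /patch (F_mem w AE) XE.
Qed.

Lemma same_int P Q t (X : Om -> \bar R) A : same_upto t P Q -> L0 t%:E X -> F_ t%:E A ->
  (\int[Q]_(w in A) X w = \int[P]_(w in A) X w)%E.
Proof.
move=> H LX FA; rewrite integral_mkcond [RHS]integral_mkcond integralE [RHS]integralE.
have /L0P[mX XE] := L0_restrict FA LX.
congr (_ - _)%E; apply: (same_ge0 H) => [|w]; rewrite ?funepos_ge0 ?funeneg_ge0//; apply/L0P.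
  by split=> [|w]; [exact: measurable_funepos|rewrite !funeposE XE].
by split=> [|w]; [exact: measurable_funeneg|rewrite !funenegE XE].
Qed.

End Law.

(** * Measures dominated by the G-expectation *)

Section Sublinear.
Variables (R : realType) (sl sb : R).
Hypotheses (sl0 : 0 <= sl) (slb : sl <= sb).
Local Notation Om := (Omega R).
Local Notation Lp := (Lip (R := R) +oo%E).
Local Notation cond_Lip := (cond_Lip sl sb).
Local Notation PP := (PP sl sb).
Implicit Types (P Q : probability Om R) (t : R) (X Y Z : Om -> R).

Definition Et t X : Om -> R := xget (fun=> 0) [set Y | cond_Lip t X Y].

Lemma EtP t X : 0 <= t -> Lp X -> cond_Lip t X (Et t X).
Proof.
move=> t0 LX; have [Y h] := cond_Lip_exists sl0 slb LX t0.
exact: (@xgetPex _ (fun=> 0) [set Y | cond_Lip t X Y] (ex_intro _ Y h)).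
Qed.

Lemma Et_eq t X Y : cond_Lip t X Y -> Et t X = Y.
Proof.
by move=> h; have [t0 LX _] := cond_Lip_Lip sl0 slb h; exact: (cond_Lip_uniq sl0 slb (EtP t0 LX) h).
Qed.

Lemma Et_Lip t X : 0 <= t -> Lp X -> Lip t%:E (Et t X).
Proof. by move=> t0 LX; have [] := cond_Lip_Lip sl0 slb (EtP t0 LX). Qed.

Lemma Et_Lip_oo t X : 0 <= t -> Lp X -> Lp (Et t X).
Proof. by move=> t0 LX; apply: Lip_le (Et_Lip t0 LX); exact: leey. Qed.

Lemma Et_le t (c1 c2 k : R) X X1 X2 : 0 <= t -> Lp X -> Lp X1 -> Lp X2 -> 0 <= c1 -> 0 <= c2 ->
  (forall w, X w <= c1 * X1 w + c2 * X2 w + k) -> forall w, Et t X w <= c1 * Et t X1 w + c2 * Et t X2 w + k.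
Proof. by move=> t0 ? ? ? c10 c20; apply: (cond_Lip_le sl0 slb (EtP _ _) (EtP _ _) (EtP _ _)). Qed.

Lemma Et_ub t X (k : R) : 0 <= t -> Lp X -> (forall w, X w <= k) -> forall w, Et t X w <= k.
Proof.
move=> t0 LX H w; have := @Et_le t 0 0 k X X X t0 LX LX LX (lexx 0) (lexx 0) _ w.
by rewrite !mul0r !add0r; apply => w'; rewrite !mul0r !add0r.
Qed.

Lemma EtD t X Y w : 0 <= t -> Lp X -> Lp Y -> Et t (fun w => X w + Y w) w <= Et t X w + Et t Y w.
Proof.
move=> t0 LX LY; have := @Et_le t 1 1 0 _ X Y t0 (LipD LX LY) LX LY ler01 ler01 _ w.
by rewrite !mul1r addr0; apply => w'; rewrite !mul1r addr0.
Qed.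

Lemma EtZ t c X w : 0 <= t -> 0 <= c -> Lp X -> Et t (fun w => c * X w) w <= c * Et t X w.
Proof.
move=> t0 c0 LX; have := @Et_le t c 0 0 _ X X t0 (LipZ c LX) LX LX c0 (lexx 0) _ w.
by rewrite mul0r !addr0; apply => w'; rewrite mul0r !addr0.
Qed.

Lemma Et_id t X : Lip t%:E X -> Et t X = X.
Proof. by move=> LX; apply: Et_eq; exact: (cond_Lip_id sl0 slb). Qed.

Definition E0 X : R := Et 0 X point.

Lemma E0E X w : Lp X -> Et 0 X w = E0 X.
Proof. by move=> LX; apply: (cond_Lip0_cst sl0 slb (EtP (lexx 0) LX)). Qed.

Lemma E0_Et t X : 0 <= t -> Lp X -> E0 (Et t X) = E0 X.
Proof.
move=> t0 LX; have c1 := EtP t0 LX; have c2 := EtP (lexx 0) (Et_Lip_oo t0 LX).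
by rewrite /E0 (Et_eq (cond_Lip_tower sl0 slb c1 c2)).
Qed.

Lemma PPE P : PP P <-> forall X, Lp X -> EL P X <= E0 X.
Proof.
split=> [H X LX|H X e c].
  rewrite -lee_fin -(EL_EFin P LX); apply: H.
  have := EtP (lexx 0) LX; rewrite (_ : Et 0 X = cst (E0 X))//.
  by apply/funext => w; exact: E0E.
have [_ LX _] := cond_Lip_Lip sl0 slb c.
by rewrite (EL_EFin P LX) lee_fin; apply: le_trans (H X LX) _; rewrite /E0 (Et_eq c).
Qed.

Definition CB : R := 3 * sb ^+ 4.

(** Domination alone gives positivity and mass 1, by testing negative functionals and constants, and
    the moment bound with the constant of [cond_Lip_moment]. *)
Lemma dominated_posfun (L : (Om -> R) -> R) :
  (forall X Y, Lp X -> Lp Y -> L (fun w => X w + Y w) = L X + L Y) ->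
  (forall (c : R) X, Lp X -> L (fun w => c * X w) = c * L X) ->
  (forall X, Lp X -> L X <= E0 X) -> posfun L CB.
Proof.
move=> LD LZ LE.
have L1 := Lip_cst (R := R) 1 (leey 0 : (0 <= +oo)%E).
have ub X k : Lp X -> (forall w, X w <= k) -> L X <= k.
  by move=> LX H; apply: le_trans (LE _ LX) _; exact: Et_ub.
have pos X : Lp X -> (forall w, 0 <= X w) -> 0 <= L X.
  move=> LX X0; have := @ub (fun w => -1 * X w) 0 (LipZ _ LX).
  by rewrite LZ// mulN1r oppr_le0; apply => w; rewrite mulN1r oppr_le0.
split=> //.
- apply/eqP; rewrite eq_le ub//=.
  have h : L (fun w => -1 * 1) <= -1 by apply: ub => [|w]; [exact: LipZ L1|rewrite mulr1].
  by rewrite LZ// mulN1r lerN2 in h.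
- by rewrite /CB mulr_ge0// exprn_even_ge0.
- move=> s t a s0 st a0.
  have Lpn : Lp (penalty (a, s, t)) by apply: Lip_pen; split=> //; exact: ltW.
  apply: le_trans (LE _ Lpn) _; rewrite /E0.
  apply: le_trans (cond_Lip_moment sl0 slb s0 st a0 (EtP (lexx 0) Lpn) _) _.
  by rewrite /CB exprMn -exprM mulrA.
Qed.

Lemma PP_posfun P : PP P -> posfun (EL P) CB.
Proof.
move=> /PPE H; apply: dominated_posfun => //.
- by move=> X Y LX LY; exact: ELD LX LY.
- by move=> c X LX; exact: ELZ LX.
Qed.

Lemma dominated_PP (L : (Om -> R) -> R) :
  (forall X Y, Lp X -> Lp Y -> L (fun w => X w + Y w) = L X + L Y) ->
  (forall (c : R) X, Lp X -> L (fun w => c * X w) = c * L X) ->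
  (forall X, Lp X -> L X <= E0 X) -> exists2 P, PP P & forall X, Lp X -> EL P X = L X.
Proof.
move=> LD LZ LE; have [P PL] := representation (dominated_posfun LD LZ LE).
by exists P => //; apply/PPE => X LX; rewrite PL// LE.
Qed.

Lemma Lip_sublinear_attained (p : (Om -> R) -> R) X0 :
  (forall X Y, Lp X -> Lp Y -> p (fun w => X w + Y w) <= p X + p Y) ->
  (forall (c : R) X, 0 <= c -> Lp X -> p (fun w => c * X w) <= c * p X) ->
  (forall X, Lp X -> p X <= E0 X) -> Lp X0 ->
  exists2 P, PP P & (forall X, Lp X -> EL P X <= p X) /\ EL P X0 = p X0.
Proof.
move=> pD pZ pE L0.
have [||||L [h1 h2 h3 h4]] := @hahn_banach R (Om -> R^o) (Lp : set (Om -> R^o)) _ _ p X0.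
- by move=> X Y; exact: LipD.
- by move=> c X; exact: LipZ.
- by split=> [X Y|c X]; [exact: pD|exact: pZ].
- exact: L0.
have [P PP1 PL] := dominated_PP h1 h2 (fun X LX => le_trans (h3 X LX) (pE X LX)).
by exists P => //; split=> [X LX|]; rewrite PL// h3.
Qed.

Lemma PP_attained X : Lp X -> exists2 P, PP P & EL P X = E0 X.
Proof.
move=> LX; have [|||P PP1 [_ h]] := @Lip_sublinear_attained E0 X _ _ _ LX => //.
- by move=> Y Z LY LZ; exact: EtD.
- by move=> c Y c0 LY; exact: EtZ.
- by exists P.
Qed.

(** Hahn-Banach is applied to [Y |-> EL P (Et t Y)], which lies below [E0] by the tower property. On
    functionals of F_t it is the linear [EL P], so the dominated measure has to agree with P
    there. *)
Lemma cond_attained P t X : PP P -> 0 <= t -> Lp X ->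
  exists2 Q, PP Q & same_upto t P Q /\ EL Q X = EL P (Et t X).
Proof.
move=> PP1 t0 LX.
have LE Y : Lp Y -> Lp (Et t Y) by exact: Et_Lip_oo.
have [|||Q PQ [h1 h2]] := @Lip_sublinear_attained (fun Y => EL P (Et t Y)) X _ _ _ LX.
- move=> Y Z LY LZ; rewrite -(ELD P (LE _ LY) (LE _ LZ)).
  by apply: EL_le => [||w]; [exact: LE (LipD LY LZ)|exact: LipD (LE _ LY) (LE _ LZ)|exact: EtD].
- move=> c Y c0 LY; rewrite -(ELZ P c (LE _ LY)).
  by apply: EL_le => [||w]; [exact: LE (LipZ c LY)|exact: LipZ (LE _ LY)|exact: EtZ].
- by move=> Y LY; rewrite -(E0_Et t0 LY); move/PPE : PP1; apply; exact: LE.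
exists Q => //; split=> //.
apply: (same_Lip t0 (PP_posfun PP1) (PP_posfun PQ)) => Z LZ.
have LZ' : Lp Z by apply: Lip_le LZ; exact: leey.
apply/eqP; rewrite eq_le; apply/andP; split.
  by apply: le_trans (h1 Z LZ') _; rewrite Et_id.
have := h1 _ (LipZ (-1) LZ'); rewrite Et_id; last exact: LipZ.
by rewrite (ELZ Q _ LZ') (ELZ P _ LZ') !mulN1r lerN2.
Qed.

(** For a nonnegative cylinder weight this is [cond_Lip_pull]. The indicator is approximated under
    the law stopped at t: composing with the stopping map makes the weight a functional of F_t and
    leaves the indicator unchanged. *)
Lemma cond_Lip_super P t X A : PP P -> 0 <= t -> Lp X -> F_ t%:E A ->
  EL P (fun w => (X w - Et t X w) * \1_A w) <= 0.
Proof.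
move=> PP1 t0 LX /F_P[mA AE]; have LY := Et_Lip t0 LX; have LY' := Et_Lip_oo t0 LX.
have LXY : Lp (fun w => X w - Et t X w) by apply: LipD => //; exact: LipN.
have [D [K [M [_ [_ M0 XM _]]]]] := Lip_SL LXY.
apply/ler_addgt0Pr => e e0; rewrite add0r.
have e1 : 0 < e / (M + 1) by rewrite divr_gt0// ltr_wpDl.
have [g [Lg g01 Hg]] := density (posfun_stopped t0 (PP_posfun PP1)) mA e1.
pose g' w := g (stop t w).
have Lg' : Lip t%:E g' by exact: Lip_stop Lg.
have Lg'' : Lp g' by apply: Lip_le Lg'; exact: leey.
have pull : EL P (fun w => (X w - Et t X w) * g' w) <= 0.
  have LXYg : Lp (fun w => (X w - Et t X w) * g' w) by exact: LipM.
  move/PPE : (PP1) => /(_ _ LXYg)/le_trans; apply.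
  apply: (cond_Lip_pull sl0 slb (EtP t0 LX) Lg' _ (EtP (lexx 0) LXYg)) => w.
  by rewrite /g'; have /andP[] := g01 (stop t w).
have mg := Lip_measurable Lg; have mg' := Lip_measurable Lg''.
have mI : measurable_fun setT (\1_A : Om -> R) by exact: measurable_indic.
have mXY := Lip_measurable LXY.
have bI w : 0 <= (\1_A w : R) <= 1 by rewrite indicE ler0n lern1 leq_b1.
have IE w : \1_A (stop t w) = \1_A w :> R by rewrite !indicE (F_mem w AE).
have b1 w : `|g' w - \1_A w| <= 1.
  by rewrite ler_norml; move: (g01 (stop t w)) (bI w) => /andP[? ?] /andP[? ?]; rewrite /g'; apply/andP; split; lra.
have mgI : measurable_fun setT (fun w => `|g' w - \1_A w|).
  by apply: measurableT_comp => //; exact: measurable_funB.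
have igI : P.-integrable setT (EFin \o (fun w => `|g' w - \1_A w|)).
  by apply: (@bounded_int _ _ _ 1) => // w; rewrite normr_id.
have Hg' : EL P (fun w => `|g' w - \1_A w|) <= e / (M + 1).
  apply: le_trans Hg; rewrite /EL /Rintegral /stopped integral_distribution.
  - by rewrite le_eqVlt; apply/orP; left; apply/eqP; congr fine; apply: eq_integral => w _; rewrite /= IE.
  - by apply/measurable_EFinP; apply: measurableT_comp => //; exact: measurable_funB.
  - by apply: eq_integrable igI => // w _; rewrite /= IE.
have i1 : P.-integrable setT (EFin \o (fun w => (X w - Et t X w) * g' w)).
  by apply: Rint_Lip; exact: LipM LXY Lg''.
have i2 : P.-integrable setT (EFin \o (fun w => (M + 1) * `|g' w - \1_A w|)).
  exact: (integrableZl measurableT (M + 1) igI).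
apply: le_trans (_ : EL P (fun w => (X w - Et t X w) * g' w + (M + 1) * `|g' w - \1_A w|) <= _).
  apply: le_Rintegral => //.
  - apply: (@bounded_int _ _ _ M) => [|w]; first exact: measurable_funM.
    rewrite normrM -[leRHS]mulr1 ler_pM// ger0_norm; by have /andP[] := bI w.
  - exact: (integrableD measurableT i1 i2).
  - move=> w _; have h1 := XM w; rewrite -lerBlDl -mulrBr.
    apply: le_trans (ler_norm _) _; rewrite normrM (distrC (\1_A w)) ler_wpM2r//.
    by apply: le_trans h1 _; rewrite lerDl.
rewrite /EL RintegralD// RintegralZl//.
have : (M + 1) * EL P (fun w => `|g' w - \1_A w|) <= e by rewrite -ler_pdivlMl ?ltr_wpDl// mulrC.
by move: pull; rewrite /EL => ? ?; lra.
Qed.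

(** Weak compactness: the limit of the expectations along the ultrafilter is again a linear
    functional dominated by [E0], hence given by a measure of [PP]. *)
Lemma PP_compact (Pn : nat -> probability Om R) : (forall n, PP (Pn n)) ->
  exists2 Q, PP Q & forall X, Lp X -> (EL (Pn n) X) @[n --> ultra] --> EL Q X.
Proof.
move=> PPn; pose L X := ulim (fun n => EL (Pn n) X).
have ub X : Lp X -> ubd (fun n => EL (Pn n) X).
  move=> LX; have [D [K [M [_ [_ M0 XM _]]]]] := Lip_SL LX; exists M => n.
  rewrite ler_norml; apply/andP; split.
    rewrite -(EL_cst (Pn n) (- M)); apply: (@EL_le R (Pn n) +oo%E) => //; first exact: Lip_cst.
    by move=> w; have := XM w; rewrite ler_norml => /andP[].
  rewrite -(EL_cst (Pn n) M); apply: (@EL_le R (Pn n) +oo%E) => //; first exact: Lip_cst.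
  by move=> w; have := XM w; rewrite ler_norml => /andP[].
have [|||Q PQ QL] := @dominated_PP L.
- move=> X Y LX LY; rewrite /L -ulimD; [|exact: ub|exact: ub].
  by congr ulim; apply/funext => n; exact: ELD LX LY.
- move=> c X LX; rewrite /L -[in RHS](ulim_cst c) -ulimM; [|exact: ubd_cst|exact: ub].
  by congr ulim; apply/funext => n; exact: ELZ LX.
- move=> X LX; rewrite /L -(ulim_cst (E0 X)); apply: ulim_le; [exact: ub|exact: ubd_cst|].
  by move=> n; move/PPE : (PPn n); apply.
by exists Q => // X LX; rewrite QL//; apply: ulim_cvg; exact: ub.
Qed.

End Sublinear.

(** * Quasi-sure analysis *)

Section QS.
Variables (R : realType) (sl sb : R).
Hypotheses (sl0 : 0 <= sl) (slb : sl <= sb).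
Local Notation Om := (Omega R).
Local Notation Lp := (Lip (R := R) +oo%E).
Local Notation PP := (PP sl sb).
Local Notation Ehat := (Ehat sl sb).
Local Notation qs := (qs sl sb).
Local Notation L1 := (L1 sl sb).
Local Notation LG1 := (LG1 sl sb).
Local Notation cvg_L1 := (cvg_L1 sl sb).
Implicit Types (P Q : probability Om R) (t : R) (X Y Z : Om -> \bar R) (A N : set Om).

Lemma PP_ex : exists P, PP P.
Proof. by have [P PP1 _] := PP_attained sl0 slb (Lip_cst (0 : R) (leey 0%E)); exists P. Qed.

Lemma Ehat_ub P X : PP P -> (\int[P]_w X w <= Ehat X)%E.
Proof. by move=> PP1; apply: ereal_sup_ubound; exists P. Qed.

Lemma Ehat_le X (c : \bar R) : (forall P, PP P -> (\int[P]_w X w <= c)%E) -> (Ehat X <= c)%E.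
Proof. by move=> H; apply: ge_ereal_sup => _ [P PP1 <-]; exact: H. Qed.

Lemma Ehat_ge0 X : (forall w, 0 <= X w)%E -> (0 <= Ehat X)%E.
Proof.
by move=> X0; have [P PP1] := PP_ex; apply: le_trans (Ehat_ub X PP1); apply: integral_ge0.
Qed.

Lemma qs_null N P : capacity sl sb N = 0%E -> PP P -> P N = 0%E.
Proof.
move=> cN PP1; apply/eqP; rewrite eq_le measure_ge0 andbT -cN.
by apply: ereal_sup_ubound; exists P.
Qed.

Lemma qs_intro N (T : Om -> Prop) : measurable N -> (forall P, PP P -> P N = 0%E) ->
  (forall w, ~ N w -> T w) -> qs T.
Proof.
move=> mN N0 H; exists N; split=> //; apply/eqP; rewrite eq_le; apply/andP; split.
  by apply: ge_ereal_sup => _ [P PP1 <-]; rewrite N0.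
have [P PP1] := PP_ex; rewrite -(N0 P PP1); apply: ereal_sup_ubound; by exists P.
Qed.

Lemma qs_ae P (T : Om -> Prop) : PP P -> qs T -> {ae P, forall w, T w}.
Proof.
move=> PP1 [N [mN cN H]]; exists N; split=> //; first exact: qs_null PP1.
by move=> w /=; apply: contra_notP => /H.
Qed.

Lemma qs_sub (T U : Om -> Prop) : (forall w, T w -> U w) -> qs T -> qs U.
Proof. by move=> TU [N [mN cN H]]; exists N; split=> // w /H/TU. Qed.

Lemma qsT (T : Om -> Prop) : (forall w, T w) -> qs T.
Proof. by move=> H; apply: (@qs_intro set0) => // P _; exact: measure0. Qed.

Lemma qs_all (T : nat -> Om -> Prop) : (forall n, qs (T n)) -> qs (fun w => forall n, T n w).
Proof.
move=> H; have /choice[N HN] n : exists N, [/\ measurable N, capacity sl sb N = 0%E & forall w, ~ N w -> T n w] by exact: H.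
apply: (@qs_intro (\bigcup_n N n)).
- by apply: bigcupT_measurable => n; have [] := HN n.
- move=> P PP1; apply: measure_negligible.
    by apply: bigcupT_measurable => n; have [] := HN n.
  apply: negligible_bigcup => n; have [mN cN _] := HN n.
  by apply/negligibleP => //; exact: qs_null PP1.
- by move=> w nN n; have [_ _ h] := HN n; apply: h => Nw; apply: nN; exists n.
Qed.

Lemma qs_and (T U : Om -> Prop) : qs T -> qs U -> qs (fun w => T w /\ U w).
Proof.
move=> HT HU; have := @qs_all (fun n => if n is 0%N then T else U); move=> h.
apply: qs_sub (h _) => [w H|[|n]//]; by split; [exact: (H 0%N)|exact: (H 1%N)].
Qed.

Lemma qs_set (T : Om -> Prop) : measurable [set w | ~ T w] ->
  (forall P, PP P -> P [set w | ~ T w] = 0%E) -> qs T.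
Proof. by move=> mT T0; apply: (qs_intro mT T0) => w /= /contrapT. Qed.

Lemma L0_meas h X : L0 h X -> measurable_fun setT X.
Proof. by case: h => [t /L0P[]|/L0oo|/L0oo]. Qed.

Lemma L1_meas h X : L1 h X -> measurable_fun setT X.
Proof. by case=> /L0_meas. Qed.

Lemma L1_int h X P : PP P -> L1 h X -> P.-integrable setT X.
Proof.
move=> PP1 LX; apply/integrableP; split; first exact: L1_meas LX.
by case: LX => _; apply: le_lt_trans; exact: (Ehat_ub (fun w => `|X w|%E) PP1).
Qed.

Lemma Lip_L0 h (X : Om -> R) : Lip h X -> L0 h (EFin \o X).
Proof.
move=> LX; have mX : measurable_fun setT (EFin \o X) by apply/measurable_EFinP; exact: Lip_measurable LX.
case: h LX => [t||] LX; [|exact: ((L0oo _).2 mX)|exact: ((L0oo _).2 mX)].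
by apply/L0P; split=> // w /=; rewrite Lip_stopE.
Qed.

Lemma Ehat_bd X (M : R) : measurable_fun setT X -> (forall w, `|X w| <= M%:E)%E -> (Ehat (fun w => `|X w|) <= M%:E)%E.
Proof.
move=> mX H; apply: Ehat_le => P _.
apply: le_trans (_ : \int[P]_w M%:E <= _)%E.
  have mX' : measurable_fun setT (fun w => `|X w|%E) by exact: measurableT_comp.
  have M0 (w : Om) : (0 <= M%:E)%E := le_trans (abse_ge0 _) (H w).
  by apply: ge0_le_integral => // w _; exact: M0.
rewrite integral_cst// [X in (_ * X)%E](_ : _ = 1%E) ?mule1//; exact: probability_setT.
Qed.

Lemma Lip_L1 h (X : Om -> R) : Lip h X -> L1 h (EFin \o X).
Proof.
move=> LX; have h1 := Lip_L0 LX; split=> //.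
have [D [K [M [_ [_ _ XM _]]]]] := Lip_SL LX.
apply: le_lt_trans (ltry M); apply: Ehat_bd; first exact: L0_meas h1.
by move=> w; rewrite lee_fin.
Qed.

Lemma L0_oo h X : L0 h X -> L0 +oo%E X.
Proof. by move=> /L0_meas ?; exact/L0oo. Qed.

Lemma L1_oo h X : L1 h X -> L1 +oo%E X.
Proof. by case=> /L0_oo. Qed.

Definition I P A X : R := fine (\int[P]_(w in A) X w).

Lemma I_E P A X : measurable A -> P.-integrable setT X -> ((I P A X)%:E = \int[P]_(w in A) X w)%E.
Proof.
move=> mA iX; rewrite /I fineK//; apply: integrable_fin_num => //.
exact: integrableS iX.
Qed.

Lemma I_split P A X : measurable A -> P.-integrable setT X -> I P setT X = I P A X + I P (~` A) X.
Proof.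
move=> mA iX; apply/EFin_inj; rewrite EFinD !I_E//; last exact: measurableC.
rewrite -integral_setU//; [by rewrite setUv|exact: measurableC| |].
  by rewrite setUv; exact: (measurable_int P iX).
by apply/disj_setPRL.
Qed.

Lemma I_le P A X Y : measurable A -> P.-integrable setT X -> P.-integrable setT Y ->
  {ae P, forall w, X w <= Y w}%E -> I P A X <= I P A Y.
Proof.
move=> mA iX iY XY; rewrite -lee_fin !I_E//.
have mX := measurable_int P iX; have mY := measurable_int P iY.
(* The minimum turns an inequality almost everywhere into one everywhere without changing the
   integral of X. *)
pose Z w := mine (X w) (Y w).
have mZ : measurable_fun setT Z by exact: measurable_mine.
have iZ : P.-integrable setT Z.
  apply: (le_integrable measurableT mZ _ (integrableD measurableT (integrable_abse iX) (integrable_abse iY))).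
  move=> w _ /=; rewrite (gee0_abs (adde_ge0 (abse_ge0 _) (abse_ge0 _))) /Z.
  by case: (leP (X w) (Y w)) => _; [rewrite leeDl|rewrite leeDr].
have -> : (\int[P]_(w in A) X w = \int[P]_(w in A) Z w)%E.
  apply: ae_eq_integral => //; [exact: measurable_funTS|exact: measurable_funTS|].
  by apply: filterS XY => w h _; rewrite /Z min_l.
apply: le_integral => //; [exact: integrableS iZ|exact: integrableS iY|].
by move=> w _; rewrite /Z ge_min lexx orbT.
Qed.

Lemma I_diff P A X X' (d : R) : measurable A -> P.-integrable setT X -> P.-integrable setT X' ->
  (\int[P]_w `|X w - X' w| <= d%:E)%E -> I P A X <= I P A X' + d.
Proof.
move=> mA iX iX' H; rewrite -lerBlDl -lee_fin EFinB !I_E//.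
rewrite -integralB//; [|exact: integrableS iX|exact: integrableS iX'].
have mB : measurable_fun setT (fun w => X w - X' w)%E.
  by apply: emeasurable_funB; [exact: (measurable_int P iX)|exact: (measurable_int P iX')].
apply: le_trans (lee_abs _) _; apply: le_trans (le_abse_integral P mA _) _; first exact: measurable_funTS.
apply: le_trans H; apply: ge0_subset_integral => //; exact: measurableT_comp.
Qed.

Lemma I_cvg P A (Xn : nat -> Om -> \bar R) X Y : measurable A -> (forall n, measurable_fun setT (Xn n)) ->
  measurable_fun setT X -> P.-integrable setT Y -> {ae P, forall w, Xn n w @[n --> \oo] --> X w} ->
  {ae P, forall w, forall n, `|Xn n w| <= Y w}%E -> I P A (Xn n) @[n --> \oo] --> I P A X.
Proof.
move=> mA mXn mX iY cX bX.
have [iX _ h] : [/\ P.-integrable A X, [sequence (\int[P]_(w in A) `|Xn n w - X w|)%E]_n @ \oo --> 0%E &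
    [sequence (\int[P]_(w in A) Xn n w)%E]_n @ \oo --> (\int[P]_(w in A) X w)%E].
  apply: (@dominated_convergence _ _ _ P A mA Xn X Y).
  - by move=> n; exact: measurable_funTS.
  - exact: measurable_funTS.
  - by apply: filterS cX => w h _.
  - exact: integrableS iY.
  - by apply: filterS bX => w h n _.
have fX : (\int[P]_(w in A) X w)%E \is a fin_num by exact: integrable_fin_num.
by move: h; rewrite -(fineK fX) => /fine_cvgP[_].
Qed.

Lemma I_same P Q t X A : same_upto t P Q -> L0 t%:E X -> F_ t%:E A -> I Q A X = I P A X.
Proof. by move=> h1 h2 h3; rewrite /I (same_int h1 h2 h3). Qed.

Lemma I_EFin P (X : Om -> R) : I P setT (EFin \o X) = EL P X.
Proof. by []. Qed.

Lemma cvg_L1P (Xn : nat -> Om -> \bar R) X : cvg_L1 Xn X <->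
  forall e : R, 0 < e -> exists N : nat, forall n, (N <= n)%N -> (Ehat (fun w => `|Xn n w - X w|) <= e%:E)%E.
Proof.
have ge0 n : (0 <= Ehat (fun w => `|Xn n w - X w|))%E by apply: Ehat_ge0.
split=> [/fine_cvgP[fin /cvgrPdist_le c] e e0|H].
  have [N1 _ h1] := fin; have [N2 _ h2] := c e e0; exists (maxn N1 N2) => n; rewrite geq_max => /andP[n1 n2].
  have := h2 n n2; rewrite sub0r normrN /= ger0_norm ?fine_ge0// -lee_fin fineK//; exact: h1.
apply/fine_cvgP; split.
  have [N HN] := H 1 ltr01; exists N => // n /= Nn.
  by rewrite ge0_fin_numE//; apply: le_lt_trans (HN n Nn) (ltry _).
apply/cvgrPdist_le => e e0; have [N HN] := H e e0; exists N => // n /= Nn.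
have h := HN n Nn; rewrite sub0r normrN /= ger0_norm ?fine_ge0// -lee_fin fineK//.
by rewrite ge0_fin_numE//; apply: le_lt_trans h (ltry _).
Qed.

Lemma Ehat_sym X Y : Ehat (fun w => `|X w - Y w|)%E = Ehat (fun w => `|Y w - X w|)%E.
Proof.
congr Defs.Ehat; apply/funext => w.
by case: (X w) (Y w) => [x||] [y||] //=; rewrite distrC.
Qed.

Lemma L1_sub_meas h k X Y : L1 h X -> L1 k Y -> measurable_fun setT (fun w => X w - Y w)%E.
Proof. by move=> /L1_meas mX /L1_meas mY; exact: emeasurable_funB. Qed.

Lemma Ehat_triangle h1 h2 h3 X Y Z : L1 h1 X -> L1 h2 Y -> L1 h3 Z ->
  (Ehat (fun w => `|X w - Z w|) <= Ehat (fun w => `|X w - Y w|) + Ehat (fun w => `|Y w - Z w|))%E.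
Proof.
move=> LX LY LZ; apply: Ehat_le => P PP1.
have mm X' Y' h h' : L1 h X' -> L1 h' Y' -> measurable_fun setT (fun w => `|X' w - Y' w|)%E.
  by move=> h1' h2'; apply: measurableT_comp => //; exact: L1_sub_meas h1' h2'.
apply: le_trans (_ : \int[P]_w (`|X w - Y w| + `|Y w - Z w|) <= _)%E; last first.
  rewrite ge0_integralD//; [|exact: mm LX LY|exact: mm LY LZ].
  by apply: leeD; exact: Ehat_ub.
apply: ae_ge0_le_integral => //.
- exact: mm LX LZ.
- by move=> w _; exact: adde_ge0.
- by apply: emeasurable_funD; [exact: mm LX LY|exact: mm LY LZ].
- have f1 := integrable_ae measurableT (L1_int PP1 LY).
  apply: filterS f1 => w /(_ Logic.I) fY _; move: fY.
  case: (X w) (Y w) (Z w) => [x||] [y||] [z||] //= _; rewrite ?lee_fin ?leey//.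
  rewrite (_ : x - z = (x - y) + (y - z)); last by ring.
  exact: ler_normD.
Qed.

End QS.

(** * Conditional expectations characterized by integrals *)

Section Cond.
Variables (R : realType) (sl sb : R).
Hypotheses (sl0 : 0 <= sl) (slb : sl <= sb).
Local Notation Om := (Omega R).
Local Notation Lp := (Lip (R := R) +oo%E).
Local Notation PP := (PP sl sb).
Local Notation Ehat := (Ehat sl sb).
Local Notation qs := (qs sl sb).
Local Notation L1 := (L1 sl sb).
Local Notation LG1 := (LG1 sl sb).
Local Notation cvg_L1 := (cvg_L1 sl sb).
Local Notation qs_decreases := (qs_decreases sl sb).
Local Notation qs_increases := (qs_increases sl sb).
Implicit Types (P Q : probability Om R) (s t : R) (X Y Z : Om -> \bar R) (A : set Om).

(* Y is a version of the conditional expectation of X: Y dominates E^P[X | F_t]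
   for every P, and is attained up to e by some Q that agrees with P on F_t. *)
Definition cond t X Y : Prop := [/\ L1 +oo%E X, L1 t%:E Y & forall P, PP P ->
  (forall A, F_ t%:E A -> I P A X <= I P A Y) /\
  forall e : R, 0 < e -> exists2 Q, PP Q & same_upto t P Q /\ I P setT Y <= I Q setT X + e].

(** Attainment on the whole space localizes to A: on the complement Y dominates X under Q, so
    nothing lost on A can be recovered there. *)
Lemma cond_att t X Y P A (e : R) : cond t X Y -> PP P -> F_ t%:E A -> 0 < e ->
  exists2 Q, PP Q & same_upto t P Q /\ I P A Y <= I Q A X + e.
Proof.
move=> [LX LY H] PP1 FA e0; have [_ /(_ e e0)[Q PQ [same att]]] := H P PP1.
exists Q => //; split=> //; have [mA _] := (F_P t A).1 FA.
have [up _] := H Q PQ; have := up _ (F_C FA).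
have LY0 : L0 t%:E Y by case: LY.
rewrite (I_same same LY0 (F_C FA)).
rewrite (I_split mA (L1_int PP1 LY)) (I_split mA (L1_int PQ LX)) in att.
by move: att => ? ?; lra.
Qed.

Lemma F_le_set t Y Y' : L0 t%:E Y -> L0 t%:E Y' -> F_ t%:E [set w | Y w <= Y' w]%E.
Proof.
move=> /L0P[mY YE] /L0P[mY' YE']; apply/F_P; split.
  by have := measurable_lee measurableT mY mY'; rewrite setTI.
by apply/seteqP; split=> w /=; rewrite YE YE'.
Qed.

Lemma F_lt_set t Y Y' : L0 t%:E Y -> L0 t%:E Y' -> F_ t%:E [set w | Y w < Y' w]%E.
Proof.
move=> LY LY'; have := F_C (F_le_set LY' LY).
rewrite (_ : ~` _ = [set w | Y w < Y' w]%E)//.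
by apply/seteqP; split=> w /=; rewrite ltNge => /negP.
Qed.

(** The passage from X to Y: a nearly optimal Q for X on A is inserted into the upper bound for X',
    and both Y and Y' are integrated alike by P and Q. *)
Lemma cond_local t X Y X' Y' P A (d : R) : cond t X Y -> cond t X' Y' -> PP P -> F_ t%:E A ->
  (forall Q, PP Q -> I Q A X <= I Q A X' + d) -> I P A Y <= I P A Y' + d.
Proof.
move=> c c' PP1 FA H; apply/ler_addgt0Pr => e e0.
have [Q PQ [same att]] := cond_att c PP1 FA e0.
have [_ [LY' _] H'] := c'; have [/(_ A FA) up _] := H' Q PQ; rewrite (I_same same LY' FA) in up.
by have := H Q PQ; move: att up => ? ? ?; lra.
Qed.

Lemma int0_null P (A : set Om) X : measurable A -> measurable_fun setT X -> (forall w, A w -> 0 < X w)%E ->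
  (\int[P]_(w in A) X w)%E = 0%E -> P A = 0%E.
Proof.
move=> mA mX X0 H.
have := @ae_eq_integral_abs _ _ _ P A mA X (measurable_funTS mX).
move=> [+ _]; rewrite (_ : (\int[P]_(x in A) `|X x|)%E = 0%E); last first.
  by rewrite -[RHS]H; apply: eq_integral => w /set_mem Aw; rewrite gee0_abs// ltW// X0.
move=> /(_ erefl) [N [mN N0 HN]].
apply: (@subset_measure0 _ _ _ P A N) => // w Aw; apply: HN => /= h'.
by have := X0 w Aw; rewrite h'// ltxx.
Qed.

Lemma cond_mono t X Y X' Y' : cond t X Y -> cond t X' Y' -> qs (fun w => X w <= X' w)%E ->
  qs (fun w => Y w <= Y' w)%E.
Proof.
move=> c c' XX; have [LX LY H] := c; have [LX' LY' H'] := c'.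
have [LY0 _] := LY; have [LY'0 _] := LY'.
have FA := F_lt_set LY'0 LY0; have [mA _] := (F_P _ _).1 FA.
have E : [set w | ~ (Y w <= Y' w)%E] = [set w | Y' w < Y w]%E.
  by apply/seteqP; split=> w /=; rewrite ltNge => /negP.
apply: (qs_set sl0 slb); rewrite E// => P PP1.
set A := [set w | Y' w < Y w]%E in FA mA *.
have h : I P A Y <= I P A Y' + 0.
  apply: (cond_local c c' PP1 FA) => Q PQ; rewrite addr0.
  by apply: I_le => //; [exact: L1_int LX|exact: L1_int LX'|exact: qs_ae XX].
rewrite addr0 in h.
have iY := L1_int PP1 LY; have iY' := L1_int PP1 LY'.
have mB : measurable_fun setT (fun w => Y w - Y' w)%E by exact: L1_sub_meas LY LY'.
apply: (int0_null mA mB) => [w /=|]; first by rewrite /A /= sube_gt0.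
apply/eqP; rewrite eq_le; apply/andP; split.
  rewrite integralB//; [|exact: integrableS iY|exact: integrableS iY'].
  by rewrite -!I_E// -EFinB lee_fin subr_le0.
by apply: integral_ge0 => w; rewrite /A /= => h'; apply: ltW; rewrite sube_gt0.
Qed.

Lemma cond_uniq t X Y Y' : cond t X Y -> cond t X Y' -> qs (fun w => Y w = Y' w).
Proof.
move=> c c'; have h1 := cond_mono c c' (qsT sl0 slb (fun w => lexx (X w))).
have h2 := cond_mono c' c (qsT sl0 slb (fun w => lexx (X w))).
by apply: qs_sub (qs_and sl0 slb h1 h2) => w [a b]; apply/eqP; rewrite eq_le a b.
Qed.

Lemma abs_split P Y Y' : P.-integrable setT Y -> P.-integrable setT Y' ->
  (\int[P]_w `|Y w - Y' w|)%E = (I P [set w | Y' w <= Y w]%E Y - I P [set w | Y' w <= Y w]%E Y' +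
   (I P (~` [set w | Y' w <= Y w]%E) Y' - I P (~` [set w | Y' w <= Y w]%E) Y))%:E.
Proof.
move=> iY iY'; set A := [set w | Y' w <= Y w]%E.
have mY := measurable_int P iY; have mY' := measurable_int P iY'.
have mA : measurable A by have := measurable_lee measurableT mY' mY; rewrite setTI.
have mB : measurable_fun setT (fun w => `|Y w - Y' w|)%E by apply: measurableT_comp => //; exact: emeasurable_funB.
have fY := integrable_ae measurableT iY; have fY' := integrable_ae measurableT iY'.
have key (D : set Om) U V : measurable D -> P.-integrable setT U -> P.-integrable setT V ->
    {ae P, forall w, D w -> `|Y w - Y' w| = U w - V w}%E ->
    (\int[P]_(w in D) `|Y w - Y' w|)%E = (I P D U - I P D V)%:E.
  move=> mD iU iV ae; rewrite EFinB !I_E// -integralB//; [|exact: integrableS iU|exact: integrableS iV].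
  apply: ae_eq_integral => //; first exact: measurable_funTS.
  have mU := measurable_int P iU; have mV := measurable_int P iV.
  by apply: measurable_funTS; exact: emeasurable_funB.
rewrite -(setUv A) integral_setU//; [|exact: measurableC|by rewrite setUv|exact/disj_setPRL].
rewrite EFinD; congr (_ + _)%E; apply: key => //; try exact: measurableC.
- apply: filterS2 fY fY' => w /(_ Logic.I) f1 /(_ Logic.I) f2; rewrite /A /=; move: f1 f2.
  by case: (Y w) (Y' w) => [y||] [y'||] //= _ _; rewrite !lee_fin => h; rewrite ger0_norm ?subr_ge0.
- apply: filterS2 fY fY' => w /(_ Logic.I) f1 /(_ Logic.I) f2; rewrite /A /=; move: f1 f2.
  case: (Y w) (Y' w) => [y||] [y'||] //= _ _; rewrite !lee_fin => /negP; rewrite -ltNge => h.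
  by rewrite ltr0_norm ?subr_lt0// opprB.
Qed.

(** The constant 2 arises because the set where Y is at least Y' and its complement are treated with
    two different nearly optimal measures. *)
Lemma cond_contr t X Y X' Y' (d : R) : cond t X Y -> cond t X' Y' ->
  (Ehat (fun w => `|X w - X' w|) <= d%:E)%E -> (Ehat (fun w => `|Y w - Y' w|) <= (2 * d)%:E)%E.
Proof.
move=> c c' H; have [LX LY h] := c; have [LX' LY' h'] := c'; apply: Ehat_le => P PP1.
rewrite abs_split; [|exact: L1_int LY|exact: L1_int LY'].
have [LY0 _] := LY; have [LY'0 _] := LY'.
have FA := F_le_set LY'0 LY0; set A := [set w | _] in FA *.
have mA B : F_ t%:E B -> measurable B by move=> /F_P[].
have h1 : I P A Y <= I P A Y' + d.
  apply: (cond_local c c' PP1 FA) => Q PQ; apply: I_diff; [exact: mA|exact: L1_int LX|exact: L1_int LX'|].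
  by apply: le_trans H; exact: Ehat_ub.
have h2 : I P (~` A) Y' <= I P (~` A) Y + d.
  apply: (cond_local c' c PP1 (F_C FA)) => Q PQ; apply: I_diff; [apply: mA; exact: F_C|exact: L1_int LX'|exact: L1_int LX|].
  by apply: le_trans H; rewrite Ehat_sym; exact: Ehat_ub.
by rewrite lee_fin; lra.
Qed.

Lemma cond_tower s t X Y Z : s <= t -> cond t X Y -> cond s Y Z -> cond s X Z.
Proof.
move=> st [LX LY H] [_ LZ H']; split=> // P PP1; split=> [A FA|e e0].
  have [up _] := H P PP1; have [up' _] := H' P PP1.
  by apply: le_trans (up _ (F_le st FA)) (up' _ FA).
have e2 : 0 < e / 2 by rewrite divr_gt0.
have [_ /(_ _ e2)[Q1 PQ1 [same1 att1]]] := H' P PP1.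
have [_ /(_ _ e2)[Q2 PQ2 [same2 att2]]] := H Q1 PQ1.
exists Q2 => //; split; last by lra.
by move=> A FA; rewrite same2 ?same1//; exact: F_le FA.
Qed.

Lemma cond_Lip_cond t (X Y : Om -> R) : cond_Lip sl sb t X Y -> cond t (EFin \o X) (EFin \o Y).
Proof.
move=> c; have [t0 LX LY] := cond_Lip_Lip sl0 slb c; have YE := Et_eq sl0 slb c.
have LY' : Lp Y by apply: Lip_le LY; exact: leey.
split=> [||P PP1]; [exact: Lip_L1|exact: Lip_L1|split=> [A FA|e e0]].
  have [mA _] := (F_P _ _).1 FA.
  have mI : measurable_fun setT (\1_A : Om -> R) by exact: measurable_indic.
  have E (Z : Om -> R) : Lp Z -> I P A (EFin \o Z) = EL P (fun w => Z w * \1_A w) /\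
      P.-integrable setT (EFin \o (fun w => Z w * \1_A w)).
    move=> LZ; split; last first.
      have [D [K [M [_ [_ M0 ZM _]]]]] := Lip_SL LZ; apply: (@bounded_int _ _ _ M) => [|w].
        by apply: measurable_funM => //; exact: Lip_measurable LZ.
      rewrite normrM -[leRHS]mulr1 ler_pM// ger0_norm indicE// lern1 leq_b1//.
    rewrite /I integral_mkcond /EL /Rintegral; congr fine; apply: eq_integral => w _.
    by rewrite /patch indicE; case: (w \in A); rewrite ?mulr1 ?mulr0.
  have [-> i1] := E _ LX; have [-> i2] := E _ LY'.
  have := cond_Lip_super sl0 slb PP1 t0 LX FA; rewrite YE.
  have -> : (fun w => (X w - Y w) * \1_A w) = fun w => X w * \1_A w - Y w * \1_A w.
    by apply/funext => w; rewrite mulrBl.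
  by rewrite /EL RintegralB// subr_le0.
have [Q PQ [same h]] := cond_attained sl0 slb PP1 t0 LX.
by exists Q => //; split=> //; rewrite !I_EFin h YE lerDl ltW.
Qed.

Lemma cond_closed t (Xn Yn : nat -> Om -> \bar R) X Y : (forall n, cond t (Xn n) (Yn n)) ->
  L1 +oo%E X -> L1 t%:E Y -> cvg_L1 Xn X -> cvg_L1 Yn Y -> cond t X Y.
Proof.
move=> c LX LY /(cvg_L1P sl0 slb) cX /(cvg_L1P sl0 slb) cY; split=> // P PP1.
have near e : 0 < e -> exists n, forall Q, PP Q -> forall A, measurable A ->
    [/\ I Q A X <= I Q A (Xn n) + e, I Q A (Xn n) <= I Q A X + e,
        I Q A Y <= I Q A (Yn n) + e & I Q A (Yn n) <= I Q A Y + e].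
  move=> e0; have [N1 h1] := cX e e0; have [N2 h2] := cY e e0; exists (maxn N1 N2) => Q PQ A mA.
  have [LXn LYn _] := c (maxn N1 N2).
  have := h1 _ (leq_maxl N1 N2); have := h2 _ (leq_maxr N1 N2); set n := maxn _ _ in LXn LYn * => b2 b1.
  have b1' := b1; rewrite Ehat_sym in b1'; have b2' := b2; rewrite Ehat_sym in b2'.
  have iX := L1_int PQ LX; have iY := L1_int PQ LY; have iXn := L1_int PQ LXn; have iYn := L1_int PQ LYn.
  by split; apply: I_diff => //; [apply: le_trans b1'|apply: le_trans b1|apply: le_trans b2'|apply: le_trans b2];
    exact: Ehat_ub.
split=> [A FA|e e0].
  have [mA _] := (F_P _ _).1 FA; apply/ler_addgt0Pr => e e0; have e2 : 0 < e / 2 by rewrite divr_gt0.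
  have [n /(_ P PP1 A mA)[h1 _ _ h2]] := near _ e2.
  by have [_ _ /(_ P PP1)[/(_ A FA) up _]] := c n; lra.
have e2 : 0 < e / 3 by rewrite divr_gt0.
have [n h] := near _ e2; have [_ _ /(_ P PP1)[_ /(_ _ e2)[Q PQ [same att]]]] := c n.
exists Q => //; split=> //.
have [_ h2 _ _] := h Q PQ setT measurableT; have [_ _ h1 _] := h P PP1 setT measurableT; lra.
Qed.

Lemma abse_between (a b c : \bar R) : (a <= b -> b <= c -> `|b| <= `|a| + `|c|)%E.
Proof.
case: a b c => [a||] [b||] [c||] //=; rewrite ?lee_fin ?leey// => ab bc.
have := ler_norm c; have := ler_norm (- a); rewrite normrN => h1 h2.
have := normr_ge0 a; have := normr_ge0 c => h3 h4.
by rewrite ler_norml; apply/andP; split; lra.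
Qed.

Lemma I_cvg_between P A (Xn : nat -> Om -> \bar R) X U V : measurable A -> PP P ->
  (forall n, measurable_fun setT (Xn n)) -> L1 +oo%E X -> L1 +oo%E U -> L1 +oo%E V ->
  qs (fun w => Xn n w @[n --> \oo] --> X w) -> qs (fun w => forall n, (U w <= Xn n w)%E /\ (Xn n w <= V w)%E) ->
  I P A (Xn n) @[n --> \oo] --> I P A X.
Proof.
move=> mA PP1 mXn LX LU LV cX bX.
apply: (@I_cvg _ P A Xn X (fun w => `|U w| + `|V w|)%E) => //.
- exact: L1_meas LX.
- by apply: integrableD => //; apply: integrable_abse; [exact: L1_int LU|exact: L1_int LV].
- exact: qs_ae cX.
- by apply: filterS (qs_ae PP1 bX) => w h n; have [h1 h2] := h n; exact: abse_between.
Qed.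

Lemma qs_dec_bounds (Xn : nat -> Om -> \bar R) X : qs_decreases Xn X ->
  qs (fun w => Xn n w @[n --> \oo] --> X w) /\ qs (fun w => forall n, (X w <= Xn n w)%E /\ (Xn n w <= Xn 0%N w)%E).
Proof.
move=> H; split; first by apply: qs_sub H => w [].
apply: qs_sub H => w [ni cX] n; split; last exact: ni.
rewrite -(cvg_lim (@ereal_hausdorff R) cX) (cvg_lim (@ereal_hausdorff R) (ereal_nonincreasing_cvgn ni)).
by apply: ereal_inf_lbound; exists n.
Qed.

Lemma qs_inc_bounds (Xn : nat -> Om -> \bar R) X : qs_increases Xn X ->
  qs (fun w => Xn n w @[n --> \oo] --> X w) /\ qs (fun w => forall n, (Xn 0%N w <= Xn n w)%E /\ (Xn n w <= X w)%E).
Proof.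
move=> H; split; first by apply: qs_sub H => w [].
apply: qs_sub H => w [ni cX] n; split; first exact: ni.
rewrite -(cvg_lim (@ereal_hausdorff R) cX) (cvg_lim (@ereal_hausdorff R) (ereal_nondecreasing_cvgn ni)).
by apply: ereal_sup_ubound; exists n.
Qed.

(** A measure nearly optimal for some [Xn n] is nearly optimal for the larger X, so a single index
    suffices. *)
Lemma cond_inc t (Xn Yn : nat -> Om -> \bar R) X Y : (forall n, cond t (Xn n) (Yn n)) ->
  L1 +oo%E X -> L1 t%:E Y -> qs_increases Xn X -> qs_increases Yn Y -> cond t X Y.
Proof.
move=> c LX LY iX iY; split=> // P PP1.
have [cX bX] := qs_inc_bounds iX; have [cY bY] := qs_inc_bounds iY.
have LXn n : L1 +oo%E (Xn n) by have [] := c n.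
have LYn n : L1 +oo%E (Yn n) by have [_ /L1_oo] := c n.
have LY' := L1_oo LY.
have cvX Q A : PP Q -> measurable A -> I Q A (Xn n) @[n --> \oo] --> I Q A X.
  by move=> PQ mA; apply: (I_cvg_between mA PQ _ LX (LXn 0%N) LX cX bX) => n; exact: L1_meas (LXn n).
have cvY Q A : PP Q -> measurable A -> I Q A (Yn n) @[n --> \oo] --> I Q A Y.
  by move=> PQ mA; apply: (I_cvg_between mA PQ _ LY' (LYn 0%N) LY' cY bY) => n; exact: L1_meas (LYn n).
split=> [A FA|e e0].
  have [mA _] := (F_P _ _).1 FA.
  apply: (ler_cvg_to (cvX P A PP1 mA) (cvY P A PP1 mA)); apply: nearW => n.
  by have [_ _ /(_ P PP1)[up _]] := c n; exact: up.
have e2 : 0 < e / 2 by rewrite divr_gt0.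
have /cvgrPdist_le/(_ _ e2)[n _ /(_ n (leqnn n))] := cvY P setT PP1 measurableT.
rewrite ler_distl => /andP[_ hn].
have [_ _ /(_ P PP1)[_ /(_ _ e2)[Q PQ [same att]]]] := c n; exists Q => //; split=> //.
have : I Q setT (Xn n) <= I Q setT X.
  apply: I_le => //; [exact: L1_int (LXn n)|exact: L1_int LX|].
  by apply: filterS (qs_ae PQ bX) => w h; have [_] := h n.
by move=> ?; lra.
Qed.

(** Uniform approximation by cylinder functionals over all of [PP] extends weak convergence to the
    closure. *)
Lemma LG1_ultra (Pn : nat -> probability Om R) Q X : (forall n, PP (Pn n)) -> PP Q ->
  (forall Z : Om -> R, Lp Z -> EL (Pn n) Z @[n --> ultra] --> EL Q Z) -> LG1 +oo%E X ->
  I (Pn n) setT X @[n --> ultra] --> I Q setT X.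
Proof.
move=> PPn PQ H [LX [Zn [LZ /(cvg_L1P sl0 slb) cZ]]]; apply/cvgrPdist_le => e e0.
have e3 : 0 < e / 3 by rewrite divr_gt0.
have [N /(_ N (leqnn N)) hN] := cZ _ e3; have hN' := hN; rewrite Ehat_sym in hN'.
have ap P : PP P -> `|I P setT X - EL P (Zn N)| <= e / 3.
  move=> PP1; rewrite -I_EFin ler_distl.
  have iX := L1_int PP1 LX; have iZ := L1_int PP1 (Lip_L1 sl sb (LZ N)).
  apply/andP; split; first rewrite lerBlDr; apply: I_diff => //.
    by apply: le_trans hN; exact: (Ehat_ub (fun w => `|(EFin \o Zn N) w - X w|%E) PP1).
  by apply: le_trans hN'; exact: (Ehat_ub (fun w => `|X w - (EFin \o Zn N) w|%E) PP1).
have /cvgrPdist_le/(_ _ e3) := H _ (LZ N); apply: filterS => n h.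
have h1 := ap _ PQ; have h2 := ap _ (PPn n).
rewrite (_ : _ - _ = (I Q setT X - EL Q (Zn N)) + (EL Q (Zn N) - EL (Pn n) (Zn N)) - (I (Pn n) setT X - EL (Pn n) (Zn N))); last by ring.
by apply: le_trans (ler_normB _ _) _; apply: le_trans (lerD (ler_normD _ _) (lexx _)) _; lra.
Qed.

(** The measure nearly optimal for [Xn n] depends on n. A weak limit Q still agrees with P on F_t;
    for fixed m the bound with [Xn m] in place of [Xn n] passes to Q, since [Xn m] lies in [LG1],
    and then m grows. *)
Lemma cond_dec t (Xn Yn : nat -> Om -> \bar R) X Y : 0 <= t -> (forall n, LG1 +oo%E (Xn n)) ->
  (forall n, cond t (Xn n) (Yn n)) ->
  L1 +oo%E X -> L1 t%:E Y -> qs_decreases Xn X -> qs_decreases Yn Y -> cond t X Y.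
Proof.
move=> t0 GX c LX LY iX iY; split=> // P PP1.
have [cX bX] := qs_dec_bounds iX; have [cY bY] := qs_dec_bounds iY.
have LXn n : L1 +oo%E (Xn n) by have [] := c n.
have LYn n : L1 +oo%E (Yn n) by have [_ /L1_oo] := c n.
have LY' := L1_oo LY.
have cvX Q A : PP Q -> measurable A -> I Q A (Xn n) @[n --> \oo] --> I Q A X.
  by move=> PQ mA; apply: (I_cvg_between mA PQ _ LX LX (LXn 0%N) cX bX) => n; exact: L1_meas (LXn n).
have cvY Q A : PP Q -> measurable A -> I Q A (Yn n) @[n --> \oo] --> I Q A Y.
  by move=> PQ mA; apply: (I_cvg_between mA PQ _ LY' LY' (LYn 0%N) cY bY) => n; exact: L1_meas (LYn n).
split=> [A FA|e e0].
  have [mA _] := (F_P _ _).1 FA.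
  apply: (ler_cvg_to (cvX P A PP1 mA) (cvY P A PP1 mA)); apply: nearW => n.
  by have [_ _ /(_ P PP1)[up _]] := c n; exact: up.
have /choice[Pn HPn] n : exists Q, [/\ PP Q, same_upto t P Q & I P setT (Yn n) <= I Q setT (Xn n) + e].
  by have [_ _ /(_ P PP1)[_ /(_ _ e0)[Q PQ [same att]]]] := c n; exists Q.
have PPn n : PP (Pn n) by have [] := HPn n.
have [Q PQ HQ] := PP_compact sl0 slb PPn; exists Q => //.
have same : same_upto t P Q.
  apply: (same_Lip t0 (PP_posfun sl0 slb PP1) (PP_posfun sl0 slb PQ)) => Z LZ.
  have LZ' : Lp Z by apply: Lip_le LZ; exact: leey.
  have E n : EL (Pn n) Z = EL P Z.
    rewrite -!I_EFin; have [_ sn _] := HPn n.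
    exact: (I_same sn (Lip_L0 LZ) (F_T t)).
  have c1 : EL (Pn n) Z @[n --> ultra] --> EL Q Z by exact: HQ.
  have c2 : EL (Pn n) Z @[n --> ultra] --> EL P Z by under eq_fun do rewrite E; exact: cvg_cst.
  exact: (cvg_unique _ c1 c2).
split=> //.
(* For [n >= m] the larger [Xn m] may replace [Xn n] under [Pn n]; the ultrafilter limit in n is
   taken with m fixed. *)
have key m : I P setT Y <= I Q setT (Xn m) + e.
  have cm := LG1_ultra PPn PQ HQ (GX m).
  rewrite -lerBlDr; apply: (cvgr_to_ge cm); apply: ultra_eventually; exists m => // n /= mn.
  have [_ _ att] := HPn n; rewrite lerBlDr.
  have h1 : I P setT Y <= I P setT (Yn n).
    apply: I_le => //; [exact: L1_int LY'|exact: L1_int (LYn n)|].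
    by apply: filterS (qs_ae PP1 bY) => w h; have [] := h n.
  have h2 : I (Pn n) setT (Xn n) <= I (Pn n) setT (Xn m).
    apply: I_le => //; [exact: L1_int (LXn n)|exact: L1_int (LXn m)|].
    by apply: filterS (qs_ae (PPn n) iX) => w [h _]; exact: h.
  by move: att => ?; lra.
rewrite -lerBlDr; apply: (cvgr_to_ge (cvX Q setT PQ measurableT)).
by apply: nearW => m; rewrite lerBlDr.
Qed.

Lemma cond_LG1_cond t X Y : cond_LG1 sl sb t X Y -> cond t X Y.
Proof.
move=> [[LX _] LY [Xn [Yn [c cX cY]]]].
apply: (cond_closed _ LX LY cX cY) => n; exact: cond_Lip_cond.
Qed.

Lemma cond_LG1_ge0 t X Y : cond_LG1 sl sb t X Y -> 0 <= t.
Proof. by move=> [_ _ [Xn [Yn [c _ _]]]]; have [] := cond_Lip_Lip sl0 slb (c 0%N). Qed.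

Lemma cond_LG1s_cond t X Y : cond_LG1s sl sb t X Y -> cond t X Y.
Proof.
move=> [[LX _] LY [Xn [Yn [c cX cY]]]].
apply: (cond_dec (cond_LG1_ge0 (c 0%N)) _ _ LX LY cX cY) => n; last exact: cond_LG1_cond.
by have [] := c n.
Qed.

Lemma cond_LG1ss_cond t X Y : cond_LG1ss sl sb t X Y -> cond t X Y.
Proof.
move=> [[LX _] LY [Xn [Yn [c cX cY]]]].
apply: (cond_inc _ LX LY cX cY) => n; exact: cond_LG1s_cond.
Qed.

Lemma cond_LG1bar_cond t X Y : cond_LG1bar sl sb t X Y -> cond t X Y.
Proof.
move=> [[LX _] LY [Xn [Yn [c cX cY]]]].
apply: (cond_closed _ LX LY cX cY) => n; exact: cond_LG1ss_cond.
Qed.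

End Cond.

(** * Existence of conditional expectations *)

Section Exist.
Variables (R : realType) (sl sb : R).
Hypotheses (sl0 : 0 <= sl) (slb : sl <= sb).
Local Notation Om := (Omega R).
Local Notation Lp := (Lip (R := R) +oo%E).
Local Notation PP := (PP sl sb).
Local Notation Ehat := (Ehat sl sb).
Local Notation qs := (qs sl sb).
Local Notation L1 := (L1 sl sb).
Local Notation LG1 := (LG1 sl sb).
Local Notation cvg_L1 := (cvg_L1 sl sb).
Local Notation qs_decreases := (qs_decreases sl sb).
Local Notation qs_increases := (qs_increases sl sb).
Local Notation cond := (cond sl sb).
Implicit Types (P Q : probability Om R) (s t : R) (X Y Z : Om -> \bar R) (A : set Om) (h : \bar R).

Lemma limn_esup_bounds (u : (\bar R)^nat) (a b : \bar R) k : (forall m, (k <= m)%N -> (a <= u m)%E /\ (u m <= b)%E) ->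
  (a <= limn_esup u)%E /\ (limn_esup u <= b)%E.
Proof.
move=> H; have E : limn_esup u = ereal_inf (range (esups u)).
  by rewrite limn_esup_lim; apply/cvg_lim => //; exact: ereal_nonincreasing_cvgn (nonincreasing_esups u).
rewrite E; split.
  apply: le_ereal_inf_tmp => _ [n _ <-]; have [h _] := H _ (leq_maxr n k).
  by apply: le_trans h _; apply: ereal_sup_ubound; exists (maxn n k) => //=; exact: leq_maxl.
apply: le_trans (_ : esups u k <= _)%E; first by apply: ereal_inf_lbound; exists k.
by apply: ge_ereal_sup => _ [n /= kn <-]; have [] := H n kn.
Qed.

Lemma L0_limn_esup t (Xn : nat -> Om -> \bar R) : (forall n, L0 t%:E (Xn n)) ->
  L0 t%:E (fun w => limn_esup (Xn ^~ w)).
Proof.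
move=> LX; apply/L0P; split.
  by apply: measurable_fun_limn_esup => n; have /L0P[] := LX n.
move=> w; congr limn_esup; apply/funext => n; by have /L0P[_ ->] := LX n.
Qed.

Lemma Ehat_qs X Y : measurable_fun setT X -> measurable_fun setT Y -> qs (fun w => X w = Y w) -> Ehat X = Ehat Y.
Proof.
move=> mX mY XY; suff E P : PP P -> (\int[P]_w X w = \int[P]_w Y w)%E.
  by rewrite /Defs.Ehat; congr ereal_sup; apply/seteqP; split=> _ [P PP1 <-]; exists P => //; rewrite E.
move=> PP1; apply: ae_eq_integral => //.
by apply: filterS (qs_ae PP1 XY) => w e _.
Qed.

Lemma L1_fin h X : L1 h X -> qs (fun w => X w \is a fin_num).
Proof.
move=> LX; have mX := L1_meas LX.
have mA : measurable [set w | ~ (X w \is a fin_num)].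
  rewrite (_ : [set w | _] = X @^-1` [set -oo%E] `|` X @^-1` [set +oo%E]).
    by rewrite -[X in X `|` _]setTI -[X in _ `|` X]setTI; apply: measurableU; apply: mX => //; exact: emeasurable_set1.
  apply/seteqP; split=> w /=; case: (X w) => [r||] //=;
    first [by move=> _; left|by move=> _; right|by move=> /(_ isT)|by case].
apply: (qs_set sl0 slb) => // P PP1; apply: measure_negligible => //.
have [N [mN N0 HN]] := integrable_ae measurableT (L1_int PP1 LX).
by exists N; split=> // w /= nf; apply: HN => /= /(_ Logic.I).
Qed.

Lemma L1_fine t X : L1 t%:E X -> L1 t%:E (fun w => (fine (X w))%:E) /\ qs (fun w => X w = (fine (X w))%:E).
Proof.
move=> LX; have [/L0P[mX XE] XN] := LX.
have mf : measurable_fun setT (fun w => (fine (X w))%:E).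
  by apply/measurable_EFinP; apply: measurableT_comp => //; exact: measurable_fine.
have qf : qs (fun w => X w = (fine (X w))%:E) by apply: qs_sub (L1_fin LX) => w h; rewrite fineK.
split=> //; split; first by apply/L0P; split=> // w; rewrite XE.
rewrite -(@Ehat_qs (fun w => `|X w|%E)) //; [exact: measurableT_comp|exact: measurableT_comp|].
by apply: qs_sub qf => w <-.
Qed.

(** The limit superior is F_t-measurable and defined at every path. Its distance to [Z k] is bounded
    by the tail sum of the increments, trivially so where that sum is infinite. *)
Lemma complete_fin t (Z : nat -> Om -> R) : (forall n, L1 t%:E (EFin \o Z n)) ->
  (forall k, (Ehat (fun w => `|(Z k.+1 w)%:E - (Z k w)%:E|) <= (2^-1 ^+ k.+1)%:E)%E) ->
  exists2 Y, L1 t%:E Y & forall k, (Ehat (fun w => `|(Z k w)%:E - Y w|) <= (2^-1 ^+ k)%:E)%E.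
Proof.
move=> LZ HZ; pose Y w := limn_esup (fun n => (Z n w)%:E).
have LY : L0 t%:E Y by apply: L0_limn_esup => n; have [] := LZ n.
have mY := L0_meas LY.
pose D k w : \bar R := `|(Z k.+1 w)%:E - (Z k w)%:E|%E.
have D0 k w : (0 <= D k w)%E by exact: abse_ge0.
have mD k : measurable_fun setT (D k) by apply: measurableT_comp => //; exact: L1_sub_meas (LZ k.+1) (LZ k).
have key k w : (`|(Z k w)%:E - Y w| <= \sum_(0 <= i <oo) D (k + i)%N w)%E.
  set S := (\sum_(0 <= i <oo) _)%E.
  have S0 : (0 <= S)%E by apply: nneseries_ge0 => i _ _.
  have part m : (`|(Z (k + m)%N w)%:E - (Z k w)%:E| <= S)%E.
    apply: le_trans (_ : \sum_(0 <= i < m) D (k + i)%N w <= _)%E; last by apply: nneseries_lim_ge => i _ _.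
    elim: m => [|m IH]; first by rewrite big_nil addn0 lee_fin subrr normr0.
    rewrite big_nat_recr//= addnS; move: IH; set s := (\sum_(0 <= i < m) _)%E => IH.
    apply: le_trans (_ : `|(Z (k + m)%N w)%:E - (Z k w)%:E| + D (k + m)%N w <= _)%E; last exact: leeD2r.
    rewrite /D lee_fin (_ : Z (k + m).+1 w - _ = (Z (k + m)%N w - Z k w) + (Z (k + m).+1 w - Z (k + m)%N w)); last by ring.
    exact: ler_normD.
  case: S S0 part => [s||] //; last by move=> _ _; rewrite leey.
  rewrite lee_fin => s0 part.
  have [|h1 h2] := @limn_esup_bounds (fun n => (Z n w)%:E) (Z k w - s)%:E (Z k w + s)%:E k.
    move=> m /subnKC <-; have := part (m - k)%N; rewrite lee_fin ler_distl => /andP[a b].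
    by rewrite !lee_fin.
  move: h1 h2; rewrite -/(Y w); case: (Y w) => [y||] //=; rewrite !lee_fin => a b.
  by rewrite ler_distlC; apply/andP; split; lra.
have EY k : (Ehat (fun w => `|(Z k w)%:E - Y w|) <= (2^-1 ^+ k)%:E)%E.
  apply: Ehat_le => P PP1.
  apply: le_trans (_ : \int[P]_w \sum_(0 <= i <oo) D (k + i)%N w <= _)%E.
    apply: ge0_le_integral => //.
    - by apply: measurableT_comp => //; apply: emeasurable_funB => //; exact: L1_meas (LZ k).
    - exact: ge0_emeasurable_sum.
  rewrite integral_nneseries//.
  have e0 : 0 <= 2^-1 ^+ k :> R by rewrite exprn_ge0.
  apply: le_trans (epsilon_trick0 xpredT e0).
  apply: lee_nneseries => i _; first by rewrite integral_ge0.
  apply: le_trans (Ehat_ub _ PP1) _; apply: le_trans (HZ _) _.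
  by rewrite lee_fin -addnS exprD natrX !exprVn.
exists Y => //; split=> //.
apply: le_lt_trans (_ : (Ehat (fun w => `|(EFin \o Z 0%N) w|) + 1%:E < +oo)%E); last first.
  by rewrite lte_add_pinfty ?ltry//; have [] := LZ 0%N.
apply: Ehat_le => P PP1.
apply: le_trans (_ : \int[P]_w (`|(EFin \o Z 0%N) w| + `|(Z 0%N w)%:E - Y w|) <= _)%E.
  apply: ge0_le_integral => //.
  - exact: measurableT_comp.
  - apply: emeasurable_funD; apply: measurableT_comp => //; first exact: L1_meas (LZ 0%N).
    by apply: emeasurable_funB => //; exact: L1_meas (LZ 0%N).
  - move=> w _ /=; case: (Y w) => [y||] //=; rewrite ?leey// lee_fin.
    by have := ler_normB (Z 0%N w) (Z 0%N w - y); rewrite subKr.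
rewrite ge0_integralD//.
- by apply: leeD; [exact: (Ehat_ub (fun w => `|(EFin \o Z 0%N) w|%E) PP1)|
    apply: le_trans (Ehat_ub (fun w => `|(Z 0%N w)%:E - Y w|%E) PP1) (EY 0%N)].
- by apply: measurableT_comp => //; exact: L1_meas (LZ 0%N).
- by apply: measurableT_comp => //; apply: emeasurable_funB => //; exact: L1_meas (LZ 0%N).
Qed.

(** A subsequence with increments below powers of 1/2 is extracted and replaced by finite versions,
    so that differences are real numbers. *)
Lemma complete t (Yn : nat -> Om -> \bar R) : (forall n, L1 t%:E (Yn n)) ->
  (forall e : R, 0 < e -> exists M : nat, forall m n, (M <= m)%N -> (M <= n)%N ->
    (Ehat (fun w => `|Yn m w - Yn n w|) <= e%:E)%E) ->
  exists2 Y, L1 t%:E Y & cvg_L1 Yn Y.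
Proof.
move=> LY HY.
have p0 k : 0 < 2^-1 ^+ k.+1 :> R by rewrite exprn_gt0// invr_gt0.
have /choice[M HM] k := HY _ (p0 k).
pose n k := \max_(j < k.+1) M j.
have nM k m : (k <= m)%N -> (M k <= n m)%N.
  by move=> km; rewrite /n (bigD1 (Ordinal (km : (k < m.+1)%N)))//= leq_maxl.
pose Z k w := fine (Yn (n k) w).
have LZ k : L1 t%:E (EFin \o Z k) by have [] := L1_fine (LY (n k)).
have qZ k : qs (fun w => Yn (n k) w = (Z k w)%:E) by have [] := L1_fine (LY (n k)).
have [|Y LY' HZ] := complete_fin LZ.
  move=> k; rewrite -(@Ehat_qs (fun w => `|Yn (n k.+1) w - Yn (n k) w|%E)).
  - by apply: HM; apply: nM.
  - by apply: measurableT_comp => //; exact: L1_sub_meas (LY _) (LY _).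
  - by apply: measurableT_comp => //; exact: L1_sub_meas (LZ k.+1) (LZ k).
  - by apply: qs_sub (qs_and sl0 slb (qZ k.+1) (qZ k)) => w [-> ->].
exists Y => //; apply/(cvg_L1P sl0 slb) => e e0.
have e2 : 0 < e / 2 by rewrite divr_gt0.
have h0 : 0 <= 2^-1 :> R by rewrite invr_ge0.
have h1 : 2^-1 < 1 :> R by lra.
have [k _ /(_ k (leqnn k)) hk] := near_expr 1 h0 h1 e2; rewrite mul1r in hk.
exists (M k) => m Mm; apply: le_trans (Ehat_triangle (LY m) (LY (n k)) LY') _.
rewrite (splitr e) EFinD; apply: leeD.
  apply: le_trans (HM k _ _ Mm (nM k k (leqnn k))) _; rewrite lee_fin; apply: le_trans hk.
  by rewrite exprS ler_piMl// ?exprn_ge0// ltW.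
rewrite (@Ehat_qs _ (fun w => `|(Z k w)%:E - Y w|%E)).
- by apply: le_trans (HZ k) _; rewrite lee_fin.
- by apply: measurableT_comp => //; exact: L1_sub_meas (LY _) LY'.
- by apply: measurableT_comp => //; exact: L1_sub_meas (LZ k) LY'.
- by apply: qs_sub (qZ k) => w ->.
Qed.

Lemma cond_complete t (Xn Yn : nat -> Om -> \bar R) X : (forall n, cond t (Xn n) (Yn n)) ->
  L1 +oo%E X -> cvg_L1 Xn X -> exists2 Y, L1 t%:E Y & cvg_L1 Yn Y.
Proof.
move=> c LX /(cvg_L1P sl0 slb) cX; apply: complete => [n|e e0]; first by have [] := c n.
have e4 : 0 < e / 4 by rewrite divr_gt0.
have [M HM] := cX _ e4; exists M => m n Mm Mn.
rewrite (_ : e = 2 * (e / 2)); last by field.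
apply: (cond_contr (c m) (c n)).
have LXn k : L1 +oo%E (Xn k) by have [] := c k.
apply: le_trans (Ehat_triangle (LXn m) LX (LXn n)) _.
rewrite (_ : e / 2 = e / 4 + e / 4); last by field.
by rewrite EFinD; apply: leeD; [exact: HM|rewrite Ehat_sym; exact: HM].
Qed.

Lemma cond0 t : 0 <= t -> cond t (cst 0%E) (cst 0%E).
Proof.
move=> t0; apply: (@cond_Lip_cond _ _ _ sl0 slb t (cst 0) (cst 0)).
by apply: (cond_Lip_id sl0 slb); exact: Lip_cst.
Qed.

Lemma L1_bound (X Y Z : Om -> \bar R) h1 h2 h3 : L1 h1 X -> L1 h2 Y -> L1 h3 Z ->
  qs (fun w => (Y w <= X w)%E /\ (X w <= Z w)%E) ->
  (Ehat (fun w => `|X w|) <= Ehat (fun w => `|Y w|) + Ehat (fun w => `|Z w|))%E.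
Proof.
move=> LX LY LZ H; apply: Ehat_le => P PP1.
have mm U h : L1 h U -> measurable_fun setT (fun w => `|U w|%E) by move=> /L1_meas mU; exact: measurableT_comp.
apply: le_trans (_ : \int[P]_w (`|Y w| + `|Z w|) <= _)%E; last first.
  rewrite ge0_integralD//; [|exact: mm LY|exact: mm LZ].
  by apply: leeD; [exact: (Ehat_ub (fun w => `|Y w|%E) PP1)|exact: (Ehat_ub (fun w => `|Z w|%E) PP1)].
apply: ae_ge0_le_integral => //.
- exact: mm LX.
- by move=> w _; exact: adde_ge0.
- by apply: emeasurable_funD; [exact: mm LY|exact: mm LZ].
- by apply: filterS (qs_ae PP1 H) => w [a b] _; exact: abse_between.
Qed.

(** Integrability of a monotone limit: the norms of [Yn] are bounded through [cond_contr] against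
    the zero pair, and Fatou's lemma passes to the limit under each P. *)
Lemma cond_limit t (Xn Yn : nat -> Om -> \bar R) (c0 : \bar R) : 0 <= t -> (forall n, cond t (Xn n) (Yn n)) ->
  (c0 < +oo)%E -> (forall n, (Ehat (fun w => `|Xn n w|) <= c0)%E) ->
  qs (fun w => Yn n w @[n --> \oo] --> limn_esup (Yn ^~ w)) -> L1 t%:E (fun w => limn_esup (Yn ^~ w)).
Proof.
move=> t0 c c0oo Xb cY; pose Y w := limn_esup (Yn ^~ w).
have c0fin : c0 \is a fin_num.
  rewrite ge0_fin_numE//; apply: le_trans (Xb 0%N); exact: Ehat_ge0.
have LYn n : L1 t%:E (Yn n) by have [] := c n.
have LY : L0 t%:E Y by apply: L0_limn_esup => n; have [] := LYn n.
split=> //; apply: le_lt_trans (ltry (2 * fine c0)); apply: Ehat_le => P PP1.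
have Yb n : (\int[P]_w `|Yn n w| <= (2 * fine c0)%:E)%E.
  apply: le_trans (Ehat_ub (fun w => `|Yn n w|%E) PP1) _.
  have E U : (fun w : Om => `|U w - cst 0%E w|)%E = (fun w => `|U w|)%E.
    by apply/funext => w; rewrite /= sube0.
  by have := @cond_contr _ _ _ _ _ _ _ _ (fine c0) (c n) (cond0 t0); rewrite !E; apply; rewrite fineK.
have mY n : measurable_fun setT (fun w => `|Yn n w|%E) by apply: measurableT_comp => //; exact: L1_meas (LYn n).
have mL : measurable_fun setT (fun w => limn_einf (fun n => `|Yn n w|%E)).
  rewrite (_ : (fun w => _) = fun w => (- limn_esup (fun n => - `|Yn n w|))%E).
    by apply: measurableT_comp => //; apply: measurable_fun_limn_esup => n; exact: measurableT_comp.
  by apply/funext => w; rewrite -limn_einfN; congr limn_einf; apply/funext => n /=; rewrite oppeK.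
have -> : (\int[P]_w `|Y w| = \int[P]_w limn_einf (fun n => `|Yn n w|))%E.
  apply: ae_eq_integral => //; first by apply: measurableT_comp => //; exact: L0_meas LY.
  apply: filterS (qs_ae PP1 cY) => w h _.
  have h' : `|Yn n w|%E @[n --> \oo] --> `|Y w|%E by exact: cvg_abse.
  by rewrite is_cvg_limn_einfE ?(cvg_lim _ h')//; apply/cvg_ex; exists `|Y w|%E.
apply: le_trans (fatou P measurableT mY (fun n w _ => abse_ge0 _)) _.
apply: le_trans (limn_einf_sup _) _.
have [|_ //] := @limn_esup_bounds (fun n => \int[P]_w `|Yn n w|)%E 0%E (2 * fine c0)%:E 0%N.
by move=> m _; split; [exact: integral_ge0|exact: Yb].
Qed.

Lemma cond_dec_ex t (Xn Yn : nat -> Om -> \bar R) X : 0 <= t -> (forall n, cond t (Xn n) (Yn n)) ->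
  L1 +oo%E X -> qs_decreases Xn X -> exists2 Y, L1 t%:E Y & qs_decreases Yn Y.
Proof.
move=> t0 c LX dX; have LXn n : L1 +oo%E (Xn n) by have [] := c n.
have ni : qs (fun w => nonincreasing_seq (Yn ^~ w)).
  have : qs (fun w => forall n, Yn n.+1 w <= Yn n w)%E.
    apply: (qs_all sl0 slb) => n; apply: (cond_mono sl0 slb (c n.+1) (c n)).
    by apply: qs_sub dX => w [h _]; exact: h.
  by apply: qs_sub => w h; apply/nonincreasing_seqP.
have cY : qs (fun w => Yn n w @[n --> \oo] --> limn_esup (Yn ^~ w)).
  apply: qs_sub ni => w h; have h' := ereal_nonincreasing_cvgn h.
  by rewrite is_cvg_limn_esupE; [exact: (cvgP _ h')|apply/cvg_ex; eexists; exact: h'].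
exists (fun w => limn_esup (Yn ^~ w)); last first.
  by apply: qs_sub (qs_and sl0 slb ni cY) => w [].
have [_ bX] := qs_dec_bounds dX.
apply: (@cond_limit t Xn Yn (Ehat (fun w => `|X w|) + Ehat (fun w => `|Xn 0%N w|))%E) => //.
  by rewrite lte_add_pinfty//; [case: LX|case: (LXn 0%N)].
move=> n; apply: (L1_bound (LXn n) LX (LXn 0%N)).
by apply: qs_sub bX => w; exact.
Qed.

Lemma cond_inc_ex t (Xn Yn : nat -> Om -> \bar R) X : 0 <= t -> (forall n, cond t (Xn n) (Yn n)) ->
  L1 +oo%E X -> qs_increases Xn X -> exists2 Y, L1 t%:E Y & qs_increases Yn Y.
Proof.
move=> t0 c LX dX; have LXn n : L1 +oo%E (Xn n) by have [] := c n.
have ni : qs (fun w => nondecreasing_seq (Yn ^~ w)).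
  have : qs (fun w => forall n, Yn n w <= Yn n.+1 w)%E.
    apply: (qs_all sl0 slb) => n; apply: (cond_mono sl0 slb (c n) (c n.+1)).
    by apply: qs_sub dX => w [h _]; exact: h.
  by apply: qs_sub => w h; apply/nondecreasing_seqP.
have cY : qs (fun w => Yn n w @[n --> \oo] --> limn_esup (Yn ^~ w)).
  apply: qs_sub ni => w h; have h' := ereal_nondecreasing_cvgn h.
  by rewrite is_cvg_limn_esupE; [exact: (cvgP _ h')|apply/cvg_ex; eexists; exact: h'].
exists (fun w => limn_esup (Yn ^~ w)); last first.
  by apply: qs_sub (qs_and sl0 slb ni cY) => w [].
have [_ bX] := qs_inc_bounds dX.
apply: (@cond_limit t Xn Yn (Ehat (fun w => `|Xn 0%N w|) + Ehat (fun w => `|X w|))%E) => //.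
  by rewrite lte_add_pinfty//; [case: (LXn 0%N)|case: LX].
move=> n; apply: (L1_bound (LXn n) (LXn 0%N) LX).
by apply: qs_sub bX => w; exact.
Qed.

Lemma ex_cond_LG1 t X : 0 <= t -> LG1 +oo%E X -> exists Y, cond_LG1 sl sb t X Y.
Proof.
move=> t0 GX; have [LX [Xn [LXn cX]]] := GX.
have c n : cond_Lip sl sb t (Xn n) (Et sl sb t (Xn n)) by exact: EtP.
have [Y LY cY] := cond_complete (fun n => cond_Lip_cond sl0 slb (c n)) LX cX.
by exists Y; split=> //; exists Xn, (fun n => Et sl sb t (Xn n)).
Qed.

Lemma ex_cond_LG1s t X : 0 <= t -> LG1s sl sb +oo%E X -> exists Y, cond_LG1s sl sb t X Y.
Proof.
move=> t0 GX; have [LX [Xn [LXn cX]]] := GX.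
have /choice[Yn c] n := ex_cond_LG1 t0 (LXn n).
have [Y LY cY] := cond_dec_ex t0 (fun n => cond_LG1_cond sl0 slb (c n)) LX cX.
by exists Y; split=> //; exists Xn, Yn.
Qed.

Lemma ex_cond_LG1ss t X : 0 <= t -> LG1ss sl sb +oo%E X -> exists Y, cond_LG1ss sl sb t X Y.
Proof.
move=> t0 GX; have [LX [Xn [LXn cX]]] := GX.
have /choice[Yn c] n := ex_cond_LG1s t0 (LXn n).
have [Y LY cY] := cond_inc_ex t0 (fun n => cond_LG1s_cond sl0 slb (c n)) LX cX.
by exists Y; split=> //; exists Xn, Yn.
Qed.

Lemma ex_cond_LG1bar t X : 0 <= t -> LG1bar sl sb +oo%E X -> Econd_defined sl sb t X.
Proof.
move=> t0 GX; have [LX [Xn [LXn cX]]] := GX.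
have /choice[Yn c] n := ex_cond_LG1ss t0 (LXn n).
have [Y LY cY] := cond_complete (fun n => cond_LG1ss_cond sl0 slb (c n)) LX cX.
by exists Y; split=> //; exists Xn, Yn.
Qed.

Lemma EcondP t X : Econd_defined sl sb t X -> cond_LG1bar sl sb t X (Econd sl sb t X).
Proof. by move=> d; exact: (@xgetPex _ (cst 0%E) [set Y | cond_LG1bar sl sb t X Y] d). Qed.

Lemma Econd_cond t X : 0 <= t -> LG1bar sl sb +oo%E X -> cond t X (Econd sl sb t X).
Proof. by move=> t0 GX; apply: (cond_LG1bar_cond sl0 slb); apply: EcondP; exact: ex_cond_LG1bar. Qed.

Lemma LG1_LG1s h X : LG1 h X -> LG1s sl sb h X.
Proof.
move=> GX; split; first by case: GX.
exists (fun=> X); split=> //; apply: (qsT sl0 slb) => w; split; [by move=> m n _|exact: cvg_cst].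
Qed.

Lemma LG1s_LG1ss h X : LG1s sl sb h X -> LG1ss sl sb h X.
Proof.
move=> GX; split; first by case: GX.
exists (fun=> X); split=> //; apply: (qsT sl0 slb) => w; split; [by move=> m n _|exact: cvg_cst].
Qed.

(** The extended difference [X - X] is 0 only where X is finite, which holds q.s. for an integrable
    X. *)
Lemma cvg_L1_of_fin h (Xn : nat -> Om -> \bar R) X : L1 h X -> (forall n, Xn n = X) -> cvg_L1 Xn X.
Proof.
move=> LX E; apply/(cvg_L1P sl0 slb) => e e0; exists 0%N => n _; rewrite E.
rewrite (@Ehat_qs _ (cst 0%E)).
- by apply: Ehat_le => P _; rewrite integral0 lee_fin ltW.
- by apply: measurableT_comp => //; exact: (L1_sub_meas LX LX).
- exact: measurable_cst.
- by apply: qs_sub (L1_fin LX) => w fX; rewrite subee// abse0.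
Qed.

Lemma LG1ss_LG1bar h X : LG1ss sl sb h X -> LG1bar sl sb h X.
Proof.
move=> GX; have LX : L1 h X by case: GX.
by split=> //; exists (fun=> X); split=> //; exact: cvg_L1_of_fin LX _.
Qed.

Lemma LG1_LG1bar h X : LG1 h X -> LG1bar sl sb h X.
Proof. by move=> ?; apply: LG1ss_LG1bar; apply: LG1s_LG1ss; exact: LG1_LG1s. Qed.

End Exist.

Lemma dist_minr (R : realType) (r a b : R) : `|Num.min r a - Num.min r b| <= `|a - b|.
Proof.
have := ler_norm (a - b); have := ler_norm (b - a); rewrite (distrC b) => a1 a2.
have a3 := normr_ge0 (a - b).
by rewrite ler_norml; case: (leP r a) => ?; case: (leP r b) => ?; apply/andP; split; lra.
Qed.

(** * Processes at random times *)

Section LG1real.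
Variables (R : realType) (sl sb : R).
Hypotheses (sl0 : 0 <= sl) (slb : sl <= sb).
Local Notation Om := (Omega R).
Local Notation Lp := (Lip (R := R) +oo%E).
Local Notation PP := (PP sl sb).
Local Notation Ehat := (Ehat sl sb).
Local Notation qs := (qs sl sb).
Local Notation L1 := (L1 sl sb).
Local Notation LG1 := (LG1 sl sb).
Implicit Types (P Q : probability Om R) (s t : R) (u z : Om -> R) (h : \bar R).

Lemma L0r h z : measurable_fun setT z -> (forall t w, h = t%:E -> z (stop t w) = z w) -> L0 h (EFin \o z).
Proof.
move=> mz H; have mX : measurable_fun setT (EFin \o z) by exact/measurable_EFinP.
case: h H => [t||] H; [|exact: ((L0oo _).2 mX)|exact: ((L0oo _).2 mX)].
by apply/L0P; split=> // w /=; rewrite (H t).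
Qed.

Lemma L0r_meas h z : L0 h (EFin \o z) -> measurable_fun setT z.
Proof. by move=> /L0_meas/measurable_EFinP. Qed.

Lemma L0r_stop h z t w : L0 h (EFin \o z) -> h = t%:E -> z (stop t w) = z w.
Proof. by move=> LZ ht; rewrite ht in LZ; have /L0P[_ /(_ w)[]] := LZ. Qed.

Definition dist (u z : Om -> R) : \bar R := Ehat (fun w => `|u w - z w|%:E).

Lemma LG1P h z : LG1 h (EFin \o z) <-> L0 h (EFin \o z) /\
  forall e : R, 0 < e -> exists2 u, Lip h u & (dist u z <= e%:E)%E.
Proof.
split=> [[[LZ _] [Xn [LXn /(cvg_L1P sl0 slb) c]]]|[LZ H]].
  split=> // e e0; have [N /(_ N (leqnn N)) hN] := c e e0.
  by exists (Xn N).
have mz := L0r_meas LZ.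
have /choice[u Hu] n : exists u, Lip h u /\ (dist u z <= (n.+1%:R^-1)%:E)%E.
  by have [|u Lu Hu] := H (n.+1%:R^-1); [rewrite invr_gt0|exists u].
have Lu n : Lip h (u n) by have [] := Hu n.
split.
  split=> //; have LU0 := Lip_L1 sl sb (Lu 0%N).
  apply: le_lt_trans (_ : (Ehat (fun w => `|(EFin \o u 0%N) w|) + dist (u 0%N) z < +oo)%E); last first.
    apply: lte_add_pinfty; first by case: LU0.
    by have [_ h1] := Hu 0%N; apply: le_lt_trans h1 (ltry _).
  have mu := Lip_measurable (Lu 0%N).
  apply: Ehat_le => P PP1.
  apply: le_trans (_ : \int[P]_w (`|(EFin \o u 0%N) w| + `|u 0%N w - z w|%:E) <= _)%E.
    apply: ge0_le_integral => //.
    - by apply/measurable_EFinP; exact: measurableT_comp.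
    - by apply: emeasurable_funD; apply/measurable_EFinP; apply: measurableT_comp => //; exact: measurable_funB.
    - move=> w _ /=; rewrite -EFinD lee_fin.
      by have := ler_normB (u 0%N w) (u 0%N w - z w); rewrite subKr.
  rewrite ge0_integralD//.
  - apply: leeD; first exact: (Ehat_ub (fun w => `|(EFin \o u 0%N) w|%E) PP1).
    exact: (Ehat_ub (fun w => `|u 0%N w - z w|%:E) PP1).
  - by apply/measurable_EFinP; exact: measurableT_comp.
  - by apply/measurable_EFinP; apply: measurableT_comp => //; exact: measurable_funB.
exists u; split=> //; apply/(cvg_L1P sl0 slb) => e e0.
exists (Num.truncn e^-1) => n Nn; have [_ hn] := Hu n; apply: le_trans hn _.
rewrite lee_fin invf_ple ?posrE//; apply: ltW; apply: lt_le_trans (truncnS_gt _) _.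
by rewrite ler_nat ltnS.
Qed.

(** One approximation argument for sums, products with a cylinder functional, minima and Lipschitz
    images; op may depend on the path. *)
Lemma LG1_op (op : Om -> R -> R -> R) (K : R) h z1 z2 : 0 <= K ->
  (forall w a b c d, `|op w a b - op w c d| <= K * (`|a - c| + `|b - d|)) ->
  (forall u1 u2, Lip h u1 -> Lip h u2 -> Lip h (fun w => op w (u1 w) (u2 w))) ->
  L0 h (EFin \o (fun w => op w (z1 w) (z2 w))) ->
  LG1 h (EFin \o z1) -> LG1 h (EFin \o z2) -> LG1 h (EFin \o (fun w => op w (z1 w) (z2 w))).
Proof.
move=> K0 opK opL LZ /LG1P[L1z H1] /LG1P[L2z H2]; apply/LG1P; split=> // e e0.
have d0 : 0 < e / (2 * (K + 1)) by rewrite divr_gt0// mulr_gt0// ltr_wpDl.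
have [u1 Lu1 h1] := H1 _ d0; have [u2 Lu2 h2] := H2 _ d0.
exists (fun w => op w (u1 w) (u2 w)); first exact: opL.
have m1 := L0r_meas L1z; have m2 := L0r_meas L2z; have mz := L0r_meas LZ.
have n1 := Lip_measurable Lu1; have n2 := Lip_measurable Lu2.
have no := Lip_measurable (opL _ _ Lu1 Lu2).
have mn (f g : Om -> R) : measurable_fun setT f -> measurable_fun setT g ->
  measurable_fun setT (fun w => `|f w - g w|).
  by move=> mf mg; apply: measurableT_comp => //; exact: measurable_funB.
apply: Ehat_le => P PP1.
have mu1 := mn _ _ n1 m1; have mu2 := mn _ _ n2 m2.
apply: le_trans (_ : \int[P]_w (K%:E * (`|u1 w - z1 w|%:E + `|u2 w - z2 w|%:E)) <= _)%E.
  apply: ge0_le_integral => //.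
  - by apply/measurable_EFinP; exact: mn.
  - apply: measurable_funeM; apply: emeasurable_funD; exact/measurable_EFinP.
  - by move=> w _; rewrite -EFinD -EFinM lee_fin.
rewrite ge0_integralZl//; last 2 first.
- by apply: emeasurable_funD; exact/measurable_EFinP.
- by move=> w _; rewrite -EFinD lee_fin addr_ge0.
rewrite ge0_integralD//; [|exact/measurable_EFinP|exact/measurable_EFinP].
apply: le_trans (_ : K%:E * ((e / (2 * (K + 1)))%:E + (e / (2 * (K + 1)))%:E) <= _)%E.
  apply: lee_wpmul2l; first by rewrite lee_fin.
  apply: leeD; [apply: le_trans h1|apply: le_trans h2].
    exact: (Ehat_ub (fun w => `|u1 w - z1 w|%:E) PP1).
  exact: (Ehat_ub (fun w => `|u2 w - z2 w|%:E) PP1).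
have K1 : 0 < K + 1 by rewrite ltr_wpDl.
rewrite -EFinD -EFinM lee_fin (_ : K * _ = e * (K / (K + 1))); last by field; rewrite gt_eqF.
by rewrite ler_piMr ?(ltW e0)// ler_pdivrMr// mul1r lerDl.
Qed.

Lemma LG1_Lip h z : Lip h z -> LG1 h (EFin \o z).
Proof.
move=> Lz; apply/LG1P; split; first exact: Lip_L0.
move=> e e0; exists z => //; apply: Ehat_le => P _.
by under eq_integral do rewrite subrr normr0; rewrite integral0 lee_fin ltW.
Qed.

Lemma LG1_L0 h z : LG1 h (EFin \o z) -> L0 h (EFin \o z).
Proof. by move=> [[]]. Qed.

Lemma LG1D h z1 z2 : LG1 h (EFin \o z1) -> LG1 h (EFin \o z2) -> LG1 h (EFin \o (fun w => z1 w + z2 w)).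
Proof.
move=> G1 G2; have l1 := LG1_L0 G1; have l2 := LG1_L0 G2.
apply: (@LG1_op (fun _ => +%R) 1) => //.
- by move=> _ a b c d; rewrite mul1r (_ : _ - _ = (a - c) + (b - d)); [exact: ler_normD|ring].
- by move=> u1 u2; exact: LipD.
- apply: L0r; first by apply: measurable_funD; [exact: L0r_meas l1|exact: L0r_meas l2].
  by move=> t w ht; rewrite (L0r_stop _ l1 ht) (L0r_stop _ l2 ht).
Qed.

Lemma LG1M h a z : Lip h a -> LG1 h (EFin \o z) -> LG1 h (EFin \o (fun w => a w * z w)).
Proof.
move=> La G1; have l1 := LG1_L0 G1; have l0 := Lip_L0 La.
have [D [K [M [_ [_ M0 aM _]]]]] := Lip_SL La.
apply: (@LG1_op (fun w x _ => a w * x) M h z z) => //.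
- move=> w x y x' y'; rewrite -mulrBr normrM; apply: ler_pM => //.
  by rewrite lerDl.
- by move=> u1 u2 Lu _; exact: LipM.
- apply: L0r; first by apply: measurable_funM; [exact: L0r_meas l0|exact: L0r_meas l1].
  by move=> t w ht; rewrite (L0r_stop _ l0 ht) (L0r_stop _ l1 ht).
Qed.

Lemma LG1_comp h (f : R -> R) (K : R) z : lip K f -> 0 <= K -> LG1 h (EFin \o z) -> LG1 h (EFin \o (fun w => f (z w))).
Proof.
move=> fK K0 G1; have l1 := LG1_L0 G1.
apply: (@LG1_op (fun w x _ => f x) K h z z) => //.
- by move=> w x y c d; apply: le_trans (fK x c) _; rewrite ler_wpM2l// lerDl.
- by move=> u1 u2 Lu _; exact: Lip_comp fK K0 Lu.
- apply: L0r => [|t w ht]; last by rewrite (L0r_stop _ l1 ht).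
  apply: measurableT_comp (L0r_meas l1); apply: continuous_measurable_fun => x.
  apply/cvgrPdist_le => e e0; apply/nbhs_ballP; exists (e / (K + 1)); first by rewrite /= divr_gt0// ltr_wpDl.
  move=> y; rewrite /ball/= ltr_pdivlMr ?ltr_wpDl// => xy; apply: le_trans (fK x y) _.
  apply: le_trans (ltW xy); rewrite mulrC ler_wpM2l// lerDl//.
Qed.

Lemma LG1_min h z1 z2 : LG1 h (EFin \o z1) -> LG1 h (EFin \o z2) -> LG1 h (EFin \o (fun w => Num.min (z1 w) (z2 w))).
Proof.
move=> G1 G2; have l1 := LG1_L0 G1; have l2 := LG1_L0 G2.
apply: (@LG1_op (fun _ => Num.min) 1) => //.
- move=> _ a b c d; rewrite mul1r.
  have := ler_norm (a - c); have := ler_norm (c - a); rewrite (distrC c).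
  have := ler_norm (b - d); have := ler_norm (d - b); rewrite (distrC d).
  have := normr_ge0 (a - c); have := normr_ge0 (b - d) => ? ? ? ? ? ?.
  by rewrite ler_norml; case: (leP a b) => ?; case: (leP c d) => ?; apply/andP; split; lra.
- by move=> u1 u2; exact: Lip_min.
- apply: L0r; first by apply: measurable_minr; [exact: L0r_meas l1|exact: L0r_meas l2].
  by move=> t w ht; rewrite (L0r_stop _ l1 ht) (L0r_stop _ l2 ht).
Qed.

Lemma LG1N h z : LG1 h (EFin \o z) -> LG1 h (EFin \o (fun w => - z w)).
Proof.
by move=> G1; apply: (@LG1_comp h -%R 1) => // x y; rewrite -opprD normrN mul1r.
Qed.

Lemma LG1_le h k z : (forall X : Om -> \bar R, L0 h X -> L0 k X) -> (h <= k)%E -> LG1 h (EFin \o z) -> LG1 k (EFin \o z).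
Proof.
move=> hk hk' /LG1P[l H]; apply/LG1P; split; first exact: hk.
by move=> e /H[u Lu Hu]; exists u => //; exact: Lip_le Lu.
Qed.

Lemma LG1_le_fin s t z : s <= t -> LG1 s%:E (EFin \o z) -> LG1 t%:E (EFin \o z).
Proof. by move=> st; apply: LG1_le => [X|]; [exact: L0_le|rewrite lee_fin]. Qed.

Lemma LG1_oo h z : LG1 h (EFin \o z) -> LG1 +oo%E (EFin \o z).
Proof. by apply: LG1_le => [X|]; [exact: L0_oo|exact: leey]. Qed.

Lemma LG1_qs h k (X Y : Om -> \bar R) : LG1 h X -> L0 k Y -> (forall u, Lip h u -> Lip k u) ->
  qs (fun w => X w = Y w) -> LG1 k Y.
Proof.
move=> [LX [Xn [LXn c]]] LY hk XY.
have mX := L1_meas LX; have mY := L0_meas LY; split.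
  split=> //; rewrite -(@Ehat_qs _ _ _ (fun w => `|X w|%E)); [by case: LX|exact: measurableT_comp|exact: measurableT_comp|].
  by apply: qs_sub XY => w ->.
exists Xn; split; first by move=> n; apply: hk.
apply/(cvg_L1P sl0 slb) => e e0; have [N HN] := (cvg_L1P sl0 slb _ _).1 c e e0; exists N => n Nn.
have mn := Lip_measurable (LXn n).
rewrite -(@Ehat_qs _ _ _ (fun w => `|(EFin \o Xn n) w - X w|%E)); [exact: HN| | |].
- by apply: measurableT_comp => //; apply: emeasurable_funB => //; exact/measurable_EFinP.
- by apply: measurableT_comp => //; apply: emeasurable_funB => //; exact/measurable_EFinP.
- by apply: qs_sub XY => w ->.
Qed.

(** Real-valued versions let the algebra of [LG1] be done in R, with F_t-measurability preserved. *)
Lemma LG1_real t (X : Om -> \bar R) : LG1 t%:E X -> exists2 z, LG1 t%:E (EFin \o z) & qs (fun w => X w = (z w)%:E).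
Proof.
move=> GX; have LX : L1 t%:E X by case: GX.
have [[L0f _] qf] := L1_fine sl0 slb LX.
by exists (fun w => fine (X w)) => //; exact: (LG1_qs GX L0f).
Qed.

Lemma cond_LG1_LG1 t (X Y : Om -> \bar R) : cond_LG1 sl sb t X Y -> LG1 t%:E Y.
Proof.
move=> [_ LY [Xn [Yn [c _ cY]]]]; split=> //; exists Yn; split=> // n.
by have [] := cond_Lip_Lip sl0 slb (c n).
Qed.

End LG1real.

(** * Approximation and oscillation at random times *)

Section SGapprox.
Variables (R : realType) (sl sb : R).
Hypotheses (sl0 : 0 <= sl) (slb : sl <= sb).
Local Notation Om := (Omega R).
Local Notation Lp := (Lip (R := R) +oo%E).
Local Notation PP := (PP sl sb).
Local Notation Ehat := (Ehat sl sb).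
Implicit Types (P Q : probability Om R) (s t : R).

Lemma SG0_modulus (T : R) (eta : R -> Om -> R) : SG0 T eta -> exists (ts : seq R) (K M : R),
  [/\ forall r, r \in ts -> 0 <= r, 0 <= K, 0 <= M, forall s w, `|eta s w| <= M &
    forall s s' w w' d, 0 <= d -> `|s - s'| <= d -> (forall r, r \in ts -> `|B (Num.min r s) w - B (Num.min r s') w'| <= d) ->
      `|eta s w - eta s' w'| <= K * d].
Proof.
move=> [n [ts [hh [tsT /bounded_lipschitzP[K [M [K0 hM hK]]] ->]]]].
exists [seq ts i | i <- enum 'I_n], K, M; split=> //.
- by move=> _ /mapP[i _ ->]; have /andP[] := tsT i.
- exact: le_trans (hM 0).
- move=> s s' w w' d d0 ss H; apply: le_trans (hK _ _) _; rewrite ler_wpM2l//.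
  apply: row_norm_le => // i; rewrite !mxE; case: splitP => j _; rewrite !mxE//.
  by apply: H; apply/mapP; exists j; rewrite ?mem_enum.
Qed.

Lemma SG0_Lip (T : R) (eta : R -> Om -> R) t : SG0 T eta -> 0 <= t -> Lip t%:E (eta t).
Proof.
move=> /SG0_modulus[ts [K [M [ts0 K0 M0 eM eK]]]] t0.
apply: (@SL_Lip _ _ [seq Num.min r t | r <- ts] K M) => //.
  by move=> _ /mapP[r rt ->]; rewrite le_min ts0// t0 lee_fin ge_min lexx orbT.
split=> // w w' d d0 cl; apply: eK; rewrite ?subrr ?normr0// => r rt.
by apply: cl; apply/mapP; exists r.
Qed.

(** Stated for arbitrary functions because the supremum over an interval of times in [SGnorm]
    carries no measurability; the integral of a nonnegative function is a supremum over simple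
    functions below it. *)
Lemma nn_int_mono P (f g : Om -> \bar R) : (forall w, 0 <= f w)%E -> (forall w, f w <= g w)%E ->
  (\int[P]_w f w <= \int[P]_w g w)%E.
Proof.
move=> f0 fg; have g0 w : (0 <= g w)%E by apply: le_trans (fg w).
rewrite !ge0_integralTE//; apply: ge_ereal_sup => _ [h /= hf <-].
by apply: ereal_sup_ubound; exists h => //= w; exact: le_trans (fg w).
Qed.

(** Passes from the moment of order beta to the mean with an arbitrarily small additive error. *)
Lemma young (b e z : R) : 1 < b -> 0 < e -> 0 <= z -> z <= e + e / e `^ b * z `^ b.
Proof.
move=> b1 e0 z0; have eb : 0 < e `^ b by rewrite powR_gt0.
have [ze|ez] := leP z e.
  by rewrite ler_wpDr// mulr_ge0 ?powR_ge0// divr_ge0// ltW.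
have h : 1 <= z / e by rewrite ler_pdivlMr// mul1r ltW.
have h2 : z / e <= (z / e) `^ b.
  by rewrite -[leLHS]powRr1 ?(le_trans ler01 h)// ler_powR// ltW.
rewrite ler_wpDl ?(ltW e0)//.
have -> : e / e `^ b * z `^ b = e * (z / e) `^ b.
  rewrite powRM// ?invr_ge0 ?(ltW e0)//.
  have -> : e^-1 `^ b = (e `^ b)^-1.
    apply/(mulfI (lt0r_neq0 eb)); rewrite mulfV ?gt_eqF//.
    by rewrite -powRM ?invr_ge0 ?(ltW e0)// mulfV ?gt_eqF// powR1.
  by ring.
by rewrite mulrC -ler_pdivrMr.
Qed.

(** The supremum over time inside the norm makes the approximation valid at every random time at
    once, uniformly over [PP]. *)
Lemma SG_approx (b : R) (X : R -> Om -> R) (e : R) : 1 < b -> SG sl sb b 1 X -> 0 < e ->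
  exists2 eta, SG0 1 eta & forall P (sg : Om -> R), PP P -> (forall w, 0 <= sg w <= 1) ->
    measurable_fun setT (fun w => eta (sg w) w - X (sg w) w) ->
    (\int[P]_w `|eta (sg w) w - X (sg w) w|%:E <= e%:E)%E.
Proof.
move=> b1 [mX cX [eta [Seta cN]]] e0; have b0 : 0 < b by exact: lt_trans b1.
pose e2 := e / 2; have e20 : 0 < e2 by rewrite divr_gt0.
pose K := e2 / e2 `^ b; have K0 : 0 < K by rewrite divr_gt0// powR_gt0.
pose S n w : \bar R := ereal_sup [set (`|eta n t w - X t w| `^ b)%:E | t in [set t : R | 0 <= t <= 1]].
have S0 n w : (0 <= S n w)%E.
  apply: le_trans (_ : (`|eta n 0 w - X 0 w| `^ b)%:E <= _)%E; first by rewrite lee_fin powR_ge0.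
  by apply: ereal_sup_ubound; exists 0 => //=; rewrite lexx ler01.
have ES0 n : (0 <= Ehat (S n))%E by exact: Ehat_ge0.
pose d := (e2 / K) `^ b^-1; have d0 : 0 < d by rewrite powR_gt0// divr_gt0.
have [n Hn] : exists n, (Ehat (S n) <= (e2 / K)%:E)%E.
  have /fine_cvgP[[N1 _ h1] /cvgrPdist_le/(_ _ d0)[N2 _ h2]] := cN.
  pose n := maxn N1 N2; exists n; have := h1 n (leq_maxl _ _); have := h2 n (leq_maxr _ _).
  rewrite sub0r normrN /SGnorm /= -/(S n).
  case: (Ehat (S n)) (ES0 n) => [r r0||] //=; last first.
    by rewrite /poweR /= invr_eq0 gt_eqF.
  rewrite lee_fin in r0; rewrite ger0_norm ?powR_ge0// => h _.
  have := ge0_ler_powR (ltW b0) _ _ h; rewrite !nnegrE !powR_ge0 => /(_ isT isT).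
  have q0 : 0 <= e2 / K by apply: divr_ge0; exact: ltW.
  by rewrite /d -!powRrM mulVf ?gt_eqF// !powRr1.
exists (eta n) => // P sg PP1 sg01 mz.
have mnz : measurable_fun setT (fun w => `|eta n (sg w) w - X (sg w) w|) by exact: measurableT_comp.
have mpz : measurable_fun setT (fun w => `|eta n (sg w) w - X (sg w) w| `^ b).
  by apply: (measurableT_comp (measurable_powR b)).
apply: le_trans (_ : \int[P]_w (e2%:E + K%:E * (`|eta n (sg w) w - X (sg w) w| `^ b)%:E) <= _)%E.
  apply: ge0_le_integral => //.
  - exact/measurable_EFinP.
  - apply: emeasurable_funD => //; apply: measurable_funeM; exact/measurable_EFinP.
  - by move=> w _; rewrite -EFinM -EFinD lee_fin young.
have mp : measurable_fun setT (fun w => (`|eta n (sg w) w - X (sg w) w| `^ b)%:E) by exact/measurable_EFinP.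
have mKp : measurable_fun setT (fun w => K%:E * (`|eta n (sg w) w - X (sg w) w| `^ b)%:E)%E by exact: measurable_funeM.
have p0 w : (0 <= (`|eta n (sg w) w - X (sg w) w| `^ b)%:E)%E by rewrite lee_fin powR_ge0.
have KE0 : (0 <= K%:E)%E by rewrite lee_fin ltW.
have eE0 : (0 <= e2%:E)%E by rewrite lee_fin ltW.
have Kp0 w : (0 <= K%:E * (`|eta n (sg w) w - X (sg w) w| `^ b)%:E)%E by exact: mule_ge0.
rewrite ge0_integralD//.
rewrite integral_cst// [X in (_ * X)%E](_ : _ = 1%E) ?mule1; last exact: probability_setT.
rewrite ge0_integralZl//.
rewrite (_ : e = e2 + K * (e2 / K)); last by rewrite mulrC divfK ?gt_eqF// /e2; field.
rewrite EFinD (EFinM K); apply: leeD2l; apply: lee_wpmul2l; first by rewrite lee_fin ltW.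
apply: le_trans Hn; apply: le_trans (Ehat_ub (S n) PP1).
apply: nn_int_mono => w; first by rewrite lee_fin powR_ge0.
by apply: ereal_sup_ubound; exists (sg w) => //=; exact: sg01.
Qed.

(** H is the sum of all dyadic penalties: its mean is at most e under every P, and where it is below
    1 the chaining bound gives the modulus of continuity. [1 <= n] places [0, 1] below the
    horizon. *)
Lemma path_osc (e : R) : 0 < e -> \forall n \near \oo, exists H : Om -> \bar R,
  [/\ measurable_fun setT H, forall w, (0 <= H w)%E, forall P, PP P -> (\int[P]_w H w <= e%:E)%E &
    forall w, (1%:E <= H w)%E \/ forall s s', 0 <= s <= 1 -> 0 <= s' <= 1 -> `|s - s'| <= (2 ^+ n)^-1 ->
      `|B s w - B s' w| <= e].
Proof.
move=> e0; pose C := CB sb; have C0 : 0 <= C by rewrite /C /CB mulr_ge0// exprn_even_ge0.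
have [A A0 AC] : exists2 A : R, 0 < A & 10 * C / A ^+ 4 * (25 / 4) <= e.
  have z0 : 0 <= 10 * C * (25 / 4) / e by apply: divr_ge0; [nra|exact: ltW].
  exists (1 + 10 * C * (25 / 4) / e); first by rewrite ltr_pwDl.
  set z := 10 * C * (25 / 4) / e in z0 *.
  have zp : 0 < 1 + z by rewrite ltr_pwDl.
  rewrite mulrAC ler_pdivrMr ?exprn_gt0//.
  have -> : 10 * C * (25 / 4) = e * z by rewrite /z [RHS]mulrC divfK// gt_eqF.
  rewrite ler_pM2l//; apply: le_trans (_ : 1 + z <= _); first by rewrite lerDr.
  by apply: ler_eXnr => //; rewrite lerDl.
have near := near_expr (20 * A) (ltW (rho_gt0 R)) (rho_lt1 R) e0.
have near1 : \forall n \near \oo, (1 <= n)%N by exists 1%N.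
near=> n.
have ne : 20 * A * rho R ^+ n <= e by near: n.
have n1 : (1 <= n)%N by near: n.
pose F j := dyatrip A j; pose H w : \bar R := limn (fun m => (pensum F m w)%:E).
have Fok j p : p \in F j -> tripok p by exact: dyatrip_ok.
have nd w : nondecreasing_seq (fun m => (pensum F m w)%:E).
  by apply/nondecreasing_seqP => m; rewrite lee_fin pensum_mono.
have Lm m : Lp (pensum F m) by exact: Lip_pensum.
have mm m : measurable_fun setT (fun w => (pensum F m w)%:E).
  by apply/measurable_EFinP; exact: Lip_measurable (Lm m).
have Hge m w : ((pensum F m w)%:E <= H w)%E by rewrite /H (cvg_lim (@ereal_hausdorff R) (ereal_nondecreasing_cvgn (nd w))); apply: ereal_sup_ubound; exists m.
exists H; split.
- by apply: (emeasurable_fun_cvg (fun m w => (pensum F m w)%:E)) => // w _; exact: ereal_nondecreasing_is_cvgn.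
- by move=> w; apply: le_trans (Hge 0%N w); rewrite lee_fin pensum_ge0.
- move=> P PP1.
  have h := @cvg_monotone_convergence _ _ _ P setT measurableT (fun m w => (pensum F m w)%:E) mm
    (fun m w _ => pensum_ge0 F m w) (fun w _ => nd w).
  rewrite -(cvg_lim _ h)//; apply: lime_le; first exact: (cvgP _ h).
  apply: nearW => m; rewrite (EL_EFin P (Lm m)) lee_fin.
  have Pf := PP_posfun sl0 slb PP1.
  apply: le_trans (Lpensum (pfD Pf) (pfZ Pf) (pf1 Pf) (pf_mom Pf) m Fok) _.
  apply: le_trans AC; apply: le_trans (_ : \sum_(j < m.+1) 10 * C / A ^+ 4 * xi R ^+ j <= _).
    by apply: ler_sum => j _; exact: dyatrip_cost.
  rewrite -mulr_sumr; apply: ler_wpM2l; last exact: xi_sum.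
  by apply: divr_ge0; [nra|rewrite exprn_ge0// ltW].
- move=> w; have [[m hm]|all1] := pselect (exists m, 1 <= pensum F m w).
    by left; apply: le_trans (Hge m w); rewrite lee_fin.
  right=> s s' /andP[s0 s1] /andP[s0' s1'] ss; apply: le_trans ne.
  have g m : good (fun s : R => B s w) A m.
    by apply: (@pensum_good _ F A m w A0) => [j p //|]; rewrite ltNge; apply/negP => hm; apply: all1; exists m.
  apply: (good_modulus (@path_cont _ w) g (ltW A0)) => //.
    by apply: le_lt_trans s1 _; rewrite ltr1n ltnS.
  by apply: le_lt_trans s1' _; rewrite ltr1n ltnS.
Unshelve. all: by end_near. Qed.

(** Paths with a good modulus contribute [K * d]; on the others the difference is at most 2M and H
    is at least 1. The value of d balances the two. *)
Lemma SG0_osc (eta : R -> Om -> R) (e : R) : SG0 1 eta -> 0 < e ->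
  \forall n \near \oo, forall P (sg sg' : Om -> R), PP P -> (forall w, 0 <= sg w <= 1) -> (forall w, 0 <= sg' w <= 1) ->
    (forall w, `|sg w - sg' w| <= (2 ^+ n)^-1) ->
    measurable_fun setT (fun w => eta (sg w) w - eta (sg' w) w) ->
    (\int[P]_w `|eta (sg w) w - eta (sg' w) w|%:E <= e%:E)%E.
Proof.
move=> /SG0_modulus[ts [K [M [ts0 K0 M0 eM eK]]]] e0.
pose d := e / (K + 2 * M + 1); have D0 : 0 < K + 2 * M + 1 by rewrite ltr_wpDl// addr_ge0// mulr_ge0.
have d0 : 0 < d by rewrite divr_gt0.
have h0 : 0 <= 2^-1 :> R by rewrite invr_ge0.
have h1 : 2^-1 < 1 :> R by lra.
have n1 := near_expr 1 h0 h1 d0; have n2 := path_osc d0.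
near=> n.
have dn : (2 ^+ n)^-1 <= d by rewrite -[leLHS]mul1r -exprVn; near: n.
have [H [mH H0 HE Hosc]] : exists H : Om -> \bar R,
  [/\ measurable_fun setT H, forall w, (0 <= H w)%E, forall P, PP P -> (\int[P]_w H w <= d%:E)%E &
    forall w, (1%:E <= H w)%E \/ forall s s', 0 <= s <= 1 -> 0 <= s' <= 1 -> `|s - s'| <= (2 ^+ n)^-1 ->
      `|B s w - B s' w| <= d] by near: n.
move=> P sg sg' PP1 sg01 sg01' ss mz.
have mnz : measurable_fun setT (fun w => `|eta (sg w) w - eta (sg' w) w|) by exact: measurableT_comp.
have Kd : 0 <= K * d by rewrite mulr_ge0// ltW.
have M2 : 0 <= 2 * M by rewrite mulr_ge0.
apply: le_trans (_ : \int[P]_w ((K * d)%:E + (2 * M)%:E * H w) <= _)%E.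
  apply: ge0_le_integral => //.
  - exact/measurable_EFinP.
  - by apply: emeasurable_funD => //; exact: measurable_funeM.
  - move=> w _; have [h|h] := Hosc w.
      apply: le_trans (_ : (2 * M)%:E * 1%:E <= _)%E.
        rewrite mule1 lee_fin; apply: le_trans (ler_normB _ _) _.
        by have := eM (sg w) w; have := eM (sg' w) w; lra.
      apply: le_trans (lee_wpmul2l _ h) _; first by rewrite lee_fin.
      by rewrite leeDr// lee_fin.
    apply: le_trans (_ : (K * d)%:E <= _)%E; last by rewrite leeDl// mule_ge0// lee_fin.
    rewrite lee_fin; apply: eK; [exact: ltW|exact: le_trans (ss w) dn|move=> r rt].
    have m01 (x : R) : 0 <= x <= 1 -> 0 <= Num.min r x <= 1.
      by move=> /andP[x0 x1]; rewrite le_min ts0// x0 ge_min x1 orbT.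
    apply: h; [exact: m01|exact: m01|]; apply: le_trans (ss w).
    exact: dist_minr.
have mKH : measurable_fun setT (fun w => (2 * M)%:E * H w)%E by exact: measurable_funeM.
have KH0 w : (0 <= (2 * M)%:E * H w)%E by rewrite mule_ge0// lee_fin.
rewrite ge0_integralD//.
rewrite integral_cst// [X in (_ * X)%E](_ : _ = 1%E) ?mule1; last exact: probability_setT.
rewrite ge0_integralZl//.
apply: le_trans (_ : (K * d)%:E + (2 * M)%:E * d%:E <= _)%E.
  by apply: leeD2l; apply: lee_wpmul2l; [rewrite lee_fin|exact: HE].
rewrite -EFinM -EFinD lee_fin -mulrDl mulrC.
apply: le_trans (_ : d * (K + 2 * M + 1) <= _); last by rewrite /d divfK// gt_eqF.
by rewrite ler_pM2l// lerDl.
Unshelve. all: by end_near. Qed.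

End SGapprox.

(** * First hitting index of an increasing sequence of events *)

Section Grid.
Variable R : realType.

(* With b k := (tau <= t_k), [hit b n] is the first k with tau <= t_k. *)
Definition hit (b : nat -> bool) n : nat := \sum_(k < n) ~~ b k.

Variable b : nat -> bool.
Hypothesis bm : forall k, b k -> b k.+1.

Lemma b_mono k l : (k <= l)%N -> b k -> b l.
Proof.
by move=> /subnKC <-; elim: (l - k)%N => [|d IH]; rewrite ?addn0 ?addnS// => /IH/bm.
Qed.

Lemma hit_full n : ~~ b n -> hit b n = n.
Proof.
move=> bn; rewrite /hit (eq_bigr (fun=> 1%N)); first by rewrite sum1_card card_ord.
by move=> [k kn] _ /=; case E : (b k) => //; rewrite (b_mono (ltnW kn) E) in bn.
Qed.

Lemma hit_rec n : hit b n.+1 = (hit b n + ~~ b n)%N.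
Proof. by rewrite /hit big_ord_recr. Qed.

Lemma hit_le n : (hit b n <= n)%N.
Proof.
elim: n => [|n IH]; first by rewrite /hit big_ord0.
by rewrite hit_rec; case: (b n); rewrite ?addn0 ?addn1// leqW.
Qed.

Lemma hitP n k : (k < n)%N -> (k < hit b n)%N = ~~ b k.
Proof.
elim: n => [//|n IH]; rewrite ltnS leq_eqVlt => /predU1P[->|kn]; rewrite hit_rec.
  case E : (b n); first by rewrite addn0 ltnNge hit_le.
  by rewrite hit_full ?E// addn1 ltnSn.
case E : (b n); first by rewrite addn0 IH.
rewrite hit_full ?E// addn1 ltnS (ltnW kn); apply/esym.
by case E' : (b k) => //; rewrite (b_mono (ltnW kn) E') in E.
Qed.

(** Summation by parts: a value at the hitting index becomes a linear combination of the indicators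
    b k, for which the stopping time property is stated. *)
Lemma hit_sum (f : nat -> R) n : f (hit b n) = f n - \sum_(k < n) (f k.+1 - f k) * (b k)%:R.
Proof.
elim: n => [|n IH]; first by rewrite /hit !big_ord0 subr0.
rewrite hit_rec big_ord_recr /=; case E : (b n).
  by rewrite addn0 IH mulr1; ring.
rewrite hit_full ?E// addn1 mulr0 addr0 big1 ?subr0// => -[k kn] _ /=.
by case E' : (b k); [rewrite (b_mono (ltnW kn) E') in E|rewrite mulr0].
Qed.

End Grid.

(** * Processes evaluated at stopping times *)

Section AtTime.
Variables (R : realType) (sl sb : R).
Hypotheses (sl0 : 0 <= sl) (slb : sl <= sb).
Local Notation Om := (Omega R).
Local Notation Lp := (Lip (R := R) +oo%E).
Local Notation PP := (PP sl sb).
Local Notation Ehat := (Ehat sl sb).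
Local Notation qs := (qs sl sb).
Local Notation L1 := (L1 sl sb).
Local Notation LG1 := (LG1 sl sb).
Local Notation LG1s := (LG1s sl sb).
Local Notation LG1ss := (LG1ss sl sb).
Local Notation dist := (dist sl sb).
Implicit Types (P Q : probability Om R) (s t : R) (u z : Om -> R) (h : \bar R).

Lemma cvg_EFin_seq (u : nat -> R) (l : R) : u n @[n --> \oo] --> l -> (u n)%:E @[n --> \oo] --> l%:E.
Proof. by move=> h; apply/fine_cvgP; split=> //; exact: nearW. Qed.

Lemma cvg_sum_seq n (u : nat -> nat -> R) (l : nat -> R) : (forall k, u k m @[m --> \oo] --> l k) ->
  \sum_(k < n) u k m @[m --> \oo] --> \sum_(k < n) l k.
Proof.
move=> H; elim: n => [|n IH]; first by under eq_fun do rewrite big_ord0; rewrite big_ord0; exact: cvg_cst.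
by under eq_fun do rewrite big_ord_recr; rewrite big_ord_recr; exact: cvgD.
Qed.

Lemma fatou_bd P (f : nat -> Om -> R) (g : Om -> R) (c : \bar R) n0 : (forall n, measurable_fun setT (f n)) ->
  measurable_fun setT g -> (forall w, f n w @[n --> \oo] --> g w) ->
  (forall n, (n0 <= n)%N -> (\int[P]_w `|f n w|%:E <= c)%E) -> (\int[P]_w `|g w|%:E <= c)%E.
Proof.
move=> mf mg cf H.
have m n : measurable_fun setT (fun w => `|f n w|%:E) by apply/measurable_EFinP; exact: measurableT_comp.
have -> : (\int[P]_w `|g w|%:E = \int[P]_w limn_einf (fun n => `|f n w|%:E))%E.
  apply: eq_integral => w _; have h : `|f n w|%:E @[n --> \oo] --> `|g w|%:E.
    by apply: cvg_EFin_seq; apply: cvg_norm.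
  by rewrite is_cvg_limn_einfE ?(cvg_lim _ h)//; exact: (cvgP _ h).
apply: le_trans (fatou P measurableT m _) _; first by move=> n w _; rewrite lee_fin.
apply: le_trans (limn_einf_sup _) _.
have [|_ //] := @limn_esup_bounds _ (fun n => \int[P]_w `|f n w|%:E)%E 0%E c n0.
by move=> k nk; split; [apply: integral_ge0 => w _; rewrite lee_fin|exact: H].
Qed.

Lemma dist_int P u z (e : R) : PP P -> (dist u z <= e%:E)%E -> (\int[P]_w `|u w - z w|%:E <= e%:E)%E.
Proof. by move=> PP1; apply: le_trans; exact: (Ehat_ub (fun w => `|u w - z w|%:E) PP1). Qed.

Lemma int_triangle P (x y z : Om -> R) (c d : R) : measurable_fun setT x -> measurable_fun setT y -> measurable_fun setT z ->
  (\int[P]_w `|x w - y w|%:E <= c%:E)%E -> (\int[P]_w `|y w - z w|%:E <= d%:E)%E ->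
  (\int[P]_w `|x w - z w|%:E <= (c + d)%:E)%E.
Proof.
move=> mx my mz h1 h2.
have mn (f g : Om -> R) : measurable_fun setT f -> measurable_fun setT g ->
  measurable_fun setT (fun w => `|f w - g w|%:E).
  by move=> mf mg; apply/measurable_EFinP; apply: measurableT_comp => //; exact: measurable_funB.
have m1 := mn _ _ mx my; have m2 := mn _ _ my mz.
apply: le_trans (_ : \int[P]_w (`|x w - y w|%:E + `|y w - z w|%:E) <= _)%E.
  apply: ge0_le_integral => //; [exact: mn|exact: emeasurable_funD|].
  move=> w _; rewrite -EFinD lee_fin (_ : x w - z w = (x w - y w) + (y w - z w)); last by ring.
  exact: ler_normD.
by rewrite ge0_integralD// EFinD; exact: leeD.
Qed.

Lemma L1_bd h z (M : R) : L0 h (EFin \o z) -> (forall w, `|z w| <= M) -> L1 h (EFin \o z).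
Proof.
move=> Lz zM; split=> //; apply: le_lt_trans (ltry M).
by apply: Ehat_bd => [|w]; [exact: L0_meas Lz|rewrite lee_fin].
Qed.

Lemma L1_close h u z (e : R) : L1 h (EFin \o u) -> L0 h (EFin \o z) -> (dist u z <= e%:E)%E -> L1 h (EFin \o z).
Proof.
move=> [Lu Nu] Lz uz; split=> //.
have mu := L0r_meas Lu; have mz := L0r_meas Lz.
have m1 : measurable_fun setT (fun w => `|u w|%:E) by apply/measurable_EFinP; exact: measurableT_comp.
have m2 : measurable_fun setT (fun w => `|u w - z w|%:E).
  by apply/measurable_EFinP; apply: measurableT_comp => //; exact: measurable_funB.
apply: le_lt_trans (_ : (Ehat (fun w => `|(EFin \o u) w|) + e%:E < +oo)%E); last by rewrite lte_add_pinfty ?ltry.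
apply: Ehat_le => P PP1.
apply: le_trans (_ : \int[P]_w (`|u w|%:E + `|u w - z w|%:E) <= _)%E.
  apply: ge0_le_integral => //.
  - by apply/measurable_EFinP; exact: measurableT_comp.
  - exact: emeasurable_funD.
  - by move=> w _ /=; rewrite -EFinD lee_fin; have := ler_normB (u w) (u w - z w); rewrite subKr.
rewrite ge0_integralD//; apply: leeD; last exact: dist_int uz.
exact: (Ehat_ub (fun w => `|(EFin \o u) w|%E) PP1).
Qed.

Lemma L1Dr h u z : L1 h (EFin \o u) -> L1 h (EFin \o z) -> L1 h (EFin \o (fun w => u w + z w)).
Proof.
move=> [Lu Nu] [Lz Nz].
have mu := L0r_meas Lu; have mz := L0r_meas Lz.
have m1 : measurable_fun setT (fun w => `|u w|%:E) by apply/measurable_EFinP; exact: measurableT_comp.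
have m2 : measurable_fun setT (fun w => `|z w|%:E) by apply/measurable_EFinP; exact: measurableT_comp.
split.
  apply: L0r; first exact: measurable_funD.
  by move=> t w ht; rewrite (L0r_stop _ Lu ht) (L0r_stop _ Lz ht).
apply: le_lt_trans (_ : (Ehat (fun w => `|(EFin \o u) w|) + Ehat (fun w => `|(EFin \o z) w|) < +oo)%E); last exact: lte_add_pinfty.
apply: Ehat_le => P PP1.
apply: le_trans (_ : \int[P]_w (`|u w|%:E + `|z w|%:E) <= _)%E.
  apply: ge0_le_integral => //.
  - by apply/measurable_EFinP; apply: measurableT_comp => //; exact: measurable_funD.
  - exact: emeasurable_funD.
  - by move=> w _ /=; rewrite -EFinD lee_fin ler_normD.
rewrite ge0_integralD//; apply: leeD.
  exact: (Ehat_ub (fun w => `|(EFin \o u) w|%E) PP1).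
exact: (Ehat_ub (fun w => `|(EFin \o z) w|%E) PP1).
Qed.

Lemma LG1_sum h n (z : nat -> Om -> R) : (0 <= h)%E -> (forall k, LG1 h (EFin \o z k)) ->
  LG1 h (EFin \o (fun w => \sum_(k < n) z k w)).
Proof.
move=> h0 H; elim: n => [|n IH].
  rewrite (_ : EFin \o _ = EFin \o cst 0); first by apply: LG1_Lip => //; exact: Lip_cst.
  by apply/funext => w /=; rewrite big_ord0.
rewrite (_ : EFin \o _ = EFin \o (fun w => \sum_(k < n) z k w + z n w)); first exact: LG1D.
by apply/funext => w /=; rewrite big_ord_recr.
Qed.

Lemma qs_eq_of_dist u z : measurable_fun setT u -> measurable_fun setT z ->
  (forall e : R, 0 < e -> (dist u z <= e%:E)%E) -> qs (fun w => u w = z w).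
Proof.
move=> mu mz H.
have mB : measurable_fun setT (fun w => `|u w - z w|) by apply: measurableT_comp => //; exact: measurable_funB.
have mE : measurable_fun setT (fun w => `|u w - z w|%:E) by exact/measurable_EFinP.
have E : [set w | ~ u w = z w] = [set w | 0%E < `|u w - z w|%:E]%E.
  by apply/seteqP; split=> w /=; rewrite lte_fin normr_gt0 subr_eq0 => /eqP.
have mA : measurable [set w | ~ u w = z w].
  by rewrite E; have := measurable_lte measurableT (measurable_cst 0%E) mE; rewrite setTI.
apply: (qs_set sl0 slb) => // P PP1; apply: (int0_null mA mE) => [w|]; first by rewrite E.
apply/eqP; rewrite eq_le; apply/andP; split; last by apply: integral_ge0 => w _; rewrite lee_fin.
apply/lee_addgt0Pr => e e0; rewrite add0e; apply: le_trans (dist_int PP1 (H e e0)).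
by apply: ge0_subset_integral => // w _; rewrite lee_fin.
Qed.

Lemma path01_cvg (f : R -> R) (s : nat -> R) (x : R) : {within [set t : R | 0 <= t <= 1], continuous f} ->
  0 <= x <= 1 -> (forall n, 0 <= s n <= 1) -> s n @[n --> \oo] --> x -> f (s n) @[n --> \oo] --> f x.
Proof.
move=> /subspace_continuousP cf x01 s01 sx.
apply: (cvg_comp s f _ (cf x x01)) => U /= HU.
have h1 : \forall n \near \oo, 0 <= s n <= 1 -> U (s n) := sx _ HU.
suff : \forall n \near \oo, U (s n) by [].
by apply: filterS h1 => n; apply; exact: s01.
Qed.

Definition grid (tau : Om -> R) n (w : Om) : R := dyadic R n (hit (fun k => tau w <= dyadic R n k) (2 ^ n)).

Section Tau.
Variable tau : Om -> R.
Hypothesis tau01 : forall w, 0 <= tau w <= 1.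

Lemma dyadic_le n k l : (k <= l)%N -> dyadic R n k <= dyadic R n l.
Proof. by move=> kl; rewrite /dyadic ler_pM2r ?invr_gt0 ?exprn_gt0// ler_nat. Qed.

Lemma dyadic_full n : dyadic R n (2 ^ n) = 1.
Proof. by rewrite /dyadic natrX divff// gt_eqF// exprn_gt0. Qed.

Lemma dyadic01 n k : (k <= 2 ^ n)%N -> 0 <= dyadic R n k <= 1.
Proof.
move=> kn; apply/andP; split; first by rewrite /dyadic divr_ge0// exprn_ge0.
by rewrite -(dyadic_full n) dyadic_le.
Qed.

Lemma tau_mono n w k : tau w <= dyadic R n k -> tau w <= dyadic R n k.+1.
Proof. by move=> h; apply: le_trans h _; exact: dyadic_le. Qed.

Lemma grid01 n w : 0 <= grid tau n w <= 1.
Proof. by apply: dyadic01; exact: hit_le. Qed.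

Lemma grid_ge n w : tau w <= grid tau n w.
Proof.
rewrite /grid; set b := fun k => _; have := hit_le b (2 ^ n); rewrite leq_eqVlt => /predU1P[->|h].
  by rewrite dyadic_full; have /andP[] := tau01 w.
by apply: contraT => nb; have := hitP (@tau_mono n w) h; rewrite nb ltnn.
Qed.

Lemma grid_lt n w : grid tau n w <= tau w + (2 ^+ n)^-1.
Proof.
rewrite /grid; set b := fun k => _; case E : (hit b (2 ^ n)) => [|k].
  rewrite /dyadic mul0r; have /andP[t0 _] := tau01 w.
  by rewrite addr_ge0// invr_ge0 exprn_ge0.
have kn : (k < 2 ^ n)%N by rewrite -E; exact: hit_le.
have := hitP (@tau_mono n w) kn; rewrite -/b E ltnSn => /esym; rewrite /b -ltNge => h.
by rewrite /dyadic -natr1 mulrDl mul1r lerD2r ltW.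
Qed.

Lemma grid_dist n w : `|grid tau n w - tau w| <= (2 ^+ n)^-1.
Proof. by rewrite ger0_norm ?subr_ge0 ?grid_ge// lerBlDl grid_lt. Qed.

Lemma grid_cvg w : grid tau n w @[n --> \oo] --> tau w.
Proof.
apply/cvgrPdist_le => e e0.
have h0 : 0 <= 2^-1 :> R by rewrite invr_ge0.
have h1 : 2^-1 < 1 :> R by lra.
have := near_expr 1 h0 h1 e0; apply: filterS => n; rewrite mul1r exprVn distrC; apply: le_trans.
exact: grid_dist.
Qed.

Lemma grid_sum (f : R -> Om -> R) n w : f (grid tau n w) w = f 1 w -
  \sum_(k < 2 ^ n) (f (dyadic R n k.+1) w - f (dyadic R n k) w) * (tau w <= dyadic R n k)%R%:R.
Proof.
by rewrite (hit_sum (@tau_mono n w) (fun k => f (dyadic R n k) w)) dyadic_full.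
Qed.

Hypothesis st : forall t, 0 <= t -> LG1s t%:E (fun w => (\1_[set w' | tau w' <= t] w)%:E).

Lemma tau_set t : 0 <= t -> F_ t%:E [set w | tau w <= t].
Proof.
move=> t0; have [[/L0P[mI IE] _] _] := st t0; apply/F_P; split.
  have mI' : measurable_fun setT (\1_[set w' | tau w' <= t] : Om -> R) by exact/measurable_EFinP.
  by move/measurable_indicP : mI'.
apply/seteqP; split=> w /=; have [] := IE w; rewrite !indicE.
  by case: (boolP (w \in _)) => [/set_mem//|_] + h; rewrite mem_set// => /eqP; rewrite oner_eq0.
by case: (boolP (stop t w \in _)) => [/set_mem//|_] + h; rewrite (mem_set (h : [set w' | tau w' <= t] w)) => /eqP; rewrite eq_sym oner_eq0.
Qed.

Lemma tau_indic t w : \1_[set w' | tau w' <= t] w = (tau w <= t)%R%:R :> R.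
Proof. by rewrite indicE; case: (boolP (tau w <= t)) => h; [rewrite mem_set|rewrite memNset//; apply/negP]. Qed.

Lemma grid_measurable (f : R -> Om -> R) n : (forall t, 0 <= t <= 1 -> measurable_fun setT (f t)) ->
  measurable_fun setT (fun w => f (grid tau n w) w).
Proof.
move=> mf; under eq_fun do rewrite grid_sum.
apply: measurable_funB; first by apply: mf; rewrite ler01 lexx.
apply: measurable_sum => k; apply: measurable_funM.
  have kn : (k < 2 ^ n)%N by [].
  by apply: measurable_funB; apply: mf; apply: dyadic01 => //; exact: ltnW.
have d0 : 0 <= dyadic R n k by have /andP[] := dyadic01 (ltnW (ltn_ord k)).
under eq_fun do rewrite -tau_indic.
by apply: measurable_indic; have /F_P[] := tau_set d0.
Qed.

Lemma indicator_approx t : 0 <= t -> exists z : nat -> Om -> R, (forall m, LG1 +oo%E (EFin \o z m)) /\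
  qs (fun w => nonincreasing_seq (z ^~ w) /\ z m w @[m --> \oo] --> ((tau w <= t)%R%:R : R)).
Proof.
move=> t0; have [_ [Z [GZ dZ]]] := st t0.
have /choice[z Hz] m : exists z, LG1 t%:E (EFin \o z) /\ qs (fun w => Z m w = (z w)%:E).
  by have [z ? ?] := LG1_real sl0 slb (GZ m); exists z.
exists z; split=> [m|]; first by have [h1 _] := Hz m; exact: (LG1_oo sl0 slb h1).
have qz : qs (fun w => forall m, Z m w = (z m w)%:E) by apply: (qs_all sl0 slb) => m; have [] := Hz m.
apply: qs_sub (qs_and sl0 slb qz dZ) => w [e [ni c]]; split.
  by move=> m m' mm; rewrite -lee_fin -!e; exact: ni.
move: c; under eq_fun do rewrite e; rewrite tau_indic => /fine_cvgP[_]; exact.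
Qed.

(** The indicators of [tau <= t_k] are decreasing limits of [LG1] functionals, but their
    coefficients have both signs. Nonnegative coefficients keep the limit decreasing, nonpositive
    ones make it increasing; the second limit is taken after the first, which is the order of limits
    in [LG1ss]. *)
Lemma grid_LG1ss (eta : R -> Om -> R) n : SG0 1 eta -> LG1ss +oo%E (fun w => (eta (grid tau n w) w)%:E).
Proof.
move=> Seta; pose N := (2 ^ n)%N; pose t k := dyadic R n k.
have t01 k : (k <= N)%N -> 0 <= t k <= 1 by exact: dyadic01.
have Leta s : 0 <= s -> Lp (eta s) by move=> s0; apply: Lip_le (SG0_Lip Seta s0); exact: leey.
have tge k : 0 <= t k by rewrite /t /dyadic divr_ge0// exprn_ge0.
pose x k w := eta (t k.+1) w - eta (t k) w.
have Lx k : Lp (x k) by apply: LipD; [exact: Leta|apply: LipN; exact: Leta].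
pose a k w := Num.max (- x k w) 0; pose b k w := Num.max (x k w) 0.
have La k : Lp (a k) by apply: Lip_maxc; exact: LipN.
have Lb k : Lp (b k) by exact: Lip_maxc.
have a0 k w : 0 <= a k w by rewrite le_max lexx orbT.
have b0 k w : 0 <= b k w by rewrite le_max lexx orbT.
have xE k w : x k w = b k w - a k w.
  by rewrite /a /b; case: (leP (x k w) 0) => h; [rewrite (@max_l _ _ (- x k w))|rewrite (@max_r _ _ (- x k w))]; lra.
pose c k w : R := (tau w <= t k)%R%:R.
have /choice[z Hz] k := indicator_approx (tge k).
have Gz k m : LG1 +oo%E (EFin \o z k m) by have [h _] := Hz k.
have qz : qs (fun w => forall k, nonincreasing_seq (z k ^~ w) /\ z k m w @[m --> \oo] --> c k w).
  by apply: (qs_all sl0 slb) => k; have [_ h] := Hz k.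
(* U collects the nonnegative coefficients with the limiting indicators; [W m] the nonpositive ones
   with the m-th approximations, so that [U + W m] increases in m. *)
pose U w := eta 1 w + \sum_(k < N) a k w * c k w.
pose W m w := - \sum_(k < N) b k w * z k m w.
have mc k : measurable_fun setT (c k).
  rewrite /c; under eq_fun do rewrite -tau_indic.
  by apply: measurable_indic; have /F_P[] := tau_set (tge k).
have GW m : LG1 +oo%E (EFin \o W m).
  apply: LG1N => //; apply: (@LG1_sum +oo%E N (fun k w => b k w * z k m w)) => // k; exact: LG1M.
have LU : L1 +oo%E (EFin \o U).
  have E k : exists M, forall w, `|a k w| <= M by have [D [K [M [_ [_ _ aM _]]]]] := Lip_SL (La k); exists M.
  have [D [K [M [_ [_ _ eM _]]]]] := Lip_SL (Leta 1 ler01); have /choice[A HA] := E.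
  apply: (@L1_bd _ _ (M + \sum_(k < N) A k)).
    apply: L0r => //; apply: measurable_funD; first exact: Lip_measurable (Leta 1 ler01).
    by apply: measurable_sum => k; apply: measurable_funM => //; exact: Lip_measurable (La k).
  move=> w; apply: le_trans (ler_normD _ _) _; apply: lerD => //.
  apply: le_trans (ler_norm_sum _ _ _) _; apply: ler_sum => k _.
  rewrite normrM -[leRHS]mulr1; apply: ler_pM => //.
  by rewrite /c; case: (tau w <= _); rewrite ?normr1 ?normr0 ?lexx ?ler01.
have GUW m : LG1s +oo%E (EFin \o (fun w => U w + W m w)).
  split; first by apply: L1Dr => //; case: (GW m).
  exists (fun m' => EFin \o (fun w => (eta 1 w + \sum_(k < N) a k w * z k m' w) + W m w)); split.
    move=> m'; apply: (LG1D sl0 slb); last exact: GW.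
    apply: (LG1D sl0 slb); first by apply: (LG1_Lip sl0 slb); exact: Leta.
    by apply: (@LG1_sum +oo%E N (fun k w => a k w * z k m' w)) => // k; exact: LG1M.
  apply: qs_sub qz => w H; split.
    move=> p q pq; rewrite /= lee_fin lerD2r lerD2l; apply: ler_sum => k _.
    by apply: ler_wpM2l => //; have [h _] := H k; exact: h.
  apply: cvg_EFin_seq; apply: cvgD; last exact: cvg_cst.
  apply: cvgD; first exact: cvg_cst.
  apply: (@cvg_sum_seq N (fun k m => a k w * z k m w) (fun k => a k w * c k w)) => k.
  by apply: cvgM; [exact: cvg_cst|have [_] := H k].
have E w : eta (grid tau n w) w = U w - \sum_(k < N) b k w * c k w.
  rewrite grid_sum /U -addrA; congr (_ + _); rewrite -sumrB -sumrN; apply: eq_bigr => k _.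
  by rewrite -/(t k) -/(t k.+1) -/(x k w) -/(c k w) xE; ring.
have [_ [K [M [_ _ _ eM _]]]] := SG0_modulus Seta.
split.
  apply: (@L1_bd _ _ M) => [|w]; last exact: eM.
  by apply: L0r => //; apply: grid_measurable => s /andP[s0 _]; exact: Lip_measurable (Leta s s0).
exists (fun m => EFin \o (fun w => U w + W m w)); split=> //.
apply: qs_sub qz => w H; split.
  move=> p q pq; rewrite /= lee_fin lerD2l lerN2; apply: ler_sum => k _.
  by apply: ler_wpM2l => //; have [h _] := H k; exact: h.
rewrite E; apply: cvg_EFin_seq; apply: cvgD; first exact: cvg_cst.
apply: cvgN; apply: (@cvg_sum_seq N (fun k m => b k w * z k m w) (fun k => b k w * c k w)) => k.
by apply: cvgM; [exact: cvg_cst|have [_] := H k].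
Qed.

Variables (beta : R) (X : R -> Om -> R).
Hypotheses (beta1 : 1 < beta) (SX : SG sl sb beta 1 X).

Lemma X_meas t : 0 <= t <= 1 -> measurable_fun setT (X t).
Proof. by move=> h; have [H _ _] := SX; exact: H. Qed.

Lemma X_grid_cvg w : X (grid tau n w) w @[n --> \oo] --> X (tau w) w.
Proof.
have [_ cX _] := SX; apply: (@path01_cvg (fun s => X s w) (fun n => grid tau n w) (tau w)).
- exact: cX.
- exact: tau01.
- by move=> n; exact: grid01.
- exact: grid_cvg.
Qed.

Lemma X_tau_meas : measurable_fun setT (fun w => X (tau w) w).
Proof.
apply: (measurable_fun_cvg (h := fun n w => X (grid tau n w) w)) => [n|w _]; last exact: X_grid_cvg.
by apply: grid_measurable; exact: X_meas.
Qed.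

(** The oscillation estimate is available for eta at grid times, not for X; X at tau is reached by
    Fatou's lemma along finer grids, on which eta and X are uniformly close. *)
Lemma X_grid_approx (e : R) : 0 < e -> exists eta n0, SG0 1 eta /\ forall n P, (n0 <= n)%N -> PP P ->
  (\int[P]_w `|eta (grid tau n w) w - X (tau w) w|%:E <= e%:E)%E /\
  (\int[P]_w `|X (grid tau n w) w - X (tau w) w|%:E <= e%:E)%E.
Proof.
move=> e0; have e3 : 0 < e / 3 by rewrite divr_gt0.
have [eta Seta Heta] := SG_approx sl0 slb beta1 SX e3.
have [n0 _ Hn0] := SG0_osc sl0 slb Seta e3.
have meta t : 0 <= t <= 1 -> measurable_fun setT (eta t).
  by move=> /andP[t0 _]; exact: Lip_measurable (SG0_Lip Seta t0).
have me n : measurable_fun setT (fun w => eta (grid tau n w) w) by exact: grid_measurable.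
have mx n : measurable_fun setT (fun w => X (grid tau n w) w) by apply: grid_measurable; exact: X_meas.
have mt := X_tau_meas.
have ex n P : PP P -> (\int[P]_w `|eta (grid tau n w) w - X (grid tau n w) w|%:E <= (e / 3)%:E)%E.
  by move=> PP1; apply: Heta => //; [exact: grid01|exact: measurable_funB].
have key n P : (n0.+1 <= n)%N -> PP P -> (\int[P]_w `|eta (grid tau n w) w - X (tau w) w|%:E <= (e / 3 + e / 3)%:E)%E.
  move=> nn PP1; apply: (@fatou_bd P (fun m w => eta (grid tau n w) w - X (grid tau m w) w) _ _ n).
  - by move=> m; exact: measurable_funB.
  - exact: measurable_funB.
  - by move=> w; apply: cvgB; [exact: cvg_cst|exact: X_grid_cvg].
  - move=> m nm; apply: (int_triangle (me n) (me m) (mx m)); last exact: ex.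
    (* Two grid approximations of levels at least n differ by at most twice [(2 ^+ n)^-1], hence the
       level [n.-1]. *)
    apply: (Hn0 n.-1) => //=; [by rewrite -ltnS prednK// (leq_trans _ nn)|exact: grid01|exact: grid01| |exact: measurable_funB].
    move=> w; rewrite (_ : _ - _ = (grid tau n w - tau w) - (grid tau m w - tau w)); last by ring.
    apply: le_trans (ler_normB _ _) _.
    have -> : (2 ^+ n.-1)^-1 = (2 ^+ n)^-1 + (2 ^+ n)^-1 :> R.
      by case: n nn {nm} => // n _; rewrite exprS invfM /=; field; rewrite gt_eqF// exprn_gt0.
    apply: lerD; first exact: grid_dist.
    apply: le_trans (grid_dist m w) _; rewrite lef_pV2 ?posrE ?exprn_gt0//.
    by rewrite ler_eXn2l// ltr1n.
exists eta, n0.+1; split=> // n P nn PP1; split.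
  by apply: le_trans (key n P nn PP1) _; rewrite lee_fin; lra.
rewrite (_ : e = e / 3 + (e / 3 + e / 3)); last by field.
apply: (int_triangle (mx n) (me n) mt); last exact: key.
by under eq_integral do rewrite distrC; exact: ex.
Qed.

Lemma X_tau_LG1bar : LG1bar sl sb +oo%E (at_time X tau).
Proof.
have /choice[Z HZ] k : exists Z : Om -> R, LG1ss +oo%E (EFin \o Z) /\
    (dist Z (fun w => X (tau w) w) <= (k.+1%:R^-1)%:E)%E.
  have k0 : 0 < k.+1%:R^-1 :> R by rewrite invr_gt0.
  have [eta [n0 [Seta H]]] := X_grid_approx k0.
  exists (fun w => eta (grid tau n0 w) w); split; first exact: grid_LG1ss.
  by apply: Ehat_le => P PP1; have [] := H n0 P (leqnn _) PP1.
have L0X : L0 +oo%E (at_time X tau).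
  by apply/L0oo; apply/measurable_EFinP; exact: X_tau_meas.
split.
  have [[LZ _] h] := HZ 0%N; exact: (L1_close LZ L0X h).
exists (fun k => EFin \o Z k); split; first by move=> k; have [] := HZ k.
apply/(cvg_L1P sl0 slb) => e e0; exists (Num.truncn e^-1) => n Nn; have [_ hn] := HZ n.
apply: le_trans hn _; rewrite lee_fin invf_ple ?posrE//; apply: ltW; apply: lt_le_trans (truncnS_gt _) _.
by rewrite ler_nat ltnS.
Qed.

Lemma X_grid_L1 n : L1 +oo%E (EFin \o (fun w => X (grid tau n w) w)).
Proof.
have [eta Seta Heta] := SG_approx sl0 slb beta1 SX ltr01.
have meta t : 0 <= t <= 1 -> measurable_fun setT (eta t).
  by move=> /andP[t0 _]; exact: Lip_measurable (SG0_Lip Seta t0).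
have me : measurable_fun setT (fun w => eta (grid tau n w) w) by exact: grid_measurable.
have mx : measurable_fun setT (fun w => X (grid tau n w) w) by apply: grid_measurable; exact: X_meas.
have [_ [K [M [_ _ _ eM _]]]] := SG0_modulus Seta.
apply: (@L1_close _ (fun w => eta (grid tau n w) w) _ 1).
- by apply: (@L1_bd _ _ M) => [|w]; [exact: L0r|exact: eM].
- exact: L0r.
- by apply: Ehat_le => P PP1; apply: Heta => //; [exact: grid01|exact: measurable_funB].
Qed.

End Tau.

Section Version.
Variables (beta : R) (X : R -> Om -> R).
Hypotheses (beta1 : 1 < beta) (SX : SG sl sb beta 1 X).

(** A process of [SG] is measurable at each time but not assumed adapted; its approximants are, and
    their L^1 limit is an adapted version. *)
Lemma SG_version t : 0 <= t <= 1 -> exists2 x : Om -> R, LG1 t%:E (EFin \o x) & qs (fun w => x w = X t w).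
Proof.
move=> t01; have /andP[t0 t1] := t01; have mX : measurable_fun setT (X t) by case: SX => h _ _; exact: h.
have /choice[u Hu] k : exists u : Om -> R, Lip t%:E u /\ (dist u (X t) <= (k.+1%:R^-1)%:E)%E.
  have k0 : 0 < k.+1%:R^-1 :> R by rewrite invr_gt0.
  have [eta Seta Heta] := SG_approx sl0 slb beta1 SX k0.
  exists (eta t); split; first exact: SG0_Lip Seta t0.
  apply: Ehat_le => P PP1; apply: (Heta P (fun=> t)) => //.
  by apply: measurable_funB => //; exact: Lip_measurable (SG0_Lip Seta t0).
have Lu k : Lip t%:E (u k) by have [] := Hu k.
have L1u k : L1 t%:E (EFin \o u k) := Lip_L1 sl sb (Lu k).
have L1X : L1 +oo%E (EFin \o X t).
  by have [_ h] := Hu 0%N; apply: (L1_close (L1_oo (L1u 0%N)) _ h); exact: L0r.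
have du e : 0 < e -> exists N : nat, forall n, (N <= n)%N -> (dist (u n) (X t) <= e%:E)%E.
  move=> e0; exists (Num.truncn e^-1) => n Nn; have [_ hn] := Hu n.
  apply: le_trans hn _; rewrite lee_fin invf_ple ?posrE//; apply: ltW; apply: lt_le_trans (truncnS_gt _) _.
  by rewrite ler_nat ltnS.
have [|Y LY cY] := complete sl0 slb L1u.
  move=> e e0; have e2 : 0 < e / 2 by rewrite divr_gt0.
  have [N HN] := du _ e2; exists N => m n Nm Nn.
  apply: le_trans (Ehat_triangle (L1u m) L1X (L1u n)) _; rewrite (splitr e) EFinD; apply: leeD; first exact: HN.
  by rewrite Ehat_sym; exact: HN.
have GY : LG1 t%:E Y by split=> //; exists u.
have [x Gx Yx] := LG1_real sl0 slb GY; exists x => //.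
have Lx : L1 t%:E (EFin \o x) by case: Gx.
apply: qs_eq_of_dist => //; first exact: L0r_meas (LG1_L0 Gx).
move=> e e0; have e2 : 0 < e / 2 by rewrite divr_gt0.
have [N1 HN1] := du _ e2; have [N2 HN2] := (cvg_L1P sl0 slb _ _).1 cY _ e2.
pose n := maxn N1 N2.
apply: le_trans (Ehat_triangle Lx (L1u n) L1X) _; rewrite (splitr e) EFinD; apply: leeD; last by apply: HN1; exact: leq_maxl.
rewrite Ehat_sym -(@Ehat_qs _ _ _ (fun w => `|(EFin \o u n) w - Y w|%E)).
- by apply: HN2; exact: leq_maxr.
- by apply: measurableT_comp => //; exact: (L1_sub_meas (L1u n) LY).
- by apply: measurableT_comp => //; exact: (L1_sub_meas (L1u n) Lx).
- by apply: qs_sub Yx => w ->.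
Qed.

End Version.

End AtTime.

(** * The Snell envelope *)

Section Snell.
Variables (R : realType) (sl sb : R).
Hypotheses (sl0 : 0 <= sl) (slb : sl <= sb).
Local Notation Om := (Omega R).
Local Notation Lp := (Lip (R := R) +oo%E).
Local Notation PP := (PP sl sb).
Local Notation Ehat := (Ehat sl sb).
Local Notation qs := (qs sl sb).
Local Notation L1 := (L1 sl sb).
Local Notation LG1 := (LG1 sl sb).
Local Notation LG1s := (LG1s sl sb).
Local Notation cond := (cond sl sb).
Local Notation Econd := (Econd sl sb).
Local Notation dya := (dyadic R).
Implicit Types (P Q : probability Om R) (s t : R) (u z : Om -> R) (A : set Om).

Lemma I_qs P A (X Y : Om -> \bar R) : PP P -> measurable A -> L1 +oo%E X -> L1 +oo%E Y ->
  qs (fun w => X w = Y w) -> I P A X = I P A Y.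
Proof.
move=> PP1 mA LX LY XY; apply/eqP; rewrite eq_le; apply/andP.
by split; apply: I_le => //; (try exact: L1_int LX); (try exact: L1_int LY);
  apply: filterS (qs_ae PP1 XY) => w ->.
Qed.

Lemma I_cut P A A' (X : Om -> \bar R) : measurable A -> measurable A' -> P.-integrable setT X ->
  I P A X = I P (A `&` A') X + I P (A `&` ~` A') X.
Proof.
move=> mA mA' iX; have mAA := measurableI _ _ mA mA'; have mAC := measurableI _ _ mA (measurableC mA').
apply/EFin_inj; rewrite EFinD !I_E// -integral_setU//.
- by rewrite -setIUr setUv setIT.
- by apply: measurable_funTS; exact: (measurable_int P iX).
- by apply/disj_setPS => w [[_ h] [_ h']].
Qed.

Lemma I_eq P A (X Y : Om -> \bar R) : (forall w, A w -> X w = Y w) -> I P A X = I P A Y.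
Proof. by move=> XY; rewrite /I; congr fine; apply: eq_integral => w /set_mem; exact: XY. Qed.

Lemma I_le_on P A (X Y : Om -> \bar R) : measurable A -> P.-integrable setT X -> P.-integrable setT Y ->
  {ae P, forall w, A w -> X w <= Y w}%E -> I P A X <= I P A Y.
Proof.
move=> mA iX iY XY.
have iX' : P.-integrable setT (X \_ A).
  by apply/(integrable_mkcond _ mA); exact: integrableS iX.
have iY' : P.-integrable setT (Y \_ A).
  by apply/(integrable_mkcond _ mA); exact: integrableS iY.
have E Z : I P A (Z \_ A) = I P A Z.
  by apply: I_eq => w Aw; rewrite /patch mem_set.
rewrite -(E X) -(E Y); apply: I_le => //.
apply: filterS XY => w h; rewrite /patch; case: (boolP (w \in A)) => [/set_mem/h//|_]; exact: lexx.
Qed.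

Lemma F_I t A A' : F_ t%:E A -> F_ t%:E A' -> F_ t%:E (A `&` A').
Proof.
move=> /F_P[mA AE] /F_P[mA' AE']; apply/F_P; split; first exact: measurableI.
by rewrite preimage_setI AE AE'.
Qed.

Lemma F_bigcap t (A : nat -> set Om) : (forall n, F_ t%:E (A n)) -> F_ t%:E (\bigcap_n A n).
Proof.
move=> H; apply/F_P; split; first by apply: bigcapT_measurable => n; have /F_P[] := H n.
by rewrite preimage_bigcap; apply: eq_bigcapr => n _; have /F_P[] := H n.
Qed.

Lemma F_meas t A : F_ t%:E A -> measurable A. Proof. by move=> /F_P[]. Qed.

Lemma qs_le_of_I t (Y Y' : Om -> \bar R) : L1 t%:E Y -> L1 t%:E Y' ->
  (forall P, PP P -> forall A, F_ t%:E A -> I P A Y <= I P A Y') -> qs (fun w => Y w <= Y' w)%E.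
Proof.
move=> LY LY' H; have [LY0 _] := LY; have [LY'0 _] := LY'.
have FA := F_lt_set LY'0 LY0; have mA := F_meas FA.
have E : [set w | ~ (Y w <= Y' w)%E] = [set w | Y' w < Y w]%E.
  by apply/seteqP; split=> w /=; rewrite ltNge => /negP.
apply: (qs_set sl0 slb); rewrite E// => P PP1; have h := H P PP1 _ FA.
have iY := L1_int PP1 LY; have iY' := L1_int PP1 LY'.
have mB : measurable_fun setT (fun w => Y w - Y' w)%E by exact: L1_sub_meas LY LY'.
apply: (int0_null mA mB) => [w /=|]; first by rewrite sube_gt0.
apply/eqP; rewrite eq_le; apply/andP; split.
  rewrite integralB//; [|exact: integrableS iY|exact: integrableS iY'].
  by rewrite -!I_E// -EFinB lee_fin subr_le0.
by apply: integral_ge0 => w /= h'; apply: ltW; rewrite sube_gt0.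
Qed.

(** Integral bounds by some v j up to e become a pointwise bound by their supremum, because the set
    where Y exceeds all the v j by a fixed amount lies in F_t and the hypothesis makes it null. *)
Lemma qs_le_approx t (v : nat -> Om -> R) (Y : Om -> \bar R) : (forall j, L1 t%:E (EFin \o v j)) -> L1 t%:E Y ->
  (forall e : R, 0 < e -> exists j, forall P A, PP P -> F_ t%:E A -> I P A Y <= I P A (EFin \o v j) + e) ->
  qs (fun w => forall e : R, 0 < e -> exists j, (Y w <= (v j w + e)%:E)%E).
Proof.
move=> Lv LY H.
pose A l : set Om := \bigcap_j [set w | (v j w + l.+1%:R^-1)%:E <= Y w]%E.
have c0 l : 0 < l.+1%:R^-1 :> R by rewrite invr_gt0.
have Lvc j (c : R) : L1 t%:E (EFin \o (fun w => v j w + c)).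
  have [Lj _] := Lv j; apply: L1Dr => //; apply: (@L1_bd _ _ _ _ _ `|c|) => //.
  by apply: L0r => //; exact: measurable_cst.
have FA l : F_ t%:E (A l).
  by apply: F_bigcap => j; apply: F_le_set; [case: (Lvc j l.+1%:R^-1)|case: LY].
have A0 l P : PP P -> P (A l) = 0%E.
  move=> PP1; have mA := F_meas (FA l); have fA : P (A l) \is a fin_num by exact: fin_num_measure.
  suff : fine (P (A l)) <= 0.
    by rewrite -lee_fin fineK// => h; apply/eqP; rewrite eq_le h measure_ge0.
  rewrite -(pmulr_rle0 _ (c0 l)); apply/ler_addgt0Pr => e e0; rewrite add0r.
  have [j Hj] := H e e0; have := Hj P (A l) PP1 (FA l).
  have : I P (A l) (EFin \o (fun w => v j w + l.+1%:R^-1)) <= I P (A l) Y.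
    apply: I_le_on => //; [exact: L1_int (Lvc _ _)|exact: L1_int LY|].
    by apply: aeW => w Aw; exact: (Aw j).
  have -> : I P (A l) (EFin \o (fun w => v j w + l.+1%:R^-1)) = I P (A l) (EFin \o v j) + l.+1%:R^-1 * fine (P (A l)).
    apply/EFin_inj; rewrite EFinD EFinM !I_E//; [|exact: L1_int (Lv j)|exact: L1_int (Lvc _ _)].
    rewrite fineK//.
    rewrite -integral_cst// -integralD//.
      by apply: integrableS (L1_int PP1 (Lv j)).
    exact: (finite_measure_integrable_cst P _ mA).
  by move: (l.+1%:R^-1 * _) => x ? ?; lra.
have NA : qs (fun w => forall l, ~ A l w).
  by apply: (qs_all sl0 slb) => l; apply: (qs_intro sl0 slb (F_meas (FA l))) => // P; exact: A0.
apply: qs_sub NA => w nA e e0.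
pose l := Num.truncn e^-1; have le : l.+1%:R^-1 <= e.
  by rewrite invf_ple ?posrE//; exact: ltW (truncnS_gt _).
have [j /negP] : exists j, ~ ((v j w + l.+1%:R^-1)%:E <= Y w)%E.
  by apply/not_existsP => h; apply: (nA l) => j _; apply: contrapT; exact: h.
rewrite -ltNge => h; exists j; apply: le_trans (ltW h) _; by rewrite lee_fin lerD2l.
Qed.

(** [limn] returns a default value where the sequence has no limit; the set where the upper and
    lower limits coincide is measurable, which settles the exceptional paths as well. *)
Lemma limn_measurable (u : nat -> Om -> \bar R) : (forall n, measurable_fun setT (u n)) ->
  measurable_fun setT (fun w => limn (u ^~ w)).
Proof.
move=> mu; pose s w := limn_esup (u ^~ w); pose i w := limn_einf (u ^~ w).
have ms : measurable_fun setT s by exact: measurable_fun_limn_esup.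
have mi : measurable_fun setT i.
  rewrite (_ : i = fun w => (- limn_esup (fun n => - u n w))%E).
    by apply: measurableT_comp => //; apply: measurable_fun_limn_esup => n; exact: measurableT_comp.
  by apply/funext => w; rewrite -limn_einfN /i; congr limn_einf; apply/funext => n /=; rewrite oppeK.
have E w : limn (u ^~ w) = if (s w <= i w)%E then s w else point.
  case: ifPn => [h|nh].
    apply/cvg_lim => //; have is_ : i w = s w by apply/eqP; rewrite eq_le h limn_einf_sup.
    apply: (@squeeze_cvge _ _ _ _ (einfs (u ^~ w)) _ (esups (u ^~ w))).
    - apply: nearW => n; apply/andP; split; [apply: ereal_inf_lbound|apply: ereal_sup_ubound]; by exists n => /=.
    - rewrite -is_ /i limn_einf_lim; exact: is_cvg_einfs.
    - rewrite /s limn_esup_lim; exact: is_cvg_esups.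
  have [c|/dvgP ->//] := pselect (cvgn (u ^~ w)); move: nh.
  by rewrite /s /i is_cvg_limn_esupE// is_cvg_limn_einfE// lexx.
under eq_fun do rewrite E; apply: measurable_fun_ifT => //.
apply: (measurable_fun_bool true); rewrite setTI.
by have := measurable_lee measurableT ms mi; rewrite setTI.
Qed.

Lemma LG1s_indic s z : LG1 s%:E (EFin \o z) -> LG1s s%:E (fun w => ((z w <= 0)%R%:R)%:E).
Proof.
move=> Gz; have Lz := LG1_L0 Gz; have s0 : (0 <= s%:E)%E.
  by have [_ [Xn [LXn _]]] := Gz; exact: LipP0 (LXn 0%N).
have mz := L0r_meas Lz.
split.
  apply: (@L1_bd _ _ _ _ (fun w => (z w <= 0)%R%:R : R) 1) => [|w]; last by case: (z w <= 0); rewrite ?normr1 ?normr0.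
  apply: L0r => [|t w ht]; last by rewrite (L0r_stop _ Lz ht).
  have -> : (fun w => (z w <= 0)%R%:R : R) = \1_[set w | z w <= 0].
    by apply/funext => w; rewrite indicE; case: (boolP (z w <= 0)) => h; [rewrite mem_set|rewrite memNset//; apply/negP].
  apply: measurable_indic; have := mz measurableT _ (measurable_itv `]-oo, 0]); rewrite setTI.
  have -> : z @^-1` [set` `]-oo, 0]] = [set w | z w <= 0] by apply/seteqP; split=> w /=; rewrite in_itv.
  by [].
pose g (p : nat) (x : R) := Num.max (1 - p%:R * Num.max x 0) 0.
have gl p : lip p%:R (g p).
  move=> x y; apply: le_trans (lip_maxc _ _ _) _; rewrite mul1r.
  rewrite (_ : 1 - _ - _ = - (p%:R * (Num.max x 0 - Num.max y 0))); last by ring.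
  by rewrite normrN normrM ger0_norm// ler_wpM2l//; have := lip_maxc 0 x y; rewrite mul1r.
exists (fun p => EFin \o (fun w => g p (z w))); split.
  by move=> p; apply: (LG1_comp sl0 slb (gl p)).
apply: (qsT sl0 slb) => w; split.
  move=> p q pq; rewrite /= lee_fin /g ge_max !le_max lexx orbT andbT lerD2l lerN2.
  by rewrite ler_wpM2r ?orbT ?le_max ?lexx ?orbT ?ler_nat.
apply: cvg_EFin_seq; have [z0|z0] := leP (z w) 0.
  rewrite (_ : (fun p => _) = cst 1); first exact: cvg_cst.
  by apply/funext => p /=; rewrite /g (max_r z0) mulr0 subr0 max_l.
apply/cvgrPdist_le => e e0; exists (Num.truncn (z w)^-1).+1 => // p /= hp.
rewrite /g (max_l (ltW z0)) max_r ?subrr ?normr0 ?(ltW e0)//.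
rewrite subr_le0 -ler_pdivrMr// mul1r; apply: ltW; apply: lt_le_trans (truncnS_gt _) _.
by rewrite ler_nat.
Qed.

Lemma LG1_max h z1 z2 : LG1 h (EFin \o z1) -> LG1 h (EFin \o z2) -> LG1 h (EFin \o (fun w => Num.max (z1 w) (z2 w))).
Proof.
move=> G1 G2; rewrite (_ : EFin \o _ = EFin \o (fun w => - Num.min (- z1 w) (- z2 w))).
  exact: (LG1N sl0 slb (LG1_min sl0 slb (LG1N sl0 slb G1) (LG1N sl0 slb G2))).
by apply/funext => w /=; rewrite oppr_min !opprK.
Qed.

Lemma dya_ge0' m k : 0 <= dya m k.
Proof. by rewrite /dyadic divr_ge0// exprn_ge0. Qed.

Variables (beta : R) (X : R -> Om -> R).
Hypotheses (beta1 : 1 < beta) (SX : SG sl sb beta 1 X).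
Local Notation V := (V sl sb X).

Lemma VE m k : (k < 2 ^ m)%N -> V m k = fun w => maxe (X (dya m k) w)%:E (Econd (dya m k) (V m k.+1) w).
Proof.
move=> km; rewrite /Defs.V -(subnSK km) /=.
by rewrite (subnSK km) subKn// ltnW.
Qed.

Lemma V_last m : V m (2 ^ m) = EFin \o X 1.
Proof. by rewrite /Defs.V subnn. Qed.

Lemma X_version m k : (k <= 2 ^ m)%N -> exists2 x : Om -> R, LG1 (dya m k)%:E (EFin \o x) & qs (fun w => x w = X (dya m k) w).
Proof. by move=> km; apply: (SG_version sl0 slb beta1 SX); exact: dyadic01. Qed.

Lemma X_meas01 m k : (k <= 2 ^ m)%N -> measurable_fun setT (X (dya m k)).
Proof. by move=> km; have [H _ _] := SX; apply: H; exact: dyadic01. Qed.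

(** [Econd] is a version chosen up to polar sets, so V is only q.s. equal to an adapted real element
    of [LG1]. Membership in [LG1] makes the next conditional expectation exist. *)
Lemma V_spec m k : (k <= 2 ^ m)%N -> measurable_fun setT (V m k) /\
  exists2 v : Om -> R, LG1 (dya m k)%:E (EFin \o v) & qs (fun w => V m k w = (v w)%:E).
Proof.
move=> km; rewrite -(subKn km); move: (leq_subr k (2 ^ m)); move: (2 ^ m - k)%N => j {k km}.
elim: j => [|j IH] jm.
  rewrite subn0 V_last; split; first by apply/measurable_EFinP; rewrite -(dyadic_full R m); exact: X_meas01.
  have [x Gx xX] := X_version (leqnn (2 ^ m)); exists x => //.
  by apply: qs_sub xX => w ->; rewrite /= dyadic_full.
have {IH}[mV [v Gv Vv]] := IH (ltnW jm).
pose k := (2 ^ m - j.+1)%N; have km : (k < 2 ^ m)%N by rewrite /k -subn_gt0 subKn.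
have kE : (2 ^ m - j = k.+1)%N by rewrite /k subnSK.
rewrite -/k; rewrite kE in mV Gv Vv.
have GV : LG1 +oo%E (V m k.+1).
  apply: (LG1_qs sl0 slb Gv); [exact/L0oo|by move=> u; apply: Lip_le; exact: leey|by apply: qs_sub Vv => w ->].
have c := Econd_cond sl0 slb (dya_ge0' m k) (LG1_LG1bar sl0 slb GV).
have [Y cY] := ex_cond_LG1 sl0 slb (dya_ge0' m k) GV.
have [y Gy Yy] := LG1_real sl0 slb (cond_LG1_LG1 sl0 slb cY).
have EY := cond_uniq sl0 slb c (cond_LG1_cond sl0 slb cY).
have [x Gx xX] := X_version (ltnW km).
split.
  rewrite VE//; apply: measurable_maxe; first by apply/measurable_EFinP; exact: X_meas01 (ltnW km).
  by have [_ LE _] := c; exact: L1_meas LE.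
exists (fun w => Num.max (x w) (y w)); first exact: LG1_max.
apply: qs_sub (qs_and sl0 slb (qs_and sl0 slb EY Yy) xX) => w [[e1 e2] e3].
by rewrite VE// e1 e2 -e3 EFin_max.
Qed.

Lemma V_LG1 m k : (k <= 2 ^ m)%N -> LG1 +oo%E (V m k).
Proof.
move=> km; have [mV [v Gv Vv]] := V_spec km.
apply: (LG1_qs sl0 slb Gv); [exact/L0oo|by move=> u; apply: Lip_le; exact: leey|by apply: qs_sub Vv => w ->].
Qed.

Lemma V_cond m k : (k < 2 ^ m)%N -> cond (dya m k) (V m k.+1) (Econd (dya m k) (V m k.+1)).
Proof. by move=> km; apply: (Econd_cond sl0 slb (dya_ge0' m k)); apply: (LG1_LG1bar sl0 slb); exact: V_LG1. Qed.

Lemma V_L1 m k : (k <= 2 ^ m)%N -> L1 +oo%E (V m k).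
Proof. by move=> /V_LG1[]. Qed.

Lemma dya_double m k : dya m.+1 (2 * k) = dya m k.
Proof. by rewrite /dyadic natrM exprS; field; rewrite gt_eqF// exprn_gt0. Qed.

(** The refined grid inserts a midpoint in each interval. Conditioning through the midpoint changes
    nothing by the tower property, and the maximum taken there only increases the value. *)
Lemma V_mono m k : (k <= 2 ^ m)%N -> qs (fun w => V m k w <= V m.+1 (2 * k) w)%E.
Proof.
move=> km; rewrite -(subKn km); move: (leq_subr k (2 ^ m)); move: (2 ^ m - k)%N => j {k km}.
elim: j => [|j IH] jm.
  by rewrite subn0 -expnS !V_last; apply: (qsT sl0 slb).
have {}IH := IH (ltnW jm).
pose k := (2 ^ m - j.+1)%N; have km : (k < 2 ^ m)%N by rewrite /k -subn_gt0 subKn.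
have kE : (2 ^ m - j = k.+1)%N by rewrite /k subnSK.
rewrite -/k; rewrite kE in IH.
have k1 : ((2 * k).+1 < 2 ^ m.+1)%N by rewrite expnS; lia.
have k0 : (2 * k < 2 ^ m.+1)%N by exact: ltnW.
have k2 : (2 * k.+1 = (2 * k).+2)%N by rewrite mulnS.
rewrite k2 in IH.
have c0 := V_cond km; have c1 := V_cond k1; have c2 := V_cond k0.
rewrite dya_double in c2.
(* The refined value at the midpoint before the maximum with X. *)
set W := Econd (dya m.+1 (2 * k).+1) _ in c1.
have LW : LG1 +oo%E W.
  have [Y cY] := ex_cond_LG1 sl0 slb (dya_ge0' m.+1 (2 * k).+1) (V_LG1 k1).
  have GY := cond_LG1_LG1 sl0 slb cY.
  have [_ [LW0 _] _] := c1.
  apply: (LG1_qs sl0 slb GY); [exact: L0_oo LW0|by move=> u; apply: Lip_le; exact: leey|].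
  by apply: qs_sub (cond_uniq sl0 slb c1 (cond_LG1_cond sl0 slb cY)) => w ->.
have cW := Econd_cond sl0 slb (dya_ge0' m k) (LG1_LG1bar sl0 slb LW).
have tt : dya m k <= dya m.+1 (2 * k).+1 by rewrite -dya_double; apply: dyadic_le.
have cc := cond_tower tt c1 cW.
have h1 := cond_mono sl0 slb c0 cc IH.
have WV : qs (fun w => W w <= V m.+1 (2 * k).+1 w)%E.
  by apply: (qsT sl0 slb) => w; rewrite (VE k1) le_max lexx orbT.
have h2 := cond_mono sl0 slb cW c2 WV.
apply: qs_sub (qs_and sl0 slb h1 h2) => w [a b].
rewrite (VE km) (VE k0) dya_double ge_max !le_max lexx /=; apply/orP; right.
exact: le_trans a b.
Qed.

Lemma Vrefined_mono n k j : (k <= 2 ^ n)%N -> qs (fun w => Vrefined sl sb X n k j w <= Vrefined sl sb X n k j.+1 w)%E.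
Proof.
move=> kn; rewrite /Vrefined addnS.
have -> : (k * 2 ^ j.+1 = 2 * (k * 2 ^ j))%N by rewrite expnS mulnCA.
by apply: V_mono; rewrite expnD leq_mul2r kn orbT.
Qed.

Lemma Vrefined_nd n k : (k <= 2 ^ n)%N -> qs (fun w => nondecreasing_seq (fun j => Vrefined sl sb X n k j w)).
Proof.
move=> kn; have h := qs_all sl0 slb (fun j => Vrefined_mono j kn).
by apply: qs_sub h => w h; apply/nondecreasing_seqP.
Qed.

Lemma dya_refine n k j : dya (n + j) (k * 2 ^ j) = dya n k.
Proof. by rewrite /dyadic natrM natrX exprD; field; rewrite !gt_eqF// exprn_gt0. Qed.

(** * Upper bound: V is a supermartingale above X *)

Section Upper.
Variables (m i : nat) (tau : Om -> R).
Hypotheses (im : (i <= 2 ^ m)%N) (Htau : stopping_times sl sb (dya m i) 1 tau).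

Let tau01 w : 0 <= tau w <= 1.
Proof. by case: Htau => [[h _] /(_ w)/andP[_ ->]]; rewrite h. Qed.

Let tau_st : forall t, 0 <= t -> LG1s t%:E (fun w => (\1_[set w' | tau w' <= t] w)%:E).
Proof. by case: Htau => [[_ h] _]. Qed.

(** Backward induction over the sets where the grid index J is at least j. Passing from [j.+1] to j
    uses that [j < J] means [t_j < tau], known at time t_j; where [J = j] the inequality is
    [X <= V]. *)
Lemma supermartingale Q A : PP Q -> F_ (dya m i)%:E A ->
  I Q A (EFin \o (fun w => X (grid tau m w) w)) <= I Q A (V m i).
Proof.
move=> PQ FA; pose N := (2 ^ m)%N; pose b w k := tau w <= dya m k.
have bm w k : b w k -> b w k.+1 by exact: tau_mono.
pose J w := hit (b w) N; have JN w : (J w <= N)%N by exact: hit_le.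
pose C j : set Om := A `&` [set w | (j <= J w)%N].
have FC j : (j < N)%N -> (i <= j)%N -> F_ (dya m j)%:E (C j.+1).
  move=> jN ij; apply: F_I; first by apply: F_le FA; exact: dyadic_le.
  rewrite (_ : [set w | _] = ~` [set w | tau w <= dya m j]).
    by apply: F_C; apply: (tau_set tau_st); exact: dya_ge0'.
  by apply/seteqP; split=> w /=; rewrite /J (hitP (bm w) jN) => /negP.
have CA : C i = A.
  apply/seteqP; split=> w; [by case|move=> Aw; split=> //=].
  rewrite leqNgt; apply/negP => Ji.
  have Jn : (J w < N)%N by exact: leq_trans Ji im.
  have : b w (J w) by apply: contraT => nb; have := hitP (bm w) Jn; rewrite nb ltnn.
  rewrite /b leNgt => /negP; apply; case: Htau => _ /(_ w)/andP[ht _]; apply: lt_le_trans ht.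
  by rewrite /dyadic ltr_pM2r ?invr_gt0 ?exprn_gt0// ltr_nat.
have mC j : (i <= j)%N -> (j <= N)%N -> measurable (C j).
  case: j => [|j] ij jN.
    have -> : C 0%N = A by apply/seteqP; split=> w; [case|].
    exact: F_meas FA.
  have [ij'|ji] := leqP i j; first exact: F_meas (FC j jN ij').
  have -> : j.+1 = i by apply/eqP; rewrite eqn_leq ij andbT.
  by rewrite CA; exact: F_meas FA.
pose Xs : Om -> \bar R := EFin \o (fun w => X (grid tau m w) w).
have iXs : Q.-integrable setT Xs by exact: (L1_int PQ (X_grid_L1 sl0 slb tau_st beta1 SX m)).
have iV k : (k <= N)%N -> Q.-integrable setT (V m k) by move=> kN; exact: (L1_int PQ (V_L1 kN)).
have XV j w : (j < N)%N -> ((X (dya m j) w)%:E <= V m j w)%E by move=> jN; rewrite VE// le_max lexx.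
suff key d : (d <= N - i)%N -> I Q (C (N - d)%N) Xs <= I Q (C (N - d)%N) (V m (N - d)%N).
  by have := key (N - i)%N (leqnn _); rewrite subKn// CA.
elim: d => [|d IH] dN.
  rewrite subn0 V_last le_eqVlt; apply/orP; left; apply/eqP; apply: I_eq => w [_ /= NJ].
  have JE : J w = N by apply/eqP; rewrite eqn_leq JN NJ.
  by rewrite /Xs /= /grid -/(b w) -/N -/(J w) JE dyadic_full.
have {}IH := IH (ltnW dN); pose j := (N - d.+1)%N.
have jN : (j < N)%N by rewrite /j; lia.
have jE : (N - d = j.+1)%N by rewrite /j; lia.
have ij : (i <= j)%N by rewrite /j; lia.
rewrite -/j; rewrite jE in IH.
pose T : set Om := [set w | (j < J w)%N].
have CT : C j `&` T = C j.+1.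
  by apply/seteqP; split=> w; [case=> [[? _] ?]|case=> Aw h; split=> //; split=> //=; exact: ltnW].
have mT : measurable T.
  rewrite (_ : T = ~` [set w | tau w <= dya m j]).
    apply: F_meas; apply: F_C; apply: (tau_set tau_st); exact: dya_ge0'.
  by apply/seteqP; split=> w /=; rewrite /T /= /J (hitP (bm w) jN) => /negP.
have mCj := mC j ij (ltnW jN).
rewrite (I_cut mCj mT iXs) (I_cut mCj mT (iV j (ltnW jN))) CT.
apply: lerD.
  apply: le_trans IH _; have [_ LE /(_ Q PQ)[up _]] := V_cond jN.
  apply: le_trans (up _ (FC j jN ij)) _.
  apply: I_le; [exact: F_meas (FC j jN ij)|exact: L1_int LE|exact: iV (ltnW jN)|].
  by apply: aeW => w; rewrite (VE jN) le_max lexx orbT.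
apply: I_le_on; [exact: measurableI mCj (measurableC mT)|exact: iXs|exact: iV (ltnW jN)|].
apply: aeW => w [[_ /= jJ] /negP]; rewrite -leqNgt => Jj.
have JE : J w = j by apply/eqP; rewrite eqn_leq Jj jJ.
by rewrite /Xs /= /grid -/(b w) -/N -/(J w) JE; exact: XV.
Qed.

End Upper.

Lemma at_time_LG1bar t tau : 0 <= t -> stopping_times sl sb t 1 tau -> LG1bar sl sb +oo%E (at_time X tau).
Proof.
move=> t0 [[tau0 st] tt]; apply: (X_tau_LG1bar sl0 slb _ st beta1 SX) => w.
by rewrite tau0; have /andP[] := tt w.
Qed.

Lemma Vrefined_version n k j : (k <= 2 ^ n)%N -> exists2 v : Om -> R, LG1 (dya n k)%:E (EFin \o v) &
  qs (fun w => Vrefined sl sb X n k j w = (v w)%:E).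
Proof.
move=> kn; have kj : (k * 2 ^ j <= 2 ^ (n + j))%N by rewrite expnD leq_mul2r kn orbT.
by have [_] := V_spec kj; rewrite dya_refine.
Qed.

(** A measure Q nearly attaining the conditional expectation on A is used for the supermartingale
    inequality on a fine grid; V at time t has a version known at t, so its integral may be taken
    under P again. *)
Lemma Vinf_ge n k tau : (k <= 2 ^ n)%N -> stopping_times sl sb (dya n k) 1 tau ->
  qs (fun w => Econd (dya n k) (at_time X tau) w <= Vinf sl sb X n k w)%E.
Proof.
move=> kn Htau; set t := dya n k; set Y := Econd t _.
have t0 : 0 <= t by exact: dya_ge0'.
have [[tau0 st] tt] := Htau.
have tau01 w : 0 <= tau w <= 1 by rewrite tau0; have /andP[] := tt w.
have cY : cond t (at_time X tau) Y := Econd_cond sl0 slb t0 (at_time_LG1bar t0 Htau).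
have [LX LY _] := cY.
have /choice[v Hv] j : exists v : Om -> R, LG1 t%:E (EFin \o v) /\ qs (fun w => Vrefined sl sb X n k j w = (v w)%:E).
  by have [v] := Vrefined_version j kn; exists v.
have Lv j : L1 t%:E (EFin \o v j) by have [[]] := Hv j.
have qv : qs (fun w => forall j, Vrefined sl sb X n k j w = (v j w)%:E).
  by apply: (qs_all sl0 slb) => j; have [] := Hv j.
have kj j : (k * 2 ^ j <= 2 ^ (n + j))%N by rewrite expnD leq_mul2r kn orbT.
suff H : forall e : R, 0 < e -> exists j, forall P A, PP P -> F_ t%:E A -> I P A Y <= I P A (EFin \o v j) + e.
  have h := qs_le_approx Lv LY H.
  have hc := Vrefined_nd kn; have hh := qs_and sl0 slb h (qs_and sl0 slb qv hc).
  apply: (qs_sub _ hh) => w [a [b c]].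
  have ub j : ((v j w)%:E <= Vinf sl sb X n k w)%E.
    rewrite -b /Vinf (cvg_lim (@ereal_hausdorff R) (ereal_nondecreasing_cvgn c)).
    by apply: ereal_sup_ubound; exists j.
  apply/lee_addgt0Pr => e e0; have [j hj] := a e e0; apply: le_trans hj _.
  by rewrite EFinD; apply: leeD2r.
move=> e e0; have e2 : 0 < e / 2 by rewrite divr_gt0.
have [eta [n0 [_ H]]] := X_grid_approx sl0 slb tau01 st beta1 SX e2.
exists n0 => P A PP1 FA; have mA := F_meas FA.
have [Q PQ [same att]] := cond_att cY PP1 FA e2.
have [_ hX] := H (n + n0)%N Q (leq_addl _ _) PQ.
have iX := L1_int PQ LX.
have iG := L1_int PQ (X_grid_L1 sl0 slb st beta1 SX (n + n0)).
have h1 : I Q A (at_time X tau) <= I Q A (EFin \o (fun w => X (grid tau (n + n0) w) w)) + e / 2.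
  apply: I_diff => //; apply: le_trans hX; rewrite le_eqVlt; apply/orP; left; apply/eqP.
  by apply: eq_integral => w _ /=; rewrite distrC.
have h2 : I Q A (EFin \o (fun w => X (grid tau (n + n0) w) w)) <= I Q A (V (n + n0) (k * 2 ^ n0)).
  by apply: supermartingale => //; rewrite dya_refine.
have h3 : I Q A (V (n + n0) (k * 2 ^ n0)) = I P A (EFin \o v n0).
  have [_ q] := Hv n0; have [Lv0 _] := Lv n0.
  rewrite (I_qs PQ mA (V_L1 (kj n0)) (L1_oo (Lv n0)) q).
  exact: (I_same same Lv0 FA).
by lra.
Qed.

(** * Lower bound: an optimal stopping rule on the grid *)

Section Lower.
Variables (m i : nat).
Hypothesis im : (i <= 2 ^ m)%N.
Let N := (2 ^ m)%N.
Variables (x v : nat -> Om -> R).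
Hypotheses (Gx : forall j, (j <= N)%N -> LG1 (dya m j)%:E (EFin \o x j))
  (Gv : forall j, (j <= N)%N -> LG1 (dya m j)%:E (EFin \o v j))
  (qx : forall j, (j <= N)%N -> qs (fun w => x j w = X (dya m j) w))
  (qv : forall j, (j <= N)%N -> qs (fun w => V m j w = (v j w)%:E)).

Fixpoint gap r w : R := if r is r'.+1 then Num.min (gap r' w) (v (i + r) w - x (i + r) w) else v i w - x i w.

Lemma gap_LG1 r : (i + r <= N)%N -> LG1 (dya m (i + r))%:E (EFin \o gap r).
Proof.
have d j : (j <= N)%N -> LG1 (dya m j)%:E (EFin \o (fun w => v j w - x j w)).
  by move=> jN; apply: (LG1D sl0 slb); [exact: Gv|apply: (LG1N sl0 slb); exact: Gx].
elim: r => [|r IH] rN; first by rewrite addn0; exact: d.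
have rN' : (i + r <= N)%N by apply: leq_trans rN; rewrite leq_add2l.
apply: (LG1_min sl0 slb); last exact: d.
by apply: (LG1_le_fin sl0 slb _ (IH rN')); apply: dyadic_le; rewrite leq_add2l.
Qed.

(** The versions satisfy [x <= v] only q.s., so the test is an inequality; this also makes the
    stopping set a sublevel set of one functional of [LG1]. *)
Definition stopped_by w r := gap r w <= 0.

Lemma stopped_by_mono w r : stopped_by w r -> stopped_by w r.+1.
Proof. by rewrite /stopped_by /= => h; rewrite ge_min h. Qed.

(** The tests run up to index [N - i - 1]; when all fail the index is [N - i], the terminal time,
    where V and X coincide q.s. *)
Let J w := hit (stopped_by w) (N - i).

Definition opt_time w : R := dya m (i + J w).

Lemma opt_index w : (i + J w <= N)%N.
Proof. by have h := hit_le (stopped_by w) (N - i); have h2 : (i <= N)%N := im; rewrite /J; lia. Qed.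

Lemma opt_stopping : stopping_times sl sb (dya m i) 1 opt_time.
Proof.
split; last first.
  move=> w; rewrite dyadic_le ?leq_addr//=; have /andP[_ ->//] := dyadic01 R (opt_index w).
split=> [w|s s0]; first exact: dya_ge0'.
(* The last grid index with [t_K <= s]. The event is empty for [K < i], full for [K >= N], and
   otherwise the sublevel set of the running minimum up to K. *)
pose K := Num.truncn (s * 2 ^+ m).
have E w : (opt_time w <= s) = (i + J w <= K)%N.
  rewrite /opt_time /dyadic ler_pdivrMr ?exprn_gt0// /K truncn_ge_nat// mulr_ge0// exprn_ge0//.
have [Ki|iK] := ltnP K i.
  rewrite (_ : (fun w => _) = EFin \o cst (0 : R)).
    by apply: LG1_LG1s => //; apply: (LG1_Lip sl0 slb); apply: Lip_cst.
  apply/funext => w /=; rewrite indicE memNset//= E => h.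
  by have := leq_ltn_trans (leq_trans (leq_addr _ _) h) Ki; rewrite ltnn.
have [NK|KN] := leqP N K.
  rewrite (_ : (fun w => _) = EFin \o cst (1 : R)).
    by apply: LG1_LG1s => //; apply: (LG1_Lip sl0 slb); apply: Lip_cst.
  by apply/funext => w /=; rewrite indicE mem_set//= E (leq_trans (opt_index w)).
have Ks : dya m K <= s.
  by rewrite /dyadic ler_pdivrMr ?exprn_gt0// truncn_le mulr_ge0// exprn_ge0.
have G : LG1 s%:E (EFin \o gap (K - i)).
  by apply: (LG1_le_fin sl0 slb Ks); have := @gap_LG1 (K - i)%N; rewrite subnKC//; apply; exact: ltnW.
rewrite (_ : (fun w => _) = fun w => ((gap (K - i) w <= 0)%R%:R)%:E); first exact: LG1s_indic.
apply/funext => w; congr EFin; rewrite indicE.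
have Kr : (K - i < N - i)%N by lia.
have -> : (w \in [set w' | opt_time w' <= s]) = (gap (K - i) w <= 0); last by [].
have := hitP (@stopped_by_mono w) Kr; rewrite -/(J w) /stopped_by => h.
have -> : (gap (K - i) w <= 0) = (opt_time w <= s).
  rewrite E; case: (boolP (gap (K - i) w <= 0)) h => _ /= h; apply/esym; [apply/idP|apply/negbTE]; lia.
by case: (boolP (opt_time w <= s)) => h'; [rewrite mem_set|rewrite memNset//; apply/negP].
Qed.

Lemma hit_minn (b : nat -> bool) n r : (forall k, b k -> b k.+1) -> (r <= n)%N -> hit b r = minn r (hit b n).
Proof.
move=> bm; elim: n => [|n IH]; first by rewrite leqn0 => /eqP->; rewrite /hit big_ord0.
rewrite leq_eqVlt => /predU1P[->|]; first by apply/esym/minn_idPr; exact: hit_le.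
rewrite ltnS => rn; rewrite (IH rn) hit_rec; case E : (b n); first by rewrite addn0.
by rewrite (hit_full bm) ?E// addn1; lia.
Qed.

Lemma gap_set k : (i + k <= N)%N -> F_ (dya m (i + k))%:E [set w | gap k w <= 0].
Proof.
move=> kN; apply: (@F_le_set _ _ (EFin \o gap k) (EFin \o cst 0)); first exact: LG1_L0 (gap_LG1 kN).
by apply: L0r => //; exact: measurable_cst.
Qed.

(** The payoff of the rule forced to stop at index r. It is known at time [t_(i+r)] and equals the
    final payoff where the rule has stopped by then, so measures agreeing up to that time integrate
    it alike. *)
Let xs r w := x (i + hit (stopped_by w) r) w.

Lemma xs_L0 r : (i + r <= N)%N -> L0 (dya m (i + r))%:E (EFin \o xs r).
Proof.
move=> rN; apply: L0r => [|t w [tE]].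
  rewrite /xs; under eq_fun do rewrite (hit_sum (@stopped_by_mono _) (fun k => x (i + k) _)).
  have mx k : (k <= r)%N -> measurable_fun setT (x (i + k)%N).
    by move=> kr; apply: L0r_meas; apply: LG1_L0; apply: Gx; lia.
  apply: measurable_funB; first exact: mx.
  apply: measurable_sum => -[k kr]; apply: measurable_funM; first by apply: measurable_funB; apply: mx => //=; exact: ltnW.
  have kN : (i + k <= N)%N by lia.
  rewrite (_ : (fun w => _) = \1_[set w | gap k w <= 0]); first by apply: measurable_indic; exact: F_meas (gap_set kN).
  by apply/funext => w; rewrite indicE /stopped_by /=; case: (boolP (gap k w <= 0)) => h; [rewrite mem_set|rewrite memNset//; apply/negP].
have st j z : (j <= r)%N -> LG1 (dya m (i + j))%:E (EFin \o z) -> z (stop t w) = z w.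
  move=> jr Gz; have h : dya m (i + j) <= t by rewrite -tE; apply: dyadic_le; rewrite leq_add2l.
  exact: (L0r_stop w (LG1_L0 (LG1_le_fin sl0 slb h Gz)) erefl).
have hE : hit (stopped_by (stop t w)) r = hit (stopped_by w) r.
  apply: eq_bigr => -[k kr] _ /=; rewrite /stopped_by (st k) ?(ltnW kr)//; apply: gap_LG1; lia.
have hr := hit_le (stopped_by w) r.
by rewrite /xs hE; apply: (st (hit (stopped_by w) r)) => //; apply: Gx; lia.
Qed.

Let xt : Om -> \bar R := EFin \o xs (N - i).

Lemma xt_opt : qs (fun w => at_time X opt_time w = xt w).
Proof.
have h : qs (fun w => forall j, (j <= N)%N -> x j w = X (dya m j) w).
  apply: (qs_all sl0 slb) => j; have [jN|jN] := leqP j N; first by apply: qs_sub (qx jN) => w ->.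
  by apply: (qsT sl0 slb).
by apply: qs_sub h => w h; rewrite /xt /= /xs /at_time /opt_time h//; exact: opt_index.
Qed.

Lemma opt_L1 : L1 +oo%E (at_time X opt_time).
Proof. by have [] := at_time_LG1bar (dya_ge0' m i) opt_stopping. Qed.

Lemma xt_L1 : L1 +oo%E xt.
Proof.
have L0x : L0 +oo%E xt by apply: L0_oo (@xs_L0 (N - i) _); rewrite subnKC.
have mx := L0_meas L0x; have [_ oE] := opt_L1; have mo := L1_meas opt_L1.
split=> //; rewrite -(@Ehat_qs _ _ _ (fun w => `|at_time X opt_time w|)%E)//; try exact: measurableT_comp.
by apply: qs_sub xt_opt => w ->.
Qed.

Let C r : set Om := [set w | (r <= J w)%N].

Lemma C_set r : (i + r < N)%N -> F_ (dya m (i + r))%:E (C r.+1).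
Proof.
move=> rN; rewrite (_ : C r.+1 = ~` [set w | gap r w <= 0]); first by apply: F_C; apply: gap_set; exact: ltnW.
have rN' : (r < N - i)%N by lia.
by apply/seteqP; split=> w; rewrite /C /J /= (hitP (@stopped_by_mono w) rN') => /negP.
Qed.

Lemma C_set' r : (i + r <= N)%N -> F_ (dya m (i + r))%:E (C r).
Proof.
case: r => [|r] rN; first by rewrite (_ : C 0 = setT); [exact: F_T|apply/seteqP; split].
by apply: (@F_le _ (dya m (i + r))); [apply: dyadic_le; lia|apply: C_set; lia].
Qed.

Lemma xt_C w r : J w = r -> xt w = (x (i + r) w)%:E.
Proof. by move=> <-. Qed.

(* Before the first time r with V = X the maximum defining V is attained by the
   conditional expectation, so some measure attains V_i up to an error e per step. *)
Lemma opt_chain r P A (e : R) : (i + r <= N)%N -> PP P -> F_ (dya m i)%:E A -> 0 < e ->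
  exists2 Q, PP Q & same_upto (dya m i) P Q /\
    I P A (EFin \o v i) <= I Q (A `&` ~` C r) xt + I Q (A `&` C r) (EFin \o v (i + r)%N) + e * r%:R.
Proof.
move=> rN PP1 FA e0; have mA := F_meas FA; elim: r rN => [|r IH] rN.
  exists P => //; split=> //.
  have -> : C 0 = setT by apply/seteqP; split.
  by rewrite setCT setI0 setIT addn0 mulr0 addr0 /I integral_set0 add0r.
have rN' : (r < N - i)%N by rewrite ltn_subRL -addnS.
set j := (i + r)%N; have jN : (j < N)%N by rewrite /j -addnS.
have [Q PQ [same H]] := IH (ltnW jN).
have j1 : (i + r.+1 = j.+1)%N by rewrite /j addnS.
have tij : dya m i <= dya m j by apply: dyadic_le; exact: leq_addr.
have FA' : F_ (dya m j)%:E A := F_le tij FA.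
have FC := C_set' (ltnW jN); have FC1 := C_set jN; rewrite -/j in FC FC1.
have CC w : C r.+1 w -> C r w by move=> /= /ltnW.
pose D := A `&` ~` C r.+1; pose E := A `&` C r.+1.
have FD : F_ (dya m j)%:E D by apply: F_I => //; exact: F_C.
have FE : F_ (dya m j)%:E E by exact: F_I.
have [Q' PQ' [same' att]] := cond_att (V_cond jN) PQ FE e0.
exists Q' => //; split; first by move=> U FU; rewrite (same' _ (F_le tij FU)); exact: same.
have Lv k : (k <= N)%N -> L1 +oo%E (EFin \o v k) by move=> kN; have [/L1_oo] := Gv kN.
have mC := F_meas FC; have mC1 := F_meas FC1; have mD := F_meas FD; have mE := F_meas FE.
have mAC := measurableI _ _ mA mC; have ivj := L1_int PQ (Lv _ (ltnW jN)).
have ixt P' (PP' : PP P') := L1_int PP' xt_L1.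
have [_ LEc _] := V_cond jN.
have e1 := I_cut mAC mC1 ivj.
have e2 : A `&` C r `&` C r.+1 = E by apply/seteqP; split=> w; [case=> [[? _] ?]|case=> ? h; split=> //; split=> //; exact: CC].
rewrite e2 in e1.
(* On this set the rule has not stopped at j, so v exceeds x strictly and the maximum defining V
   must be the conditional expectation. *)
have h1 : I Q E (EFin \o v j) <= I Q E (Econd (dya m j) (V m j.+1)).
  apply: I_le_on => //; first exact: L1_int LEc.
  apply: filterS (qs_ae PQ (qs_and sl0 slb (qx (ltnW jN)) (qv (ltnW jN)))) => w [xX Vv] [_ Cw] /=.
  have gw : ~~ (gap r w <= 0).
    by rewrite -/(stopped_by w r) -(hitP (@stopped_by_mono w) rN').
  have xv : x j w < v j w.
    rewrite -subr_gt0 ltNge; apply: contra gw; rewrite /j; case: (r) => [|r'] /= h; first by rewrite addn0 in h.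
    by rewrite ge_min h orbT.
  move: Vv; rewrite VE// -xX; case: (leP (Econd (dya m j) (V m j.+1) w) (x j w)%:E) => h; last by move=> ->.
  by move=> [xv']; move: xv; rewrite xv' ltxx.
have h2 : I Q (A `&` C r `&` ~` C r.+1) (EFin \o v j) <= I Q (A `&` C r `&` ~` C r.+1) xt.
  apply: I_le_on => //; [exact: measurableI mAC (measurableC mC1)|exact: ixt|].
  apply: aeW => w [[_ Cw] nC]; have JE : J w = r by apply/eqP; rewrite eqn_leq Cw andbT leqNgt; apply/negP.
  rewrite (xt_C JE) lee_fin -/j -subr_le0.
  have : gap r w <= 0.
    by have := hitP (@stopped_by_mono w) rN'; rewrite -/(J w) JE ltnn => /esym/negbFE.
  rewrite /j; case Er : (r) => [|r'] /=; first by rewrite addn0.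
  rewrite ge_min => /orP[g|//]; have rN2 : (r' < N - i)%N by rewrite Er in rN'; exact: ltnW.
  have := hitP (@stopped_by_mono w) rN2; rewrite -/(J w) JE Er ltnSn => /esym.
  by rewrite /stopped_by g.
have h3 := I_cut mD mC (ixt Q PQ).
have e3 : D `&` C r = A `&` C r `&` ~` C r.+1 by apply/seteqP; split=> w; [case=> [[? ?] ?]|case=> [[? ?] ?]].
have e4 : D `&` ~` C r = A `&` ~` C r.
  by apply/seteqP; split=> w; [case=> [[? ?] ?]|case=> ? h; split=> //; split=> // /CC].
rewrite e3 e4 in h3.
(* The payoff collected on D is decided by time t_j, up to which Q' agrees with Q. *)
have h4 : I Q' D xt = I Q D xt.
  have DE P' : I P' D xt = I P' D (EFin \o xs r).
    apply: I_eq => w [_ nC]; have Jr : (J w <= r)%N by rewrite leqNgt; apply/negP.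
    by rewrite /xt /= /xs (hit_minn (@stopped_by_mono w) (ltnW rN')) -/(J w) (minn_idPr Jr).
  by rewrite !DE; apply: (I_same same') => //; apply: xs_L0; exact: ltnW.
have h5 : I Q' E (V m j.+1) = I Q' E (EFin \o v j.+1) by exact: I_qs PQ' mE (V_L1 jN) (Lv _ jN) (qv jN).
rewrite j1 -/D -/E h4 -h5 h3 -(natr1 r) mulrDr mulr1.
rewrite -/j in H; move: H att h1 h2 e1.
move: (I Q (A `&` C r `&` ~` C r.+1) xt) (I Q E (Econd _ _)) (I Q (A `&` C r `&` ~` C r.+1) _) => a1 a2 a3.
move: (I Q (A `&` ~` C r) xt) (I Q E (EFin \o v j)) (I Q (A `&` C r) _) (I Q' E _) (e * r%:R) (I P A _) => a4 a5 a6 a7 a8 a9.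
by move=> *; lra.
Qed.

Lemma opt_attains : qs (fun w => V m i w <= Econd (dya m i) (at_time X opt_time) w)%E.
Proof.
set Y := Econd _ _; have c : cond (dya m i) (at_time X opt_time) Y.
  by apply: (Econd_cond sl0 slb (dya_ge0' m i)); exact: at_time_LG1bar (dya_ge0' m i) opt_stopping.
have [_ LY H] := c; have [Lv _] := Gv im; have LY0 : L0 (dya m i)%:E Y by case: LY.
suff h : qs (fun w => (v i w)%:E <= Y w)%E by apply: qs_sub (qs_and sl0 slb h (qv im)) => w [a ->].
apply: (qs_le_of_I Lv LY) => P PP1 A FA; apply/ler_addgt0Pr => d d0.
(* There are k steps with an error each; dividing by [k.+1] keeps the total below d and covers
   [k = 0]. *)
pose k := (N - i)%N; have e0 : 0 < d / k.+1%:R by rewrite divr_gt0.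
have ik : (i + k = N)%N by rewrite /k subnKC.
have [Q PQ [same h]] : exists2 Q, PP Q & same_upto (dya m i) P Q /\
    I P A (EFin \o v i) <= I Q (A `&` ~` C k) xt + I Q (A `&` C k) (EFin \o v (i + k)%N) + d / k.+1%:R * k%:R.
  by apply: opt_chain; rewrite ?ik.
have mA := F_meas FA; have mC : measurable (C k) by apply: F_meas (@C_set' k _); rewrite ik.
have [up _] := H Q PQ.
have h1 : I Q (A `&` C k) (EFin \o v (i + k)%N) <= I Q (A `&` C k) xt.
  have [LvN _] := Gv (leqnn N).
  apply: I_le_on; [exact: measurableI|rewrite ik; exact: (L1_int PQ (L1_oo LvN))|exact: (L1_int PQ xt_L1)|].
  apply: filterS (qs_ae PQ (qs_and sl0 slb (qx (leqnn N)) (qv (leqnn N)))) => w [xX Vv] [_ Cw].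
  have JE : J w = k by apply/eqP; rewrite eqn_leq Cw hit_le.
  by rewrite (xt_C JE) /= ik -Vv V_last xX dyadic_full.
have h2 := I_cut mA mC (L1_int PQ xt_L1).
have h3 : I Q A xt = I Q A (at_time X opt_time).
  by apply/esym; exact: I_qs PQ mA opt_L1 xt_L1 xt_opt.
have h4 := up _ FA; have h5 : I Q A Y = I P A Y by exact: (I_same same).
have h6 : d / k.+1%:R * k%:R <= d by rewrite mulrAC ler_pdivrMr// ler_pM2l// ler_nat.
move: h h1 h2 h3 h4 h5 h6; move: (_ * k%:R) => z *; lra.
Qed.

End Lower.

Lemma V_attained m i : (i <= 2 ^ m)%N -> exists2 tau, stopping_times sl sb (dya m i) 1 tau &
  qs (fun w => V m i w <= Econd (dya m i) (at_time X tau) w)%E.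
Proof.
move=> im.
have /choice[x Hx] j : exists x : Om -> R, (j <= 2 ^ m)%N -> LG1 (dya m j)%:E (EFin \o x) /\ qs (fun w => x w = X (dya m j) w).
  have [jm|jm] := leqP j (2 ^ m); first by have [x ? ?] := X_version jm; exists x.
  by exists (cst 0).
have /choice[v Hv] j : exists v : Om -> R, (j <= 2 ^ m)%N -> LG1 (dya m j)%:E (EFin \o v) /\ qs (fun w => V m j w = (v w)%:E).
  have [jm|jm] := leqP j (2 ^ m); first by have [_ [v ? ?]] := V_spec jm; exists v.
  by exists (cst 0).
have Gx j jm := (Hx j jm).1; have qx j jm := (Hx j jm).2.
have Gv j jm := (Hv j jm).1; have qv j jm := (Hv j jm).2.
by exists (opt_time m i x v); [exact: opt_stopping|exact: opt_attains].
Qed.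

Lemma Vinf_least n k (eta : Om -> \bar R) : (k <= 2 ^ n)%N ->
  (forall tau, stopping_times sl sb (dya n k) 1 tau -> qs (fun w => Econd (dya n k) (at_time X tau) w <= eta w)%E) ->
  qs (fun w => Vinf sl sb X n k w <= eta w)%E.
Proof.
move=> kn H; have h : qs (fun w => forall j, Vrefined sl sb X n k j w <= eta w)%E.
  apply: (qs_all sl0 slb) => j.
  have kj : (k * 2 ^ j <= 2 ^ (n + j))%N by rewrite expnD leq_mul2r kn orbT.
  have [tau] := V_attained kj; rewrite dya_refine => /H h1 h2.
  by apply: qs_sub (qs_and sl0 slb h1 h2) => w [a b]; exact: le_trans b a.
apply: qs_sub (qs_and sl0 slb h (Vrefined_nd kn)) => w [a b].
rewrite /Vinf (cvg_lim (@ereal_hausdorff R) (ereal_nondecreasing_cvgn b)).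
by apply: ge_ereal_sup => _ [j _ <-]; exact: a.
Qed.

Lemma Vinf_L0 n k : (k <= 2 ^ n)%N -> L0 +oo%E (Vinf sl sb X n k).
Proof.
move=> kn; apply/L0oo; apply: limn_measurable => j.
have kj : (k * 2 ^ j <= 2 ^ (n + j))%N by rewrite expnD leq_mul2r kn orbT.
by have [] := V_spec kj.
Qed.

End Snell.

(** The definedness clauses ensure that every [Econd] in the statement is a genuine version and not
    the default value 0. *)
Theorem theorem4p6 (R : realType) (sl sb : R) (hsl : 0 <= sl) (hsb : sl <= sb)
    (beta : R) (hbeta : 1 < beta) (X : R -> Omega R -> R)
    (hX : SG sl sb beta 1 X) :
  (forall n k : nat, (k < 2 ^ n)%N ->
     Econd_defined sl sb (dyadic R n k) (V sl sb X n k.+1)) /\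
  (forall n k : nat, (k <= 2 ^ n)%N ->
     [/\ qs sl sb (fun w => nondecreasing_seq (fun j => Vrefined sl sb X n k j w)),
         (forall tau, stopping_times sl sb (dyadic R n k) 1 tau ->
            Econd_defined sl sb (dyadic R n k) (at_time X tau)) &
         is_qs_ess_sup sl sb
           [set Econd sl sb (dyadic R n k) (at_time X tau)
             | tau in stopping_times sl sb (dyadic R n k) 1]
           (Vinf sl sb X n k)]).
Proof.
split=> [n k kn|n k kn].
  by apply: ex_cond_LG1bar => //; [exact: dya_ge0'|apply: LG1_LG1bar => //; exact: (V_LG1 hsl hsb hbeta hX)].
split.
- exact: Vrefined_nd hbeta hX _ _ _.
- by move=> tau Htau; apply: ex_cond_LG1bar => //; [exact: dya_ge0'|apply: (at_time_LG1bar hsl hsb hbeta hX) Htau; exact: dya_ge0'].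
split.
- exact: Vinf_L0 hbeta hX _ _ _.
- by move=> _ [tau Htau <-]; exact: Vinf_ge hbeta hX _ _ _ _ Htau.
- by move=> eta _ H; apply: (Vinf_least hsl hsb hbeta hX kn) => tau Htau; apply: H; exists tau.
Qed.
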